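(* Let $\alpha\in\mathbb R$, $0<p,q\le\infty$, $s\in(0,2)$, $f\in C_c^\infty(\mathbb R^n)$ (viewed in $\mathcal S'/\mathcal P$), and $F^s(x,t)=P^s_tf(x)$. With the usual modification (essential supremum) when $q=\infty$ or $p=\infty$: (i) For $\beta\in(0,1]$ and $\alpha<\beta$: $\|f\|_{\dot B^\alpha_{p,q}}\approx\Big(\int_0^\infty\big(\int_{\mathbb R^n}|t^{-\frac1q-\alpha+\beta}P^s_t((-\Delta)^{\beta/2}f)(x)|^pdx\big)^{q/p}dt\Big)^{1/q}$, and for $p<\infty$, $\|f\|_{\dot F^\alpha_{p,q}}\approx\Big(\int_{\mathbb R^n}\big(\int_0^\infty|t^{-\frac1q-\alpha+\beta}P^s_t((-\Delta)^{\beta/2}f)(x)|^qdt\big)^{p/q}dx\Big)^{1/p}$. (ii) For $\alpha<1$: $\|f\|_{\dot B^\alpha_{p,q}}\gtrsim\Big(\int_0^\infty\big(\int_{\mathbb R^n}|t^{-\frac1q-\alpha+1}\nabla_xF^s(x,t)|^pdx\big)^{q/p}dt\Big)^{1/q}$, and for $p<\infty$, $\|f\|_{\dot F^\alpha_{p,q}}\gtrsim\Big(\int_{\mathbb R^n}\big(\int_0^\infty|t^{-\frac1q-\alpha+1}\nabla_xF^s(x,t)|^qdt\big)^{p/q}dx\Big)^{1/p}$. (iii) For $\alpha<s$: the same two statements as in (ii) hold with $\approx$ in place of $\gtrsim$ and $\partial_tF^s$ in place of $\nabla_xF^s$.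
   Context: $P^s_tf(x)=C_{n,s}\int\frac{t^s}{(|x-y|^2+t^2)^{(n+s)/2}}f(y)dy$ ($C_{n,s}$ normalizing the kernel to integral 1). Fractional Laplacian $\widehat{(-\Delta)^{\beta/2}f}=(2\pi|\xi|)^\beta\widehat f$, $\widehat f(\xi)=\int f(x)e^{-2\pi ix\cdot\xi}dx$. Homogeneous spaces: fix $\varphi\in\mathcal S(\mathbb R^n)$ with $\operatorname{supp}\widehat\varphi=\{1/2\le|\xi|\le2\}$ and $\sum_{j\in\mathbb Z}\widehat\varphi(2^{-j}\xi)^2=1$ for $\xi\ne0$; $\varphi_j(x)=2^{jn}\varphi(2^jx)$. For $f\in\mathcal S'/\mathcal P$ (tempered distributions modulo polynomials): $\|f\|_{\dot B^\alpha_{p,q}}=\big(\sum_{j\in\mathbb Z}(2^{j\alpha}\|\varphi_j*f\|_{L^p})^q\big)^{1/q}$ and, for $p<\infty$, $\|f\|_{\dot F^\alpha_{p,q}}=\big\|\big(\sum_j(2^{j\alpha}|\varphi_j*f|)^q\big)^{1/q}\big\|_{L^p}$ (sup in $j$ when $q=\infty$). $A\approx B$ means $A\lesssim B\lesssim A$ with constants independent of $f$. *)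

(* Defs.v *)
From HB Require Import structures.
From mathcomp Require Import all_boot all_order all_algebra.
From mathcomp Require Import all_classical all_reals all_analysis.
From mathcomp Require Import ess_sup_inf.
From mathcomp Require Import complex.

Set Implicit Arguments.
Unset Strict Implicit.
Unset Printing Implicit Defensive.

Import Order.TTheory GRing.Theory Num.Theory.
Import numFieldNormedType.Exports.

Local Open Scope classical_set_scope.
Local Open Scope ring_scope.
Local Open Scope complex_scope.

Section HarmonicDefs.
Variable R : realType.
Variable n : nat.

Definition vec := 'rV[R]_n.

Definition dotp (x y : 'rV[R]_n) : R := \sum_(i < n) x ord0 i * y ord0 i.
Definition enorm (x : 'rV[R]_n) : R := Num.sqrt (dotp x x).

Definition evec (i : 'I_n) : 'rV[R]_n := \row_(j < n) (j == i)%:R.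

Definition cabs (z : R[i]) : R := Num.sqrt (@complex.Re R z ^+ 2 + @complex.Im R z ^+ 2).

Definition cexpi (th : R) : R[i] := cos th +i* sin th.

End HarmonicDefs.

Definition vcons (R : realType) (n : nat) (a : R) (v : 'rV[R]_n) : 'rV[R]_n.+1 :=
  \row_(i < n.+1) match unlift ord0 i with Some j => v ord0 j | None => a end.

(** Lebesgue integral over R^n of an extended-real valued function, computed as
    the iterated one-dimensional Lebesgue integral (Fubini/Tonelli). *)
Fixpoint iint (R : realType) (n : nat) : ('rV[R]_n -> \bar R) -> \bar R :=
  match n return ('rV[R]_n -> \bar R) -> \bar R with
  | 0 => fun g => g 0
  | n'.+1 => fun g =>
      (\int[@lebesgue_measure R]_(a in [set: R]) iint (fun v => g (vcons a v)))%E
  end.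

Section HarmonicDefs2.
Variable R : realType.
Variable n : nat.
Local Notation vec := ('rV[R]_n).

Definition cint (g : vec -> R[i]) : R[i] :=
  fine (iint (fun x => (@complex.Re R (g x))%:E)) +i* fine (iint (fun x => (@complex.Im R (g x))%:E)).

Definition esssupRn (h : vec -> \bar R) : \bar R :=
  ereal_inf [set M : \bar R |
     iint (fun x => (\1_[set y | (M < h y)%E] x)%:E) = 0%E].

Definition cderiv (g : R -> R[i]) (t : R) : R[i] :=
  (derive1 (fun u => @complex.Re R (g u)) t) +i* (derive1 (fun u => @complex.Im R (g u)) t).

Definition cderivable (g : R -> R[i]) (t : R) : Prop :=
  derivable (fun u => @complex.Re R (g u)) t 1 /\ derivable (fun u => @complex.Im R (g u)) t 1.

Definition pderiv (i : 'I_n) (g : vec -> R[i]) : vec -> R[i] :=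
  fun x => cderiv (fun h => g (x + h *: @evec R n i)) 0.

Definition iter_pderiv (ds : seq 'I_n) (g : vec -> R[i]) : vec -> R[i] :=
  foldr pderiv g ds.

Definition smooth (g : vec -> R[i]) : Prop :=
  forall ds : seq 'I_n,
    continuous (fun x => @complex.Re R (iter_pderiv ds g x)) /\
    continuous (fun x => @complex.Im R (iter_pderiv ds g x)) /\
    (forall (i : 'I_n) (x : vec),
        cderivable (fun h => iter_pderiv ds g (x + h *: @evec R n i)) 0).

Definition Cc_infty (g : vec -> R[i]) : Prop :=
  smooth g /\ exists M : R, forall x, M < enorm x -> g x = 0.

Definition schwartz (g : vec -> R[i]) : Prop :=
  smooth g /\
  forall (ds : seq 'I_n) (N : nat), exists C : R,
    forall x, (1 + enorm x) ^+ N * cabs (iter_pderiv ds g x) <= C.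

Definition fourier (g : vec -> R[i]) (xi : vec) : R[i] :=
  cint (fun x => g x * cexpi (- (2 * pi * dotp x xi))).

(** Fractional Laplacian (-Delta)^{beta/2} g, given by its Fourier transform
    (2 pi |xi|)^beta \hat g(xi), i.e. (Fourier inversion)
    x |-> \int (2 pi |xi|)^beta \hat g(xi) e^{2 pi i x.xi} dxi. *)
Definition fraclap (beta : R) (g : vec -> R[i]) (x : vec) : R[i] :=
  cint (fun xi => ((2 * pi * enorm xi) `^ beta)%:C * fourier g xi
                  * cexpi (2 * pi * dotp x xi)).

Definition conv (g h : vec -> R[i]) (x : vec) : R[i] :=
  cint (fun y => g y * h (x - y)).

Definition lpdil (phi : vec -> R[i]) (j : int) (x : vec) : R[i] :=
  ((2 : R) ^ (j * n%:Z)%R)%:C * phi (((2 : R) ^ j) *: x).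

(** Admissible Littlewood-Paley function: phi in S(R^n), supp \hat phi is the
    annulus {1/2 <= |xi| <= 2}, and sum_{j in Z} \hat phi(2^{-j} xi)^2 = 1 for
    xi <> 0 (the series, which has finitely many nonzero terms, is taken as
    the limit of the symmetric partial sums over -N <= j <= N). *)
Definition lp_admissible (phi : vec -> R[i]) : Prop :=
  schwartz phi /\
  closure [set xi : vec | fourier phi xi != 0] =
    [set xi : vec | 2^-1 <= enorm xi <= 2] /\
  forall xi : vec, xi != 0 ->
    let S := fun N : nat =>
      \sum_(k < (N + N).+1)
         fourier phi (((2 : R) ^ (- (k%:Z - N%:Z))) *: xi) ^+ 2 in
    ((fun N => @complex.Re R (S N)) @ \oo --> (1 : R)) /\
    ((fun N => @complex.Im R (S N)) @ \oo --> (0 : R)).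

(** Normalizing constant C_{n,s} of the kernel t^s/(|x|^2+t^2)^{(n+s)/2}
    (the integral of the kernel does not depend on t > 0; computed at t = 1). *)
Definition Cns (s : R) : R :=
  (fine (iint (fun y : vec =>
     ((enorm y ^+ 2 + 1) `^ (- ((n%:R + s) / 2)))%:E)))^-1.

Definition Pst (s t : R) (g : vec -> R[i]) (x : vec) : R[i] :=
  cint (fun y => (Cns s * (t `^ s) *
                  ((enorm (x - y) ^+ 2 + t ^+ 2) `^ (- ((n%:R + s) / 2))))%:C
                 * g y).

Definition grad_x_abs (F : vec -> R -> R[i]) (x : vec) (t : R) : R :=
  Num.sqrt (\sum_(i < n) cabs (pderiv i (fun y => F y t) x) ^+ 2).

Definition dt_abs (F : vec -> R -> R[i]) (x : vec) (t : R) : R :=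
  cabs (cderiv (fun u => F x u) t).

Definition einv (q : \bar R) : R :=
  match q with EFin r => r^-1 | _ => 0 end.

Definition LpRn (p : \bar R) (h : vec -> \bar R) : \bar R :=
  match p with
  | EFin r => ((iint (fun x => h x `^ r)) `^ r^-1)%E
  | _ => esssupRn h
  end.

Definition Lqt (q : \bar R) (h : R -> \bar R) : \bar R :=
  match q with
  | EFin r =>
      ((\int[@lebesgue_measure R]_(t in [set u : R | (0 < u)%R]) h t `^ r) `^ r^-1)%E
  | _ => ess_sup (@lebesgue_measure R) (fun t => if (0 < t)%R then h t else 0%E)
  end.

Definition lqZ (q : \bar R) (a : int -> \bar R) : \bar R :=
  match q with
  | EFin r => ((\esum_(j in [set: int]) a j `^ r) `^ r^-1)%E
  | _ => ereal_sup (range a)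
  end.

Definition besov (phi : vec -> R[i]) (alpha : R) (p q : \bar R)
  (f : vec -> R[i]) : \bar R :=
  lqZ q (fun j => ((2 : R) `^ (j%:~R * alpha))%:E *
                  LpRn p (fun x => (cabs (conv (lpdil phi j) f x))%:E))%E.

Definition triebel (phi : vec -> R[i]) (alpha : R) (p q : \bar R)
  (f : vec -> R[i]) : \bar R :=
  LpRn p (fun x => lqZ q (fun j =>
     ((2 : R) `^ (j%:~R * alpha) * cabs (conv (lpdil phi j) f x))%:E)).

Definition mixB (p q : \bar R) (gamma : R) (G : vec -> R -> R) : \bar R :=
  Lqt q (fun t => LpRn p (fun x => (`| t `^ gamma * G x t |)%:E)).

Definition mixF (p q : \bar R) (gamma : R) (G : vec -> R -> R) : \bar R :=
  LpRn p (fun x => Lqt q (fun t => (`| t `^ gamma * G x t |)%:E)).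

Definition equiv_norms (Cl : (vec -> R[i]) -> Prop)
  (A B : (vec -> R[i]) -> \bar R) : Prop :=
  exists C : R, 0 < C /\ forall f, Cl f ->
    (A f <= C%:E * B f)%E /\ (B f <= C%:E * A f)%E.

Definition dominated (Cl : (vec -> R[i]) -> Prop)
  (B A : (vec -> R[i]) -> \bar R) : Prop :=
  exists C : R, 0 < C /\ forall f, Cl f -> (B f <= C%:E * A f)%E.

End HarmonicDefs2.

(* Main.v *)
(** On the Fourier side, [t^beta P^s_t (-Delta)^(beta/2) f], [t grad P^s_t f] and
[t d/dt P^s_t f] multiply the transform of [f] by [sigma (t xi)], where [sigma] is
[|xi|^beta], [xi_i] or [|xi|^2] times a Bessel-type factor
[mb b r = int_0^oo l^(b-1) e^(-l-r/l) dl] at [r = pi^2 |xi|^2]; this follows from writing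
the Poisson kernel as a superposition of Gaussians.  The same superposition bounds the
finite differences of [sigma (tau xi)] on the unit annulus, with decay as [tau] tends to
[0] (at the rate [tau^b'], [b' = beta], [1], [s]) and to infinity.

If [A] and [B] are two such symbols, or Littlewood-Paley bumps, the partition of unity
[sum_j Phi(2^-j xi)^2 = 1] writes [A(tD) f] as a sum over dyadic [m] of convolutions of
[B(2^-m D) f] with kernels dominated by polynomially decaying bumps [eta (2^m)], with
coefficients decaying in the scale gap; dividing by [B] is possible when [B] does not vanish
off the origin, which fails for [xi_i], hence the one-sided estimate (ii).  The
Stromberg-Torchinsky device upgrades this to [r]-th powers for any [r <= 1], and
[alpha < b'] makes the weights geometrically summable.  With [r < min (p, q)], Minkowski's
inequality gives the Besov estimates and a Fefferman-Stein inequality for the [eta]-averages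
the Triebel-Lizorkin ones; the latter is obtained by duality and a direct bound for
[int (sum_j T_j h_j)^e], without maximal functions.  The integral in [t] is cut into shells
[t = th 2^-l] with [1 <= th <= 2]. *)
Require Import Defs.
From HB Require Import structures.
From mathcomp Require Import all_boot all_order all_algebra.
From mathcomp Require Import all_classical all_reals all_analysis.
From mathcomp Require Import ess_sup_inf complex.
From mathcomp Require Import measurable_realfun ring lra zify.
Import Order.TTheory GRing.Theory Num.Theory.
Local Open Scope ring_scope.

Set Implicit Arguments.
Unset Strict Implicit.
Unset Printing Implicit Defensive.
Import numFieldNormedType.Exports.
Local Open Scope classical_set_scope.
Local Open Scope ring_scope.
Local Notation Re := (@complex.Re _).
Local Notation Im := (@complex.Im _).
Local Notation mcomp := measurableT_comp.
Local Notation mEFinP := measurable_EFinP.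
Local Notation mfun := (measurable_fun setT).

(* Two facts shape the proof: the symbols are not smooth at the origin, and p, q may be below 1.
   Smoothness is therefore required on annuli only, and it enters through finite differences: these
   pass through an integral over Gaussian widths and through products and quotients of symbols by
   elementary algebra, where iterated partial derivatives would each need a justification. A step of
   length 1/(2 |x_i|) makes a difference multiply the transform by -2, which is how differences
   yield kernel decay. Below 1 the space L^p has no triangle inequality, so pointwise estimates are
   first raised to a power r < min (p, q), after which p/r and q/r exceed 1. That passage rests on
   an estimate of a multiplier by itself at other scales; like the duality arguments, it ends by
   absorbing a quantity into a smaller power of itself. Absorption needs finiteness in advance: it
   comes from the boundedness of multipliers applied to a test function, whose transform decays
   rapidly, and from truncation to finitely many scales. *)
Tactic Notation "le_via" uconstr(x) := refine (@le_trans _ _ x _ _ _ _).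

Lemma le_of_eq {d} {T : porderType d} (x y : T) : x = y -> (x <= y)%O.
Proof. by move=> ->. Qed.

(* Automation for sign and measurability side conditions *)
Create HintDb side discriminated.
Hint Constants Opaque: side.
Hint Variables Opaque: side.

Ltac unfold_head t:= match t with
 | ?f _=> unfold_head f
 | _=> match goal with x:= _ |- _=> constr_eq x t; unfold x; cbv beta end
 end.

Ltac sign_step:= match goal with
 | |- is_true (@Order.le _ _ _ ?x)=> match x with
  | @GRing.mul _ _ _=> apply: mulr_ge0
  | @mule _ _ _=> apply: mule_ge0
  | @GRing.add _ _ (@GRing.opp _ _)=> rewrite subr_ge0
  | @GRing.add _ _ _=> apply: addr_ge0
  | @adde _ _ _=> apply: adde_ge0
  | @GRing.exp _ _ _=> first [exact: sqr_ge0 | apply: exprn_ge0]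
  | @GRing.inv _ _=> rewrite invr_ge0
  | @GRing.natmul _ _ _=> first [exact: ler0n | apply: mulrn_wge0]
  | @GRing.one _=> exact: ler01
  | @Num.norm _ _ _=> exact: normr_ge0
  | @powR _ _ _=> exact: powR_ge0
  | @expR _ _=> exact: expR_ge0
  | @poweR _ _ _=> exact: poweR_ge0
  | EFin _=> rewrite lee_fin
  | @fine _ _=> apply: fine_ge0
  | @indic _ _ _ _=> rewrite indicE
  | @integral _ _ _ _ _ _=> apply: integral_ge0
  | bigop _ _ _=> first [apply: sumr_ge0 | apply: prodr_ge0 | apply: sume_ge0 | apply: prode_ge0]
  | _=> exact: sqrtr_ge0
  | _=> unfold_head x
  end
 | |- is_true (@Order.lt _ _ _ ?x)=> match x with
  | @GRing.mul _ _ _=> apply: mulr_gt0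
  | @GRing.add _ _ (@GRing.opp _ _)=> rewrite subr_gt0
  | @GRing.add _ _ _=> first [apply: addr_gt0 | apply: ltr_wpDr | apply: ltr_wpDl]
  | @GRing.exp _ _ _=> apply: exprn_gt0
  | @GRing.inv _ _=> rewrite invr_gt0
  | @GRing.natmul _ _ _=> by rewrite ltr0n
  | @GRing.one _=> exact: ltr01
  | @powR _ _ _=> apply: powR_gt0
  | @expR _ _=> exact: expR_gt0
  | @pi _=> exact: pi_gt0
  | EFin _=> rewrite lte_fin
  | _=> unfold_head x
  end
 | |- is_true (in_mem _ _)=> rewrite nnegrE
 | |- is_true (~~ (_ == _))=> rewrite gt_eqF//
 | |- (_ == _) = false=> rewrite gt_eqF//
 end.

Ltac measurable_step:= match goal with
 | H: measurable_fun _ ?h |- measurable_fun _ (fun x=> ?h (@?g x))=> apply: (mcomp H)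
 | H: forall i, measurable_fun _ _ |- measurable_fun _ (fun x=> _ (@?g x))=> apply: (mcomp (H _))
 | |- measurable_fun ?D ?f=> match f with
  | fun x=> x=> exact: measurable_id
  | id=> exact: measurable_id
  | fun x=> ?h x=> change (measurable_fun D h)
  | fst=> exact: measurable_fst
  | snd=> exact: measurable_snd
  | fun x=> fst (@?a x)=> apply: (mcomp measurable_fst)
  | fun x=> snd (@?a x)=> apply: (mcomp measurable_snd)
  | fun x=> (@?a x, @?b x)=> apply/measurable_fun_pairP; split
  | fun x=> EFin (@?a x)=> apply/mEFinP
  | fun x=> @GRing.mul _ (@?a x) (@?b x)=> apply: measurable_funM
  | fun x=> @mule _ (@?a x) (@?b x)=> apply: emeasurable_funM
  | fun x=> @GRing.add _ (@?a x) (@?b x)=> apply: measurable_funD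
  | fun x=> @adde _ (@?a x) (@?b x)=> apply: emeasurable_funD
  | fun x=> @GRing.opp _ (@?a x)=> apply: measurable_funN
  | fun x=> @GRing.exp _ (@?a x) _=> apply: measurable_funX
  | fun x=> @expR _ (@?a x)=> apply: (mcomp (@measurable_expR _))
  | fun x=> @powR _ (@?a x) _=> apply: (mcomp (measurable_powR _))
  | fun x=> @poweR _ (@?a x) _=> apply: (mcomp (measurable_poweR _))
  | fun x=> @Num.norm _ _ (@?a x)=> apply: (mcomp (@normr_measurable _ _))
  | indic _=> apply: measurable_indic
  | fun x=> _=> exact: measurable_cst
  | fun x=> ?t=> unfold_head t
  | _=> unfold_head f
  end
 | |- measurable_fun ?D _=> tryif unify D [set: _] then fail else apply: measurable_funTS
 end.

Hint Extern 1 (is_true (@Order.le _ _ _ _))=> apply: ltW; assumption: side.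
Hint Extern 2 (is_true _)=> sign_step: side.
Hint Extern 9 (is_true (@Order.le ring_display _ _ _))=> apply: ltW: side.
Hint Extern 2 (_ = false)=> sign_step: side.
Hint Extern 2 (measurable_fun _ _)=> measurable_step: side.
Ltac side:= solve [done | intros; cbv beta; auto 12 with side nocore | move=> * /=; auto 12 with side nocore].

Definition rV_display: measure_display. Proof. exact: default_measure_display. Qed.

(** * Lebesgue measure on row vectors *)
Section measurable_rV.
Context {R: realType}.
Variable n: nat.

Definition tuple_of_rV (v: 'rV[R]_n): n.-tuple R:= [tuple v ord0 i | i < n].

(** Pulled back from the product sigma-algebra on tuples, so that a map into row vectors is
    measurable as soon as its coordinates are. *)
Definition rV_measurable: set (set 'rV[R]_n) :=
 preimage_set_system [set: 'rV[R]_n] tuple_of_rV measurable.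
Let rVm0: rV_measurable set0.
Proof. by exists set0=> //; rewrite preimage_set0 setI0. Qed.
Let rVmC A: rV_measurable A -> rV_measurable (~` A).
Proof.
by move=> [B mB <-]; exists (~` B); [exact: measurableC|rewrite !setTI].
Qed.
Let rVmU (F: (set 'rV[R]_n)^nat): (forall i, rV_measurable (F i)) ->
 rV_measurable (\bigcup_i F i).
Proof.
move=> mF; have /choice[G GF]: forall i, exists B, measurable B /\ F i = tuple_of_rV @^-1` B.
 by move=> i; have [B mB <-]:= mF i; exists B; rewrite setTI.
exists (\bigcup_i G i); first by apply: bigcupT_measurable=> i; have []:= GF i.
rewrite setTI preimage_bigcup; apply: eq_bigcupr=> i _.
by have [_ ->]:= GF i.
Qed.

HB.instance Definition _:= @isMeasurable.Build rV_display 'rV[R]_n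
 rV_measurable rVm0 rVmC rVmU.
Lemma meas_fun_rVP d (T: measurableType d) (f: T -> 'rV[R]_n) :
 (forall i, mfun (fun x=> f x ord0 i)) -> mfun f.
Proof.
move=> mf; have mt: mfun (tuple_of_rV \o f).
 apply/measurable_fun_tnthP=> i /=.
 rewrite (_: _ \o _ = (fun x=> f x ord0 i)); first exact: mf.
 by apply/funext=> x /=; rewrite tnth_mktuple.
move=> _ _ [B mB <-]; rewrite !setTI.
by have:= mt measurableT _ mB; rewrite setTI.
Qed.
Hint Resolve meas_fun_rVP: side.
Lemma meas_coord i: mfun (fun v: 'rV[R]_n=> v ord0 i).
Proof.
rewrite (_: (fun v=> _) = (fun t: n.-tuple R=> tnth t i) \o tuple_of_rV).
 apply: mcomp; first exact: measurable_tnth.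
 move=> _ B mB; exists B=> //.
by apply/funext=> v /=; rewrite tnth_mktuple.
Qed.

End measurable_rV.
Hint Extern 0 (measurable_fun _ (fun v=> v ord0 _)) =>
 solve [apply: meas_coord]: core.

Section rV_lemmas.
Context {R: realType}.

Definition vtail n (v: 'rV[R]_n.+1): 'rV[R]_n:= \row_i v ord0 (lift ord0 i).
Lemma vcons0 n (a: R) (v: 'rV[R]_n): vcons a v ord0 ord0 = a.
Proof. by rewrite mxE unlift_none. Qed.
Lemma vconsS n (a: R) (v: 'rV[R]_n) i: vcons a v ord0 (lift ord0 i) = v ord0 i.
Proof. by rewrite mxE liftK. Qed.
Lemma meas_vcons n :
 mfun (fun z: R*'rV[R]_n=> vcons z.1 z.2).
Proof.
apply: meas_fun_rVP=> i.
have [j ->|->]:= unliftP ord0 i.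
 under eq_fun do rewrite vconsS.
 by apply: (mcomp (meas_coord j)).
by under eq_fun do rewrite vcons0; exact: measurable_fst.
Qed.

End rV_lemmas.

Section muR.
Context {R: realType}.

Definition dirac0: {sigma_finite_measure set 'rV[R]_0 -> \bar R}:= @dirac _ 'rV[R]_0 0 R.

Section step.
Variables (n: nat) (m: {sigma_finite_measure set 'rV[R]_n -> \bar R}).
Let vc (z: measurableTypeR R*'rV[R]_n):= vcons z.1 z.2.
Let mvc: mfun vc:= @meas_vcons R n.

Definition mustep: set 'rV[R]_n.+1 -> \bar R:= pushforward (@lebesgue_measure R \x m)%E vc.
Let M: {measure set 'rV[R]_n.+1 -> \bar R} :=
 measure_function_pushforward__canonical__measure_function_Measure
  (@lebesgue_measure R \x m)%E mvc.
HB.instance Definition _:= @isMeasure.Build _ _ _ mustep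
 (measure0 M) (measure_ge0 M) (@measure_semi_sigma_additive _ _ _ M).
Let sf: sigma_finite setT mustep.
Proof.
have /sigma_finiteP[F [TF ndF Foo]]:= sigma_finiteT (@lebesgue_measure R).
have /sigma_finiteP[G [TG ndG Goo]]:= sigma_finiteT m.
pose D k:= [set v: 'rV[R]_n.+1 | F k (v ord0 ord0) /\ G k (vtail v)].
have e k: vc @^-1` D k = F k `*` G k.
 apply/seteqP; split=> -[a v] /=; rewrite /D /vc/= vcons0 (_: vtail _ = v)//;
 by apply/rowP=> l; rewrite !mxE liftK.
exists D.
 apply/seteqP; split=> // v _.
 have [k _ Fk]: (\bigcup_k F k) (v ord0 ord0) by rewrite -TF.
 have [l _ Gl]: (\bigcup_k G k) (vtail v) by rewrite -TG.
 exists (maxn k l)=> //; split.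
  by move: (v ord0 ord0) Fk; exact/subsetPset/ndF/leq_maxl.
 by move: (vtail v) Gl; exact/subsetPset/ndG/leq_maxr.
move=> k; have [mFk Fk]:= Foo k; have [mGk Gk]:= Goo k; split; last first.
 by rewrite /mustep /pushforward e product_measure1E// lte_mul_pinfty// ge0_fin_numE.
rewrite (_: D k = (fun v: 'rV[R]_n.+1=> (v ord0 ord0, vtail v)) @^-1` (F k `*` G k))//.
rewrite -[X in measurable X]setTI.
suff: mfun (fun v: 'rV[R]_n.+1=> (v ord0 ord0: measurableTypeR R, vtail v)).
 by apply=> //; exact: measurableX.
apply/measurable_fun_pairP; split=> /=; first exact: meas_coord.
apply: meas_fun_rVP=> l /=.
by rewrite /comp/=; under eq_fun do rewrite mxE; exact: meas_coord.
Qed.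

HB.instance Definition _:= Measure_isSigmaFinite.Build _ _ _ mustep sf.
Definition musucc: {sigma_finite_measure set 'rV[R]_n.+1 -> \bar R}:= mustep.
End step.

(** Lebesgue measure on R^n, built by the same recursion on the first coordinate as [iint], so that
    the two integrals can be compared one coordinate at a time. On R^0, a single point, it is the
    unit mass. *)
Fixpoint mu n: {sigma_finite_measure set 'rV[R]_n -> \bar R} :=
 match n with 0=> dirac0 | n'.+1=> musucc (mu n') end.

End muR.

Section lebesgue_affine.
Context {R: realType}.
Local Open Scope ereal_scope.
(** By uniqueness of Lebesgue measure: c times the push-forward under x -> c x + b gives every
    half-open interval its length. *)
Lemma ge0_integral_affine (c b: R) (f: R -> \bar R): (0 < c)%R ->
 measurable_fun [set: R] f -> (forall x, 0 <= f x) ->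
 c%:E*\int[@lebesgue_measure R]_x f (c*x + b)%R = \int[@lebesgue_measure R]_x f x.
Proof.
move=> c0 mf f0.
pose phi (x: measurableTypeR R): measurableTypeR R:= (c*x + b)%R.
have mphi: mfun phi.
 by apply: measurable_funD=> //; side.
have c0': (0 <= c)%R by side.
pose M: {measure set (measurableTypeR R) -> \bar R} :=
 mscale (NngNum c0') (measure_function_pushforward__canonical__measure_function_Measure
  (@lebesgue_measure R) mphi).
have ME A: measurable A -> @lebesgue_measure R A = M A.
 apply: lebesgue_measure_unique=> _ [[u v]] _ <-.
 rewrite /M/= /mscale/= /pushforward.
 have -> : phi @^-1` `]u, v] = [set` `](u - b)/c, (v - b)/c]%R].
  apply/seteqP; split=> x; rewrite /phi/= !in_itv/= ltr_pdivrMr// ler_pdivlMr//;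
  by rewrite ltrBlDr lerBrDr mulrC.
 rewrite /= !lebesgue_measure_itv/= !lte_fin ltr_pM2r ?invr_gt0// ltrD2r.
 case: ifPn=> _; last by rewrite mule0.
 rewrite -!EFinD -EFinM; congr (_%:E); rewrite -mulrBl mulrCA mulfV ?gt_eqF// mulr1.
 ring.
transitivity (\int[M]_x f x); last first.
 by apply: eq_measure_integral=> A mA _; exact: (esym (ME A mA)).
rewrite ge0_integral_mscale//= ge0_integral_pushforward//=.
Qed.
Lemma ge0_integralN (f: R -> \bar R):
 measurable_fun [set: R] f -> (forall x, 0 <= f x) ->
 \int[@lebesgue_measure R]_x f (- x)%R = \int[@lebesgue_measure R]_x f x.
Proof.
move=> mf f0.
have mN: mfun (-%R: measurableTypeR R -> measurableTypeR R).
 side.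
transitivity (\int[pushforward (@lebesgue_measure R) (-%R: measurableTypeR R -> measurableTypeR R)]_x f x).
 by rewrite ge0_integral_pushforward.
by apply: eq_measure_integral=> A mA _; exact: lebesgue_measureN.
Qed.

End lebesgue_affine.

Section iint_mu.
Context {R: realType}.
Local Open Scope ereal_scope.
Lemma meas_vcons1 n (g: 'rV[R]_n.+1 -> \bar R) a :
 mfun g -> mfun (fun v=> g (vcons a v)).
Proof.
move=> mg; apply: mcomp=> //.
exact: (measurable_fun_pair2 a (@meas_vcons R n)).
Qed.
Lemma meas_vcons2 n (g: 'rV[R]_n.+1 -> \bar R) :
 mfun g -> mfun (fun z: R*'rV[R]_n=> g (vcons z.1 z.2)).
Proof. by move=> mg; apply: mcomp=> //; exact: meas_vcons. Qed.
Lemma integral_mu0 (g: 'rV[R]_0 -> \bar R): \int[mu 0]_v g v = g 0%R.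
Proof.
have -> : g = cst (g 0%R) by apply/funext=> v; rewrite (_: v = 0%R)//; apply/rowP=> -[].
rewrite integral_cst//= /cst diracE mem_set//.
by rewrite mule1.
Qed.
Let vc n (z: measurableTypeR R*'rV[R]_n):= vcons z.1 z.2.
Let mvc n: mfun (@vc n):= @meas_vcons R n.
Lemma integral_muSE n (g: 'rV[R]_n.+1 -> \bar R) :
 \int[mu n.+1]_v g v = \int[pushforward (@lebesgue_measure R \x mu n) (@vc n)]_v g v.
Proof. by []. Qed.
Lemma ge0_integral_muS n (g: 'rV[R]_n.+1 -> \bar R) :
 mfun g -> (forall v, 0 <= g v) ->
 \int[mu n.+1]_v g v = \int[@lebesgue_measure R]_a \int[mu n]_v g (vcons a v).
Proof.
move=> mg g0.
rewrite integral_muSE ge0_integral_pushforward//.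
rewrite (fubini_tonelli1 (m1:= @lebesgue_measure R))//; try side.
- exact: meas_vcons2.
- exact: mvc.
Qed.
Lemma meas_integral_mu n (g: 'rV[R]_n.+1 -> \bar R) :
 mfun g -> (forall v, 0 <= g v) ->
 mfun (fun a: R=> \int[mu n]_v g (vcons a v)).
Proof.
move=> mg g0.
apply: (measurable_fun_fubini_tonelli_F (fun z=> g (vcons z.1 z.2)))=> //=.
side.
Qed.
Lemma ge0_iintE n (g: 'rV[R]_n -> \bar R) :
 mfun g -> (forall v, 0 <= g v) -> iint g = \int[mu n]_v g v.
Proof.
elim: n g=> [|n IH] g mg g0 /=; first by rewrite integral_mu0.
rewrite ge0_integral_muS//; apply: eq_integral=> a _.
by rewrite IH//; exact: meas_vcons1.
Qed.
Lemma integrable_muS n (g: 'rV[R]_n.+1 -> \bar R) :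
 (mu n.+1).-integrable setT g ->
 (@lebesgue_measure R \x mu n).-integrable setT (fun z=> g (vcons z.1 z.2)).
Proof.
move=> /integrableP[mg ig]; apply/integrableP; split; first side.
rewrite (fubini_tonelli1 (m1:= @lebesgue_measure R) (m2:= mu n) (fun z=> `|g (vcons z.1 z.2)|))//=.
 by have:= ig; rewrite ge0_integral_muS//; exact: mcomp.
by apply: (@meas_vcons2 n (fun v=> `|g v|)); exact: mcomp.
Qed.
Lemma integral_muS n (g: 'rV[R]_n.+1 -> \bar R) :
 (mu n.+1).-integrable setT g ->
 \int[mu n.+1]_v g v = \int[@lebesgue_measure R]_a \int[mu n]_v g (vcons a v).
Proof.
move=> ig; have mg:= measurable_int _ ig.
rewrite (integral12_prod_meas1 (integrable_muS ig)) integralE [RHS]integralE.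
congr (_ - _); rewrite integral_muSE ge0_integral_pushforward//;
 do ?[exact: measurable_funeneg|exact: measurable_funepos|exact: mvc].
- by rewrite preimage_setT; apply: eq_integral=> x _; rewrite unlock.
- by rewrite preimage_setT; apply: eq_integral=> x _; rewrite unlock.
Qed.
(** No integrability is involved: an extended-real integral is always the difference of the
    integrals of the positive and negative parts, so measurability in a parameter survives each
    iteration. *)
Lemma meas_iint d (T: measurableType d) n (g: T*'rV[R]_n -> \bar R) :
 mfun g -> mfun (fun x=> iint (fun v=> g (x, v))).
Proof.
elim: n d T g=> [|n IH] d T g mg /=.
 by apply: mcomp=> //; side.
pose h (z: T*R):= iint (fun v=> g (z.1, vcons z.2 v)).
have mh: mfun h.
 apply: (IH _ (T*R)%type (fun z=> g (z.1.1, vcons z.1.2 z.2))).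
 apply: mcomp=> //; apply/measurable_fun_pairP; split=> /=.
  exact: (mcomp measurable_fst measurable_fst).
 apply: (@measurableT_comp _ _ _ _ _ _ (fun z=> vcons z.1 z.2) _ (fun z: T*R*'rV[R]_n=> (z.1.2, z.2))).
  side.
 apply/measurable_fun_pairP; split=> /=; last exact: measurable_snd.
 exact: (mcomp measurable_snd measurable_fst).
rewrite (_: (fun x=> _) = (fun x=> \int[@lebesgue_measure R]_a h^\+ (x, a) -
  \int[@lebesgue_measure R]_a h^\- (x, a))); last first.
 apply/funext=> x; rewrite integralE; congr (_ - _); apply: eq_integral=> a _; by rewrite unlock.
apply: emeasurable_funB;
 apply: (@measurable_fun_fubini_tonelli_F _ _ _ _ _ (@lebesgue_measure R))=> //.
 exact: measurable_funepos.
exact: measurable_funeneg.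
Qed.
(** The slices of an integrable function are integrable for almost every first coordinate only, so
    the induction hypothesis is used almost everywhere; [meas_iint] provides the measurability of
    the iterated side. *)
Lemma iintE n (g: 'rV[R]_n -> \bar R) :
 (mu n).-integrable setT g -> iint g = \int[mu n]_v g v.
Proof.
elim: n g=> [|n IH] g ig /=; first by rewrite integral_mu0.
rewrite integral_muS//.
have ig2:= integrable_muS ig.
apply: ae_eq_integral=> //.
- apply: (@meas_iint _ R n (fun z=> g (vcons z.1 z.2))).
 exact: (meas_vcons2 (measurable_int _ ig)).
- exact: (measurable_fubini_F ig2).
have:= ae_integrable1 ig2; apply: filterS=> a /= iga _.
exact: IH.
Qed.

End iint_mu.

Section measurable_vector.
Context {R: realType} {d} {T: measurableType d} {n: nat}.
Implicit Types f g: T -> 'rV[R]_n.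
Lemma meas_addV f g: mfun f -> mfun g ->
 mfun (fun x=> f x + g x).
Proof.
move=> mf mg; apply: meas_fun_rVP=> i.
under eq_fun do rewrite mxE.
by apply: measurable_funD; apply: (mcomp (meas_coord i)).
Qed.
Hint Resolve meas_addV: side.
Lemma meas_scaleV (c: T -> R) f: mfun c -> mfun f ->
 mfun (fun x=> c x *: f x).
Proof.
move=> mc mf; apply: meas_fun_rVP=> i.
under eq_fun do rewrite mxE.
by apply: measurable_funM=> //; apply: (mcomp (meas_coord i)).
Qed.
Hint Resolve meas_scaleV: side.
Lemma meas_oppV f: mfun f ->
 mfun (fun x=> - f x).
Proof.
move=> mf; under eq_fun do rewrite -scaleN1r.
by apply: meas_scaleV=> //; side.
Qed.
Hint Resolve meas_oppV: side.
Lemma meas_subV f g: mfun f -> mfun g ->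
 mfun (fun x=> f x - g x).
Proof. side. Qed.
Lemma meas_dotp f g: mfun f -> mfun g ->
 mfun (fun x=> dotp (f x) (g x)).
Proof.
move=> mf mg; apply: measurable_sum=> i.
by apply: measurable_funM; apply: (mcomp (meas_coord i)).
Qed.

End measurable_vector.

Section continuous_measurable_rV.
Context {R: realType} {n: nat}.
Let B (u: 'rV[rat]_n) (k: nat): set 'rV[R]_n :=
 [set x | forall i, `|x ord0 i - ratr (u ord0 i)| < k.+1%:R^-1].
Let mB u k: measurable (B u k).
Proof.
have -> : B u k = \bigcap_(i: 'I_n) [set x: 'rV[R]_n | `|x ord0 i - ratr (u ord0 i)| < k.+1%:R^-1].
 by apply/seteqP; split=> x /= h i; [move=> _|]; exact: h.
apply: fin_bigcap_measurable=> // i _.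
rewrite -[X in measurable X]setTI.
apply: (@measurable_fun_ltr _ _ _ _ (fun x: 'rV[R]_n=> `|x ord0 i - ratr (u ord0 i)|) (cst k.+1%:R^-1))=> //.
by apply: mcomp=> //; apply: measurable_funB=> //; exact: meas_coord.
Qed.
(** The countably many rational cubes [B u k] form a base of the topology, so an open set is the
    union of those it contains. *)
Lemma open_measurable_rV (U: set 'rV[R]_n): open U -> measurable U.
Proof.
move=> oU; have -> : U = \bigcup_(p: 'rV[rat]_n*nat) (if `[< B p.1 p.2 `<=` U >] then B p.1 p.2 else set0).
 apply/seteqP; split=> [x Ux|x [[u k] _]]; last by case: asboolP=> // + /=; exact.
 have /nbhs_ballP[e /= e0 xe]: nbhs x U by move: oU; rewrite openE; exact.
 have [k ke]: exists k: nat, 2*(k.+1%:R^-1) < e.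
  have [k _ hk]:= near_infty_natSinv_lt (PosNum (divr_gt0 e0 (ltr0Sn _ 1))).
  by exists k; have /= := hk k (leqnn k); rewrite ltr_pdivlMr// mulrC.
 have /choice[u hu]: forall i, exists q: rat, `|x ord0 i - ratr q| < k.+1%:R^-1.
  move=> i; have [|q]:= @rat_in_itvoo R (x ord0 i - k.+1%:R^-1) (x ord0 i + k.+1%:R^-1).
   by rewrite ltrD2l gtrN// invr_gt0.
  rewrite in_itv/= => /andP[q1 q2]; exists q; rewrite ltr_norml; move: q1 q2; set z:= k.+1%:R^-1=> q1 q2; apply/andP; split; lra.
 have BU: B (\row_i u i) k `<=` U.
  move=> y By; apply: xe.
  split=> // i0 i; rewrite !ord1 /ball/=; have:= hu i; have /= := By i; rewrite mxE=> h1 h2.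
  have -> : x ord0 i - y ord0 i = (x ord0 i - ratr (u i)) - (y ord0 i - ratr (u i)) by ring.
  apply: le_lt_trans (ler_normB _ _) _; move: ke h1 h2; set z:= k.+1%:R^-1=> *; lra.
 exists (\row_i u i, k)=> //=; case: asboolP=> // _ i; first by rewrite mxE.
apply: countable_bigcupT_measurable; first exact: countableP.
by move=> [u k]; case: ifPn=> // _; exact: mB.
Qed.
Lemma continuous_measurable_rV (f: 'rV[R]_n -> R): continuous f -> mfun f.
Proof.
move=> cf; apply: (measurability _ (RGenOpens.measurableE R))=> _ [_ [a [b ->] <-]].
rewrite setTI; apply: open_measurable_rV; apply: open_comp; last exact: interval_open.
by move=> x _; exact: cf.
Qed.
Hint Resolve continuous_measurable_rV: side.

End continuous_measurable_rV.

Section affine.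
Context {R: realType}.
Local Open Scope ereal_scope.
Lemma vcons_affine n c (b: 'rV[R]_n.+1) a v :
 (c *: vcons a v + b = vcons (c*a + b ord0 ord0) (c *: v + vtail b))%R.
Proof.
apply/rowP=> i; rewrite !mxE; case: unliftP=> [j ->|->] //.
by rewrite !mxE.
Qed.
Lemma meas_affine n (c: R) (b: 'rV[R]_n): mfun (fun x: 'rV[R]_n=> (c *: x + b)%R).
Proof.
apply: meas_addV; last side.
by apply: meas_scaleV; [side|side].
Qed.
Lemma ge0_integral_mu_affine n (c: R) (b: 'rV[R]_n) (f: 'rV[R]_n -> \bar R): (0 < c)%R ->
 mfun f -> (forall x, 0 <= f x) ->
 (c^+n)%:E*\int[mu n]_x f (c *: x + b)%R = \int[mu n]_x f x.
Proof.
move=> c0; elim: n b f=> [|n IH] b f mf f0.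
 by rewrite expr0 mul1e !integral_mu0; congr f; apply/rowP=> -[].
have c0n: (0 <= c^+n)%R by side.
have mfc: mfun (fun x: 'rV[R]_n.+1=> f (c *: x + b)%R).
 by apply: mcomp=> //; exact: meas_affine.
rewrite !ge0_integral_muS//.
under eq_integral do under eq_integral do rewrite vcons_affine.
pose g (a: R):= \int[mu n]_v f (vcons a v).
have mg: measurable_fun [set: R] g by exact: meas_integral_mu.
rewrite -(ge0_integral_affine (b ord0 ord0) c0 mg); last side.
rewrite exprS EFinM -muleA; congr (_*_).
rewrite -ge0_integralZl//; last 2 first.
- rewrite [X in measurable_fun _ X](_: _ = (fun a=> \int[mu n]_v f (c *: vcons a v + b)%R)).
  exact: (@meas_integral_mu R n (fun x=> f (c *: x + b)%R)).
 by apply/funext=> a; apply: eq_integral=> v _; rewrite vcons_affine.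
- side.
apply: eq_integral=> a _.
apply: (IH (vtail b) (fun v=> f (vcons (c*a + b ord0 ord0)%R v)))=> //.
exact: meas_vcons1.
Qed.
Lemma ge0_integral_muN n (f: 'rV[R]_n -> \bar R) :
 mfun f -> (forall x, 0 <= f x) ->
 \int[mu n]_x f (- x)%R = \int[mu n]_x f x.
Proof.
elim: n f=> [|n IH] f mf f0.
 by rewrite !integral_mu0; congr f; apply/rowP=> -[].
have mfN: mfun (fun x: 'rV[R]_n.+1=> f (- x)%R).
 by apply: mcomp=> //; apply: meas_oppV; side.
rewrite (ge0_integral_muS mfN); last by move=> v; exact: f0.
rewrite (ge0_integral_muS mf f0).
have e a v: (- vcons a v = vcons (- a) (- v) :> 'rV[R]_n.+1)%R.
 by apply/rowP=> i; rewrite !mxE; case: unliftP=> // j _; rewrite !mxE.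
under eq_integral do under eq_integral do rewrite e.
rewrite -[RHS]ge0_integralN; last 2 first.
- exact: meas_integral_mu.
- side.
by apply: eq_integral=> a _; apply: IH=> //; exact: meas_vcons1.
Qed.
Lemma integral_mu_shift n (b: 'rV[R]_n) (f: 'rV[R]_n -> \bar R) :
 mfun f -> \int[mu n]_x f (x + b)%R = \int[mu n]_x f x.
Proof.
move=> mf; rewrite integralE [RHS]integralE; congr (_ - _).
 rewrite -[RHS](ge0_integral_mu_affine b (@ltr01 R))//; last exact: measurable_funepos.
 by rewrite expr1n mul1e; apply: eq_integral=> x _; rewrite unlock scale1r.
rewrite -[RHS](ge0_integral_mu_affine b (@ltr01 R))//; last exact: measurable_funeneg.
by rewrite expr1n mul1e; apply: eq_integral=> x _; rewrite unlock scale1r.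
Qed.
Lemma integral_muN n (f: 'rV[R]_n -> \bar R) :
 mfun f -> \int[mu n]_x f (- x)%R = \int[mu n]_x f x.
Proof.
move=> mf; rewrite integralE [RHS]integralE; congr (_ - _).
 rewrite -[RHS]ge0_integral_muN//; last exact: measurable_funepos.
 by apply: eq_integral=> x _; rewrite unlock.
rewrite -[RHS]ge0_integral_muN//; last exact: measurable_funeneg.
by apply: eq_integral=> x _; rewrite unlock.
Qed.
Lemma ge0_integral_mu_scale n (c: R) (g: 'rV[R]_n -> \bar R): (0 < c)%R ->
 mfun g -> (forall x, 0 <= g x) ->
 \int[mu n]_x g (c *: x)%R = (c ^- n)%:E*\int[mu n]_x g x.
Proof.
move=> c0 mg g0; rewrite -(ge0_integral_mu_affine 0%R c0 mg g0) muleA -EFinM mulVf ?expf_neq0 ?gt_eqF// mul1e.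
by apply: eq_integral=> x _; rewrite addr0.
Qed.
Lemma integral_mu_scale n (c: R) (f: 'rV[R]_n -> \bar R): (0 < c)%R ->
 (mu n).-integrable setT f -> \int[mu n]_x f (c *: x)%R = (c ^- n)%:E*\int[mu n]_x f x.
Proof.
move=> c0 intf; have mf:= measurable_int _ intf.
rewrite integralE [in RHS]integralE muleBr//; last first.
 apply: fin_num_adde_defl; rewrite fin_numN.
 by have:= integral_fune_fin_num measurableT (integrable_funeneg measurableT intf).
rewrite -!ge0_integral_mu_scale//; [|exact: measurable_funeneg|exact: measurable_funepos].
by congr (_ - _); apply: eq_integral=> x _; rewrite unlock.
Qed.
Lemma ge0_integral_prod_coord n (f: 'I_n -> R -> R): (forall i, measurable_fun [set: R] (f i)) ->
 (forall i x, 0 <= f i x)%R ->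
 \int[mu n]_x (\prod_(i < n) f i (x ord0 i))%:E = \prod_(i < n) \int[@lebesgue_measure R]_u (f i u)%:E.
Proof.
elim: n f=> [|n IH] f mf f0; first by rewrite integral_mu0 !big_ord0.
have mp m (h: 'I_m -> R -> R): (forall i, measurable_fun [set: R] (h i)) ->
 mfun (fun x: 'rV[R]_m=> \prod_(i < m) h i (x ord0 i))%R.
 move=> mh; apply: measurable_prod=> i _.
 by apply: (mcomp (mh i)); exact: meas_coord.
rewrite ge0_integral_muS//; try side; last first.
- by apply/mEFinP; exact: mp.
rewrite big_ord_recl -IH// -ge0_integralZr//; try side; last first.
- by apply/mEFinP; exact: mf.
apply: eq_integral=> a _.
under eq_integral do rewrite big_ord_recl vcons0 EFinM.
rewrite ge0_integralZl//=; try side; last first.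
- apply/mEFinP.
 under eq_fun do under eq_bigr do rewrite vconsS.
 by apply: (mp n (fun i=> f (lift ord0 i))).
congr (_*_); apply: eq_integral=> v _; congr (_%:E).
by apply: eq_bigr=> i _; rewrite vconsS.
Qed.

End affine.
Hint Resolve meas_addV meas_scaleV meas_oppV meas_subV meas_dotp: side.

Local Open Scope complex_scope.

(** * Complex-valued integrals *)
Section complex_facts.
Context {R: realType}.
Implicit Types z w: R[i].
Lemma complex_ext z w: Re z = Re w -> Im z = Im w -> z = w.
Proof. by case: z w=> [a b] [c e] /= -> ->. Qed.
Lemma ReM z w: Re (z*w) = Re z*Re w - Im z*Im w.
Proof. by case: z w=> [a b] [c e]. Qed.
Lemma ImM z w: Im (z*w) = Re z*Im w + Im z*Re w.
Proof. by case: z w=> [a b] [c e]. Qed.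
Lemma ReD z w: Re (z + w) = Re z + Re w. Proof. by case: z w=> [a b] [c e]. Qed.
Lemma ImD z w: Im (z + w) = Im z + Im w. Proof. by case: z w=> [a b] [c e]. Qed.
Lemma ReN z: Re (- z) = - Re z. Proof. by case: z. Qed.
Lemma ImN z: Im (- z) = - Im z. Proof. by case: z. Qed.
Lemma ReB z w: Re (z - w) = Re z - Re w. Proof. by rewrite ReD ReN. Qed.
Lemma ImB z w: Im (z - w) = Im z - Im w. Proof. by rewrite ImD ImN. Qed.
Lemma ReRM (r: R) z: Re (r%:C*z) = r*Re z. Proof. by rewrite ReM /= mul0r subr0. Qed.
Lemma ImRM (r: R) z: Im (r%:C*z) = r*Im z. Proof. by rewrite ImM /= mul0r addr0. Qed.
Lemma cabs_ge0 z: 0 <= cabs z. Proof. side. Qed.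
Hint Resolve cabs_ge0: side.
Lemma cabs_normc z: cabs z = ComplexField.Normc.normc z. Proof. by case: z. Qed.
Lemma cabsM z w: cabs (z*w) = cabs z*cabs w.
Proof. by rewrite !cabs_normc ComplexField.Normc.normcM. Qed.
Lemma cabsD z w: cabs (z + w) <= cabs z + cabs w.
Proof. by have:= ler_normD z w; rewrite !normc_def -rmorphD lecR. Qed.
Lemma cabsN z: cabs (- z) = cabs z.
Proof. by rewrite /cabs ReN ImN !sqrrN. Qed.
Lemma cabsB z w: cabs (z - w) <= cabs z + cabs w.
Proof. by rewrite (le_trans (cabsD _ _))// cabsN. Qed.
Lemma cabs_real (r: R): cabs r%:C = `|r|.
Proof. by rewrite /cabs/= expr0n/= addr0 sqrtr_sqr. Qed.
Lemma cabs0: cabs (0: R[i]) = 0.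
Proof. by have:= cabs_real 0; rewrite normr0. Qed.
Lemma cabs0_eq0 z: cabs z = 0 -> z = 0.
Proof. by rewrite cabs_normc; exact: ComplexField.Normc.eq0_normc. Qed.
Lemma cabs1: cabs (1: R[i]) = 1.
Proof. by have:= cabs_real 1; rewrite normr1. Qed.
Lemma cabs_eq0 z: (cabs z == 0) = (z == 0).
Proof. by apply/eqP/eqP=> [/cabs0_eq0//|->]; rewrite cabs0. Qed.
Lemma cabs_gt0 z: z != 0 -> 0 < cabs z.
Proof. by move=> z0; rewrite lt_def cabs_ge0 cabs_eq0 z0. Qed.
Lemma cabsV z: cabs z^-1 = (cabs z)^-1.
Proof.
have [->|z0]:= eqVneq z 0; first by rewrite invr0 cabs0 invr0.
have c0: cabs z != 0 by rewrite cabs_eq0.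
by apply: (mulfI c0); rewrite -cabsM !mulfV// cabs1.
Qed.
Lemma cabsX z k: cabs (z^+k) = cabs z^+k.
Proof. by elim: k=> [|k IH]; rewrite ?expr0 ?cabs1// !exprS cabsM IH. Qed.
Lemma cabs_sum I (r: seq I) (P: pred I) (F: I -> R[i]) :
 cabs (\sum_(i <- r | P i) F i) <= \sum_(i <- r | P i) cabs (F i).
Proof.
elim/big_ind2: _=> [||i _//]; first by rewrite cabs0.
by move=> a x b y h1 h2; rewrite (le_trans (cabsD _ _))// lerD.
Qed.
Lemma Re_le_cabs z: `|Re z| <= cabs z.
Proof. by rewrite /cabs -sqrtr_sqr ler_sqrt// ?addr_ge0 ?sqr_ge0// lerDl sqr_ge0. Qed.
Lemma Im_le_cabs z: `|Im z| <= cabs z.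
Proof. by rewrite /cabs -sqrtr_sqr ler_sqrt// ?addr_ge0 ?sqr_ge0// lerDr sqr_ge0. Qed.
Lemma cabs_le z: cabs z <= `|Re z| + `|Im z|.
Proof.
rewrite /cabs -[leRHS]ger0_norm ?addr_ge0// -sqrtr_sqr ler_sqrt ?sqr_ge0//.
rewrite sqrrD !real_normK ?num_real// -addrA lerD2l lerDr.
side.
Qed.
Lemma cexpiD (a b: R): cexpi (a + b) = cexpi a*cexpi b.
Proof. by apply: complex_ext; rewrite ?ReM ?ImM /= ?cosD ?sinD//; ring. Qed.
Lemma cexpi0: cexpi (0: R) = 1.
Proof. by rewrite /cexpi cos0 sin0. Qed.
Lemma cabs_cexpi (a: R): cabs (cexpi a) = 1.
Proof. by rewrite /cabs/= cos2Dsin2 sqrtr1. Qed.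
Lemma cexpi_sum I (r: seq I) (F: I -> R) :
 cexpi (\sum_(i <- r) F i) = \prod_(i <- r) cexpi (F i).
Proof. by elim: r=> [|i r IH]; rewrite ?big_nil ?cexpi0// !big_cons cexpiD IH. Qed.
Lemma dotpC n (x y: 'rV[R]_n): dotp x y = dotp y x.
Proof. by apply: eq_bigr=> i _; rewrite mulrC. Qed.
Lemma dotpDl n (x y z: 'rV[R]_n): dotp (x + y) z = dotp x z + dotp y z.
Proof. by rewrite /dotp -big_split/=; apply: eq_bigr=> i _; rewrite mxE mulrDl. Qed.
Lemma dotpDr n (x y z: 'rV[R]_n): dotp z (x + y) = dotp z x + dotp z y.
Proof. by rewrite dotpC dotpDl !(dotpC z). Qed.
Lemma dotpZl n (c: R) (x z: 'rV[R]_n): dotp (c *: x) z = c*dotp x z.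
Proof. by rewrite /dotp mulr_sumr; apply: eq_bigr=> i _; rewrite mxE mulrA. Qed.
Lemma dotpZr n (c: R) (x z: 'rV[R]_n): dotp z (c *: x) = c*dotp z x.
Proof. by rewrite dotpC dotpZl dotpC. Qed.
Lemma dotpNl n (x z: 'rV[R]_n): dotp (- x) z = - dotp x z.
Proof. by rewrite -scaleN1r dotpZl mulN1r. Qed.
Lemma dotpNr n (x z: 'rV[R]_n): dotp z (- x) = - dotp z x.
Proof. by rewrite dotpC dotpNl dotpC. Qed.
Lemma dotp_ge0 n (x: 'rV[R]_n): 0 <= dotp x x.
Proof. by apply: sumr_ge0=> i _; rewrite -expr2 sqr_ge0. Qed.
Lemma enorm_ge0 n (x: 'rV[R]_n): 0 <= enorm x.
Proof. side. Qed.
Lemma enorm_sqr n (x: 'rV[R]_n): enorm x^+2 = dotp x x.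
Proof. by rewrite sqr_sqrtr ?dotp_ge0. Qed.
Lemma dotp_evec n (x: 'rV[R]_n) i: dotp (evec R i) x = x ord0 i.
Proof.
rewrite /dotp (bigD1 i)//= mxE eqxx mul1r big1 ?addr0// => j /negPf ji.
by rewrite mxE ji mul0r.
Qed.
End complex_facts.

Section Cint.
Context {R: realType} {d} {T: measurableType d}.
Implicit Types (m: {measure set T -> \bar R}) (f g: T -> R[i]).

Definition cmeas f:= mfun (fun x=> Re (f x)) /\ mfun (fun x=> Im (f x)).
Definition cintg m f:= cmeas f /\ m.-integrable setT (fun x=> (cabs (f x))%:E).
Definition Cint m f: R[i]:= fine (\int[m]_x (Re (f x))%:E) +i* fine (\int[m]_x (Im (f x))%:E).
Lemma cmeas_cst (c: R[i]): cmeas (fun=> c).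
Proof. side. Qed.
Lemma cmeasD f g: cmeas f -> cmeas g -> cmeas (fun x=> f x + g x).
Proof.
by move=> [a b] [c e]; split; under eq_fun do rewrite ?ReD ?ImD; exact: measurable_funD.
Qed.
Lemma cmeasM f g: cmeas f -> cmeas g -> cmeas (fun x=> f x * g x).
Proof.
move=> [a b] [c e]; split; under eq_fun do rewrite ?ReM ?ImM.
 by apply: measurable_funB; side.
by apply: measurable_funD; side.
Qed.
Lemma cmeas_real (h: T -> R): mfun h -> cmeas (fun x=> (h x)%:C).
Proof. side. Qed.
Lemma cmeasN f: cmeas f -> cmeas (fun x=> - f x).
Proof.
move=> mf; have -> : (fun x=> - f x) = (fun x=> (-1)%:C*f x).
 by apply/funext=> x; rewrite rmorphN1 mulN1r.
by apply: cmeasM=> //; side.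
Qed.
Lemma cmeasB f g: cmeas f -> cmeas g -> cmeas (fun x=> f x - g x).
Proof. by move=> mf mg; apply: cmeasD=> //; exact: cmeasN. Qed.
Lemma cmeas_sum I (r: seq I) (F: I -> T -> R[i]) :
 (forall i, cmeas (F i)) -> cmeas (fun x=> \sum_(i <- r) F i x).
Proof.
move=> mF; elim: r=> [|i r IH].
 by under eq_fun do rewrite big_nil; side.
by under eq_fun do rewrite big_cons; exact: cmeasD.
Qed.
Lemma cmeas_cexpi (h: T -> R): mfun h -> cmeas (fun x=> cexpi (h x)).
Proof.
move=> mh; split=> /=.
 by apply: (@measurableT_comp _ _ _ _ _ _ (@cos R))=> //; apply: continuous_measurable_fun; exact: continuous_cos.
by apply: (@measurableT_comp _ _ _ _ _ _ (@sin R))=> //; apply: continuous_measurable_fun; exact: continuous_sin.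
Qed.
Lemma cmeas_cabs f: cmeas f -> mfun (fun x=> cabs (f x)).
Proof.
move=> [a b]; apply: mcomp; first by apply: continuous_measurable_fun; exact: sqrt_continuous.
side.
Qed.
Hint Resolve cmeas_cabs: side.
Lemma cintgP m f (h: T -> R): cmeas f -> m.-integrable setT (EFin \o h) ->
 (forall x, cabs (f x) <= h x) -> cintg m f.
Proof.
move=> mf ih fh; split=> //.
apply: le_integrable ih=> //; first side.
by move=> x _ /=; rewrite lee_fin (ger0_norm (cabs_ge0 _)) ger0_norm// (le_trans _ (fh x))// cabs_ge0.
Qed.
Lemma cintg_Re m f: cintg m f -> m.-integrable setT (fun x=> (Re (f x))%:E).
Proof.
move=> [[mf _] fi]; apply: le_integrable fi=> //; first side.
by move=> x _ /=; rewrite lee_fin (ger0_norm (cabs_ge0 _)) Re_le_cabs.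
Qed.
Lemma cintg_Im m f: cintg m f -> m.-integrable setT (fun x=> (Im (f x))%:E).
Proof.
move=> [[_ mf] fi]; apply: le_integrable fi=> //; first side.
by move=> x _ /=; rewrite lee_fin (ger0_norm (cabs_ge0 _)) Im_le_cabs.
Qed.
Lemma cintgM_bounded m f g (M: R): cintg m f -> cmeas g ->
 (forall x, cabs (g x) <= M) -> cintg m (fun x=> f x * g x).
Proof.
move=> fi mg gM; apply: (@cintgP m _ (fun x=> M*cabs (f x)))=> //.
- by apply: cmeasM=> //; case: fi.
- by have:= integrableZl measurableT M fi.2.
- by move=> x; rewrite cabsM mulrC ler_wpM2r ?cabs_ge0.
Qed.
Lemma cintgMl_bounded m f g (M: R): cintg m f -> cmeas g ->
 (forall x, cabs (g x) <= M) -> cintg m (fun x=> g x*f x).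
Proof.
move=> a b c; have:= cintgM_bounded a b c.
by congr cintg; apply/funext=> x; rewrite mulrC.
Qed.
Lemma cintgZ m f (c: R[i]): cintg m f -> cintg m (fun x=> c*f x).
Proof. by move=> fi; apply: (@cintgMl_bounded m f (fun=> c) (cabs c))=> //; side. Qed.
Lemma cintgD m f g: cintg m f -> cintg m g -> cintg m (fun x=> f x + g x).
Proof.
move=> fi gi; apply: (@cintgP m _ (fun x=> cabs (f x) + cabs (g x))).
- by apply: cmeasD; [case: fi|case: gi].
- by have:= integrableD measurableT fi.2 gi.2.
- by move=> x; exact: cabsD.
Qed.
Lemma cintgN m f: cintg m f -> cintg m (fun x=> - f x).
Proof. by move=> fi; have:= cintgZ (-1) fi; under eq_fun do rewrite mulN1r. Qed.
Lemma cintgB m f g: cintg m f -> cintg m g -> cintg m (fun x=> f x - g x).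
Proof. by move=> fi gi; apply: cintgD=> //; exact: cintgN. Qed.
Lemma eq_Cint m f g: f =1 g -> Cint m f = Cint m g.
Proof. by move=> fg; congr Cint; apply/funext. Qed.
Lemma CintD m f g: cintg m f -> cintg m g ->
 Cint m (fun x=> f x + g x) = Cint m f + Cint m g.
Proof.
move=> fi gi; apply: complex_ext; rewrite ?ReD ?ImD /=.
 under eq_integral do rewrite ReD EFinD.
 have a:= cintg_Re fi; have b:= cintg_Re gi.
 by rewrite integralD//= fineD//; exact: integral_fune_fin_num.
under eq_integral do rewrite ImD EFinD.
have a:= cintg_Im fi; have b:= cintg_Im gi.
by rewrite integralD//= fineD//; exact: integral_fune_fin_num.
Qed.
Lemma CintZ m f (c: R[i]): cintg m f -> Cint m (fun x=> c*f x) = c*Cint m f.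
Proof.
move=> fi; have a:= cintg_Re fi; have b:= cintg_Im fi.
have fa:= integral_fune_fin_num measurableT a; have fb:= integral_fune_fin_num measurableT b.
apply: complex_ext; rewrite ?ReM ?ImM /=.
 under eq_integral do rewrite ReM EFinB !EFinM.
 rewrite integralB//=; [|exact: integrableZl..].
 by rewrite !integralZl// fineB ?fineM// fin_numM.
under eq_integral do rewrite ImM EFinD !EFinM.
rewrite integralD//=; [|exact: integrableZl..].
by rewrite !integralZl// fineD ?fineM// fin_numM.
Qed.
Lemma CintN m f: cintg m f -> Cint m (fun x=> - f x) = - Cint m f.
Proof. by move=> fi; rewrite -mulN1r -CintZ//; apply: eq_Cint=> x; rewrite mulN1r. Qed.
Lemma CintB m f g: cintg m f -> cintg m g ->
 Cint m (fun x=> f x - g x) = Cint m f - Cint m g.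
Proof. by move=> fi gi; rewrite CintD ?CintN//; exact: cintgN. Qed.
Lemma Cint_sum m I (r: seq I) (F: I -> T -> R[i]): (forall i, cintg m (F i)) ->
 cintg m (fun x=> \sum_(i <- r) F i x) /\
 Cint m (fun x=> \sum_(i <- r) F i x) = \sum_(i <- r) Cint m (F i).
Proof.
move=> iF; elim: r=> [|i r [IH1 IH2]].
 under eq_fun do rewrite big_nil; rewrite big_nil; split.
  apply: (@cintgP m _ (fun=> 0)); [side|exact: integrable0|by rewrite cabs0].
 apply: complex_ext=> /=; rewrite integral0//.
under eq_fun do rewrite big_cons; rewrite big_cons; split; first exact: cintgD.
by rewrite CintD// IH2.
Qed.
Lemma Cint_real m (h: T -> R): Cint m (fun x=> (h x)%:C) = (fine (\int[m]_x (h x)%:E))%:C.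
Proof. by apply: complex_ext=> //=; rewrite integral0. Qed.
(** The factor 2 is the price of treating the real and imaginary parts separately; it only affects
    constants. *)
Lemma cabs_Cint m f: cintg m f ->
 ((cabs (Cint m f))%:E <= 2%:E*\int[m]_x (cabs (f x))%:E)%E.
Proof.
move=> fi; have a:= cintg_Re fi; have b:= cintg_Im fi.
le_via (`|\int[m]_x (Re (f x))%:E| + `|\int[m]_x (Im (f x))%:E|)%E.
 have:= cabs_le (Cint m f); rewrite -lee_fin EFinD.
 have -> : `|Re (Cint m f)|%:E = `|\int[m]_x (Re (f x))%:E|%E.
  by rewrite -[in RHS](fineK (integral_fune_fin_num measurableT a)).
 by rewrite -[X in (_ + `|X|)%E](fineK (integral_fune_fin_num measurableT b)).
have -> : (2%:E = 1 + 1 :> \bar R)%E by rewrite -EFinD.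
rewrite ge0_muleDl// mul1e; apply: leeD.
 apply: le_trans (le_abse_integral _ _ _) _=> //; first by case/integrableP: a.
 apply: ge0_le_integral=> //.
 - by apply: mcomp=> //; case/integrableP: a.
 - by case: fi=> _ /integrableP[].
 - by move=> x _; rewrite lee_fin Re_le_cabs.
apply: le_trans (le_abse_integral _ _ _) _=> //; first by case/integrableP: b.
apply: ge0_le_integral=> //.
- by apply: mcomp=> //; case/integrableP: b.
- by case: fi=> _ /integrableP[].
- by move=> x _; rewrite lee_fin Im_le_cabs.
Qed.
Lemma Cint_dominated m (f_: nat -> T -> R[i]) f (h: T -> R) :
 (forall k, cmeas (f_ k)) -> cmeas f -> m.-integrable setT (EFin \o h) ->
 (forall k x, cabs (f_ k x) <= h x) ->
 (forall x, (fun k=> Re (f_ k x)) @ \oo --> Re (f x)) ->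
 (forall x, (fun k=> Im (f_ k x)) @ \oo --> Im (f x)) ->
 (fun k=> Re (Cint m (f_ k))) @ \oo --> Re (Cint m f) /\
 (fun k=> Im (Cint m (f_ k))) @ \oo --> Im (Cint m f).
Proof.
move=> mf_ mf ih fh cRe cIm; split=> /=.
- have []:= @dominated_convergence _ T R m setT measurableT (fun k x=> (Re (f_ k x))%:E) (fun x=> (Re (f x))%:E) (EFin \o h).
 + by move=> k; apply/mEFinP; case: (mf_ k).
 + by apply/mEFinP; case: mf.
 + by apply: aeW=> x _; apply: cvg_EFin=> //; [exact: nearW|exact: cRe].
 + exact: ih.
 + by apply: aeW=> x k _; rewrite /= lee_fin (le_trans (Re_le_cabs _)).
 + move=> i _ c; apply: (@fine_cvg _ _ _ _ (fun k=> \int[m]_x (Re (f_ k x))%:E)%E).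
  by rewrite fineK//; exact: integral_fune_fin_num.
- have []:= @dominated_convergence _ T R m setT measurableT (fun k x=> (Im (f_ k x))%:E) (fun x=> (Im (f x))%:E) (EFin \o h).
 + by move=> k; apply/mEFinP; case: (mf_ k).
 + by apply/mEFinP; case: mf.
 + by apply: aeW=> x _; apply: cvg_EFin=> //; [exact: nearW|exact: cIm].
 + exact: ih.
 + by apply: aeW=> x k _; rewrite /= lee_fin (le_trans (Im_le_cabs _)).
 + move=> i _ c; apply: (@fine_cvg _ _ _ _ (fun k=> \int[m]_x (Im (f_ k x))%:E)%E).
  by rewrite fineK//; exact: integral_fune_fin_num.
Qed.

End Cint.

Section Cint_fubini.
Context {R: realType} {d1 d2} {T1: measurableType d1} {T2: measurableType d2}.
Variables (m1: {sigma_finite_measure set T1 -> \bar R}) (m2: {sigma_finite_measure set T2 -> \bar R}).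
(** [Cint] applies [fine] to inner integrals that are finite almost everywhere only; on the
    exceptional null set the default value 0 is invisible to the outer integral. *)
Let fine_fubini (f: T1*T2 -> R): (m1 \x m2)%E.-integrable setT (EFin \o f) ->
 fine (\int[m1]_x (fine (\int[m2]_y (f (x, y))%:E)%E)%:E)%E =
 fine (\int[m2]_y (fine (\int[m1]_x (f (x, y))%:E)%E)%:E)%E.
Proof.
move=> fi; congr fine.
transitivity (\int[m1]_x \int[m2]_y (f (x, y))%:E)%E.
 apply: ae_eq_integral=> //.
 - by apply/mEFinP; apply: (mcomp (fine_measurable measurableT)); exact: (measurable_fubini_F fi).
 - exact: (measurable_fubini_F fi).
 - have:= ae_integrable1 fi; apply: filterS=> x /= ix _.
  by rewrite fineK//; exact: integral_fune_fin_num.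
rewrite (Fubini fi); apply: ae_eq_integral=> //.
- exact: (measurable_fubini_G fi).
- by apply/mEFinP; apply: (mcomp (fine_measurable measurableT)); exact: (measurable_fubini_G fi).
- have:= ae_integrable2 fi; apply: filterS=> x /= ix _.
 by rewrite fineK//; exact: integral_fune_fin_num.
Qed.
Lemma Cint_fubini (f: T1*T2 -> R[i]): cintg (m1 \x m2)%E f ->
 Cint m1 (fun x=> Cint m2 (fun y=> f (x, y))) = Cint m2 (fun y=> Cint m1 (fun x=> f (x, y))).
Proof.
move=> fi; apply: complex_ext=> /=.
 exact: (fine_fubini (f:= fun z=> Re (f z)) (cintg_Re fi)).
exact: (fine_fubini (f:= fun z=> Im (f z)) (cintg_Im fi)).
Qed.
Lemma cintg_prodM (f: T1 -> R[i]) (g: T2 -> R[i]) (h: T1*T2 -> R[i]) (M: R) :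
 cintg m1 f -> cintg m2 g -> cmeas h -> (forall z, cabs (h z) <= M) ->
 cintg (m1 \x m2)%E (fun z=> f z.1 * g z.2*h z).
Proof.
move=> fi gi mh hM; apply: (@cintgM_bounded _ _ _ _ _ _ M)=> //.
have mfg: cmeas (fun z: T1*T2=> f z.1 * g z.2).
 case: fi gi=> [[a b] _] [[c e] _].
 by apply: cmeasM; split; [exact: (mcomp a measurable_fst)|exact: (mcomp b measurable_fst)|
  exact: (mcomp c measurable_snd)|exact: (mcomp e measurable_snd)].
split=> //; apply/integrable12ltyP; first by apply/mEFinP; exact: cmeas_cabs.
under eq_integral do under eq_integral do rewrite abse_EFin ger0_norm ?cabs_ge0// cabsM EFinM.
have [[_ /integrableP[mf fo]] [_ /integrableP[mg go]]]:= (fi, gi).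
have E k (T: measurableType k) (m: {measure set T -> \bar R}) (u: T -> R[i]) :
  (\int[m]_x `|(cabs (u x))%:E| = \int[m]_x (cabs (u x))%:E)%E.
 by apply: eq_integral=> x _; rewrite abse_EFin ger0_norm ?cabs_ge0.
rewrite (eq_integral (fun x=> (cabs (f x))%:E*\int[m2]_y (cabs (g y))%:E)%E); last first.
 move=> x _ /=; rewrite ge0_integralZl ?lee_fin ?cabs_ge0//=.
 side.
rewrite ge0_integralZr//; try side.
rewrite -!E lte_mul_pinfty//; first exact: integral_ge0.
by rewrite ge0_fin_numE//; exact: integral_ge0.
Qed.

End Cint_fubini.

Section cint_mu.
Context {R: realType} {n: nat}.
Implicit Types f g: 'rV[R]_n -> R[i].
Lemma cintE f: cintg (mu n) f -> cint f = Cint (mu n) f.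
Proof.
move=> fi; apply: complex_ext=> /=; rewrite iintE//.
 exact: cintg_Re.
exact: cintg_Im.
Qed.
Lemma Cint_shift f (b: 'rV[R]_n): cmeas f -> Cint (mu n) (fun x=> f (x + b)) = Cint (mu n) f.
Proof.
move=> [mf1 mf2]; apply: complex_ext=> /=; congr fine.
 by apply: (integral_mu_shift b (f:= fun x=> (Re (f x))%:E)); side.
by apply: (integral_mu_shift b (f:= fun x=> (Im (f x))%:E)); side.
Qed.
Lemma Cint_neg f: cmeas f -> Cint (mu n) (fun x=> f (- x)) = Cint (mu n) f.
Proof.
move=> [mf1 mf2]; apply: complex_ext=> /=; congr fine.
 by apply: (integral_muN (f:= fun x=> (Re (f x))%:E)); side.
by apply: (integral_muN (f:= fun x=> (Im (f x))%:E)); side.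
Qed.
Lemma cmeas_comp {d} {T: measurableType d} f (h: T -> 'rV[R]_n): cmeas f -> mfun h ->
 cmeas (fun x=> f (h x)).
Proof. by move=> [a b] mh; split; [apply: (mcomp a)|apply: (mcomp b)]. Qed.
Lemma cintg_shift f (b: 'rV[R]_n): cintg (mu n) f -> cintg (mu n) (fun x=> f (x + b)).
Proof.
move=> [mf /integrableP[mf2 fi]].
have ms: mfun (fun x: 'rV[R]_n=> x + b).
 by apply: meas_addV; [side|side].
have mfb:= cmeas_comp mf ms; split=> //.
apply/integrableP; split; first by apply/mEFinP; exact: cmeas_cabs.
by rewrite (integral_mu_shift b (f:= fun x=> `|(cabs (f x))%:E|%E))//; exact: mcomp.
Qed.
Lemma cintg_neg f: cintg (mu n) f -> cintg (mu n) (fun x=> f (- x)).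
Proof.
move=> [mf /integrableP[mf2 fi]].
have mfb: cmeas (fun x: 'rV[R]_n=> f (- x)) by apply: cmeas_comp=> //; apply: meas_oppV; side.
split=> //; apply/integrableP; split; first by apply/mEFinP; exact: cmeas_cabs.
by rewrite (integral_muN (f:= fun x=> `|(cabs (f x))%:E|%E))//; exact: mcomp.
Qed.
Lemma Cint_scale f (c: R): 0 < c -> cintg (mu n) f ->
 Cint (mu n) (fun x=> f (c *: x)) = (c ^- n)%:C*Cint (mu n) f.
Proof.
move=> c0 fi; have a:= cintg_Re fi; have b:= cintg_Im fi.
apply: complex_ext; rewrite ?ReRM ?ImRM /=.
 by rewrite (integral_mu_scale c0 a) fineM//; exact: integral_fune_fin_num.
by rewrite (integral_mu_scale c0 b) fineM//; exact: integral_fune_fin_num.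
Qed.

End cint_mu.
Hint Resolve cabs_ge0 dotp_ge0 enorm_ge0 cmeas_cst cmeasD cmeasM cmeas_real cmeasN cmeasB cmeas_cexpi cmeas_cabs: side.
Hint Extern 1 (cmeas _)=> match goal with
 | H: cintg _ ?f |- cmeas ?f=> exact: (proj1 H)
 | H: cmeas ?f |- cmeas (fun x=> ?f (@?g x))=> apply: (cmeas_comp H) end: side.

Section derive_under.
Context {R: realType} {d} {Y: measurableType d}.
Variable (m: {measure set Y -> \bar R}).
Lemma is_derive_under_integral (f f': R -> Y -> R) (G: Y -> R) (a e: R): 0 < e ->
 (forall x, m.-integrable setT (EFin \o f x)) ->
 (forall x y, `|x - a| < e -> is_derive x (1: R) (f ^~ y) (f' x y)) ->
 m.-integrable setT (EFin \o G) ->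
 (forall x y, `|x - a| < e -> `|f' x y| <= G y) ->
 is_derive a (1: R) (fun x=> (\int[m]_y (f x y))%R) (\int[m]_y (f' a y))%R.
Proof.
move=> e0 fi fd Gi fG.
have I x: (`]a - e, a + e[%classic: set R) x -> `|x - a| < e.
 by rewrite /= in_itv/= ltr_norml=> /andP[h1 h2]; apply/andP; split; lra.
have Ia: (`]a - e, a + e[%classic: set R) a by rewrite /= in_itv/= ltrBlDr ltrDl e0.
have G0 y: 0 <= G y by rewrite (le_trans (normr_ge0 (f' a y)))// fG// subrr normr0.
have d1 x y: (`]a - e, a + e[%classic: set R) x -> derive1 (f ^~ y) x = f' x y.
 by move=> /I xa; rewrite derive1E; exact: (@derive_val _ _ _ _ _ _ _ (fd x y xa)).
have D: derivable (fun x=> (\int[m]_y (f x y))%R) a 1.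
 apply: (@derivable_under_integral R _ Y m f setT measurableT a (a - e) (a + e) Ia _ _ G)=> //.
 - by move=> x y /I xa _; by have []:= fd x y xa.
 - by move=> x y xI _; rewrite /partial1of2 d1// fG//; exact: I.
split=> //; rewrite -derive1E.
rewrite (@differentiation_under_integral R _ Y m f setT measurableT a (a - e) (a + e) Ia _ _ G).
- by apply: eq_Rintegral=> y _; rewrite /partial1of2 d1.
- by move=> x _; exact: fi.
- by move=> x y /I xa _; have []:= fd x y xa.
- exact: G0.
- exact: Gi.
- by move=> x y xI _; rewrite /partial1of2 d1// fG//; exact: I.
Qed.

End derive_under.

(** * The Fourier transform *)
Section gauss1.
Context {R: realType}.
Notation leb:= (@lebesgue_measure R).
Lemma integrable_gauss_scaled (c: R): 0 < c ->
 leb.-integrable [set: R] (fun x=> (expR (- (c*x^+2)))%:E).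
Proof.
move=> c0; have s0: 0 < Num.sqrt c by rewrite sqrtr_gt0.
apply/integrableP; split.
 apply/mEFinP; apply: mcomp=> //; apply: measurable_funN.
 side.
have /integrableP[mg gi]:= @integrableT_gauss R.
have:= ge0_integral_affine 0 s0 (f:= fun x=> `|(gauss_fun x)%:E|%E).
have -> : (fun x: R=> `|(gauss_fun (Num.sqrt c*x + 0))%:E|%E) = (fun x: R=> `|(expR (- (c*x^+2)))%:E|%E).
 by apply/funext=> x; rewrite addr0 /gauss_fun exprMn sqr_sqrtr// ltW.
move=> H; have {}H:= H (mcomp (@abse_measurable R setT) mg) (fun=> abse_ge0 _).
rewrite ltey; apply/eqP=> E.
by have:= gi; rewrite -H E gt0_muley ?lte_fin// ltxx.
Qed.
Lemma mul_expN_le (k: nat) (c x: R): 0 < c -> 0 <= x -> x^+k*expR (- (c*x)) <= k`!%:R/c^+k.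
Proof.
move=> c0 x0; have cx: 0 <= c*x by side.
rewrite ler_pdivlMr ?exprn_gt0// mulrAC -exprMn [x*c]mulrC expRN ler_pdivrMr ?expR_gt0//.
case: k=> [|k]; first by rewrite expr0 fact0 mul1r (le_trans _ (expR_ge1Dx _))// lerDl.
have:= expR_ge1Dxn k cx=> h; have: (c*x)^+k.+1/(k.+1)`!%:R <= expR (c*x) by lra.
by rewrite ler_pdivrMr ?ltr0n ?fact_gt0// [X in _ <= X -> _]mulrC.
Qed.
Lemma integrable_gauss_poly (k: nat) (c: R): 0 < c ->
 leb.-integrable [set: R] (fun x=> (`|x| ^+ k*expR (- (c*x^+2)))%:E).
Proof.
move=> c0; have c20: 0 < c/2 by side.
have mm: measurable_fun [set: R] (fun x=> `|x| ^+ k*expR (- (c*x^+2))).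
 apply: measurable_funM; first by apply: measurable_funX; side.
 apply: mcomp=> //; apply: measurable_funN.
 side.
pose M:= 1 + k`!%:R/(c/2)^+k.
have:= integrableZl measurableT M (integrable_gauss_scaled c20).
apply: le_integrable=> //; first side.
move=> x _; rewrite abseM !abse_EFin -EFinM lee_fin -normrM (ger0_norm (mulr_ge0 (exprn_ge0 k (normr_ge0 x)) (expR_ge0 _))).
rewrite ger0_norm; last side.
have -> : - (c*x^+2) = - ((c/2)*x^+2) + - ((c/2)*x^+2) by field.
rewrite expRD mulrA ler_wpM2r ?expR_ge0//.
have [x1|x1]:= leP `|x| 1.
 rewrite -[leRHS]mulr1 ler_pM ?exprn_ge0 ?expR_ge0//.
  by rewrite (@le_trans _ _ 1) ?exprn_ile1// lerDl divr_ge0// exprn_ge0// ltW.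
 by rewrite -[leRHS]expR0 ler_expR lerNl oppr0; apply: mulr_ge0; [side|side].
le_via (`|x| ^+ k*expR (- (c/2 * `|x|))).
 rewrite ler_wpM2l ?exprn_ge0// ler_expR lerN2 (ler_wpM2l (ltW c20))//.
 by move: x1; rewrite -[x^+2]real_normK ?num_real//; set y:= `|x|; nra.
by rewrite (le_trans (mul_expN_le k c20 (normr_ge0 x)))// lerDr.
Qed.
Let J (xi: R):= (\int[leb]_x (expR (- x^+2)*cos (x*xi)))%R.
Let L (xi: R):= (\int[leb]_x (x*expR (- x^+2)*sin (x*xi)))%R.
Lemma mgx (h: R -> R) (k: nat) (c: R): 0 < c -> measurable_fun [set: R] h ->
 (forall x, `|h x| <= `|x| ^+ k*expR (- (c*x^+2))) -> leb.-integrable [set: R] (fun x=> (h x)%:E).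
Proof.
move=> c0 mh hh; apply: le_integrable (integrable_gauss_poly k c0)=> //; first side.
move=> x _ /=; rewrite lee_fin (le_trans (hh x))//.
exact: ler_norm.
Qed.
Let mg (xi: R): measurable_fun [set: R] (fun x: R=> expR (- x^+2)*cos (x*xi)).
Proof.
apply: measurable_funM.
 side.
apply: (mcomp (continuous_measurable_fun (@continuous_cos R))).
side.
Qed.
Let mgs (xi: R): measurable_fun [set: R] (fun x: R=> expR (- x^+2)*sin (x*xi)).
Proof.
apply: measurable_funM.
 side.
apply: (mcomp (continuous_measurable_fun (@continuous_sin R))).
side.
Qed.
Let norm_cos (y: R): `|cos y| <= 1.
Proof. by rewrite ler_norml cos_geN1 cos_le1. Qed.
Let norm_sin (y: R): `|sin y| <= 1.
Proof. by rewrite ler_norml sin_geN1 sin_le1. Qed.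
Let ig xi: leb.-integrable [set: R] (fun x=> (expR (- x^+2)*cos (x*xi))%:E).
Proof.
apply: (@mgx _ 0 1)=> // x; rewrite expr0 mul1r mul1r normrM ger0_norm ?expR_ge0//.
by rewrite ler_piMr ?expR_ge0.
Qed.
Let igs xi: leb.-integrable [set: R] (fun x=> (expR (- x^+2)*sin (x*xi))%:E).
Proof.
apply: (@mgx _ 0 1)=> // x; rewrite expr0 mul1r mul1r normrM ger0_norm ?expR_ge0//.
by rewrite ler_piMr ?expR_ge0.
Qed.
Let igL xi: leb.-integrable [set: R] (fun x=> (x*expR (- x^+2)*sin (x*xi))%:E).
Proof.
apply: (@mgx _ 1 1)=> //.
 under eq_fun do rewrite -mulrA; apply: measurable_funM=> //.
move=> x; rewrite expr1 mul1r !normrM (ger0_norm (expR_ge0 _)).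
by rewrite ler_piMr ?mulr_ge0 ?expR_ge0.
Qed.
Let derivJ (a: R): is_derive a (1: R) J (- L a).
Proof.
have -> : - L a = (\int[leb]_x (- (x*expR (- x^+2)*sin (x*a))))%R.
 rewrite -mulN1r -RintegralZl//; last exact: igL.
 by apply: eq_Rintegral=> x _; rewrite mulN1r.
apply: (@is_derive_under_integral R _ _ leb (fun xi x=> expR (- x^+2)*cos (x*xi))
 (fun xi x=> - (x*expR (- x^+2)*sin (x*xi)))
 (fun x=> `|x| ^+ 1*expR (- (1*x^+2))) a 1)=> //.
- move=> x y _; apply: is_derive_eq; rewrite /GRing.scale/=; ring.
- exact: integrable_gauss_poly.
- move=> x y _; rewrite normrN expr1 mul1r !normrM (ger0_norm (expR_ge0 _)).
 by rewrite ler_piMr ?mulr_ge0 ?expR_ge0.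
Qed.
(** By translation invariance this is constant in [h]. Its vanishing derivative at 0 plays the part
    of the integration by parts that relates [L] to [J]. *)
Let K (xi h: R):= (\int[leb]_x (expR (- (x + h)^+2)*sin ((x + h)*xi)))%R.
Let leb_shift (h: R) (f: R -> R): measurable_fun [set: R] f ->
 (\int[leb]_x (f (x + h))%:E = \int[leb]_x (f x)%:E)%E.
Proof.
move=> mf; have mf':= mcomp (@EFin_measurable R setT) mf.
rewrite integralE [RHS]integralE; congr (_ - _)%E.
 rewrite -[RHS](ge0_integral_affine h (@ltr01 R))//; last exact: measurable_funepos.
 by rewrite mul1e; apply: eq_integral=> x _; rewrite unlock mul1r.
rewrite -[RHS](ge0_integral_affine h (@ltr01 R))//; last exact: measurable_funeneg.
by rewrite mul1e; apply: eq_integral=> x _; rewrite unlock mul1r.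
Qed.
Let leb_neg (f: R -> R): measurable_fun [set: R] f ->
 (\int[leb]_x (f (- x))%:E = \int[leb]_x (f x)%:E)%E.
Proof.
move=> mf; have mf':= mcomp (@EFin_measurable R setT) mf.
rewrite integralE [RHS]integralE; congr (_ - _)%E.
 rewrite -[RHS]ge0_integralN//; last exact: measurable_funepos.
 by apply: eq_integral=> x _; rewrite unlock.
rewrite -[RHS]ge0_integralN//; last exact: measurable_funeneg.
by apply: eq_integral=> x _; rewrite unlock.
Qed.
Let K_cst xi h: K xi h = K xi 0.
Proof.
rewrite /K /Rintegral; congr fine.
rewrite (leb_shift h (mgs xi)); apply: eq_integral=> x _; by rewrite addr0.
Qed.
Let derivK xi: is_derive (0: R) (1: R) (K xi) (xi*J xi - 2*L xi).
Proof.
have -> : xi*J xi - 2*L xi = (\int[leb]_x (expR (- (x + 0)^+2)*(- 2*(x + 0))*sin ((x + 0)*xi) + expR (- (x + 0)^+2)*xi*cos ((x + 0)*xi)))%R.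
 rewrite -!RintegralZl//; [|exact: igL|exact: ig].
 rewrite -RintegralB//=; [|exact: (integrableZl _ _ (ig xi))|exact: (integrableZl _ _ (igL xi))].
 by apply: eq_Rintegral=> x _; rewrite !addr0; ring.
apply: (@is_derive_under_integral R _ _ leb (fun h x=> expR (- (x + h)^+2)*sin ((x + h)*xi))
 (fun h x=> expR (- (x + h)^+2)*(- 2*(x + h))*sin ((x + h)*xi) + expR (- (x + h)^+2)*xi*cos ((x + h)*xi))
 (fun x=> expR 1*((2 + `|xi|)*(`|x| ^+ 0*expR (- (2^-1*x^+2))) + 2*(`|x| ^+ 1*expR (- (2^-1*x^+2))))) 0 1)=> //.
- move=> h.
 have: leb.-integrable setT (fun x=> (expR (- (x + h)^+2)*sin ((x + h)*xi))%:E).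
  apply/integrableP; split; first side.
  have /integrableP[_]:= igs xi.
  by rewrite -(leb_shift h (f:= fun x=> `|expR (- x^+2)*sin (x*xi)|))//; side.
 by [].
- move=> h y _; apply: is_derive_eq; rewrite /GRing.scale/=; ring.
- have A:= integrable_gauss_poly 0 (_: 0 < 2^-1 :> R); have B:= integrable_gauss_poly 1 (_: 0 < 2^-1 :> R).
 have:= integrableZl measurableT (expR 1) (integrableD measurableT (integrableZl measurableT (2 + `|xi|) (A _)) (integrableZl measurableT 2 (B _))).
 by apply.
- move=> h x; rewrite subr0=> h1.
 (* For |h| <= 1: (x + h)^2 - x^2/2 + 1 = (x + 2 h)^2/2 + (1 - h^2) >= 0. *)
 have hx: expR (- (x + h)^+2) <= expR 1*expR (- (2^-1*x^+2)).
  rewrite -expRD ler_expR; have: h^+2 <= 1 by rewrite -[h^+2]real_normK ?num_real// exprn_ile1// ltW.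
  have:= sqr_ge0 (x + 2*h); rewrite !expr2; lra.
 have xh: `|x + h| <= `|x| + 1 by rewrite (le_trans (ler_normD _ _))// lerD2l ltW.
 have e0:= expR_ge0 (- (x + h)^+2).
 rewrite (le_trans (ler_normD _ _))// !normrM !(ger0_norm e0) normrN (ger0_norm (_: 0 <= 2))//.
 le_via (expR (- (x + h)^+2)*(2*(`|x| + 1) + `|xi|)).
  rewrite mulrDr lerD//.
   by rewrite -[leRHS]mulr1 ler_pM// ?mulr_ge0// ler_wpM2l// ler_wpM2l.
  by rewrite -[leRHS]mulr1 ler_pM// mulr_ge0.
 le_via (expR 1*expR (- (2^-1*x^+2))*(2*(`|x| + 1) + `|xi|)).
  by rewrite ler_wpM2r// addr_ge0// mulr_ge0// addr_ge0.
 by rewrite expr0 expr1 le_eqVlt; apply/orP; left; apply/eqP; ring.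
Qed.
(** Since [L xi] is xi/2 times [J xi], the formula J' = -L is a linear differential equation; the
    integrating factor e^(xi^2/4) makes the product constant, and the value at 0 is the Gaussian
    integral. *)
Lemma J_ode xi: J xi = Num.sqrt pi*expR (- (xi^+2/4)).
Proof.
have LJ x: L x = x/2*J x.
 have K0: K x = cst (K x 0) by apply/funext=> h; rewrite K_cst.
 have:= @derive_val _ _ _ _ _ _ _ (derivK x); rewrite K0 derive_cst=> /eqP.
 by rewrite eq_sym subr_eq0=> /eqP e; apply: (@mulfI _ 2)=> //; rewrite -e; field.
pose G (x: R):= J x*expR (x^+2/4).
have dG x: is_derive x (1: R) G 0.
 have dJ:= derivJ x; apply: is_derive_eq.
 by rewrite LJ /GRing.scale/=; field.
have G0: G xi = G 0 by apply: is_derive_0_is_cst.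
have J0: J 0 = Num.sqrt pi.
 rewrite /J /Rintegral; under eq_integral do rewrite mulr0 cos0 mulr1.
 by have:= @integralT_gauss R; rewrite /gauss_fun=> ->.
move: G0; rewrite /G expr0n/= mul0r expR0 mulr1 J0=> <-.
by rewrite -mulrA -expRD addrN expR0 mulr1.
Qed.
Lemma gauss_sin xi: (\int[leb]_x (expR (- x^+2)*sin (x*xi)))%R = 0.
Proof.
set I:= Rintegral _ _ _; suff: I = - I by move=> h; lra.
rewrite /I -mulN1r -RintegralZl//; last exact: igs.
rewrite {1}/Rintegral -(leb_neg (mgs xi)); congr fine; apply: eq_integral=> x _.
by rewrite sqrrN mulNr sinN mulN1r mulrN.
Qed.
Lemma gauss_cos xi: (\int[leb]_x (expR (- x^+2)*cos (x*xi)))%R = Num.sqrt pi*expR (- (xi^+2/4)).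
Proof. exact: J_ode. Qed.
Let leb_scale (c: R) (h: R -> R): 0 < c -> leb.-integrable [set: R] (EFin \o h) ->
 leb.-integrable [set: R] (fun x=> (h (c*x))%:E) /\
 (\int[leb]_x (h (c*x)))%R = c^-1*(\int[leb]_x (h x))%R.
Proof.
move=> c0 ih; have mh:= measurable_int _ ih.
have S g: measurable_fun [set: R] g -> (forall x, 0 <= g x)%E -> (\int[leb]_x g (c*x)%R = c^-1%:E*\int[leb]_x g x)%E.
 move=> mgg g0; rewrite -(ge0_integral_affine 0 c0 mgg g0) muleA -EFinM mulVf ?gt_eqF// mul1e.
 by apply: eq_integral=> x _; rewrite addr0.
split.
 apply/integrableP; split.
  by apply: (mcomp mh); side.
 rewrite (S (fun x=> `|(h x)%:E|%E))//; last exact: mcomp.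
 have /integrableP[_ hi]:= ih.
 by rewrite lte_mul_pinfty// lee_fin invr_ge0 ltW.
rewrite /Rintegral -[c^-1]/(fine (c^-1%:E)) -fineM//; last exact: integral_fune_fin_num.
congr fine; rewrite integralE [in RHS]integralE muleBr//; last first.
 apply: fin_num_adde_defl; rewrite fin_numN.
 by have:= integral_fune_fin_num measurableT (integrable_funeneg measurableT ih).
rewrite -!S//; [|exact: measurable_funeneg|exact: measurable_funepos].
by congr (_ - _)%E; apply: eq_integral=> x _; rewrite unlock.
Qed.
Lemma Cint_gauss1 (c a eta: R): 0 < c ->
 let g:= fun u: measurableTypeR R=> (expR (- (c*u^+2)))%:C*cexpi (a*(u*eta)) in
 cintg leb g /\ Cint leb g = (Num.sqrt (pi/c)*expR (- (a^+2/(4*c)*eta^+2)))%:C.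
Proof.
move=> c0 g; split.
 apply: (@cintgP R _ (measurableTypeR R) leb g (fun x: R=> expR (- (c*x^+2)))).
 - apply: cmeasM.
   apply: cmeas_real; apply: mcomp=> //; apply: measurable_funN.
   side.
  side.
 - exact: integrable_gauss_scaled.
 - by move=> x; rewrite cabsM cabs_real cabs_cexpi mulr1 ger0_norm ?expR_ge0.
have s0: 0 < Num.sqrt c by rewrite sqrtr_gt0.
have se: Num.sqrt c^+2 = c by rewrite sqr_sqrtr// ltW.
apply: complex_ext=> /=.
- rewrite (_: fine _ = (\int[leb]_x (expR (- (Num.sqrt c*x)^+2)*cos ((Num.sqrt c*x)*(a*eta/Num.sqrt c))))%R).
  rewrite (leb_scale s0 (ig _)).2 gauss_cos sqrtrM ?pi_ge0// sqrtrV ?(ltW c0)// mulrA [_^-1*_]mulrC.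
  congr (_*expR _); congr (- _).
  by rewrite !exprMn exprVn se; field; rewrite gt_eqF.
 congr fine; apply: eq_integral=> x _; rewrite exprMn se mul0r subr0; congr (_*cos _)%:E.
 by field; rewrite gt_eqF.
- rewrite (_: fine _ = (\int[leb]_x (expR (- (Num.sqrt c*x)^+2)*sin ((Num.sqrt c*x)*(a*eta/Num.sqrt c))))%R).
  by rewrite (leb_scale s0 (igs _)).2 gauss_sin mulr0.
 congr fine; apply: eq_integral=> x _; rewrite exprMn se mul0r addr0; congr (_*sin _)%:E.
 by field; rewrite gt_eqF.
Qed.

End gauss1.

Section FT.
Context {R: realType} {n: nat}.
Implicit Types (g h: 'rV[R]_n -> R[i]) (x xi: 'rV[R]_n).

(** The factor [a] in the phase is a parameter: [- (2 * pi)] gives the transform and [2 * pi] its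
    inverse. Later statements assume a^2 = (2 pi)^2 and so serve both. *)
Definition FT (a: R) g xi: R[i]:= Cint (mu n) (fun x=> g x*cexpi (a*dotp x xi)).
Definition gau (c: R) x: R:= expR (- (c*dotp x x)).
Lemma cintg_char a g xi: cintg (mu n) g -> cintg (mu n) (fun x=> g x*cexpi (a*dotp x xi)).
Proof.
move=> gi; apply: (@cintgM_bounded _ _ _ _ _ _ 1)=> //; first side.
by move=> x; rewrite cabs_cexpi.
Qed.
Lemma fourierE g xi: cintg (mu n) g -> fourier g xi = FT (- (2 * pi)) g xi.
Proof.
move=> gi; rewrite /fourier /FT -cintE; last exact: cintg_char.
by congr cint; apply/funext=> x; rewrite mulNr.
Qed.

End FT.

Section prod_coord.
Context {R: realType}.
Notation leb:= (@lebesgue_measure R).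
Lemma CintS n (f: 'rV[R]_n.+1 -> R[i]): cintg (mu n.+1) f ->
 (forall a, cintg (mu n) (fun v=> f (vcons a v))) ->
 Cint (mu n.+1) f = Cint leb (fun a=> Cint (mu n) (fun v=> f (vcons a v))).
Proof.
move=> fi si; apply: complex_ext=> /=; congr fine.
 rewrite integral_muS; last exact: cintg_Re.
 apply: eq_integral=> a _; rewrite fineK//.
 by apply: integral_fune_fin_num=> //; exact: cintg_Re (si a).
rewrite integral_muS; last exact: cintg_Im.
apply: eq_integral=> a _; rewrite fineK//.
by apply: integral_fune_fin_num=> //; exact: cintg_Im (si a).
Qed.
Lemma Cint_mu0 (f: 'rV[R]_0 -> R[i]): Cint (mu 0) f = f 0.
Proof. by apply: complex_ext=> /=; rewrite integral_mu0. Qed.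
Lemma cintg_prod_coord n (f: 'I_n -> measurableTypeR R -> R[i]): (forall i, cintg leb (f i)) ->
 cintg (mu n) (fun x=> \prod_(i < n) f i (x ord0 i)).
Proof.
move=> fi; have mf: cmeas (fun x: 'rV[R]_n=> \prod_(i < n) f i (x ord0 i)).
 elim: (index_enum _)=> [|i r IH].
  by under eq_fun do rewrite big_nil; side.
 under eq_fun do rewrite big_cons; apply: cmeasM=> //.
 have [[a b] _]:= fi i.
 by split; [apply: (mcomp a)|apply: (mcomp b)]; exact: meas_coord.
split=> //; apply/integrableP; split; first side.
rewrite (eq_integral (fun x: 'rV[R]_n=> (\prod_(i < n) cabs (f i (x ord0 i)))%:E)); last first.
 move=> x _; rewrite abse_EFin ger0_norm ?cabs_ge0//; congr _%:E.
 by elim/big_rec2: _=> [|i y z _ <-]; rewrite ?cabs1// cabsM.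
rewrite (@ge0_integral_prod_coord R n (fun i u=> cabs (f i u))); try side; last first.
- by move=> i; have [a _]:= fi i; exact: cmeas_cabs.
elim/big_rec: _=> [|i z _ h]; first exact: ltry.
have [_ /integrableP[_]]:= fi i.
under eq_integral do rewrite abse_EFin ger0_norm ?cabs_ge0//.
have [z0|z0]:= leP 0%E z.
 move=> ?; rewrite lte_mul_pinfty// ?ge0_fin_numE//; apply: integral_ge0=> u _; by side.
move=> _; apply: le_lt_trans (ltry 0); apply: mule_ge0_le0; last side.
side.
Qed.
Lemma Cint_prod_coord n (f: 'I_n -> measurableTypeR R -> R[i]): (forall i, cintg leb (f i)) ->
 Cint (mu n) (fun x=> \prod_(i < n) f i (x ord0 i)) = \prod_(i < n) Cint leb (f i).
Proof.
elim: n f=> [|n IH] f fi; first by rewrite Cint_mu0 !big_ord0.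
have E a (v: 'rV[R]_n): \prod_(i < n.+1) f i (vcons a v ord0 i) = f ord0 a*\prod_(i < n) f (lift ord0 i) (v ord0 i).
 by rewrite big_ord_recl vcons0; congr (_*_); apply: eq_bigr=> i _; rewrite vconsS.
have pi':= @cintg_prod_coord n (fun i=> f (lift ord0 i)) (fun i=> fi _).
rewrite CintS; last 2 first.
- exact: cintg_prod_coord.
- by move=> a; under eq_fun do rewrite E; exact: cintgZ.
rewrite big_ord_recl -IH; last by move=> i; exact: fi.
rewrite mulrC -CintZ//; apply: eq_Cint=> a.
rewrite (eq_Cint _ (E a)) CintZ// mulrC; congr (_*_).
Qed.
Lemma FT_gau n (c a: R) (xi: 'rV[R]_n): 0 < c ->
 cintg (mu n) (fun x=> (gau c x)%:C) /\
 FT a (fun x: 'rV[R]_n=> (gau c x)%:C) xi = (Num.sqrt (pi/c)^+n * gau (a^+2/(4*c)) xi)%:C.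
Proof.
move=> c0.
have gE (k: R) m (x: 'rV[R]_m): gau k x = \prod_i expR (- (k*x ord0 i^+2)).
 rewrite /gau /dotp mulr_sumr -sumrN expR_sum; apply: eq_bigr=> i _; by rewrite expr2.
have E b (x: 'rV[R]_n): (gau c x)%:C*cexpi (b*dotp x xi) =
  \prod_i ((expR (- (c*x ord0 i^+2)))%:C*cexpi (b*(x ord0 i*xi ord0 i))).
 rewrite big_split/= -rmorph_prod -gE -cexpi_sum; congr (_*cexpi _).
 by rewrite mulr_sumr.
have G b i:= Cint_gauss1 b (xi ord0 i) c0.
split.
 have:= @cintg_prod_coord n _ (fun i=> (G 0 i).1).
 congr cintg; apply/funext=> x; rewrite -E mul0r cexpi0 mulr1//.
rewrite /FT (eq_Cint _ (E a)) (@Cint_prod_coord n _ (fun i=> (G a i).1)).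
under eq_bigr do rewrite (G a _).2.
rewrite -rmorph_prod big_split/= prodr_const card_ord gE; congr (_*_)%:C.
Qed.

End prod_coord.
Lemma RCM (R: realType) (a b: R): (a*b)%:C = a%:C*b%:C.
Proof. exact: rmorphM. Qed.
Lemma gau_width (R: realType) (p u: R): 0 < p -> 0 < u ->
 (2 * p)^+2/(4*(p*u^+2))*u^+2 = p.
Proof. by move=> p0 u0; field; rewrite !gt_eqF. Qed.
Lemma cvg_mulr_cst (R: realType) (c: R) (u: nat -> R) (l: R) :
 u @ \oo --> l -> (fun k=> c*u k) @ \oo --> c * l.
Proof. by move=> ul; apply: cvgM=> //; exact: cvg_cst. Qed.

Arguments cvg_mulr_cst {R} c {u l}.

Section multiplier.
Context {R: realType} {n: nat}.
Implicit Types (g h G: 'rV[R]_n -> R[i]) (x xi: 'rV[R]_n).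
(** The convolution theorem in the form used throughout: the function convolved with [k] is given as
    the transform of an integrable [G], so absolute convergence of the double integral is
    immediate. *)
Lemma conv_FT (a: R) (k G: 'rV[R]_n -> R[i]) x: cintg (mu n) k -> cintg (mu n) G ->
 Cint (mu n) (fun y=> k y*FT a G (x - y)) =
 Cint (mu n) (fun xi=> FT (- a) k xi*G xi*cexpi (a*dotp x xi)).
Proof.
move=> ki Gi.
pose F (z: 'rV[R]_n*'rV[R]_n):= k z.1*G z.2*cexpi (a*dotp (x - z.1) z.2).
have Fi: cintg (mu n \x mu n)%E F.
 apply: (@cintg_prodM _ _ _ _ _ _ _ _ _ _ 1)=> //; last by move=> z; rewrite cabs_cexpi.
 apply: cmeas_cexpi; apply: measurable_funM=> //.
 apply: meas_dotp; last side.
 side.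
transitivity (Cint (mu n) (fun y=> Cint (mu n) (fun xi=> F (y, xi)))).
 apply: eq_Cint=> y; rewrite /FT -CintZ; last exact: cintg_char.
 by apply: eq_Cint=> xi; rewrite /F/= dotpC mulrA.
rewrite (Cint_fubini Fi); apply: eq_Cint=> xi.
rewrite mulrAC -mulrA mulrC /FT -CintZ; last exact: cintg_char.
apply: eq_Cint=> y; rewrite /F/= dotpDl dotpNl mulrDr cexpiD mulrN -mulNr.
by ring.
Qed.

(** Continuity along the sequences x - z/(k+1) only. This is what dominated convergence asks for in
    the inversion formula, and it is preserved by the algebraic operations on symbols. *)
Definition raycont h:= forall x z,
 (fun k: nat=> Re (h (x - k.+1%:R^-1 *: z))) @ \oo --> Re (h x) /\
 (fun k: nat=> Im (h (x - k.+1%:R^-1 *: z))) @ \oo --> Im (h x).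
Lemma gau_scale (c s: R) x: gau c (s *: x) = gau (c*s^+2) x.
Proof. by rewrite /gau dotpZl dotpZr; congr expR; ring. Qed.
Lemma gau_le1 (c: R) x: 0 <= c -> gau c x <= 1.
Proof. by move=> c0; rewrite -[leRHS]expR0 ler_expR oppr_le0 mulr_ge0// dotp_ge0. Qed.
Lemma cmeas_gau (c: R): cmeas (fun x=> (gau c x)%:C).
Proof.
apply: cmeas_real; apply: mcomp=> //; apply: measurable_funN.
side.
Qed.
Lemma cvg_invS: (fun k: nat=> (k.+1%:R^-1: R)) @ \oo --> (0: R).
Proof. exact: cvg_harmonic. Qed.
(** Insert a wide Gaussian into the inverse transform. By [conv_FT] the result [A k] is also the
    mean [B k] of [h] against a Gaussian concentrated at [x]; letting k tend to infinity on both
    sides gives the formula. *)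
Lemma FT_inversion (a: R) h (M: R): a^+2 = (2 * pi)^+2 ->
 cintg (mu n) h -> (forall x, cabs (h x) <= M) -> raycont h ->
 cintg (mu n) (FT a h) -> forall x, FT (- a) (FT a h) x = h x.
Proof.
move=> a2 hi hM hc Hi x.
have pi0:= @pi_gt0 R.
pose s (k: nat): R:= k.+1%:R^-1.
have s0 (k: nat): 0 < s k by side.
(* Chosen so that the transform of this Gaussian, rescaled by [s k], becomes [gau pi], which has
   total mass 1. *)
pose eps (k: nat):= pi*s k^+2.
have e0 (k: nat): 0 < eps k by side.
pose A (k: nat):= Cint (mu n) (fun xi=> (FT a h xi*(gau (eps k) xi)%:C)*cexpi (- a*dotp xi x)).
pose B (k: nat):= Cint (mu n) (fun z=> h (x - s k *: z)*(gau pi z)%:C).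
have AB (k: nat): A k = B k.
 have gi:= (FT_gau 0 (0: 'rV[R]_n) (e0 k)).1.
 have:= conv_FT (- a) x hi gi; rewrite opprK.
 have -> : A k = Cint (mu n) (fun xi=> FT a h xi*(gau (eps k) xi)%:C*cexpi (- a*dotp x xi)).
  by apply: eq_Cint=> xi; rewrite dotpC.
 move=> <-.
 pose f y:= h y*FT (- a) (fun x0: 'rV[R]_n=> (gau (eps k) x0)%:C) (x - y).
 have fE y: f y = h y*(Num.sqrt (pi/eps k)^+n * gau (a^+2/(4*eps k)) (x - y))%:C.
  by rewrite /f (FT_gau _ _ (e0 k)).2 sqrrN.
 have c1: 0 < a^+2/(4*eps k) by rewrite a2 divr_gt0 ?exprn_gt0 ?mulr_gt0.
 have sxy: mfun (fun y: 'rV[R]_n=> x - y).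
  by apply: meas_subV; [side|side].
 have fm: cmeas f.
  rewrite (funext fE); apply: cmeasM; first by case: hi.
  apply: cmeas_real; apply: measurable_funM=> //.
  have [mg _]:= cmeas_gau (a^+2/(4*eps k)); side.
 have mfx: cmeas (fun y: 'rV[R]_n=> f (y + x)).
  by apply: cmeas_comp=> //; apply: meas_addV; [side|side].
 rewrite -/f -(Cint_shift x fm) -(Cint_neg mfx).
 pose g (z: 'rV[R]_n):= h (x - z)*(Num.sqrt (pi/eps k)^+n * gau (a^+2/(4*eps k)) z)%:C.
 have -> : (fun y: 'rV[R]_n=> f (- y + x)) = g.
  apply/funext=> y; rewrite fE /g [- y + x]addrC (_: x - (x - y) = y)//.
  by rewrite opprD opprK addrA subrr add0r.
 have gint: cintg (mu n) g.
  apply: (@cintgMl_bounded _ _ _ _ _ _ M); last by move=> z; exact: hM.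
  - under eq_fun do rewrite rmorphM; apply: cintgZ; exact: (FT_gau 0 (0: 'rV[R]_n) c1).1.
  - by apply: cmeas_comp=> //; case: hi.
 have:= Cint_scale (s0 k) gint=> Eg.
 have -> : Cint (mu n) g = (s k^+n)%:C*Cint (mu n) (fun z: 'rV[R]_n=> g (s k *: z)).
  rewrite Eg mulrA -RCM mulfV; first by rewrite mul1r.
  side.
 have gsi: cintg (mu n) (fun z: 'rV[R]_n=> h (x - s k *: z)*(gau pi z)%:C).
  apply: (@cintgMl_bounded _ _ _ _ _ _ M); last by move=> z; exact: hM.
  - exact: (FT_gau 0 (0: 'rV[R]_n) pi0).1.
  - apply: cmeas_comp; first by case: hi.
   apply: meas_subV; first side.
   side.
 have E1 z: g (s k *: z) = ((s k ^- n)%:C)*(h (x - s k *: z)*(gau pi z)%:C).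
  rewrite /g gau_scale.
  have -> : a^+2/(4*eps k)*s k^+2 = pi.
   by rewrite a2; exact: gau_width.
  have -> : Num.sqrt (pi/eps k) = (s k)^-1.
   rewrite /eps invfM mulrA mulfV ?gt_eqF// mul1r -exprVn sqrtr_sqr ger0_norm//.
   side.
  by rewrite exprVn RCM; ring.
 rewrite (eq_Cint _ E1) CintZ// mulrA -RCM mulfV ?expf_neq0 ?gt_eqF// mul1r.
 by [].
have scvg: s k @[k --> \oo] --> (0: R):= cvg_invS.
have gcvg xi: gau (eps k) xi @[k --> \oo] --> (1: R).
 have e1: (fun k: nat=> - (eps k*dotp xi xi)) @ \oo --> (0: R).
  rewrite (_: (fun k: nat=> _) = (fun k=> - (pi*dotp xi xi)*(s k*s k))); last first.
   by apply/funext=> k; rewrite /eps; ring.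
  rewrite -[X in _ --> X](mulr0 (- (pi*dotp xi xi))); apply: cvg_mulr_cst.
  by rewrite -[X in _ --> X](mulr0 (0: R)); exact: cvgM.
 by have:= cvg_comp _ _ e1 (@continuous_expR R 0); rewrite expR0.
have fin:= FT_gau 0 (0: 'rV[R]_n) pi0.
have I1: Cint (mu n) (fun z: 'rV[R]_n=> (gau pi z)%:C) = 1.
 have:= fin.2; rewrite /FT mulfV ?gt_eqF// sqrtr1 expr1n mul1r /gau expr0n/= !mul0r oppr0 expR0.
 move=> E; transitivity ((1: R)%:C)=> //; rewrite -E; apply: eq_Cint=> z.
 by rewrite mul0r cexpi0 mulr1.
have [AR AI]: (fun k=> Re (A k)) @ \oo --> Re (FT (- a) (FT a h) x) /\
  (fun k=> Im (A k)) @ \oo --> Im (FT (- a) (FT a h) x).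
 apply: (@Cint_dominated _ _ _ _ _ _ (fun xi=> cabs (FT a h xi))); try side.
 - move=> k; apply: cmeasM; last side.
  by apply: cmeasM; [case: Hi|exact: cmeas_gau].
 - by case: Hi.
 - move=> k xi; rewrite !cabsM cabs_cexpi mulr1 cabs_real ger0_norm ?expR_ge0//.
  by rewrite ler_piMr ?cabs_ge0// gau_le1// ltW.
 - move=> xi; rewrite -[X in _ --> X]mulr1.
  rewrite (_: (fun k: nat=> _) = (fun k=> Re (FT a h xi*cexpi (- a*dotp xi x)) * gau (eps k) xi)).
   exact: cvg_mulr_cst.
  by apply/funext=> k; rewrite mulrAC [X in Re X]mulrC ReRM mulrC.
 - move=> xi; rewrite -[X in _ --> X]mulr1.
  rewrite (_: (fun k: nat=> _) = (fun k=> Im (FT a h xi*cexpi (- a*dotp xi x)) * gau (eps k) xi)).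
   exact: cvg_mulr_cst.
  by apply/funext=> k; rewrite mulrAC [X in Im X]mulrC ImRM mulrC.
have [BR BI]: (fun k=> Re (B k)) @ \oo --> Re (h x*1) /\ (fun k=> Im (B k)) @ \oo --> Im (h x*1).
 rewrite -I1 -CintZ; last exact: fin.1.
 apply: (@Cint_dominated _ _ _ _ _ _ (fun z=> M*cabs (gau pi z)%:C)).
 - move=> k; apply: cmeasM; last exact: cmeas_gau.
  apply: cmeas_comp; first by case: hi.
  apply: meas_subV; first side.
  side.
 - by apply: cmeasM; [side|exact: cmeas_gau].
 - by have:= integrableZl measurableT M fin.1.2.
 - by move=> k z; rewrite cabsM ler_wpM2r ?cabs_ge0.
 - move=> z; rewrite mulrC ReRM.
  rewrite (_: (fun k: nat=> _) = (fun k=> gau pi z*Re (h (x - s k *: z)))).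
   exact: (cvg_mulr_cst _ (hc x z).1).
  by apply/funext=> k; rewrite mulrC ReRM.
 - move=> z; rewrite mulrC ImRM.
  rewrite (_: (fun k: nat=> _) = (fun k=> gau pi z*Im (h (x - s k *: z)))).
   exact: (cvg_mulr_cst _ (hc x z).2).
  by apply/funext=> k; rewrite mulrC ImRM.
rewrite mulr1 in BR BI; rewrite -(funext AB) in BR BI.
apply: complex_ext; [exact: (cvg_unique _ AR BR)|exact: (cvg_unique _ AI BI)].
Qed.

End multiplier.

(** * Decay of a transform from finite differences *)

Section kernel_decay.
Context {R: realType} {n: nat}.
Implicit Types (h: 'rV[R]_n -> R[i]) (x d: 'rV[R]_n).

(** Comparable to 1 + |x|. The l1 norm is taken because its exponential factors over the
    coordinates. *)
Definition nu x: R:= 1 + \sum_(i < n) `|x ord0 i|.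
Definition fdiff d h x: R[i]:= h (x + d) - h x.
Lemma nu_ge1 x: 1 <= nu x.
Proof. by rewrite lerDl sumr_ge0. Qed.
Lemma nu_gt0 x: 0 < nu x.
Proof. exact: lt_le_trans (nu_ge1 x). Qed.
Hint Resolve nu_gt0: side.
Lemma cintg_fdiff d h k: cintg (mu n) h -> cintg (mu n) (iter k (fdiff d) h).
Proof.
by move=> hi; elim: k=> [//|k IH]/=; apply: cintgB=> //; exact: cintg_shift.
Qed.
Lemma FT_fdiff a d h x: cintg (mu n) h -> FT a (fdiff d h) x = (cexpi (- (a*dotp d x)) - 1)*FT a h x.
Proof.
move=> hi; have hd:= cintg_shift d hi.
rewrite /FT /fdiff; under eq_Cint do rewrite mulrBl.
rewrite CintB; [|exact: cintg_char..].
rewrite mulrBl mul1r; congr (_ - _).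
have mh: cmeas (fun y=> h y*cexpi (a*dotp y x)) by side.
rewrite -[in RHS](Cint_shift d mh) -CintZ; last exact: (cintg_shift d (cintg_char a x hi)).
apply: eq_Cint=> y; rewrite dotpDl mulrDr cexpiD.
have E: cexpi (- (a*dotp d x))*cexpi (a*dotp d x) = 1 by rewrite -cexpiD addNr cexpi0.
by rewrite -[LHS]mul1r -E; ring.
Qed.
Lemma FT_iter_fdiff a d h k x: cintg (mu n) h ->
 FT a (iter k (fdiff d) h) x = (cexpi (- (a*dotp d x)) - 1)^+k*FT a h x.
Proof.
move=> hi; elim: k=> [|k IH]; first by rewrite expr0 mul1r.
by rewrite iterS FT_fdiff ?IH ?exprS ?mulrA//; exact: cintg_fdiff.
Qed.
Lemma cexpiNpi: cexpi (pi: R) = -1 /\ cexpi (- pi: R) = -1.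
Proof.
split; apply: complex_ext=> /=; rewrite ?cosN ?sinN ?cospi ?sinpi ?oppr0//.
Qed.
(** Differences replace derivatives. With the step d = 1/(2 x_i), for the largest coordinate x_i,
    the phase a d x_i is half a turn, so each difference multiplies the transform by -2 and K of
    them give 2^K |FT| <= 2 B |d|^K. The constant c absorbs the comparison of nu x with |x_i|. *)
Lemma FT_decay (K: nat) (d0: R): 0 < d0 -> exists C: R, 0 < C /\
 forall a h (B: R), a^+2 = (2 * pi)^+2 -> 0 <= B -> cintg (mu n) h ->
 (\int[mu n]_x (cabs (h x))%:E <= B%:E)%E ->
 (forall (i: 'I_n) (d: R), `|d| <= d0 ->
   (\int[mu n]_x (cabs (iter K (fdiff (d *: evec R i)) h x))%:E <= (B * `|d| ^+ K)%:E)%E) ->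
 forall x, cabs (FT a h x) <= C*B*nu x ^- K.
Proof.
move=> d00; pose c:= 1 + n%:R/(2*d0) + 2*d0 + n%:R.
have n0: (0: R) <= n%:R by [].
have q0: 0 <= n%:R/(2*d0) by side.
have c0: 0 < c by rewrite /c; lra.
exists (2*c^+K); split; first side.
move=> a h B a2 B0 hi hB hd x.
have pi0:= @pi_gt0 R.
have F0: cabs (FT a h x) <= 2*B.
 rewrite -lee_fin (le_trans (cabs_Cint (cintg_char a x hi)))// EFinM lee_wpmul2l//.
 by under eq_integral do rewrite cabsM cabs_cexpi mulr1.
(* Either the largest coordinate reaches 1/(2 d0), so that the step 1/(2 x_i) is admissible, or x
   lies in a bounded set, where the trivial L^1 bound suffices. *)
have [[i xi]|small]:= pselect (exists i: 'I_n, 1 <= 2*d0 * `|x ord0 i| /\ forall j, `|x ord0 j| <= `|x ord0 i|).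
 have [x1 xmax]:= xi; have xi0: 0 < `|x ord0 i|.
  by rewrite lt_def normr_ge0 andbT; apply/eqP=> e; move: x1; rewrite e mulr0 ler10.
 have x0: x ord0 i != 0 by rewrite -normr_gt0.
 pose d:= (2*x ord0 i)^-1.
 have nd: `|d| = (2 * `|x ord0 i|)^-1 by rewrite /d normfV normrM ger0_norm.
 have dd: `|d| <= d0.
  rewrite nd -[leLHS]mul1r ler_pdivrMr ?mulr_gt0//; move: x1; lra.
 have E: cexpi (- (a*dotp (d *: evec R i) x)) = -1.
  rewrite dotpZl dotp_evec.
  have -> : a*(d*x ord0 i) = a/2 by rewrite /d; field.
  have [h1 h2]:= cexpiNpi.
  have /eqP: (a - 2 * pi)*(a + 2 * pi) = 0 by rewrite -subr_sqr a2 subrr.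
  rewrite mulf_eq0=> /orP[|] /eqP e.
   by rewrite (_: - (a/2) = - pi)//; lra.
  by rewrite (_: - (a/2) = pi)//; lra.
 have F1: 2^+K*cabs (FT a h x) <= 2*(B * `|d| ^+ K).
  have <- : cabs (FT a (iter K (fdiff (d *: evec R i)) h) x) = 2^+K*cabs (FT a h x).
   rewrite FT_iter_fdiff// E cabsM cabsX; congr (_^+_*_).
   by rewrite -opprD cabsN -[1 + 1]/(2%:R) -(rmorph_nat (real_complex R)) cabs_real ger0_norm.
  have ii:= cintg_fdiff (d *: evec R i) K hi.
  rewrite -lee_fin (le_trans (cabs_Cint (cintg_char a x ii)))// EFinM lee_wpmul2l//.
  under eq_integral do rewrite cabsM cabs_cexpi mulr1.
  exact: hd.
 have nux: nu x <= c * `|x ord0 i|.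
  have: \sum_(j < n) `|x ord0 j| <= n%:R * `|x ord0 i|.
   rewrite -[X in X%:R*_]card_ord mulr_natl -sumr_const; exact: ler_sum.
  rewrite /nu /c; have: 0 <= (1 + n%:R/(2*d0)) * `|x ord0 i| by rewrite mulr_ge0// addr_ge0.
  lra.
 rewrite ler_pdivlMr ?exprn_gt0 ?nu_gt0//.
 have y0: 0 < 2 * `|x ord0 i| by rewrite mulr_gt0.
 have {}F1: cabs (FT a h x)*(`|x ord0 i| ^+ K) <= 2*B.
  move: F1; rewrite nd exprVn mulrA ler_pdivlMr ?exprn_gt0//; apply: le_trans.
  rewrite exprMn; set F:= cabs _; set y:= _^+K.
  have -> : 2^+K*F*(2^+K*y) = (F*y)*(2^+K*2^+K) by ring.
  rewrite ler_peMr//; first side.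
  by rewrite -exprD exprn_ege1// ler1n.
 le_via (cabs (FT a h x)*(c * `|x ord0 i|)^+K).
  by rewrite ler_wpM2l ?cabs_ge0// lerXn2r// ?nnegrE ?(ltW (nu_gt0 x))// mulr_ge0 ?ltW.
 rewrite exprMn mulrCA (_: 2*c^+K*B = c^+K*(2*B)); last by ring.
 by rewrite ler_wpM2l// exprn_ge0// ltW.
have xs i: `|x ord0 i| <= (2*d0)^-1.
 rewrite leNgt; apply/negP=> xi; apply: small.
 have [j _ jmax]:= @arg_maxP _ _ _ i xpredT (fun k=> `|x ord0 k|) isT.
 exists j; split=> [|k]; last exact: jmax.
 rewrite -ler_pdivrMl ?mulr_gt0// mulr1; apply: le_trans (jmax i isT); side.
have nux: nu x <= c.
 have: \sum_(j < n) `|x ord0 j| <= n%:R/(2*d0).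
  rewrite -[X in X%:R/_]card_ord mulr_natl -sumr_const; exact: ler_sum.
 rewrite /nu /c; lra.
rewrite ler_pdivlMr ?exprn_gt0 ?nu_gt0// mulrAC; apply: ler_pM=> //; rewrite ?cabs_ge0 ?exprn_ge0 ?(ltW (nu_gt0 x))//.
by rewrite lerXn2r// ?nnegrE ?(ltW (nu_gt0 x)) ?(ltW c0).
Qed.

End kernel_decay.
Hint Resolve nu_gt0: side.

(** * Calculus of iterated differences *)

Section finite_differences.

Definition sdiff (V: zmodType) (a: nat -> V) (j: nat): V:= a j.+1 - a j.
Lemma sdiffM (T: pzRingType) (a b: nat -> T) :
 sdiff (fun j=> a j*b j) = (fun j=> sdiff a j*b j.+1 + a j*sdiff b j).
Proof. by apply/funext=> j; rewrite /sdiff mulrBl mulrBr addrA subrK. Qed.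
Lemma iter_sdiffD (V: zmodType) k (a b: nat -> V) j :
 iter k (@sdiff V) (fun j=> a j + b j) j = iter k (@sdiff V) a j + iter k (@sdiff V) b j.
Proof.
elim: k j=> [//|k IH] j; rewrite !iterS /sdiff !IH.
by rewrite opprD addrACA.
Qed.
Lemma iter_sdiff0 (V: zmodType) k j: iter k (@sdiff V) (fun=> 0) j = 0.
Proof. by elim: k j=> [//|k IH] j; rewrite iterS /sdiff !IH subrr. Qed.
Lemma iter_sdiff_shift (V: zmodType) k (a: nat -> V) j :
 iter k (@sdiff V) (fun j=> a j.+1) j = iter k (@sdiff V) a j.+1.
Proof. by elim: k j=> [//|k IH] j; rewrite !iterS /sdiff !IH. Qed.
Lemma eq_iter_sdiff (V: zmodType) k (a b: nat -> V) j: (forall i, (j <= i <= j + k)%N -> a i = b i) ->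
 iter k (@sdiff V) a j = iter k (@sdiff V) b j.
Proof.
elim: k j=> [|k IH] j ab; first by apply: ab; rewrite addn0 leqnn.
rewrite !iterS /sdiff !IH// => i /andP[h1 h2]; apply: ab; rewrite ?h1 ?(ltnW h1)//.
 by rewrite addnS ltnW// ltnS.
by rewrite /= -addSnnS.
Qed.

Context {R: realType}.

(** Discrete counterpart of a C^K bound along a segment of K steps of length [e]: a difference of
    order k gains k factors [e]. *)
Definition dbound (K: nat) (A e: R) (a: nat -> R[i]) :=
 forall k j, (j + k <= K)%N -> cabs (iter k (@sdiff _) a j) <= A*e^+k.
Lemma dboundW K A B e a: A <= B -> 0 <= e -> dbound K A e a -> dbound K B e a.
Proof.
by move=> AB e0 h k j jk; rewrite (le_trans (h _ _ jk))// ler_wpM2r// exprn_ge0.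
Qed.
Lemma eq_dbound K A e a b: (forall j, (j <= K)%N -> a j = b j) -> dbound K A e a -> dbound K A e b.
Proof.
move=> ab h k j jk; rewrite -(@eq_iter_sdiff _ k a)//; first exact: h.
by move=> i /andP[_ ij]; apply: ab; exact: leq_trans ij jk.
Qed.
Lemma dbound_sdiff K A e a: dbound K.+1 A e a -> dbound K (A*e) e (sdiff a).
Proof.
move=> h k j jk; rewrite -iterSr -mulrA -exprS.
by apply: h; rewrite addnS ltnS.
Qed.
Lemma dbound_shift K A e a: dbound K.+1 A e a -> dbound K A e (fun j=> a j.+1).
Proof. by move=> h k j jk; rewrite iter_sdiff_shift; apply: h; rewrite addSn ltnS. Qed.
Lemma dbound_pred K A e a: dbound K.+1 A e a -> dbound K A e a.
Proof. by move=> h k j jk; apply: h; exact: leqW. Qed.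
(** Discrete Leibniz rule; each order of difference doubles the number of terms, hence 2^K. *)
Lemma dboundM K A B e a b: 0 <= A -> 0 <= B -> 0 <= e -> dbound K A e a -> dbound K B e b ->
 dbound K (2^+K*(A*B)) e (fun j=> a j*b j).
Proof.
elim: K A B a b=> [|K IH] A B a b A0 B0 e0 ha hb k j jk.
 move: jk; rewrite leqn0 addn_eq0=> /andP[/eqP-> /eqP->] /=.
 rewrite cabsM expr0 mul1r expr0 mulr1; apply: ler_pM; rewrite ?cabs_ge0//.
  by have:= ha 0%N 0%N isT; rewrite /= mulr1.
 by have:= hb 0%N 0%N isT; rewrite /= mulr1.
case: k jk=> [|k] jk.
 rewrite /= cabsM expr0 mulr1; le_via (A*B).
  have:= ha 0%N j jk; have:= hb 0%N j jk; rewrite /= !mulr1=> h1 h2.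
  by apply: ler_pM; rewrite ?cabs_ge0.
 by rewrite ler_peMl ?mulr_ge0// exprn_ege1// ler1n.
have jk': (j + k <= K)%N by move: jk; rewrite addnS ltnS.
rewrite iterSr sdiffM iter_sdiffD (le_trans (cabsD _ _))//.
have h1:= IH _ _ _ _ (mulr_ge0 A0 e0) B0 e0 (dbound_sdiff ha) (dbound_shift hb) k j jk'.
have h2:= IH _ _ _ _ A0 (mulr_ge0 B0 e0) e0 (dbound_pred ha) (dbound_sdiff hb) k j jk'.
apply: le_trans (lerD h1 h2) _.
by apply: le_of_eq; rewrite !exprS; ring.
Qed.
Lemma sdiffV (a: nat -> R[i]) j: a j != 0 -> a j.+1 != 0 ->
 sdiff (fun j=> (a j)^-1) j = - (sdiff a j*((a j)^-1*(a j.+1)^-1)).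
Proof. by move=> a0 a1; rewrite /sdiff; field; rewrite a0 a1. Qed.
Lemma dboundN K A e a: dbound K A e a -> dbound K A e (fun j=> - a j).
Proof.
move=> h k j jk; have -> : iter k (@sdiff _) (fun j=> - a j) j = - iter k (@sdiff _) a j.
 elim: k {jk} j=> [//|k IH] j; rewrite !iterS /sdiff !IH; ring.
by rewrite cabsN h.
Qed.
(** Discrete quotient rule: by [sdiffV] a difference of 1/a is a product of a difference of a with
    two shifted copies of 1/a, so each order follows from the lower ones and [dboundM]. *)
Lemma dboundV (K: nat) (A c: R): 0 <= A -> 0 < c -> exists2 B: R, 0 <= B &
 forall e a, 0 <= e -> dbound K A e a -> (forall j, (j <= K)%N -> c <= cabs (a j)) ->
 dbound K B e (fun j=> (a j)^-1).
Proof.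
move=> A0 c0; elim: K=> [|K [B B0 IH]].
 exists c^-1; rewrite ?invr_ge0 ?ltW// => e a e0 _ ca k j.
 rewrite leqn0 addn_eq0=> /andP[/eqP-> /eqP->] /=.
 by rewrite cabsV expr0 mulr1 lef_pV2 ?posrE ?ca// (lt_le_trans c0)// ca.
pose B':= 2^+K*(A*(2^+K*(B*B))).
exists (B' + c^-1); first side.
move=> e a e0 ha ca.
have B'0: 0 <= B' by side.
have nz j: (j <= K.+1)%N -> a j != 0.
 by move=> jk; rewrite -cabs_eq0 gt_eqF// (lt_le_trans c0)// ca.
move=> [|k] j jk.
 rewrite /= cabsV expr0 mulr1 (@le_trans _ _ c^-1) ?lerDr//.
 rewrite addn0 in jk; by rewrite lef_pV2 ?posrE ?ca// (lt_le_trans c0)// ca.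
have jk': (j + k <= K)%N by move: jk; rewrite addnS ltnS.
have b1:= IH e a e0 (dbound_pred ha) (fun j jk=> ca j (leqW jk)).
have b2:= IH e _ e0 (dbound_shift ha) (fun j jk=> ca j.+1 jk).
have b3:= dboundM (mulr_ge0 A0 e0) (mulr_ge0 (exprn_ge0 K (ler0n R 2)) (mulr_ge0 B0 B0)) e0
 (dbound_sdiff ha) (dboundM B0 B0 e0 b1 b2).
have b4:= eq_dbound (b:= sdiff (fun j=> (a j)^-1)) _ (dboundN b3).
rewrite iterSr; apply: le_trans (b4 _ k j jk') _.
 by move=> i iK; rewrite sdiffV// nz// leqW.
rewrite (_: (B' + c^-1)*e^+k.+1 = ((B' + c^-1)*e)*e^+k); last by rewrite exprS mulrA.
apply: ler_wpM2r; first side.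
rewrite (_: 2^+K*_ = B'*e); last by rewrite /B'; ring.
by rewrite ler_wpM2r// lerDl invr_ge0 ltW.
Qed.
Lemma iter_fdiff_seq n (h: 'rV[R]_n -> R[i]) d k x (j: nat) :
 iter k (fdiff d) h (x + j%:R *: d) = iter k (@sdiff _) (fun j: nat=> h (x + j%:R *: d)) j.
Proof.
elim: k j=> [//|k IH] j; rewrite !iterS /sdiff -!IH.
have -> : x + j.+1%:R *: d = x + j%:R *: d + d by rewrite -addrA -natr1 scalerDl scale1r.
by [].
Qed.
Lemma iter_sdiff_real k (a: nat -> R) j: iter k (@sdiff _) (fun j=> (a j)%:C) j = (iter k (@sdiff _) a j)%:C.
Proof.
elim: k j=> [//|k IH] j; rewrite !iterS /sdiff !IH.
by rewrite rmorphB.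
Qed.
Lemma is_derive_sdiff (g g': R -> R) (d: R): (forall u, is_derive u (1: R) g (g' u)) ->
 forall k j u, is_derive u (1: R) (fun u=> iter k (@sdiff _) (fun j: nat=> g (u + j%:R*d)) j)
  (iter k (@sdiff _) (fun j: nat=> g' (u + j%:R*d)) j).
Proof.
move=> dg; elim=> [|k IH] j u.
 rewrite /=; have h1: is_derive u (1: R) (fun u: R=> u + j%:R*d) 1.
  by apply: is_derive_eq; rewrite addr0.
 have h2:= dg (u + j%:R*d).
 have:= @is_derive1_comp _ g (fun u: R=> u + j%:R*d) u _ _ h2 h1.
 by rewrite mulr1.
have:= is_deriveB (IH j.+1 u) (IH j u).
by [].
Qed.
(** The mean value theorem trades one difference for one derivative and a factor |d|. The bounds are
    kept on one interval lo..hi because every intermediate segment stays inside the initial one. *)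
Lemma sdiff_derive_bound (g: nat -> R -> R) (B: nat -> R) (lo hi d: R) :
 (forall k u, is_derive u (1: R) (g k) (g k.+1 u)) ->
 (forall k u, lo <= u <= hi -> `|g k u| <= B k) ->
 forall k m u, lo <= u <= hi -> lo <= u + k%:R*d <= hi ->
 `|iter k (@sdiff _) (fun j: nat=> g m (u + j%:R*d)) 0| <= B (m + k)%N * `|d| ^+ k.
Proof.
move=> dg gB; elim=> [|k IH] m u lu lud.
 by rewrite /= mul0r addr0 expr0 mulr1 addn0 gB.
pose H v:= iter k (@sdiff _) (fun j: nat=> g m (v + j%:R*d)) 0.
have HE: iter k.+1 (@sdiff _) (fun j: nat=> g m (u + j%:R*d)) 0 = H (u + d) - H u.
 rewrite iterS /sdiff; congr (_ - _); rewrite -iter_sdiff_shift /H.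
 by apply: eq_iter_sdiff=> j _; congr g; rewrite mulrSr; ring.
have dH v: is_derive v (1: R) H (iter k (@sdiff _) (fun j: nat=> g m.+1 (v + j%:R*d)) 0).
 exact: is_derive_sdiff.
have cH: continuous H by move=> v; apply/differentiable_continuous/derivable1_diffP; have []:= dH v.
have kd: (k.+1%:R: R) = k%:R + 1 by rewrite -natr1.
have key v: (u <= v <= u + d) || (u + d <= v <= u) ->
 `|iter k (@sdiff _) (fun j: nat=> g m.+1 (v + j%:R*d)) 0| <= B (m + k.+1)%N * `|d| ^+ k.
 move=> hv; rewrite -addSnnS; apply: IH.
  move: lu lud hv; rewrite kd mulrDl mul1r; have:= ler0n R k; set K:= k%:R=> K0 /andP[l1 l2] /andP[l3 l4].
  move=> /orP[|] /andP[v1 v2]; apply/andP; split; nra.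
 move: lu lud hv; rewrite kd mulrDl mul1r; have:= ler0n R k; set K:= k%:R=> K0 /andP[l1 l2] /andP[l3 l4].
 move=> /orP[|] /andP[v1 v2]; apply/andP; split; nra.
rewrite HE exprS mulrCA mulrC.
have [d0|d0]:= leP 0 d.
 have [||v vI ->]:= @MVT_segment R H (fun v=> iter k (@sdiff _) (fun j: nat=> g m.+1 (v + j%:R*d)) 0) u (u + d).
 - by rewrite lerDl.
 - by apply: continuous_subspaceT.
 rewrite addrAC subrr add0r normrM; apply: ler_wpM2r=> //; apply: key.
 by move: vI; rewrite in_itv/= => ->.
have [||v vI E]:= @MVT_segment R H (fun v=> iter k (@sdiff _) (fun j: nat=> g m.+1 (v + j%:R*d)) 0) (u + d) u.
- by rewrite gerDl ltW.
- by apply: continuous_subspaceT.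
rewrite distrC E opprD addrA subrr add0r normrM normrN; apply: ler_wpM2r=> //; apply: key.
by move: vI; rewrite in_itv/= => ->; rewrite orbT.
Qed.

End finite_differences.

(** * Differences of Gaussians away from the origin *)

Section gauss_differences.
Context {R: realType}.

(** Up to sign the Hermite polynomials: the k-th derivative of e^(-u^2) is [herm k] times
    e^(-u^2). *)
Fixpoint herm (k: nat): {poly R} :=
 match k with 0=> 1%:P | k'.+1=> deriv (herm k') - 2%:P*'X*herm k' end.
Let g (k: nat) (u: R):= (herm k).[u]*expR (- u^+2).
Let dg k u: is_derive u (1: R) (g k) (g k.+1 u).
Proof.
have dp:= is_derive_poly (herm k) u.
rewrite /g /=; apply: is_derive_eq; rewrite !hornerE /GRing.scale/=; ring.
Qed.
Lemma herm_bound k: exists2 B: R, 0 <= B & forall u, `|g k u| <= B*expR (- (u^+2/2)).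
Proof.
pose S:= \sum_(i < size (herm k)) `|(herm k)`_i| * (1 + i`!%:R/2^-1^+i).
exists S; first side.
move=> u; rewrite /g normrM (ger0_norm (expR_ge0 _)).
have -> : - u^+2 = - (u^+2/2) + - (u^+2/2) by field.
rewrite expRD mulrA ler_wpM2r ?expR_ge0//.
le_via ((\sum_(i < size (herm k)) `|(herm k)`_i| * `|u| ^+ i)*expR (- (u^+2/2))).
 rewrite ler_wpM2r ?expR_ge0// horner_coef (le_trans (ler_norm_sum _ _ _))//.
 by apply: ler_sum=> i _; rewrite normrM normrX.
rewrite mulr_suml; apply: ler_sum=> i _; rewrite -mulrA ler_wpM2l//.
have e1: expR (- (u^+2/2)) <= 1 by rewrite -[leRHS]expR0 ler_expR oppr_le0 divr_ge0 ?sqr_ge0.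
have [u1|u1]:= leP `|u| 1.
 rewrite -[leRHS]mulr1 ler_pM ?exprn_ge0 ?expR_ge0//.
 by rewrite (@le_trans _ _ 1) ?exprn_ile1// lerDl divr_ge0// exprn_ge0.
le_via (`|u| ^+ i*expR (- (2^-1 * `|u|))).
 rewrite ler_wpM2l ?exprn_ge0// ler_expR lerN2 -[u^+2]real_normK ?num_real//.
 by move: u1; set y:= `|u|; nra.
by rewrite (le_trans (mul_expN_le i _ (normr_ge0 u)))// ?invr_gt0// lerDr.
Qed.
Lemma is_derive_scaled_gauss (c: R) k u: is_derive u (1: R) (fun u=> c^+k * g k (c*u)) (c^+k.+1 * g k.+1 (c*u)).
Proof.
have h1: is_derive u (1: R) (fun u: R=> c*u) c by apply: is_derive_eq; rewrite /GRing.scale/= mulr1.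
have h2:= @is_derive1_comp _ (g k) (fun u: R=> c*u) u _ _ (dg k (c*u)) h1.
have:= is_deriveZ (c^+k) h2; rewrite exprSr=> h; apply: is_derive_eq.
by rewrite /GRing.scale/=; ring.
Qed.
Lemma gau_line n (c: R) (x: 'rV[R]_n) (i: 'I_n) (u: R) :
 gau c (x + u *: evec R i) = expR (- (c*(dotp x x - x ord0 i^+2)))*expR (- (c*(x ord0 i + u)^+2)).
Proof.
rewrite -expRD /gau; congr expR; rewrite dotpDl !dotpDr !dotpZl !dotpZr (dotpC x) !dotp_evec.
by have -> : evec R i ord0 i = 1 by [rewrite mxE eqxx]; ring.
Qed.
(** Along a coordinate line a Gaussian is a constant times a one-dimensional Gaussian, whose
    derivatives [herm_bound] controls at the cost of half the exponent. Distance at least 1/4 from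
    the origin then leaves e^(-c/32), and half of that pays for the powers of sqrt c produced by
    differentiation; hence e^(-c/64), uniformly in c. *)
Lemma gau_dbound n (K: nat): exists2 C: R, 0 <= C &
 forall (c: R) (x: 'rV[R]_n) (i: 'I_n) (d: R), 0 <= c ->
 (forall u, 0 <= u <= K%:R -> 4^-1 <= enorm (x + (u*d) *: evec R i)) ->
 dbound K (C*expR (- (c/64))) `|d| (fun j: nat=> (gau c (x + j%:R *: (d *: evec R i)))%:C).
Proof.
have /choice[B hB]: forall k, exists B: R, 0 <= B /\ forall u, `|g k u| <= B*expR (- (u^+2/2)).
 by move=> k; have [B B0 h]:= herm_bound k; exists B.
have [C C0 CE]: exists2 C: R, 0 <= C & forall k, (k <= K)%N -> forall c, 0 <= c -> B k*Num.sqrt c^+k*expR (- (c/32)) <= C*expR (- (c/64)).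
 exists (\sum_(k < K.+1) B k*(1 + k`!%:R/64^-1^+k)).
  by apply: sumr_ge0=> k _; rewrite mulr_ge0 ?(hB _).1// addr_ge0// divr_ge0// exprn_ge0.
 move=> k kK c c0; rewrite (_: - (c/32) = - (c/64) + - (c/64)); last by field.
 rewrite expRD mulrA ler_wpM2r ?expR_ge0//.
 rewrite (bigD1 (Ordinal (kK: (k < K.+1)%N)))//= -[leLHS]addr0 lerD//; last first.
  by apply: sumr_ge0=> j _; rewrite mulr_ge0 ?(hB _).1// addr_ge0// divr_ge0// exprn_ge0.
 rewrite -mulrA ler_wpM2l ?(hB _).1//.
 have [c1|c1]:= leP c 1.
  rewrite (@le_trans _ _ 1)//; last by rewrite lerDl divr_ge0// exprn_ge0.
  rewrite -[leRHS]mulr1 ler_pM ?exprn_ge0 ?expR_ge0 ?sqrtr_ge0//.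
   by rewrite exprn_ile1 ?sqrtr_ge0// -sqrtr1 ler_sqrt.
  by rewrite -[leRHS]expR0 ler_expR oppr_le0 divr_ge0.
 le_via (c^+k*expR (- (64^-1*c))).
  rewrite [64^-1*c]mulrC ler_wpM2r ?expR_ge0// lerXn2r ?nnegrE ?sqrtr_ge0//.
  rewrite -[leRHS]ger0_norm// -sqrtr_sqr ler_sqrt ?sqr_ge0// expr2; nra.
 by rewrite (le_trans (mul_expN_le k _ c0)) ?invr_gt0// lerDr.
exists C=> // c x i d c0 hx k j jk.
have C1:= CE k (leq_trans (leq_addl _ _) jk) c c0.
rewrite iter_sdiff_real cabs_real.
have E0 (m: nat): gau c (x + m%:R *: (d *: evec R i)) = expR (- (c*(dotp x x - x ord0 i^+2))) * g 0 (Num.sqrt c*(x ord0 i + m%:R*d)).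
 rewrite scalerA gau_line /g /= hornerE mul1r exprMn sqr_sqrtr//.
set E:= expR (- (c*(dotp x x - x ord0 i^+2))) in E0.
pose G (k: nat) (u: R):= E*(Num.sqrt c^+k * g k (Num.sqrt c*u)).
have -> : iter k (@sdiff _) (fun m: nat=> gau c (x + m%:R *: (d *: evec R i))) j =
 iter k (@sdiff _) (fun m: nat=> G 0 ((x ord0 i + j%:R*d) + m%:R*d)) 0.
 have H (a: nat -> R): iter k (@sdiff _) a j = iter k (@sdiff _) (fun m=> a (m + j)%N) 0.
  elim: j a {jk}=> [a|j IH a]; first by apply: eq_iter_sdiff=> m _; rewrite addn0.
  rewrite -iter_sdiff_shift IH; apply: eq_iter_sdiff=> m _; by rewrite addnS.
 rewrite H; apply: eq_iter_sdiff=> m _; rewrite E0 /G expr0 mul1r; congr (_ * g _ (_*_)).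
 by rewrite natrD; ring.
pose lo:= Num.min (x ord0 i + j%:R*d) (x ord0 i + j%:R*d + k%:R*d).
pose hi:= Num.max (x ord0 i + j%:R*d) (x ord0 i + j%:R*d + k%:R*d).
apply: (le_trans (sdiff_derive_bound (g:= G) (B:= fun k=> B k*Num.sqrt c^+k*expR (- (c/32))) (lo:= lo) (hi:= hi) (d:= d) _ _ (k:= k) 0 _ _)).
- move=> l u; rewrite /G; apply: is_deriveZ; exact: is_derive_scaled_gauss.
- move=> l v hv.
 have [u hu vE]: exists2 u, 0 <= u <= K%:R & v = x ord0 i + u*d.
  move: hv; rewrite /lo /hi; set a:= x ord0 i + j%:R*d=> /andP[v1 v2].
  have jkK: j%:R + k%:R <= K%:R :> R by rewrite -natrD ler_nat.
  have j0:= ler0n R j; have k0:= ler0n R k.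
  have [d0|d0|d0]:= ltrgtP d 0.
  - exists (j%:R + (v - a)/d); last by rewrite /a; field; rewrite lt_eqF.
   move: v1 v2; rewrite (@min_r _ _ a) ?(@max_l _ _ a) ?gerDl ?mulr_ge0_le0 ?(ltW d0)// => v1 v2.
   have w0: 0 <= (v - a)/d by rewrite ler_ndivlMr// mul0r subr_le0.
   have wk: (v - a)/d <= k%:R by rewrite ler_ndivrMr//; lra.
   by apply/andP; split; lra.
  - exists (j%:R + (v - a)/d); last by rewrite /a; field; rewrite gt_eqF.
   move: v1 v2; rewrite (@min_l _ _ a) ?(@max_r _ _ a) ?lerDl ?mulr_ge0 ?(ltW d0)// => v1 v2.
   have w0: 0 <= (v - a)/d by side.
   have wk: (v - a)/d <= k%:R by rewrite ler_pdivrMr//; lra.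
   by apply/andP; split; lra.
  - exists j%:R; first by apply/andP; split; lra.
   move: v1 v2; rewrite /a d0 !mulr0 !addr0 minxx maxxx=> v1 v2; apply/eqP; rewrite eq_le v1 v2//.
 have e16: 16^-1 <= dotp x x - x ord0 i^+2 + v^+2.
  have h1:= hx u hu; have h2:= enorm_sqr (x + (u*d) *: evec R i).
  have -> : dotp x x - x ord0 i^+2 + v^+2 = enorm (x + (u*d) *: evec R i)^+2.
   rewrite h2 dotpDl !dotpDr !dotpZl !dotpZr (dotpC x) !dotp_evec vE.
   by have -> : evec R i ord0 i = 1 by [rewrite mxE eqxx]; ring.
  move: h1; set y:= enorm _=> h1; nra.
 have xx: 0 <= dotp x x - x ord0 i^+2.
  rewrite subr_ge0 /dotp (bigD1 i)//= -expr2 lerDl; apply: sumr_ge0=> m _.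
  by rewrite -expr2 sqr_ge0.
 rewrite /G !normrM ger0_norm ?expR_ge0// (ger0_norm (exprn_ge0 _ (sqrtr_ge0 _))).
 le_via (E*(Num.sqrt c^+l*(B l*expR (- ((Num.sqrt c * v)^+2/2))))).
  by rewrite ler_wpM2l ?expR_ge0// ler_wpM2l ?exprn_ge0 ?sqrtr_ge0//; rewrite -normrM; exact: (hB l).2.
 rewrite (_: _*_ = (B l*Num.sqrt c^+l)*(E*expR (- ((Num.sqrt c * v)^+2/2)))); last by ring.
 apply: ler_wpM2l; first by rewrite mulr_ge0 ?(hB _).1// exprn_ge0// sqrtr_ge0.
 rewrite /E -expRD ler_expR exprMn sqr_sqrtr//.
 move: xx e16; set X:= _ - _; set V:= v^+2=> X0 XV.
 have h1: 0 <= c*(X + V - 16^-1) by side.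
 have h2: 0 <= c*X by side.
 lra.
- by rewrite /lo /hi ge_min lexx le_max lexx.
- by rewrite /lo /hi ge_min lexx orbT le_max lexx orbT.
by rewrite add0n ler_wpM2r// exprn_ge0.
Qed.

End gauss_differences.

Local Close Scope complex_scope.
Local Open Scope ereal_scope.

(** * Vector-valued inequalities for averages *)
Section hoelder_ereal.
Context {R: realType}.
Lemma le_poweR (r: R) (x y: \bar R): (0 <= r)%R -> 0 <= x -> x <= y -> x`^r <= y`^r.
Proof.
by move=> r0 x0 xy; apply: gt0_ler_poweR=> //; rewrite in_itv/= leey andbT// (le_trans x0).
Qed.
Lemma poweRK (r: R) (x: \bar R): r != 0%R -> 0 <= x -> (x`^r)`^r^-1 = x.
Proof. by move=> r0 x0; rewrite -poweRrM mulfV// poweRe1. Qed.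
Lemma poweRVK (r: R) (x: \bar R): r != 0%R -> 0 <= x -> (x`^r^-1)`^r = x.
Proof. by move=> r0 x0; rewrite -poweRrM mulVf// poweRe1. Qed.
Lemma young_ereal (x y: \bar R) (p q: R): (0 < p)%R -> (0 < q)%R -> (p^-1 + q^-1 = 1)%R ->
 0 <= x -> 0 <= y -> x*y <= (p^-1)%:E*x`^p + (q^-1)%:E*y`^q.
Proof.
move=> p0 q0 pq; have pi0: (0 < p^-1)%R by side.
have qi0: (0 < q^-1)%R by side.
case: x=> [x| |]//; case: y=> [y| |]// x0 y0.
- rewrite !poweR_EFin -!EFinM -EFinD lee_fin.
 by have:= conjugate_powR x0 y0 p0 q0 pq; rewrite [(_/p)%R]mulrC [(_/q)%R]mulrC.
- have -> : (q^-1)%:E * +oo`^q = +oo by rewrite poweRyr ?gt_eqF// gt0_muley.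
 by rewrite addey ?leey// gt_eqF// (lt_le_trans (ltNyr 0%R))// mule_ge0 ?poweR_ge0// lee_fin ltW.
- have -> : (p^-1)%:E * +oo`^p = +oo by rewrite poweRyr ?gt_eqF// gt0_muley.
 by rewrite addye ?leey// gt_eqF// (lt_le_trans (ltNyr 0%R))// mule_ge0 ?poweR_ge0// lee_fin ltW.
- have -> : (p^-1)%:E * +oo`^p = +oo by rewrite poweRyr ?gt_eqF// gt0_muley.
 by rewrite addye ?leey// gt_eqF// (lt_le_trans (ltNyr 0%R))// mule_ge0 ?poweR_ge0// lee_fin ltW.
Qed.

Context {d} {T: measurableType d} (m: {measure set T -> \bar R}).
Implicit Types f g: T -> \bar R.
Lemma ge0_integral_eq0_mul f g: mfun f -> mfun g ->
 (forall x, 0 <= f x) -> (forall x, 0 <= g x) -> \int[m]_x f x = 0 -> \int[m]_x (f x * g x) = 0.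
Proof.
move=> mf mg f0 g0 If.
have: ae_eq m setT f (cst 0).
 apply/ae_eq_integral_abs=> //; rewrite -[RHS]If; apply: eq_integral=> x _; exact: gee0_abs.
move=> fae; transitivity (\int[m]_x cst 0 x); last exact: integral0.
apply: ae_eq_integral=> //; first side.
by apply: filterS fae=> x /= + _=> ->//; rewrite mul0e.
Qed.
Lemma hoelder_normalized f g (p q a b: R): (0 < p)%R -> (0 < q)%R -> (p^-1 + q^-1 = 1)%R ->
 mfun f -> mfun g ->
 (forall x, 0 <= f x) -> (forall x, 0 <= g x) -> (0 < a)%R -> (0 < b)%R ->
 \int[m]_x (f x`^p) = (a`^p)%:E -> \int[m]_x (g x`^q) = (b`^q)%:E ->
 \int[m]_x (f x * g x) <= (a*b)%:E.
Proof.
move=> p0 q0 pq mf mg f0 g0 a0 b0 IF IG.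
have ia0: (0 < a^-1)%R by side.
have ib0: (0 < b^-1)%R by side.
have ap0: (0 < a`^p)%R by side.
have bq0: (0 < b`^q)%R by side.
have key: (a^-1*b^-1)%:E*\int[m]_x (f x * g x) <= 1; last first.
 by move: key; rewrite -invfM lee_pdivrMl ?mulr_gt0// mule1 mulrC.
rewrite -ge0_integralZl//; try side.
le_via (\int[m]_x ((p^-1*(a`^p)^-1)%:E*f x`^p + (q^-1*(b`^q)^-1)%:E * g x`^q)).
 apply: ge0_le_integral=> //; try side.
 - by apply: emeasurable_funD; side.
 - move=> x _; rewrite EFinM muleACA.
  have fa: 0 <= (a^-1)%:E*f x by side.
  have gb: 0 <= (b^-1)%:E * g x by side.
  apply: (le_trans (young_ereal p0 q0 pq fa gb)).
  rewrite !poweRM ?lee_fin ?(ltW ia0) ?(ltW ib0)// !poweR_EFin.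
  have pV (c r: R): (0 < c)%R -> (c^-1`^r = (c`^r)^-1)%R.
   by move=> c0; rewrite -powR_inv1 ?(ltW c0)// -powRrM mulN1r powRN.
  by rewrite !pV// !muleA -!EFinM.
rewrite ge0_integralD//; try side.
rewrite !ge0_integralZl//; try side.
by rewrite IF IG -!EFinM -EFinD lee_fin -!mulrA !mulVf ?mulr1 ?pq// gt_eqF.
Qed.
Lemma hoelder_ereal f g (p q: R): (0 < p)%R -> (0 < q)%R -> (p^-1 + q^-1 = 1)%R ->
 mfun f -> mfun g ->
 (forall x, 0 <= f x) -> (forall x, 0 <= g x) ->
 \int[m]_x (f x * g x) <= (\int[m]_x (f x`^p))`^p^-1*(\int[m]_x (g x`^q))`^q^-1.
Proof.
move=> p0 q0 pq mf mg f0 g0.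
have mfp: mfun (fun x=> f x`^p) by side.
have mgq: mfun (fun x=> g x`^q) by side.
have pn:= gt_eqF p0; have qn:= gt_eqF q0.
set F:= \int[m]_x (f x`^p); set G:= \int[m]_x (g x`^q).
have F0: 0 <= F by side.
have G0: 0 <= G by side.
have [Fz|Fz]:= eqVneq F 0.
 rewrite (_: \int[m]_x _ = 0) ?mule_ge0 ?poweR_ge0//.
 have: \int[m]_x (f x`^p*(g x`^p)) = 0.
  by apply: ge0_integral_eq0_mul=> //; [side|move=> x; side|move=> x; side].
 move=> E; have: ae_eq m setT (fun x=> f x * g x) (cst 0).
  have: ae_eq m setT (fun x=> f x`^p * g x`^p) (cst 0).
   apply/ae_eq_integral_abs=> //.
    side.
   by rewrite -[RHS]E; apply: eq_integral=> x _; rewrite gee0_abs// mule_ge0 ?poweR_ge0.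
  apply: filterS=> x /= h _; have:= h I; rewrite -poweRM// => /poweR_eq0_eq0; apply.
  side.
 move=> h; transitivity (\int[m]_x cst 0 x); last exact: integral0.
 by apply: ae_eq_integral=> //; side.
have [Gz|Gz]:= eqVneq G 0.
 rewrite (_: \int[m]_x _ = 0) ?mule_ge0 ?poweR_ge0//.
 have: \int[m]_x (g x`^q*(f x`^q)) = 0.
  by apply: ge0_integral_eq0_mul=> //; [side|move=> x; side|move=> x; side].
 move=> E; have: ae_eq m setT (fun x=> f x * g x) (cst 0).
  have: ae_eq m setT (fun x=> g x`^q*f x`^q) (cst 0).
   apply/ae_eq_integral_abs=> //.
    side.
   by rewrite -[RHS]E; apply: eq_integral=> x _; rewrite gee0_abs// mule_ge0 ?poweR_ge0.
  apply: filterS=> x /= h _; have:= h I; rewrite -poweRM// muleC=> /poweR_eq0_eq0; apply.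
  side.
 move=> h; transitivity (\int[m]_x cst 0 x); last exact: integral0.
 by apply: ae_eq_integral=> //; side.
have {Fz}Fp: 0 < F by rewrite lt0e Fz.
have {Gz}Gp: 0 < G by rewrite lt0e Gz.
have [Fy|Fy]:= eqVneq F +oo.
 by rewrite Fy poweRyr ?invr_eq0 ?pn// gt0_mulye ?leey// poweR_gt0.
have [Gy|Gy]:= eqVneq G +oo.
 by rewrite Gy poweRyr ?invr_eq0 ?qn// gt0_muley ?leey// poweR_gt0.
have Ff: F \is a fin_num by rewrite ge0_fin_numE// ltey.
have Gf: G \is a fin_num by rewrite ge0_fin_numE// ltey.
pose a:= (fine F`^p^-1)%R; pose b:= (fine G`^q^-1)%R.
have a0: (0 < a)%R by apply: powR_gt0; rewrite fine_gt0// Fp ltey.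
have b0: (0 < b)%R by apply: powR_gt0; rewrite fine_gt0// Gp ltey.
have aE: F`^p^-1 = a%:E by rewrite /a -poweR_EFin fineK.
have bE: G`^q^-1 = b%:E by rewrite /b -poweR_EFin fineK.
have ap: \int[m]_x (f x`^p) = (a`^p)%:E by rewrite -poweR_EFin -aE -poweRrM mulVf ?pn// poweRe1.
have bq: \int[m]_x (g x`^q) = (b`^q)%:E by rewrite -poweR_EFin -bE -poweRrM mulVf ?qn// poweRe1.
by rewrite aE bE -EFinM; exact: hoelder_normalized ap bq.
Qed.
(** Jensen's inequality for a weight of arbitrary mass: Hoelder's inequality for the splitting w =
    w^(1/Q) w^(1/P). *)
Lemma jensen_ereal (w: T -> R) (h: T -> \bar R) (P: R): (1 <= P)%R ->
 mfun w -> mfun h -> (forall x, 0 <= w x)%R -> (forall x, 0 <= h x) ->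
 (\int[m]_x ((w x)%:E*h x))`^P <= (\int[m]_x (w x)%:E)`^(P - 1)*\int[m]_x ((w x)%:E*h x`^P).
Proof.
move=> P1 mw mh w0 h0; have P0: (0 < P)%R by apply: lt_le_trans P1.
have [->|Pn]:= eqVneq P 1%R.
 rewrite subrr poweRe0 mul1e poweRe1; last side.
 by under [X in _ <= X]eq_integral do rewrite poweRe1//.
have {}P1: (1 < P)%R by rewrite lt_def Pn.
pose Q:= (P/(P - 1))%R.
have Q0: (0 < Q)%R by side.
have PQ: (Q^-1 + P^-1 = 1)%R by rewrite /Q; field; rewrite !gt_eqF// subr_gt0.
have wE x: (w x)%:E*h x = (w x`^Q^-1)%:E*((w x`^P^-1)%:E*h x).
 rewrite muleA -EFinM; congr (_%:E*_).
 have [->|wx]:= eqVneq (w x) 0%R; first by rewrite powR0 ?mul0r// invr_eq0 gt_eqF.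
 by rewrite -powRD ?PQ ?powRr1// wx implybT.
under eq_integral do rewrite wE.
have mwq r: mfun (fun x=> (w x`^r)%:E).
 side.
le_via (((\int[m]_x ((w x`^Q^-1)%:E`^Q))`^Q^-1*(\int[m]_x (((w x`^P^-1)%:E*h x)`^P))`^P^-1)`^P).
 apply: le_poweR; first side.
  side.
 apply: hoelder_ereal=> //; try side.
rewrite poweRM ?poweR_ge0// poweRVK ?gt_eqF//; last side.
rewrite -poweRrM (_: Q^-1*P = P - 1)%R; last by rewrite /Q; field; rewrite !gt_eqF// subr_gt0.
apply: le_of_eq; congr (_`^_*_).
 by apply: eq_integral=> x _; rewrite poweR_EFin -powRrM mulVf ?gt_eqF// powRr1.
apply: eq_integral=> x _; rewrite poweRM ?lee_fin ?powR_ge0// poweR_EFin -powRrM mulVf ?gt_eqF// powRr1//.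
Qed.

End hoelder_ereal.

(** * Sums over all integers *)

Section zsum.
Context {R: realType}.
Implicit Types a b: int -> \bar R.

(** Lists the integers as 0, -1, 1, -2, 2, ..., which turns a sum over them into an integral for the
    counting measure on [nat], so that the integral inequalities above apply. *)
Definition zs (k: nat): int:= if odd k then Negz k./2 else Posz k./2.
Lemma zs_bij: set_bij [set: nat] [set: int] zs.
Proof.
split=> //.
- move=> j k _ _; rewrite /zs; have:= odd_double_half j; have:= odd_double_half k.
 by case: (odd j); case: (odd k)=> /= h1 h2 // -[] h; rewrite -h1 -h2 h.
- move=> [m|m] _ /=; [exists m.*2|exists m.*2.+1]=> //; rewrite /zs/= odd_double/= ?doubleK// uphalf_double//.
Qed.

Definition zsum a:= \esum_(j in [set: int]) a j.
Lemma zsum_nat a: (forall j, 0 <= a j) -> zsum a = \sum_(k <oo) a (zs k).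
Proof. by move=> a0; rewrite nneseries_esumT// /zsum (reindex_esum _ _ zs a zs_bij). Qed.
Lemma zsum_int a: (forall j, 0 <= a j) -> zsum a = \int[counting]_k a (zs k).
Proof. by move=> a0; rewrite ge0_integral_count// zsum_nat. Qed.
Lemma zsum_ge0 a: (forall j, 0 <= a j) -> 0 <= zsum a.
Proof. by move=> a0; exact: esum_ge0. Qed.
Hint Resolve zsum_ge0: side.
Lemma le_zsum a b: (forall j, a j <= b j) -> zsum a <= zsum b.
Proof. by move=> ab; apply: le_esum=> j _. Qed.
Lemma eq_zsum a b: (forall j, a j = b j) -> zsum a = zsum b.
Proof. by move=> ab; congr zsum; apply/funext. Qed.
Lemma zsumZ (c: R) a: (0 <= c)%R -> (forall j, 0 <= a j) -> zsum (fun j=> c%:E*a j) = c%:E*zsum a.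
Proof. by move=> c0 a0; rewrite !zsum_nat// ?nneseriesZl// => j; rewrite mule_ge0. Qed.
Lemma zsumD a b: (forall j, 0 <= a j) -> (forall j, 0 <= b j) -> zsum (fun j=> a j + b j) = zsum a + zsum b.
Proof. by move=> a0 b0; rewrite /zsum esumD. Qed.
Lemma zsum_shift a i: zsum (fun j=> a (j + i)%R) = zsum a.
Proof.
rewrite /zsum [RHS](reindex_esum [set: int] setT (fun j=> j + i)%R)//; split=> //.
- by move=> j k _ _ /addIr.
- by move=> k _; exists (k - i)%R=> //; rewrite subrK.
Qed.
Lemma zsum_opp a: zsum (fun j=> a (- j)%R) = zsum a.
Proof.
rewrite /zsum [RHS](reindex_esum [set: int] setT (fun j=> - j)%R)//; split=> //.
Qed.
Lemma zsum_conv a i: zsum (fun j=> a (i - j)%R) = zsum a.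
Proof. by rewrite -[RHS](zsum_shift _ i) -[RHS]zsum_opp; apply: eq_zsum=> j; rewrite addrC. Qed.
Lemma zsum_interchange (c: int -> int -> \bar R): (forall i j, 0 <= c i j) ->
 zsum (fun i=> zsum (c i)) = zsum (fun j=> zsum (c ^~ j)).
Proof.
move=> c0; rewrite !zsum_nat; last 2 first.
- by move=> j; exact: zsum_ge0.
- by move=> j; exact: zsum_ge0.
rewrite (eq_eseriesr (g:= fun k=> \sum_(l <oo) c (zs k) (zs l))); last by move=> k _; rewrite zsum_nat.
by rewrite nneseries_interchange//; apply: eq_eseriesr=> k _; rewrite zsum_nat.
Qed.
Lemma zsum_term a i: (forall j, 0 <= a j) -> a i <= zsum a.
Proof.
move=> a0; apply: esum_ge; exists [set i]; last by rewrite fsbig_set1.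
by split.
Qed.
Lemma zsum_eq0: zsum (fun=> 0) = 0.
Proof. exact: esum1. Qed.
Lemma zsum_single a i: (forall j, j != i -> a j = 0) -> 0 <= a i -> zsum a = a i.
Proof.
move=> az ai; apply/eqP; rewrite eq_le; apply/andP; split; last first.
 by apply: zsum_term=> j; have [->//|/az->]:= eqVneq j i.
apply: le_of_eq; rewrite -[RHS](@esum_set1 _ _ i a ai) [RHS]esum_mkcond.
apply: eq_esum=> j _; case: ifPn=> //; rewrite notin_setE/= => /eqP; exact: az.
Qed.

(** Truncation to a half-open window of 2 J scales, reindexed from 0 by [zsum_zcut]. Absorption
    arguments are run on the truncation, where finiteness is available, and passed to the limit by
    monotone convergence. *)
Definition zcut (J: nat) a (j: int):= if (- J%:Z <= j < J%:Z)%R then a j else 0.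
Lemma zcut_ge0 J a j: (forall j, 0 <= a j) -> 0 <= zcut J a j.
Proof. by move=> a0; rewrite /zcut; case: ifP. Qed.
Hint Resolve zcut_ge0: side.
Lemma zcut_le J a j: (forall j, 0 <= a j) -> zcut J a j <= a j.
Proof. by move=> a0; rewrite /zcut; case: ifP. Qed.
Lemma zsum_sum n (c: 'I_n -> int -> \bar R): (forall i j, 0 <= c i j) ->
 zsum (fun j=> \sum_(i < n) c i j) = \sum_(i < n) zsum (c i).
Proof.
elim: n c=> [|n IH] c c0; first by rewrite big_ord0 -[RHS]zsum_eq0; apply: eq_zsum=> j; rewrite big_ord0.
rewrite big_ord_recr/= -IH// -zsumD//; last side.
by apply: eq_zsum=> j; rewrite big_ord_recr.
Qed.
Lemma zsum_zcut J a: (forall j, 0 <= a j) -> zsum (zcut J a) = \sum_(i < J + J) a (i%:Z - J%:Z)%R.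
Proof.
move=> a0; pose c (i: 'I_(J + J)) (j: int):= if (j == i%:Z - J%:Z)%R then a j else 0.
have c0 i j: 0 <= c i j by rewrite /c; case: ifP.
transitivity (zsum (fun j=> \sum_(i < J + J) c i j)).
 apply: eq_zsum=> j; rewrite /zcut; case: ifP=> [jJ|jJ]; last first.
  rewrite big1// => i _; rewrite /c; case: eqP=> // ji; move: jJ; have:= ltn_ord i; rewrite ji=> iJ.
  by move=> /negbT/negP[]; apply/andP; split; lia.
 have kJ: (`|(j + J%:Z)%R|%N < J + J)%N by lia.
 rewrite (bigD1 (Ordinal kJ))//= big1 ?adde0=> [|i /eqP ni]; rewrite /c.
  by case: eqP=> // /= h; exfalso; apply: h; lia.
 by case: eqP=> // ji; exfalso; apply: ni; apply/val_inj=> /=; lia.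
rewrite zsum_sum//; apply: eq_bigr=> i _.
rewrite (@zsum_single _ (i%:Z - J%:Z)%R) /c ?eqxx//.
by move=> j /negbTE ->.
Qed.
Lemma zcut_nondecreasing J K a j: (forall j, 0 <= a j) -> (J <= K)%N -> zcut J a j <= zcut K a j.
Proof.
move=> a0 JK; rewrite /zcut; case: ifP=> [/andP[h1 h2]|_]; last by case: ifP.
by rewrite ifT//; apply/andP; split; lia.
Qed.
Lemma zsum_cvg a: (forall j, 0 <= a j) -> zsum (zcut J a) @[J --> \oo] --> zsum a.
Proof.
move=> a0; have nd: {homo (fun J=> zsum (zcut J a)): J K/(J <= K)%N >-> J <= K}.
 by move=> J K JK; apply: le_zsum=> j; exact: zcut_nondecreasing.
suff -> : zsum a = ereal_sup (range (fun J=> zsum (zcut J a))) by exact: ereal_nondecreasing_cvgn.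
apply/eqP; rewrite eq_le; apply/andP; split; last first.
 by apply: ge_ereal_sup=> _ [J _ <-]; apply: le_zsum=> j; exact: zcut_le.
rewrite zsum_nat//; apply: lime_le; first by apply: is_cvg_nneseries=> *.
apply: nearW=> m; le_via (zsum (zcut m a)); last by apply: ereal_sup_ubound; exists m.
rewrite zsum_nat; last side.
apply: le_trans (nneseries_lim_ge m _); last side.
rewrite big_mkord [leRHS]big_mkord; apply: lee_sum=> k _; rewrite /zcut ifT//.
by have:= ltn_ord k; rewrite /zs; have:= odd_double_half k; case: (odd k)=> /= h1 h2; apply/andP; split; lia.
Qed.
Lemma poweR_cvg (u: nat -> \bar R) (l: \bar R) (e: R): (0 < e)%R -> (forall k, 0 <= u k) ->
 {homo u: m n/(m <= n)%N >-> m <= n} -> u @ \oo --> l -> (u k`^e) @[k --> \oo] --> l`^e.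
Proof.
move=> e0 u0 nd /cvg_lim=> /(_ (@ereal_hausdorff _)).
rewrite (cvg_lim _ (ereal_nondecreasing_cvgn nd))// => <-.
have nd': {homo (fun k=> u k`^e): m n/(m <= n)%N >-> m <= n}.
 by move=> m k mk; apply: le_poweR; [side|exact: u0|exact: nd].
suff -> : ereal_sup (range u)`^e = ereal_sup (range (fun k=> u k`^e)) by exact: ereal_nondecreasing_cvgn.
have s0: 0 <= ereal_sup (range u) by apply: le_trans (u0 0%N) _; apply: ereal_sup_ubound; exists 0%N.
have t0: 0 <= ereal_sup (range (fun k=> u k`^e)).
 by apply: le_trans (poweR_ge0 (u 0%N) e) _; apply: ereal_sup_ubound; exists 0%N.
apply/eqP; rewrite eq_le; apply/andP; split; last first.
 apply: ge_ereal_sup=> _ [k _ <-]; apply: le_poweR=> //; first side.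
 by apply: ereal_sup_ubound; exists k.
rewrite -[leRHS](@poweRVK _ e) ?gt_eqF//; apply: le_poweR=> //; first side.
apply: ge_ereal_sup=> _ [k _ <-]; rewrite -[leLHS](@poweRK _ e) ?gt_eqF//.
apply: le_poweR; rewrite ?invr_ge0 ?poweR_ge0 ?(ltW e0)//.
by apply: ereal_sup_ubound; exists k.
Qed.
Lemma integral_poweR_cvg {d} {T: measurableType d} (m: {measure set T -> \bar R}) (u: nat -> T -> \bar R)
  (f: T -> \bar R) (e: R) (M: \bar R): (0 < e)%R -> (forall k, mfun (u k)) ->
 (forall k x, 0 <= u k x) -> (forall x, {homo u ^~ x: m n/(m <= n)%N >-> m <= n}) ->
 (forall x, u k x @[k --> \oo] --> f x) -> (forall k, \int[m]_x (u k x`^e) <= M) ->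
 \int[m]_x (f x`^e) <= M.
Proof.
move=> e0 mu u0 nd uf IM.
have -> : \int[m]_x (f x`^e) = \int[m]_x limn (fun k=> u k x`^e).
 by apply: eq_integral=> x _; apply/esym/cvg_lim=> //; apply: poweR_cvg=> //; exact: nd.
have nd' x: {homo (fun k=> u k x`^e): m n/(m <= n)%N >-> m <= n}.
 by move=> j k jk; apply: le_poweR; [side|exact: u0|exact: nd].
rewrite (monotone_convergence m measurableT (g':= fun k x=> u k x`^e)); try side.
apply: lime_le; last exact: nearW.
apply: ereal_nondecreasing_is_cvgn=> j k jk; apply: ge0_le_integral=> //; try side.
by move=> x _; exact: nd'.
Qed.
(** Subadditivity of the e-th power, from z/s <= (z/s)^e for 0 <= z <= s; extended to infinite sums
    by monotone limits. *)
Lemma zsum_poweR_le1 a (e: R): (0 < e)%R -> (e <= 1)%R -> (forall j, 0 <= a j) ->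
 zsum a`^e <= zsum (fun j=> a j`^e).
Proof.
move=> e0 e1 a0.
have sub (x y: \bar R): 0 <= x -> 0 <= y -> (x + y)`^e <= x`^e + y`^e.
 move=> x0 y0; have [->|sn0]:= eqVneq (x + y) 0.
  by rewrite poweR0r ?gt_eqF// adde_ge0 ?poweR_ge0.
 case: x x0 sn0=> [x| |]//; case: y y0=> [y| |]//; last 3 first.
 - by move=> _ x0 _; rewrite addey// [X in _ + X]poweRyr ?gt_eqF// addey ?leey// gt_eqF// (lt_le_trans (ltNyr 0%R)) ?poweR_ge0.
 - by move=> y0 _ _; rewrite addye// [X in X + _]poweRyr ?gt_eqF// addye ?leey// gt_eqF// (lt_le_trans (ltNyr 0%R)) ?poweR_ge0.
 - by move=> *; rewrite /= ?addye// [X in X + _]poweRyr ?gt_eqF// addye ?leey// gt_eqF// (lt_le_trans (ltNyr 0%R)) ?poweR_ge0.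
 rewrite !lee_fin=> y0 x0; rewrite -EFinD eqe=> sn0.
 set s:= (x + y)%R; have s0: (0 < s)%R by rewrite lt_def sn0 addr_ge0.
 have key (z: R): (0 <= z)%R -> (z <= s)%R -> (z/s*s`^e <= z`^e)%R.
  move=> z0 zs; rewrite -[X in (_ <= X`^_)%R](divfK (negbT (gt_eqF s0)) z) powRM ?divr_ge0// ?(ltW s0)//.
  rewrite ler_wpM2r ?powR_ge0//; have [->|zn]:= eqVneq z 0%R; first by rewrite mul0r powR_ge0.
  have zs0: (0 < z/s)%R by rewrite divr_gt0// lt_def zn.
  rewrite -[leLHS]powRr1 ?(ltW zs0)//; apply: ger_powR=> //.
  by rewrite zs0/= ler_pdivrMr// mul1r.
 have:= lerD (key x x0 _) (key y y0 _); rewrite -mulrDl -mulrDl divff ?gt_eqF// mul1r.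
 by apply; rewrite /s ?lerDl ?lerDr.
rewrite zsum_nat// zsum_nat; last side.
have nd: {homo (fun n=> \sum_(0 <= i < n) a (zs i)): m n/(m <= n)%N >-> m <= n}.
 by apply: ereal_nondecreasing_series=> *.
have c: \sum_(0 <= i < n) a (zs i) @[n --> \oo] --> \sum_(k <oo) a (zs k).
 by apply: is_cvg_nneseries=> *.
have s0 k: 0 <= \sum_(0 <= i < k) a (zs i) by side.
have c':= poweR_cvg e0 s0 nd c.
rewrite -(cvg_lim _ c')//; apply: lime_le; first by apply/cvg_ex; eexists; exact: c'.
apply: nearW=> n.
apply: le_trans (nneseries_lim_ge n _); last side.
elim: n=> [|n IH]; first by rewrite !big_geq// poweR0r// gt_eqF.
rewrite !big_nat_recr//=; apply: (le_trans (sub _ _ (s0 n) (a0 _))).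
exact: leeD.
Qed.
Lemma jensen_zsum (w: int -> R) (h: int -> \bar R) (P: R): (1 <= P)%R ->
 (forall j, 0 <= w j)%R -> (forall j, 0 <= h j) ->
 zsum (fun j=> (w j)%:E*h j)`^P <= zsum (fun j=> (w j)%:E)`^(P - 1)*zsum (fun j=> (w j)%:E*h j`^P).
Proof.
move=> P1 w0 h0; rewrite !zsum_int//; try side.
by apply: (@jensen_ereal _ _ _ counting (fun k=> w (zs k)) (fun k=> h (zs k))).
Qed.
Lemma hoelder_zsum a b (p q: R): (0 < p)%R -> (0 < q)%R -> (p^-1 + q^-1 = 1)%R ->
 (forall j, 0 <= a j) -> (forall j, 0 <= b j) ->
 zsum (fun j=> a j*b j) <= zsum (fun j=> a j`^p)`^p^-1*zsum (fun j=> b j`^q)`^q^-1.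
Proof.
move=> p0 q0 pq a0 b0; rewrite !zsum_int//; try side.
by apply: (@hoelder_ereal _ _ _ counting (fun k=> a (zs k)) (fun k=> b (zs k))).
Qed.

Section integral.
Context {d} {T: measurableType d} (m: {measure set T -> \bar R}).
Lemma meas_zsum (a: int -> T -> \bar R): (forall j, mfun (a j)) ->
 (forall j x, 0 <= a j x) -> mfun (fun x=> zsum (a ^~ x)).
Proof.
move=> ma a0; apply: (eq_measurable_fun (fun x=> \sum_(k <oo) a (zs k) x)).
 by move=> x _; rewrite zsum_nat.
by apply: ge0_emeasurable_sum=> // k x _ _; exact: a0.
Qed.
Lemma integral_zsum (D: set T) (a: int -> T -> \bar R): measurable D -> (forall j, measurable_fun D (a j)) ->
 (forall j x, D x -> 0 <= a j x) -> \int[m]_(x in D) zsum (a ^~ x) = zsum (fun j=> \int[m]_(x in D) a j x).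
Proof.
move=> mD ma a0; rewrite zsum_nat; last side.
rewrite -integral_nneseries//; last by move=> k x; exact: a0.
by apply: eq_integral=> x /set_mem Dx; rewrite zsum_nat// => j; exact: a0.
Qed.
Lemma integral_zsum_le (a: int -> T -> \bar R) (e: R) (M: \bar R): (0 < e)%R ->
 (forall j, mfun (a j)) -> (forall j x, 0 <= a j x) ->
 (forall J, \int[m]_x (zsum (zcut J (a ^~ x))`^e) <= M) -> \int[m]_x (zsum (a ^~ x)`^e) <= M.
Proof.
move=> e0 ma a0; apply: integral_poweR_cvg=> //.
- move=> J; apply: (meas_zsum (a:= fun j x=> zcut J (a ^~ x) j))=> [j|j x]; last side.
 rewrite /zcut; case: (_ <= _ < _)%R; [exact: ma|side].
- by move=> J x; apply: zsum_ge0=> j; side.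
- by move=> x J K JK; apply: le_zsum=> j; exact: zcut_nondecreasing.
- by move=> x; exact: zsum_cvg.
Qed.

End integral.
End zsum.
Hint Resolve zsum_ge0 meas_zsum: side.

Section ereal_powers.
Context {R: realType}.
Implicit Types x y: \bar R.
Lemma poweRSr (e: R) x: (1 <= e)%R -> 0 <= x -> x`^e = x*x`^(e - 1).
Proof.
move=> e1 x0; have [->|en]:= eqVneq e 1%R; first by rewrite subrr poweRe0 mule1 poweRe1.
rewrite -{2}(poweRe1 x0) -poweRD ?[(1 + _)%R]addrC ?subrK//.
rewrite /poweRD_def; apply/implyP=> /eqP; lra.
Qed.
(** The convexity inequality for the e-th power, from Young's inequality applied to x and (x +
    y)^(e-1). *)
Lemma poweR_add_telescope (e: R) x y: (1 <= e)%R -> 0 <= x -> 0 <= y ->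
 (x + y)`^e <= x`^e + e%:E*(y*(x + y)`^(e - 1)).
Proof.
move=> e1 x0 y0; have e0: (0 < e)%R by exact: lt_le_trans e1.
have xy0: 0 <= x + y by rewrite adde_ge0.
have [->|en]:= eqVneq e 1%R; first by rewrite subrr poweRe0 mule1 mul1e !poweRe1.
have e1': (0 < e - 1)%R by rewrite subr_gt0 lt_def en.
case: y y0 xy0=> [y| |]//; last first.
 move=> _ _; rewrite addey; last by rewrite gt_eqF// (lt_le_trans (ltNyr 0%R)).
 rewrite poweRyr ?gt_eqF// poweRyr ?gt_eqF// mulyy gt0_muley ?lte_fin// addey ?leey//.
 by rewrite gt_eqF// (lt_le_trans (ltNyr 0%R)) ?poweR_ge0.
case: x x0=> [x| |]//; last first.
 move=> _ y0 _; rewrite [X in _ <= X + _]poweRyr ?gt_eqF//.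
 apply: (@le_trans _ _ +oo); first exact: leey.
 by rewrite leeDl// !mule_ge0 ?poweR_ge0// lee_fin ltW.
rewrite !lee_fin=> x0 y0 xy0.
change ((x + y)`^e <= x`^e + e*(y*(x + y)`^(e - 1)))%R.
pose e':= (e/(e - 1))%R.
have e'0: (0 < e')%R by side.
have ee: (e^-1 + e'^-1 = 1)%R by rewrite /e'; field; rewrite !gt_eqF.
have Y:= conjugate_powR x0 (powR_ge0 (x + y) (e - 1)) e0 e'0 ee.
have E1: (((x + y)`^(e - 1))`^e' = (x + y)`^e)%R.
 by rewrite -powRrM /e' mulrCA divff ?mulr1// gt_eqF.
have E2: ((x + y)`^e = x*(x + y)`^(e - 1) + y*(x + y)`^(e - 1))%R.
 rewrite -mulrDl; have:= @poweRSr e (x + y)%:E e1 xy0; rewrite !poweR_EFin -EFinM=> -[] //.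
rewrite E1 in Y; set Z:= ((x + y)`^e)%R in Y E2 *; set X:= (x`^e)%R in Y *.
set W:= (y*_)%R in E2 *.
have e'E: (Z/e' = Z - Z/e)%R by rewrite -[X in (_ = X - _)%R]mulr1 -ee; ring.
have: (Z/e <= X/e + W)%R by rewrite {}e'E in Y; lra.
by rewrite ler_pdivrMr// mulrDl divfK ?gt_eqF// [(W*e)%R]mulrC.
Qed.
(** Each term is paired with a power of the partial sum that ends at it. For averages ordered from
    wide to narrow this partial sum contains no narrower average, hence varies slowly at the scale
    of the term; this is what makes [sop_ek_star] work. *)
Lemma poweR_sum_telescope (e: R) m (a: nat -> \bar R): (1 <= e)%R -> (forall i, 0 <= a i) ->
 (\sum_(i < m) a i)`^e <= e%:E*\sum_(j < m) (a j*(\sum_(i < j.+1) a i)`^(e - 1)).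
Proof.
move=> e1 a0; have e0: (0 < e)%R by exact: lt_le_trans e1.
elim: m=> [|m IH]; first by rewrite !big_ord0 mule0 poweR0r// gt_eqF.
rewrite big_ord_recr [in leRHS]big_ord_recr ge0_muleDr//=; try side.
have s0: 0 <= \sum_(i < m) a i by side.
apply: (le_trans (poweR_add_telescope e1 s0 (a0 m))).
by rewrite [in leRHS]big_ord_recr/= leeD2r.
Qed.
Lemma poweR_sum_le (e: R) m: (0 < e)%R -> exists2 C: R, (0 <= C)%R & forall a: nat -> \bar R,
 (forall i, 0 <= a i) -> (\sum_(i < m) a i)`^e <= C%:E*\sum_(i < m) a i`^e.
Proof.
move=> e0; elim: m=> [|m [C C0 IH]].
 by exists 0%R=> // a a0; rewrite !big_ord0 mule0 poweR0r// gt_eqF.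
exists (2`^e*(C + 1))%R=> [|a a0]; first side.
rewrite !big_ord_recr/=; set x:= \sum_(i < m) a i; set y:= a m.
have x0: 0 <= x by side.
have y0: 0 <= y by exact: a0.
have s0: 0 <= \sum_(i < m) a i`^e by side.
have p2 (u v: \bar R): 0 <= u -> 0 <= v -> u <= v -> (u + v)`^e <= (2`^e)%:E * v`^e.
 move=> u0 v0 uv; rewrite -poweR_EFin -poweRM ?lee_fin//; apply: le_poweR; rewrite ?(ltW e0) ?adde_ge0//.
 by rewrite (_: 2%R = 1 + 1)%R// EFinD ge0_muleDl// !mul1e leeD2r.
have p3: (x + y)`^e <= (2`^e)%:E*(x`^e + y`^e).
 have [xy|/ltW yx]:= leP x y.
  apply: (le_trans (p2 _ _ x0 y0 xy)); apply: lee_wpmul2l; rewrite ?lee_fin ?powR_ge0//.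
  by rewrite leeDr// poweR_ge0.
 rewrite addeC; apply: (le_trans (p2 _ _ y0 x0 yx)); apply: lee_wpmul2l; rewrite ?lee_fin ?powR_ge0//.
 by rewrite leeDl// poweR_ge0.
apply: (le_trans p3); rewrite EFinM -muleA; apply: lee_wpmul2l; first side.
rewrite ge0_muleDr// ?poweR_ge0//; apply: leeD.
 apply: (le_trans (IH a a0)); apply: lee_wpmul2r=> //; by rewrite lee_fin lerDl.
by rewrite EFinD ge0_muleDl ?lee_fin// mul1e leeDr// mule_ge0 ?lee_fin ?poweR_ge0.
Qed.
(** Divides by x^(1 - 1/e), which is legitimate because x is known to be finite. *)
Lemma absorb_power (e K: R) (B x: \bar R): (1 < e)%R -> (0 <= K)%R -> 0 <= B -> 0 <= x -> x < +oo ->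
 x <= K%:E*B`^e^-1*x`^(1 - e^-1) -> x <= (K`^e)%:E*B.
Proof.
move=> e1 K0 B0 x0 xoo h; have e0: (0 < e)%R by exact: lt_trans e1.
have [->|xn]:= eqVneq x 0; first side.
have xp: 0 < x by rewrite lt0e xn.
case: x x0 xoo h xn xp=> [x| |]// x0 _ h xn xp.
have {}h: x%:E`^e^-1 <= K%:E*B`^e^-1.
 have z0: (0 < x`^(1 - e^-1))%R by side.
 rewrite -(@lee_pmul2r _ (x`^(1 - e^-1))%:E)// ?lte_fin//.
 apply: le_trans h; rewrite poweR_EFin -EFinM -powRD; last by rewrite xn implybT.
 by rewrite [(_ + (1 - _))%R]addrC subrK powRr1.
have:= le_poweR (ltW e0) (poweR_ge0 _ _) h.
by rewrite poweRVK ?gt_eqF// poweRM ?poweR_ge0// poweRVK ?gt_eqF.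
Qed.

End ereal_powers.

Section sop.
Context {R: realType} (n: nat) (k: 'rV[R]_n -> R).
Hypothesis mk: mfun k.
Hypothesis k0: forall x, (0 <= k x)%R.
Implicit Types f g: 'rV[R]_n -> \bar R.

Definition sop f x:= \int[mu n]_y ((k (x - y))%:E*f y).
Lemma sop_ge0 f x: (forall y, 0 <= f y) -> 0 <= sop f x.
Proof. by move=> f0; apply: integral_ge0=> y _; rewrite mule_ge0 ?lee_fin. Qed.
Lemma meas_kernelE x: mfun (fun y: 'rV[R]_n=> (k (x - y))%:E).
Proof.
apply/mEFinP; apply: (mcomp mk).
by apply: meas_subV; [side|side].
Qed.
Hint Resolve meas_kernelE: side.
Lemma meas_kernel2: mfun (fun z: 'rV[R]_n*'rV[R]_n=> (k (z.1 - z.2))%:E).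
Proof.
apply/mEFinP; apply: (mcomp mk).
by apply: meas_subV; [side|side].
Qed.
Lemma le_sop f g x: mfun f -> mfun g -> (forall y, 0 <= f y) ->
 (forall y, f y <= g y) -> sop f x <= sop g x.
Proof.
move=> mf mg f0 fg; have mK:= meas_kernelE x; apply: ge0_le_integral=> //; try side.
by move=> y _; apply: lee_wpmul2l; rewrite ?lee_fin.
Qed.
Lemma meas_sop_prod f: mfun f ->
 mfun (fun z: 'rV[R]_n*'rV[R]_n=> (k (z.1 - z.2))%:E*f z.2).
Proof.
move=> mf; apply: emeasurable_funM; first exact: meas_kernel2.
side.
Qed.
Hint Resolve meas_sop_prod: side.
Lemma meas_sop f: mfun f -> (forall y, 0 <= f y) -> mfun (sop f).
Proof.
move=> mf f0; apply: (@measurable_fun_fubini_tonelli_F _ _ _ _ _ (mu n)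
 (fun z: 'rV[R]_n*'rV[R]_n=> (k (z.1 - z.2))%:E*f z.2)).
 exact: meas_sop_prod.
side.
Qed.
Hint Resolve meas_sop: side.
Lemma sop_cst x: \int[mu n]_y (k (x - y))%:E = \int[mu n]_y (k y)%:E.
Proof.
have mK: mfun (fun y=> (k y)%:E) by side.
rewrite -[RHS]integral_muN// -[RHS](integral_mu_shift (- x)).
 by apply: eq_integral=> y _; rewrite opprB.
by apply: (mcomp mK); apply: meas_oppV.
Qed.
Lemma sop_cst' y: \int[mu n]_x (k (x - y))%:E = \int[mu n]_x (k x)%:E.
Proof. by rewrite (integral_mu_shift (- y) (f:= fun x=> (k x)%:E))//; apply/mEFinP. Qed.
Lemma sop_poweR f x (P: R): (1 <= P)%R -> mfun f -> (forall y, 0 <= f y) ->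
 sop f x`^P <= (\int[mu n]_y (k y)%:E)`^(P - 1)*sop (fun y=> f y`^P) x.
Proof.
move=> P1 mf f0; rewrite -(sop_cst x).
have /mEFinP mK:= meas_kernelE x.
by apply: (@jensen_ereal _ _ _ (mu n) (fun y: 'rV[R]_n=> k (x - y)) f).
Qed.
Lemma sop_adjoint f g: mfun f -> mfun g -> (forall y, 0 <= f y) ->
 (forall y, 0 <= g y) -> (forall y, k (- y) = k y) ->
 \int[mu n]_x (sop f x * g x) = \int[mu n]_x (f x*sop g x).
Proof.
move=> mf mg f0 g0 ks; rewrite /sop.
transitivity (\int[mu n]_x \int[mu n]_y ((k (x - y))%:E*f y * g x)).
 apply: eq_integral=> x _; rewrite ge0_integralZr//; last side.
 by apply: emeasurable_funM=> //; exact: meas_kernelE.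
rewrite (@fubini_tonelli _ _ _ _ _ (mu n) (mu n) (fun z: 'rV[R]_n*'rV[R]_n=> (k (z.1 - z.2))%:E*f z.2 * g z.1)); try side; last first.
- apply: emeasurable_funM; first exact: meas_sop_prod.
 side.
apply: eq_integral=> y _ /=; rewrite -ge0_integralZl//; try side; last first.
- by apply: emeasurable_funM=> //; exact: meas_kernelE.
by apply: eq_integral=> x _; rewrite -(opprB y x) ks muleA (muleC (f y)).
Qed.
Lemma integral_sop f: mfun f -> (forall y, 0 <= f y) ->
 \int[mu n]_x sop f x = (\int[mu n]_y (k y)%:E)*\int[mu n]_y f y.
Proof.
move=> mf f0; rewrite /sop (@fubini_tonelli _ _ _ _ _ (mu n) (mu n) (fun z: 'rV[R]_n*'rV[R]_n=> (k (z.1 - z.2))%:E*f z.2)); try side; last first.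
- exact: meas_sop_prod.
rewrite -ge0_integralZl//; last side.
apply: eq_integral=> y _ /=; rewrite -(sop_cst' y) ge0_integralZr//; try side.
apply/mEFinP; apply: (mcomp mk).
by apply: meas_subV; [side|side].
Qed.
Lemma integral_sop_poweR f (P: R): (1 <= P)%R -> mfun f -> (forall y, 0 <= f y) ->
 \int[mu n]_x (sop f x`^P) <= (\int[mu n]_y (k y)%:E)`^P*\int[mu n]_y (f y`^P).
Proof.
move=> P1 mf f0; have P0: (0 < P)%R by exact: lt_le_trans P1.
have I0: 0 <= \int[mu n]_y (k y)%:E by side.
have mfP: mfun (fun y=> f y`^P) by side.
have fP0 y: 0 <= f y`^P by side.
le_via (\int[mu n]_x ((\int[mu n]_y (k y)%:E)`^(P - 1)*sop (fun y=> f y`^P) x)).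
 apply: ge0_le_integral=> //; try side.
 - by apply: (mcomp (measurable_poweR P)); exact: meas_sop.
 - by apply: measurable_funeM; exact: meas_sop.
 - by move=> x _; exact: sop_poweR.
rewrite ge0_integralZl//; try side; last 2 first.
- exact: meas_sop.
- by move=> x _; exact: sop_ge0.
by rewrite integral_sop// muleA (poweRSr P1 I0) (muleC (_`^(P - 1))).
Qed.

End sop.
Hint Resolve sop_ge0 meas_kernelE meas_kernel2 meas_sop_prod meas_sop: side.

(** * Sums of averages against exponential kernels *)

Section exponential_kernel.
Context {R: realType} (n: nat).
Implicit Types x y: 'rV[R]_n.

Definition l1 x: R:= \sum_(i < n) `|x ord0 i|.
Lemma l1_ge0 x: (0 <= l1 x)%R.
Proof. by apply: sumr_ge0. Qed.
Hint Resolve l1_ge0: side.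
Lemma l1D x y: (l1 (x + y) <= l1 x + l1 y)%R.
Proof. by rewrite /l1 -big_split; apply: ler_sum=> i _; rewrite mxE ler_normD. Qed.
Lemma l1N x: l1 (- x) = l1 x.
Proof. by apply: eq_bigr=> i _; rewrite mxE normrN. Qed.
Lemma l1Z (c: R) x: (0 <= c)%R -> l1 (c *: x) = (c * l1 x)%R.
Proof. by move=> c0; rewrite /l1 mulr_sumr; apply: eq_bigr=> i _; rewrite mxE normrM ger0_norm. Qed.
Lemma meas_l1: mfun l1.
Proof.
apply: measurable_sum=> i; apply: (mcomp (@normr_measurable R setT)).
exact: meas_coord.
Qed.
Hint Resolve meas_l1: side.

(** A bump of width 1/r whose integral does not depend on r. The exponential profile is chosen for
    its Harnack property: translation by h changes it by a factor of at most e^(r |h|), so its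
    averages vary slowly. *)
Definition ek (r: R) x: R:= (r^+n*expR (- (r * l1 x)))%R.
Lemma ek_ge0 r x: (0 <= r)%R -> (0 <= ek r x)%R.
Proof. by move=> r0; rewrite mulr_ge0 ?exprn_ge0 ?expR_ge0. Qed.
Hint Resolve ek_ge0: side.
Lemma ekN r x: ek r (- x) = ek r x.
Proof. by rewrite /ek l1N. Qed.
Lemma meas_ek r: mfun (ek r).
Proof.
apply: measurable_funM; first side.
apply: (mcomp (@measurable_expR R)); apply: mcomp=> //.
by apply: measurable_funM; [side|exact: meas_l1].
Qed.
Hint Resolve meas_ek: side.

Definition ekI: \bar R:= \int[mu n]_x (expR (- l1 x))%:E.
Lemma integral_ek r: (0 < r)%R -> \int[mu n]_x (ek r x)%:E = ekI.
Proof.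
move=> r0; have mE: mfun (fun x: 'rV[R]_n=> (expR (- l1 x))%:E).
 apply/mEFinP; apply: (mcomp (@measurable_expR R)); apply: mcomp=> //.
 exact: meas_l1.
have E0 x: 0 <= (expR (- l1 x))%:E by side.
have -> : ekI = (r^+n)%:E*\int[mu n]_x (expR (- l1 (r *: x)))%:E.
 rewrite (ge0_integral_mu_scale r0 mE E0) muleA -EFinM divff ?mul1e// expf_neq0// gt_eqF//.
rewrite -ge0_integralZl; last 4 first.
- side.
- apply/mEFinP; apply: (mcomp (@measurable_expR R)); apply: mcomp=> //.
 apply: (mcomp meas_l1); apply: meas_scaleV; [side|side].
- side.
- side.
by apply: eq_integral=> x _; rewrite /ek l1Z ?(ltW r0).
Qed.
Lemma integral_expR_abs: \int[@lebesgue_measure R]_u (expR (- `|u|))%:E < +oo.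
Proof.
pose h:= fun u: R=> (exponential_pdf 1 u)%:E: \bar R.
have mh: measurable_fun [set: R] h by apply/mEFinP; exact: measurable_exponential_pdf.
have h0 u: 0 <= h u by rewrite lee_fin exponential_pdf_ge0.
apply: (@le_lt_trans _ _ (\int[@lebesgue_measure R]_u (h u + h (- u)%R))).
 apply: ge0_le_integral=> //.
 - apply/mEFinP; apply: (mcomp (@measurable_expR R)); apply: mcomp=> //.
 - by apply: emeasurable_funD=> //; apply: (mcomp mh).
 - move=> u _; have [u0|u0]:= leP 0%R u.
   le_via (h u); last by rewrite leeDl.
   by rewrite lee_fin /exponential_pdf patchE mem_set/= ?in_itv/= ?u0// mulN1r mul1r ger0_norm.
  le_via (h (- u)%R); last by rewrite leeDr.
  by rewrite lee_fin /exponential_pdf patchE mem_set/= ?in_itv/= ?oppr_ge0 ?(ltW u0)// mulN1r mul1r ltr0_norm.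
rewrite ge0_integralD//; last by apply: (mcomp mh).
by rewrite (ge0_integralN mh h0) integral_exponential_pdf// -EFinD ltry.
Qed.
Lemma ekI_ge0: 0 <= ekI.
Proof. by apply: integral_ge0=> x _; rewrite lee_fin expR_ge0. Qed.
Hint Resolve ekI_ge0: side.
Lemma ekI_lty: ekI < +oo.
Proof.
rewrite /ekI; under eq_integral do rewrite /l1 -sumrN expR_sum.
rewrite (@ge0_integral_prod_coord _ n (fun _ u=> expR (- `|u|)%R)); try side.
- rewrite -ge0_fin_numE; last side.
 elim/big_ind: _=> // [x y|i _]; first exact: fin_numM.
 rewrite ge0_fin_numE; first exact: integral_expR_abs.
 side.
- by move=> _; apply: (mcomp (@measurable_expR R)); apply: mcomp.
Qed.

Local Notation S:= (fun r=> sop (ek r)).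
Lemma ek_shift (r r': R) x y w: (0 <= r)%R -> (r <= r')%R ->
 (ek r (y - w) <= expR (r' * l1 (x - y))*ek r (x - w))%R.
Proof.
move=> r0 rr; rewrite /ek mulrCA; apply: ler_wpM2l; first side.
rewrite -expRD ler_expR.
have h: (l1 (x - w) <= l1 (x - y) + l1 (y - w))%R by rewrite (_: x - w = (x - y) + (y - w))%R ?l1D// addrA subrK.
have:= ler_wpM2l r0 h; have:= ler_wpM2r (l1_ge0 (x - y)) rr; lra.
Qed.
Lemma sop_ek_slow (r r': R) (u: 'rV[R]_n -> \bar R) x y: (0 <= r)%R -> (r <= r')%R ->
 mfun u -> (forall x, 0 <= u x) ->
 sop (ek r) u y <= (expR (r' * l1 (x - y)))%:E*sop (ek r) u x.
Proof.
move=> r0 rr mu0 u0; rewrite /sop -ge0_integralZl; try side; last 2 first.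
- by apply: emeasurable_funM=> //; apply: meas_kernelE; side.
- by move=> w _; rewrite mule_ge0 ?lee_fin ?ek_ge0.
apply: ge0_le_integral=> //.
- by move=> w _; rewrite mule_ge0 ?lee_fin ?ek_ge0.
- by apply: emeasurable_funM=> //; apply: meas_kernelE; side.
- by apply: measurable_funeM; apply: emeasurable_funM=> //; apply: meas_kernelE; side.
- by move=> w _; rewrite muleA -EFinM; apply: lee_wpmul2r=> //; rewrite lee_fin ek_shift.
Qed.
(** Moves the average onto the slowly varying factor. The power of [Y] grows by at most e^(r |x -
    y|/2), so half the decay of the kernel survives; what remains is 2^n times a kernel of width
    2/r, of mass 2^n [ekI]. *)
Lemma slow_test (r c e: R) (u Y: 'rV[R]_n -> \bar R): (0 < r)%R -> (1 <= e)%R -> (c*(e - 1) <= 2^-1)%R ->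
 mfun u -> (forall x, 0 <= u x) -> mfun Y -> (forall x, 0 <= Y x) ->
 (forall x y, Y y <= (expR (c*r * l1 (x - y)))%:E*Y x) ->
 \int[mu n]_x (sop (ek r) u x*Y x`^(e - 1)) <= (2^+n)%:E*ekI*\int[mu n]_x (u x*Y x`^(e - 1)).
Proof.
move=> r0 e1 ce mu0 u0 mY Y0 slow; have e10: (0 <= e - 1)%R by side.
have mYe: mfun (fun x=> Y x`^(e - 1)) by side.
have rh: (0 < r/2)%R by side.
have k0 x: (0 <= ek r x)%R by side.
rewrite sop_adjoint//; try side; last first.
- by move=> x; exact: ekN.
rewrite -ge0_integralZl; try side.
apply: ge0_le_integral=> //; try side.
- by move=> x _; rewrite mule_ge0// sop_ge0=> [//|y|y]; rewrite ?ek_ge0 ?(ltW r0)// poweR_ge0.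
- apply: emeasurable_funM=> //; apply: meas_sop=> //; first side.
 side.
move=> x _; rewrite muleCA; apply: lee_wpmul2l=> //.
rewrite -(integral_ek rh) -(sop_cst (k:= ek (r/2)) (meas_ek _) x).
have mk2: mfun (fun y: 'rV[R]_n=> (ek (r/2) (x - y))%:E).
 side.
have k20 y: 0 <= (ek (r/2) (x - y))%:E by rewrite lee_fin ek_ge0// ltW.
rewrite -ge0_integralZl ?lee_fin ?exprn_ge0//.
rewrite -ge0_integralZr//; try side.
apply: ge0_le_integral=> //; try side.
- by apply: emeasurable_funM=> //; apply: meas_kernelE; side.
move=> y _; have:= le_poweR e10 (Y0 y) (slow x y).
rewrite poweRM ?lee_fin ?expR_ge0// poweR_EFin=> h.
le_via ((ek r (x - y))%:E*((expR (c*r * l1 (x - y))`^(e - 1))%:E*Y x`^(e - 1))).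
 by apply: lee_wpmul2l=> //; rewrite lee_fin ek_ge0// ltW.
rewrite muleA -EFinM; apply: lee_wpmul2r; first side.
rewrite -EFinM lee_fin /ek -expRM expr_div_n.
have l0:= l1_ge0 (x - y); set l:= l1 _ in l0 *.
rewrite [leRHS](_: _ = r^+n*expR (- (r/2 * l)))%R; last by field; rewrite expf_neq0.
rewrite -[leLHS]mulrA; apply: ler_wpM2l; first side.
rewrite -expRD ler_expR.
have:= ler_wpM2r (mulr_ge0 (ltW r0) l0) ce; lra.
Qed.
Lemma sop_ek_widen (c r: R) (u: 'rV[R]_n -> \bar R) x: (0 < c)%R -> (c <= 1)%R -> (0 < r)%R ->
 mfun u -> (forall x, 0 <= u x) ->
 sop (ek r) u x <= (c ^- n)%:E*sop (ek (c*r)) u x.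
Proof.
move=> c0 c1 r0 mu0 u0; have cr: (0 < c*r)%R by side.
have mK r': mfun (fun y: 'rV[R]_n=> (ek r' (x - y))%:E).
 side.
rewrite /sop -ge0_integralZl; try side; last first.
- by move=> w _; rewrite mule_ge0 ?lee_fin ?ek_ge0// ltW.
apply: ge0_le_integral=> //; try side.
- by move=> w _; rewrite mule_ge0 ?lee_fin ?ek_ge0// ltW.
move=> w _; rewrite muleA -EFinM; apply: lee_wpmul2r=> //; rewrite lee_fin /ek exprMn !mulrA.
rewrite mulVf ?mul1r ?expf_neq0 ?gt_eqF//; apply: ler_wpM2l; first side.
rewrite ler_expR lerN2 -mulrA; apply: ler_piMl=> //; by rewrite mulr_ge0 ?l1_ge0// ltW.
Qed.
(** For e > 1, [poweR_sum_telescope] pairs the j-th average with a power of the sum of the averages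
    at least as wide. Once widened by 1/c, that sum is slow enough for [slow_test]. Hoelder's
    inequality then bounds [A r] by B^(1/e) (A (c r))^(1 - 1/e), and absorption finishes. Neither
    the number of terms nor the starting scale enters the constant. *)
Lemma sop_ek_star (e: R): (1 <= e)%R -> exists2 C: R, (0 <= C)%R &
 forall (z: R) m (u: nat -> 'rV[R]_n -> \bar R), (0 < z)%R ->
  (forall i, mfun (u i)) -> (forall i x, 0 <= u i x) ->
  \int[mu n]_x ((\sum_(i < m) sop (ek (z*2^+i)) (u i) x)`^e) <=
  C%:E*\int[mu n]_x ((\sum_(i < m) u i x)`^e).
Proof.
move=> e1; have e0: (0 < e)%R by exact: lt_le_trans e1.
have If: ekI \is a fin_num by rewrite ge0_fin_numE ?ekI_lty ?ekI_ge0.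
have ek0' r x: (0 < r)%R -> (0 <= ek r x)%R by side.
have zp (z: R) i: (0 < z)%R -> (0 < z*2^+i)%R by side.
have [->|en]:= eqVneq e 1%R.
 exists (fine ekI)=> [|z m u z0 mu0 u0]; first side.
 have s0 i x: 0 <= sop (ek (z*2^+i)) (u i) x by side.
 rewrite (eq_integral (fun x=> \sum_(i < m) sop (ek (z*2^+i)) (u i) x)); last first.
  by move=> x _; rewrite poweRe1// sume_ge0.
 rewrite [in leRHS](eq_integral (fun x=> \sum_(i < m) u i x)); last first.
  by move=> x _; rewrite poweRe1// sume_ge0.
 rewrite !ge0_integral_sum//; last first.
  by move=> i; apply: meas_sop=> //; [side|move=> y; rewrite ek0'// zp].
 rewrite ge0_sume_distrr//; last side.
 apply: lee_sum=> i _; rewrite integral_sop//; try side.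
 by rewrite integral_ek ?zp// fineK.
have {}e1': (1 < e)%R by rewrite lt_def en.
pose c:= ((2*e)^-1)%R.
have c0: (0 < c)%R by side.
have ce: (c*(e - 1) <= 2^-1)%R by rewrite /c invfM -mulrA ler_piMr ?invr_ge0// ler_pdivrMl// mulr1; lra.
have c1: (c <= 1)%R by rewrite /c invf_le1 ?mulr_gt0//; lra.
pose K:= (e*((c ^- n)`^(e - 1)*(2^+n*fine ekI)))%R.
have K0: (0 <= K)%R by side.
exists (K`^e)%R=> [|z m u z0 mu0 u0]; first side.
pose X (r: R) j (x: 'rV[R]_n):= \sum_(i < j) sop (ek (r*2^+i)) (u i) x.
have mS r i: (0 < r)%R -> mfun (sop (ek (r*2^+i)) (u i)).
 side.
have S0 r i x: (0 < r)%R -> 0 <= sop (ek (r*2^+i)) (u i) x.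
 side.
have X0 r j x: (0 < r)%R -> 0 <= X r j x by side.
have mX r j: (0 < r)%R -> mfun (X r j) by move=> r0; apply: emeasurable_sum=> i; exact: mS.
set B:= \int[mu n]_x ((\sum_(i < m) u i x)`^e).
have B0: 0 <= B by side.
have U0 x: 0 <= \sum_(i < m) u i x by side.
have mU: mfun (fun x=> \sum_(i < m) u i x) by exact: emeasurable_sum.
have mP (g: 'rV[R]_n -> \bar R) (p: R): mfun g -> mfun (fun x=> g x`^p).
 side.
pose A (r: R):= \int[mu n]_x (X r m x`^e).
have A0 r: 0 <= A r by side.
have e10: (0 <= e - 1)%R by side.
have step r: (0 < r)%R -> A r <= K%:E*B`^e^-1*(A (c*r)%R)`^(1 - e^-1).
 move=> r0; have cr0: (0 < c*r)%R by side.
 le_via (\int[mu n]_x (e%:E*\sum_(j < m)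
   (sop (ek (r*2^+j)) (u j) x*(((c ^- n)`^(e - 1))%:E*X (c*r)%R j.+1 x`^(e - 1))))).
  apply: ge0_le_integral=> //; try side.
  - apply: measurable_funeM; apply: emeasurable_sum=> j; apply: emeasurable_funM; first exact: mS.
   side.
  move=> x _.
  apply: (le_trans (@poweR_sum_telescope _ e m (fun i=> sop (ek (r*2^+i)) (u i) x) e1 _)).
   by move=> i; exact: S0.
  apply: lee_wpmul2l; first side.
  apply: lee_sum=> j _; apply: lee_wpmul2l; first exact: S0.
  rewrite -poweR_EFin -poweRM ?X0 ?lee_fin ?invr_ge0 ?exprn_ge0 ?(ltW c0)//.
  apply: le_poweR=> //; first side.
  rewrite ge0_sume_distrr; last by move=> i _; exact: S0.
  by apply: lee_sum=> i _; rewrite -mulrA; apply: sop_ek_widen=> //; exact: zp.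
 rewrite ge0_integralZl//; try side; last first.
 - apply: emeasurable_sum=> j; apply: emeasurable_funM; first exact: mS.
  side.
 rewrite ge0_integral_sum//; last 2 first.
 - move=> j; apply: emeasurable_funM; first exact: mS.
  side.
 - side.
 le_via (e%:E*\sum_(j < m) (((c ^- n)`^(e - 1)*(2^+n*fine ekI))%:E *
   \int[mu n]_x (u j x*X (c*r)%R m x`^(e - 1)))).
  apply: lee_wpmul2l; first side.
  apply: lee_sum=> j _.
  under eq_integral do rewrite muleCA.
  rewrite ge0_integralZl//; try side.
  rewrite EFinM -muleA; apply: lee_wpmul2l; first side.
  apply: (le_trans (@slow_test (r*2^+j) c e (u j) (X (c*r)%R j.+1) _ e1 ce (mu0 j) (u0 j) _ _ _)); try side.
  - move=> x y; rewrite /X ge0_sume_distrr; last by move=> i _; exact: S0.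
   apply: lee_sum=> i _; rewrite mulrA; apply: sop_ek_slow=> //; first side.
   rewrite ler_wpM2l ?(ltW cr0)//; rewrite ler_eXn2l ?ltr1n// -ltnS; exact: ltn_ord.
  rewrite [in leRHS]EFinM fineK//; apply: lee_wpmul2l; first by rewrite mule_ge0 ?ekI_ge0 ?lee_fin ?exprn_ge0.
  apply: ge0_le_integral=> //; try side.
  move=> x _; apply: lee_wpmul2l=> //; apply: le_poweR=> //; first exact: X0.
  rewrite /X; have:= ltn_ord j; rewrite -(big_mkord xpredT (fun i=> sop (ek (c*r*2^+i)) (u i) x)).
  rewrite -(big_mkord xpredT (fun i=> sop (ek (c*r*2^+i)) (u i) x))=> jm.
  rewrite [leRHS](big_cat_nat (n:= j.+1))//= leeDl//; apply: sume_ge0=> i _; exact: S0.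
 rewrite -ge0_sume_distrr; last side.
 rewrite -ge0_integral_sum//; try side.
 rewrite muleA -EFinM -/K -muleA; apply: lee_wpmul2l; first side.
 pose q:= (e/(e - 1))%R.
 have e1p: (0 < e - 1)%R by side.
 have q0: (0 < q)%R by side.
 have eq1: (e^-1 + q^-1 = 1)%R by rewrite /q; field; rewrite !gt_eqF.
 have h:= @hoelder_ereal _ _ _ (mu n) (fun x=> \sum_(i < m) u i x) (fun x=> X (c*r)%R m x`^(e - 1)) e q
  e0 q0 eq1 mU (mP _ _ (mX _ _ cr0)) U0 (fun x=> poweR_ge0 _ _).
 apply: (le_trans _ (le_trans h _)).
  apply: le_of_eq; apply: eq_integral=> x _.
  by rewrite ge0_sume_distrl.
 apply: lee_wpmul2l; first side.
 rewrite (_: q^-1 = 1 - e^-1)%R; last by rewrite -eq1 addrAC subrr add0r.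
 apply: le_of_eq; congr (_`^_); apply: eq_integral=> x _.
 by rewrite -poweRrM /q mulrCA divff ?mulr1// gt_eqF.
have [->|Bf]:= eqVneq B +oo.
 have [K00|Kn]:= eqVneq K 0%R; last first.
  by rewrite gt0_muley ?leey// lte_fin powR_gt0// lt_def Kn.
 by apply: (le_trans (step z z0)); rewrite K00 !mul0e powR0 ?gt_eqF// mul0e.
have [C C0 hC]:= @poweR_sum_le R e m e0.
have Afin r: (0 < r)%R -> A r <= C%:E*\sum_(i < m) ((fine ekI`^e)%:E*B).
 move=> r0; le_via (\int[mu n]_x (C%:E*\sum_(i < m) sop (ek (r*2^+i)) (u i) x`^e)).
  apply: ge0_le_integral=> //; try side.
  - by apply: measurable_funeM; apply: emeasurable_sum=> j; apply: mP; exact: mS.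
  - by move=> x _; apply: (hC (fun i=> sop (ek (r*2^+i)) (u i) x))=> i; exact: S0.
 rewrite ge0_integralZl//; try side; last first.
 - by apply: emeasurable_sum=> j; apply: mP; exact: mS.
 apply: lee_wpmul2l=> //; rewrite ge0_integral_sum//; try side.
 apply: lee_sum=> i _.
 apply: (le_trans (integral_sop_poweR (meas_ek _) _ e1 (mu0 i) (u0 i))); first by move=> y; rewrite ek0'// zp.
 rewrite integral_ek ?zp// -poweR_EFin fineK//; apply: lee_wpmul2l; first side.
 apply: ge0_le_integral=> //; try side.
 move=> x _; apply: le_poweR=> //; first side.
 by rewrite (bigD1 i)//= leeDl// sume_ge0.
(* Each step replaces r by c r, so the absorption is performed on the supremum over all r > 0. It is
   finite because the bound [Afin], though dependent on m, does not depend on r. *)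
pose As:= ereal_sup [set A r | r in [set r: R | (0 < r)%R]].
have As0: 0 <= As by apply: le_trans (A0 z) _; apply: ereal_sup_ubound; exists z.
have Bfin: B \is a fin_num by rewrite ge0_fin_numE// ltey.
have Asf: As < +oo.
 apply: (@le_lt_trans _ _ (C%:E*\sum_(i < m) ((fine ekI`^e)%:E*B))).
  by apply: ge_ereal_sup=> _ [r r0 <-]; exact: Afin.
 by rewrite -(fineK Bfin); under eq_bigr do rewrite -EFinM; rewrite sumEFin -EFinM ltry.
le_via As; first by apply: ereal_sup_ubound; exists z.
apply: absorb_power=> //.
apply: ge_ereal_sup=> _ [r r0 <-]; apply: (le_trans (step r r0)).
apply: lee_wpmul2l; first side.
apply: le_poweR=> //; first by rewrite subr_ge0 invf_le1.
by apply: ereal_sup_ubound; exists (c*r)%R=> //=; rewrite mulr_gt0.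
Qed.

End exponential_kernel.
Hint Resolve l1_ge0 meas_l1 ek_ge0 meas_ek ekI_ge0: side.

(** * Sums of averages against polynomially decaying kernels *)

Section polynomial_kernel.
Context {R: realType} (n: nat).
Implicit Types x y: 'rV[R]_n.
Lemma nuE x: nu x = (1 + l1 x)%R. Proof. by []. Qed.
Lemma meas_nu: mfun (@nu R n).
Proof. by apply: measurable_funD; [side|exact: meas_l1]. Qed.

(** A bump of width 1/r whose integral does not depend on r. Decay of order n + 1 is enough for
    integrability and leaves one spare power, which makes the superposition [eta_le_ek] summable. *)
Definition eta (r: R) x: R:= (r^+n*(nu (r *: x)) ^- n.+1)%R.
Lemma eta_ge0 r x: (0 < r)%R -> (0 <= eta r x)%R.
Proof. by move=> r0; rewrite mulr_ge0 ?invr_ge0 ?exprn_ge0 ?(ltW r0)// ltW// nu_gt0. Qed.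
Hint Resolve eta_ge0: side.
Lemma etaN r x: eta r (- x) = eta r x.
Proof. by rewrite /eta scalerN !nuE l1N. Qed.
Lemma meas_nuV N (r: R): mfun (fun x: 'rV[R]_n=> (nu (r *: x)) ^- N)%R.
Proof.
have -> : (fun x: 'rV[R]_n=> (nu (r *: x)) ^- N)%R = (fun x: 'rV[R]_n=> (nu (r *: x))`^(- N%:R))%R.
 by apply/funext=> x; rewrite powRN powR_mulrn// ltW// nu_gt0.
apply: (mcomp (measurable_powR _)); apply: (mcomp meas_nu).
by apply: meas_scaleV; [side|side].
Qed.
Lemma meas_eta r: mfun (eta r).
Proof. by apply: measurable_funM; [side|exact: meas_nuV]. Qed.
Hint Resolve meas_eta: side.
Lemma nneseries_geometric_lty (z: R): (0 <= z)%R -> (z < 1)%R -> \sum_(k <oo) (z^+k)%:E < +oo.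
Proof.
move=> z0 z1; apply: (@le_lt_trans _ _ ((1 - z)^-1)%:E); last exact: ltry.
apply: lime_le; first by apply: is_cvg_nneseries=> k _ _; rewrite lee_fin exprn_ge0.
apply: nearW=> m; rewrite sumEFin lee_fin big_mkord; have z1': (0 < 1 - z)%R by side.
rewrite -[leRHS]mul1r ler_pdivlMr//; have:= subrX1 z m; rewrite -opprB -[(z - 1)%R]opprB mulNr=> /oppr_inj.
by rewrite mulrC=> <-; rewrite gerBl exprn_ge0.
Qed.

Definition dy (k: nat): R:= (2^-1^+k)%R.
Lemma dy_gt0 k: (0 < dy k)%R. Proof. by rewrite exprn_gt0// invr_gt0. Qed.
Hint Resolve dy_gt0: side.
(** At each point one term dominates: the least k with nu (r x) <= 2^k, where the exponential is
    still of order one. The n + 1 powers of 2^-k split into n for the normalization of the wider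
    kernel and one for the weight [dy k]. *)
Lemma eta_le_ek: exists2 C: R, (0 < C)%R &
 forall r x, (0 < r)%R -> (eta r x)%:E <= C%:E*\sum_(k <oo) (dy k)%:E*(ek (dy k*r) x)%:E.
Proof.
exists (expR 1*2^+n.+1)%R=> [|r x r0]; first side.
have [k hk]: exists k, (nu (r *: x) <= 2^+k)%R.
 exists (Num.bound (nu (r *: x))); apply/ltW/(lt_le_trans (archi_boundP _)); first exact/ltW/nu_gt0.
 by rewrite -natrX ler_nat ltnW// ltn_expl.
have {k hk} [k hk kmin]: exists2 k, (nu (r *: x) <= 2^+k)%R & forall j, (nu (r *: x) <= 2^+j)%R -> (k <= j)%N.
 have ex: exists k, (fun k=> nu (r *: x) <= 2^+k)%R k by exists k.
 by exists (ex_minn ex); case: ex_minnP.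
have T0 j: 0 <= (dy j)%:E*(ek (dy j*r) x)%:E.
 by rewrite mule_ge0 ?lee_fin ?ek_ge0 ?mulr_ge0 ?(ltW r0)// ltW// dy_gt0.
le_via ((expR 1*2^+n.+1)%:E*((dy k)%:E*(ek (dy k*r) x)%:E)); last first.
 apply: lee_wpmul2l; first side.
 apply: le_trans (nneseries_lim_ge k.+1 _)=> //.
 by rewrite big_nat_recr//= leeDr// sume_ge0.
rewrite -!EFinM lee_fin /eta /ek exprMn.
have l0:= l1_ge0 x.
have hl: (1 <= expR 1*expR (- (dy k*r * l1 x)))%R.
 rewrite -expRD -[leLHS]expR0 ler_expR subr_ge0 -mulrA -l1Z ?(ltW r0)//.
 rewrite /dy exprVn ler_pdivrMl ?exprn_gt0// mulr1; apply: le_trans hk; by rewrite nuE lerDr.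
have hn: ((nu (r *: x)) ^- n.+1 <= 2^+n.+1*(dy k*dy k^+n))%R.
 rewrite -exprS; case: k hk kmin {hl T0}=> [|k] hk kmin.
  rewrite /dy expr0 expr1n mulr1 (@le_trans _ _ 1%R)//; last by rewrite exprn_ege1// ler1n.
  by rewrite invf_le1 ?exprn_gt0 ?nu_gt0// exprn_ege1// nu_ge1.
 have: (2^+k < nu (r *: x))%R by rewrite ltNge; apply/negP=> /kmin; rewrite ltnn.
 move=> h; rewrite -exprMn (_: 2*dy k.+1 = 2^-1^+k)%R; last by rewrite /dy exprS mulrA divff// mul1r.
 rewrite -!exprVn.
 apply: lerXn2r; rewrite ?nnegrE ?invr_ge0 ?(ltW (nu_gt0 _)) ?exprn_ge0 ?invr_ge0//.
 by rewrite exprVn lef_pV2 ?posrE ?nu_gt0 ?exprn_gt0// ltW.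
have rn0: (0 <= r^+n)%R by side.
have:= ler_wpM2l rn0 hn; move/le_trans; apply.
set E:= expR (- _) in hl *; set D:= dy k in hl *.
have D0: (0 <= D*D^+n)%R by rewrite mulr_ge0 ?exprn_ge0 // ltW// dy_gt0.
have: (0 <= r^+n*(2^+n.+1*(D*D^+n)))%R by side.
move=> h; have:= ler_wpM2l h hl; rewrite mulr1=> /le_trans; apply.
by apply: le_of_eq; ring.
Qed.

Definition etaI: \bar R:= \int[mu n]_x (eta 1 x)%:E.
Lemma integral_eta r: (0 < r)%R -> \int[mu n]_x (eta r x)%:E = etaI.
Proof.
move=> r0; have mE: mfun (fun x: 'rV[R]_n=> (eta 1 x)%:E).
 by apply/mEFinP; exact: meas_eta.
have E0 x: 0 <= (eta 1 x)%:E by rewrite lee_fin eta_ge0.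
have -> : etaI = (r^+n)%:E*\int[mu n]_x (eta 1 (r *: x))%:E.
 by rewrite (ge0_integral_mu_scale r0 mE E0) muleA -EFinM divff ?mul1e// expf_neq0// gt_eqF.
rewrite -ge0_integralZl; try side; last first.
- apply/mEFinP; apply: (mcomp (meas_eta _)).
 by apply: meas_scaleV; [side|side].
by apply: eq_integral=> x _; rewrite /eta scale1r expr1n mul1r EFinM.
Qed.
Lemma etaI_ge0: 0 <= etaI.
Proof. by apply: integral_ge0=> x _; rewrite lee_fin eta_ge0. Qed.
Lemma meas_ekE r: mfun (fun x: 'rV[R]_n=> (ek r x)%:E).
Proof. by apply/mEFinP; exact: meas_ek. Qed.
Hint Resolve meas_ekE: side.
Lemma etaI_lty: etaI < +oo.
Proof.
have [C C0 hC]:= eta_le_ek.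
have ek0 k r x: (0 < r)%R -> 0 <= (dy k)%:E*(ek (dy k*r) x)%:E.
 by move=> r0; rewrite mule_ge0 ?lee_fin ?ek_ge0 ?mulr_ge0 ?(ltW r0)// ltW// dy_gt0.
have mek k r: mfun (fun x: 'rV[R]_n=> (dy k)%:E*(ek (dy k*r) x)%:E).
 by apply: measurable_funeM; exact: meas_ekE.
have mS: mfun (fun x: 'rV[R]_n=> \sum_(k <oo) (dy k)%:E*(ek (dy k*1) x)%:E).
 by apply: ge0_emeasurable_sum=> // k x _ _; exact: ek0.
apply: (@le_lt_trans _ _ (\int[mu n]_x (C%:E*\sum_(k <oo) (dy k)%:E*(ek (dy k*1) x)%:E))).
 apply: ge0_le_integral=> //; try side.
 - by move=> x _; rewrite lee_fin eta_ge0.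
 - by apply/mEFinP; exact: meas_eta.
rewrite ge0_integralZl//; try side; last first.
- by move=> x _; apply: nneseries_ge0=> k _ _; exact: ek0.
rewrite integral_nneseries//; last by move=> k x _; exact: ek0.
rewrite (eq_eseriesr (g:= fun k=> (fine (@ekI R n)*dy k)%:E)); last first.
 move=> k _; rewrite ge0_integralZl//; last 3 first.
 - exact: meas_ekE.
 - by move=> x _; rewrite lee_fin ek_ge0// mulr1 ltW// dy_gt0.
 - by rewrite lee_fin ltW// dy_gt0.
 rewrite integral_ek ?mulr1 ?dy_gt0// mulrC EFinM fineK// ge0_fin_numE ?ekI_lty ?ekI_ge0//.
under eq_eseriesr do rewrite EFinM.
rewrite nneseriesZl; last by move=> k _; rewrite lee_fin ltW// dy_gt0.
rewrite muleA -EFinM; have h0: (0 <= 2^-1 :> R)%R by side.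
have h1: (2^-1 < 1 :> R)%R by rewrite invf_lt1// ltr1n.
apply: lte_mul_pinfty=> //; last exact: nneseries_geometric_lty h0 h1.
by rewrite lee_fin mulr_ge0 ?fine_ge0 ?ekI_ge0// ltW.
Qed.
Lemma sop_eta_le: exists2 C: R, (0 < C)%R &
 forall r (u: 'rV[R]_n -> \bar R) x, (0 < r)%R -> mfun u -> (forall x, 0 <= u x) ->
 sop (eta r) u x <= C%:E*\int[counting]_k ((dy k)%:E*sop (ek (dy k*r)) u x).
Proof.
have [C C0 hC]:= eta_le_ek; exists C=> // r u x r0 mu0 u0.
have ek0 k y: (0 <= ek (dy k*r) y)%R by rewrite ek_ge0// mulr_ge0// ltW// dy_gt0.
have d0 k: (0 <= dy k)%R by side.
have mK k: mfun (fun y: 'rV[R]_n=> (ek (dy k*r) (x - y))%:E).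
 side.
have mKu k: mfun (fun y: 'rV[R]_n=> (dy k)%:E*((ek (dy k*r) (x - y))%:E*u y)).
 side.
have Ku0 k y: 0 <= (dy k)%:E*((ek (dy k*r) (x - y))%:E*u y) by side.
rewrite ge0_integral_count; last by move=> k; rewrite mule_ge0 ?lee_fin ?sop_ge0.
rewrite (eq_eseriesr (g:= fun k=> \int[mu n]_y ((dy k)%:E*((ek (dy k*r) (x - y))%:E*u y)))); last first.
 move=> k _; rewrite ge0_integralZl ?lee_fin//; first side.
 side.
rewrite -integral_nneseries//.
rewrite -ge0_integralZl; try side; last 2 first.
- by apply: ge0_emeasurable_sum.
- by move=> y _; apply: nneseries_ge0.
apply: ge0_le_integral=> //.
- by move=> y _; rewrite mule_ge0 ?lee_fin ?eta_ge0.
- by apply: emeasurable_funM=> //; apply: meas_kernelE; side.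
- by apply: measurable_funeM; apply: ge0_emeasurable_sum.
move=> y _; apply: (le_trans (lee_wpmul2r (u0 y) (hC r (x - y)%R r0))).
rewrite -muleA; apply: lee_wpmul2l; first side.
case: (u y) (u0 y)=> [v| |]// v0.
 rewrite muleC -nneseriesZl; last side.
 by apply: le_of_eq; apply: eq_eseriesr=> k _; rewrite muleC muleA.
apply: (@le_trans _ _ +oo); first exact: leey.
le_via ((dy 0)%:E*((ek (dy 0*r) (x - y))%:E * +oo)).
 rewrite gt0_muley ?gt0_muley// lte_fin ?dy_gt0// /ek mulr_gt0 ?expR_gt0 ?exprn_gt0 ?mulr_gt0 ?dy_gt0//.
apply: le_trans (nneseries_lim_ge 1 _); last side.
by rewrite big_nat1.
Qed.
Lemma counting_dy_lty: \int[counting]_k (dy k)%:E < +oo.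
Proof.
rewrite ge0_integral_count; last by move=> k; rewrite lee_fin ltW// dy_gt0.
by apply: nneseries_geometric_lty; rewrite ?invr_ge0// invf_lt1// ltr1n.
Qed.
(** Jensen's inequality for the summable weights [dy k] reduces the claim to [sop_ek_star] at each
    width 2^k; the constant of the latter does not depend on the starting scale, so the sum over k
    converges. *)
Lemma sop_eta_star (e: R): (1 <= e)%R -> exists2 C: R, (0 <= C)%R &
 forall (z: R) m (u: nat -> 'rV[R]_n -> \bar R), (0 < z)%R ->
  (forall i, mfun (u i)) -> (forall i x, 0 <= u i x) ->
  \int[mu n]_x ((\sum_(i < m) sop (eta (z*2^+i)) (u i) x)`^e) <=
  C%:E*\int[mu n]_x ((\sum_(i < m) u i x)`^e).
Proof.
move=> e1; have e0: (0 < e)%R by exact: lt_le_trans e1.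
have [C1 C10 h1]:= sop_eta_le; have [C2 C20 h2]:= @sop_ek_star R n e e1.
have d0 k: (0 <= dy k)%R by side.
have D0: 0 <= \int[counting]_k (dy k)%:E by side.
have Df: \int[counting]_k (dy k)%:E \is a fin_num by rewrite ge0_fin_numE// counting_dy_lty.
set D:= fine (\int[counting]_k (dy k)%:E).
have DE: \int[counting]_k (dy k)%:E = D%:E by rewrite fineK.
have D0': (0 <= D)%R by side.
exists (C1`^e*(D`^(e - 1)*(C2*D)))%R=> [|z m u z0 mu0 u0]; first side.
have zp i: (0 < z*2^+i)%R by side.
pose X k (x: 'rV[R]_n):= \sum_(i < m) sop (ek (dy k*(z*2^+i))) (u i) x.
have S0 k i x: 0 <= sop (ek (dy k*(z*2^+i))) (u i) x.
 side.
have mSk k i: mfun (sop (ek (dy k*(z*2^+i))) (u i)).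
 side.
have X0 k x: 0 <= X k x by side.
have mX k: mfun (X k) by apply: emeasurable_sum=> i; exact: mSk.
have mXe k: mfun (fun x=> X k x`^e).
 side.
have mE i: mfun (sop (eta (z*2^+i)) (u i)).
 side.
have E0 i x: 0 <= sop (eta (z*2^+i)) (u i) x by side.
have sE x: \int[counting]_k ((dy k)%:E*X k x`^e) = \sum_(k <oo) (dy k)%:E*X k x`^e.
 by rewrite ge0_integral_count// => k; rewrite mule_ge0 ?lee_fin ?poweR_ge0.
have pt x: (\sum_(i < m) sop (eta (z*2^+i)) (u i) x)`^e <=
  (C1`^e*D`^(e - 1))%:E*\sum_(k <oo) (dy k)%:E*X k x`^e.
 le_via ((C1%:E*\int[counting]_k ((dy k)%:E*X k x))`^e).
  apply: le_poweR; first side.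
   side.
  le_via (\sum_(i < m) (C1%:E*\int[counting]_k ((dy k)%:E*sop (ek (dy k*(z*2^+i))) (u i) x))).
   by apply: lee_sum=> i _; exact: h1.
  rewrite -ge0_sume_distrr; last side.
  apply: lee_wpmul2l; first side.
  rewrite -ge0_integral_sum//; last side.
  apply: le_of_eq; apply: eq_integral=> k _.
  by rewrite ge0_sume_distrr// => i _; exact: S0.
 rewrite poweRM ?lee_fin ?(ltW C10)//; last side.
 rewrite poweR_EFin EFinM -muleA; apply: lee_wpmul2l; first side.
 rewrite -sE -poweR_EFin -DE.
 exact: (@jensen_ereal _ _ _ counting (@dy) (fun k=> X k x)).
have mSer: mfun (fun x=> \sum_(k <oo) (dy k)%:E*X k x`^e).
 apply: ge0_emeasurable_sum=> [k x _ _|k _]; last side.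
 side.
le_via (\int[mu n]_x ((C1`^e*D`^(e - 1))%:E*\sum_(k <oo) (dy k)%:E*X k x`^e)).
 apply: ge0_le_integral=> //.
 - side.
 - by apply: (mcomp (measurable_poweR e)); exact: emeasurable_sum.
 - side.
rewrite ge0_integralZl ?lee_fin ?mulr_ge0 ?powR_ge0//; last first.
 by move=> x _; apply: nneseries_ge0=> k _ _; rewrite mule_ge0 ?lee_fin ?poweR_ge0.
rewrite (_: (C1`^e*(D`^(e - 1)*(C2*D)))%:E = (C1`^e*D`^(e - 1))%:E*(C2*D)%:E); last first.
 by rewrite -EFinM mulrA.
rewrite -[leRHS]muleA; apply: lee_wpmul2l; first side.
rewrite integral_nneseries//; try side.
set B:= \int[mu n]_x ((\sum_(i < m) u i x)`^e).
have B0: 0 <= B by side.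
le_via (\sum_(k <oo) ((dy k)%:E*(C2%:E*B))).
 apply: lee_nneseries=> [k _ _|k _].
  side.
 rewrite ge0_integralZl ?lee_fin//; last side.
 apply: lee_wpmul2l; first side.
 rewrite /X; under eq_integral do under eq_bigr do rewrite mulrA.
 by apply: h2=> //; rewrite mulr_gt0// dy_gt0.
have S2: \sum_(k <oo) (dy k)%:E = D%:E by rewrite -ge0_integral_count// => k; rewrite lee_fin.
have [Boo|Bn]:= eqVneq (C2%:E*B) +oo.
 have: 0 < D%:E.
  rewrite -S2; apply: lt_le_trans (nneseries_lim_ge 1 _); last side.
  by rewrite big_nat1 lte_fin dy_gt0.
 by move=> Dp; rewrite mulrC EFinM -[leRHS]muleA Boo (gt0_muley Dp) leey.
have [b bE]: exists b, C2%:E*B = b%:E.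
 exists (fine (C2%:E*B)); rewrite fineK// ge0_fin_numE ?ltey//.
 side.
rewrite mulrC EFinM -[leRHS]muleA bE; under eq_eseriesr do rewrite muleC.
by rewrite nneseriesZl ?S2 1?muleC// => k _; rewrite lee_fin.
Qed.

Definition tz (j: int): R:= (2 ^ j)%R.
Lemma tz_gt0 j: (0 < tz j)%R. Proof. exact: exprz_gt0. Qed.
Hint Resolve tz_gt0: side.
Lemma tz_subn (i J: nat): tz (i%:Z - J%:Z) = (tz (- J%:Z)*2^+i)%R.
Proof. by rewrite /tz expfzDr ?pnatr_eq0// mulrC. Qed.
Lemma sop_eta_tz_subn (i J: nat) (g: 'rV[R]_n -> \bar R) x :
 sop (eta (tz (i%:Z - J%:Z))) g x = sop (eta (tz (- J%:Z)*2^+i)) g x.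
Proof. by rewrite tz_subn. Qed.
Lemma meas_sop_eta r (u: 'rV[R]_n -> \bar R): (0 < r)%R -> mfun u ->
 (forall x, 0 <= u x) -> mfun (sop (eta r) u).
Proof.
side.
Qed.
Lemma sop_eta_ge0 r (u: 'rV[R]_n -> \bar R) x: (0 < r)%R -> (forall x, 0 <= u x) -> 0 <= sop (eta r) u x.
Proof. side. Qed.
Hint Resolve sop_eta_ge0: side.
Lemma sop_eta_zstar (e: R): (1 <= e)%R -> exists2 C: R, (0 <= C)%R &
 forall (u: int -> 'rV[R]_n -> \bar R),
  (forall i, mfun (u i)) -> (forall i x, 0 <= u i x) ->
  \int[mu n]_x (zsum (fun i=> sop (eta (tz i)) (u i) x)`^e) <=
  C%:E*\int[mu n]_x (zsum (u ^~ x)`^e).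
Proof.
move=> e1; have e0: (0 < e)%R by exact: lt_le_trans e1.
have [C C0 h]:= sop_eta_star e1; exists C=> // u mu0 u0.
apply: (@integral_zsum_le _ _ _ _ (fun i=> sop (eta (tz i)) (u i)))=> //.
- by move=> j; apply: meas_sop_eta=> //; side.
- by move=> j x; apply: sop_eta_ge0=> //; side.
move=> J; pose u' (i: nat):= u (i%:Z - J%:Z)%R.
have:= h (tz (- J%:Z)) (J + J)%N u' (tz_gt0 _) (fun i=> mu0 _) (fun i=> u0 _).
move=> hh; apply: le_trans (le_trans hh _).
 apply: le_of_eq; apply: eq_integral=> x _.
 rewrite zsum_zcut; last by move=> j; apply: sop_eta_ge0=> //; side.
 by under eq_bigr do rewrite sop_eta_tz_subn.
apply: lee_wpmul2l; first side.
apply: ge0_le_integral=> //; try side.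
- by apply: (mcomp (measurable_poweR e)); apply: emeasurable_sum=> i; exact: mu0.
- by apply: (mcomp (measurable_poweR e)); exact: meas_zsum.
move=> x _; apply: le_poweR; first side.
 side.
rewrite -(zsum_zcut J (u0 ^~ x)); apply: le_zsum=> j; exact: zcut_le.
Qed.

End polynomial_kernel.
Hint Resolve meas_nu eta_ge0 meas_nuV meas_eta dy_gt0 etaI_ge0 meas_ekE tz_gt0 meas_sop_eta sop_eta_ge0: side.

(** * Fefferman-Stein inequality for the averages *)

Section fefferman_stein.
Context {R: realType} (n: nat).
Local Notation T j g:= (sop (eta (tz j)) g).
Implicit Types (g: int -> 'rV[R]_n -> \bar R) (u v: 'rV[R]_n -> \bar R).
Lemma meas_poweRr {d} {X: measurableType d} (f: X -> \bar R) (p: R) :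
 mfun f -> mfun (fun x=> f x`^p).
Proof. side. Qed.
Hint Resolve meas_poweRr: side.
Lemma le_integral_ge0 {d} {X: measurableType d} (m: {measure set X -> \bar R}) (f h: X -> \bar R) :
 mfun f -> mfun h -> (forall x, 0 <= f x) -> (forall x, f x <= h x) ->
 \int[m]_x f x <= \int[m]_x h x.
Proof. by move=> mf mh f0 fh; apply: ge0_le_integral. Qed.
Lemma meas_T j (u: 'rV[R]_n -> \bar R): mfun u ->
 (forall x, 0 <= u x) -> mfun (T j u).
Proof. side. Qed.
Hint Resolve meas_T: side.
Lemma T_ge0 j (u: 'rV[R]_n -> \bar R) x: (forall x, 0 <= u x) -> 0 <= T j u x.
Proof. side. Qed.
Hint Resolve T_ge0: side.
Lemma T_poweR (Q: R) j u (x: 'rV[R]_n): (1 <= Q)%R -> mfun u -> (forall x, 0 <= u x) ->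
 T j u x`^Q <= (etaI n)`^(Q - 1)*T j (fun y=> u y`^Q) x.
Proof.
move=> Q1 mu0 u0; rewrite -(@integral_eta R n (tz j)) ?tz_gt0//; apply: sop_poweR=> //; try side.
Qed.
Lemma integral_T_poweR (P: R) j u: (1 <= P)%R -> mfun u -> (forall x, 0 <= u x) ->
 \int[mu n]_x (T j u x`^P) <= (etaI n)`^P*\int[mu n]_x (u x`^P).
Proof.
move=> P1 mu0 u0; rewrite -(@integral_eta R n (tz j)) ?tz_gt0//; apply: integral_sop_poweR=> //; try side.
Qed.
Lemma etaI_EFin (e: R): (0 <= e)%R -> exists2 c: R, (0 <= c)%R & (etaI n: \bar R)`^e = c%:E.
Proof.
move=> e0; exists (fine (etaI n: \bar R)`^e)%R; first side.
by rewrite -poweR_EFin fineK// ge0_fin_numE ?etaI_ge0 ?etaI_lty.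
Qed.
Lemma T_adjoint j u v: mfun u -> mfun v -> (forall x, 0 <= u x) ->
 (forall x, 0 <= v x) -> \int[mu n]_x (T j u x * v x) = \int[mu n]_x (u x*T j v x).
Proof.
move=> mu0 mv u0 v0; apply: sop_adjoint=> //; try side.
by move=> y; exact: etaN.
Qed.
(** The range Q <= P: Jensen's inequality moves the power Q inside each average, after which
    [sop_eta_zstar] applies with exponent P/Q >= 1. *)
Lemma fs_ge (P Q: R): (1 <= Q)%R -> (Q <= P)%R -> exists2 C: R, (0 < C)%R & forall g,
 (forall j, mfun (g j)) -> (forall j x, 0 <= g j x) ->
 \int[mu n]_x (zsum (fun j=> T j (g j) x`^Q)`^(P/Q)) <=
 C%:E*\int[mu n]_x (zsum (fun j=> g j x`^Q)`^(P/Q)).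
Proof.
move=> Q1 QP; have Q0: (0 < Q)%R by exact: lt_le_trans Q1.
have PQ1: (1 <= P/Q)%R by rewrite ler_pdivlMr// mul1r.
have PQ0: (0 <= P/Q)%R by exact: le_trans PQ1.
have [C C0 hC]:= @sop_eta_zstar R n _ PQ1.
have [c c0 cE]: exists2 c: R, (0 <= c)%R & (etaI n: \bar R)`^(Q - 1) = c%:E.
 by apply: etaI_EFin; rewrite subr_ge0.
exists (c`^(P/Q)*C + 1)%R=> [|g mg g0]; first by rewrite ltr_wpDl// mulr_ge0 ?powR_ge0.
have mgQ j: mfun (fun x=> g j x`^Q) by side.
have gQ0 j x: 0 <= g j x`^Q by side.
have mT j: mfun (T j (fun x=> g j x`^Q)) by side.
have T0 j x: 0 <= T j (fun x=> g j x`^Q) x by side.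
le_via (\int[mu n]_x ((c`^(P/Q))%:E*zsum (fun j=> T j (fun x=> g j x`^Q) x)`^(P/Q))).
 apply: le_integral_ge0=> //.
 - apply: meas_poweRr; apply: (meas_zsum (a:= fun j x=> T j (g j) x`^Q)).
   by move=> j; apply: meas_poweRr; exact: meas_T.
  side.
 - side.
 - side.
 - move=> x; rewrite -poweR_EFin -poweRM ?lee_fin//; last by apply: zsum_ge0=> j; exact: T0.
  apply: le_poweR=> //; first by apply: zsum_ge0=> j; side.
  rewrite -zsumZ//; apply: le_zsum=> j; rewrite -cE; exact: T_poweR.
rewrite ge0_integralZl ?lee_fin ?powR_ge0//; last 2 first.
- by apply: meas_poweRr; side.
- side.
have B0: 0 <= \int[mu n]_x (zsum (fun j=> g j x`^Q)`^(P/Q)) by side.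
le_via ((c`^(P/Q)*C)%:E*\int[mu n]_x (zsum (fun j=> g j x`^Q)`^(P/Q))).
 rewrite EFinM -muleA; apply: lee_wpmul2l; first side.
 exact: (hC (fun j x=> g j x`^Q)).
by apply: lee_wpmul2r=> //; rewrite lee_fin lerDl.
Qed.
Lemma zcut_cst_lty J (c: R): (0 <= c)%R -> zsum (zcut J (fun=> c%:E)) < +oo.
Proof. by move=> c0; rewrite zsum_zcut ?sumEFin ?ltry// => j; rewrite lee_fin. Qed.
Lemma powR_identity (z a b c: R): (0 <= z)%R -> c != 0%R -> b != 0%R -> ((a + 1)*b = c)%R ->
 ((z`^a*z)`^b = z`^c)%R.
Proof.
move=> z0 c0 b0 abc; have [->|zn]:= eqVneq z 0%R; first by rewrite mulr0 !powR0.
by rewrite -[X in (_*X)%R](powRr1 z0) -powRD ?zn ?implybT// -powRrM abc.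
Qed.
Lemma meas_fine_T {d} {X: measurableType d} (f: X -> \bar R): mfun f ->
 mfun (fun x=> fine (f x)).
Proof. by move=> mf; apply: (mcomp _ mf)=> //; side. Qed.
(** The range P < Q, by duality. The averages are symmetric and can be moved onto a dual sequence
    [h]; Hoelder's inequality in j and in x leaves the same inequality for the conjugate exponents,
    which satisfy Q' <= P' and fall under [fs_ge]. The bounds [M] make every average finite, so that
    the negative power of [Z] below can be taken among real numbers. *)
Lemma fs_lt (P Q: R): (1 < P)%R -> (P < Q)%R -> exists2 C: R, (0 < C)%R & forall g (M: int -> R),
 (forall j, mfun (g j)) -> (forall j x, 0 <= g j x) -> (forall j x, g j x <= (M j)%:E) ->
 \int[mu n]_x (zsum (fun j=> T j (g j) x`^Q)`^(P/Q)) <=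
 C%:E*\int[mu n]_x (zsum (fun j=> g j x`^Q)`^(P/Q)).
Proof.
move=> P1 PQ; have Q1: (1 < Q)%R by exact: lt_trans PQ.
have P0: (0 < P)%R by exact: lt_trans P1.
have Q0: (0 < Q)%R by exact: lt_trans Q1.
have pn:= gt_eqF P0; have qn:= gt_eqF Q0.
have P10: (0 < P - 1)%R by side.
have Q10: (0 < Q - 1)%R by side.
pose P':= (P/(P - 1))%R; pose Q':= (Q/(Q - 1))%R.
have P'0: (0 < P')%R by side.
have Q'0: (0 < Q')%R by side.
have PP: (P^-1 + P'^-1 = 1)%R by rewrite /P'; field; rewrite pn gt_eqF.
have QQ: (Q^-1 + Q'^-1 = 1)%R by rewrite /Q'; field; rewrite qn gt_eqF.
have Q'1: (1 <= Q')%R by rewrite /Q' ler_pdivlMr// mul1r gerBl.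
have QP': (Q' <= P')%R by rewrite /Q' /P' ler_pdivrMr// mulrAC ler_pdivlMr//; nra.
have [C1 C10 h1]:= fs_ge Q'1 QP'.
pose K:= (C1`^P'^-1)%R.
have [ce ce0 ceE]:= etaI_EFin (ltW P0).
have PQ0: (0 < P/Q)%R by side.
have PQle1: (P/Q <= 1)%R by rewrite ler_pdivrMr// mul1r ltW.
have K0: (0 <= K)%R by side.
exists (K`^P + 1)%R=> [|g M mg g0 gM]; first side.
have mgQ j: mfun (fun x=> g j x`^Q) by side.
have mzg: mfun (fun x=> zsum (fun j=> g j x`^Q)).
 by apply: (meas_zsum (a:= fun j x=> g j x`^Q))=> // j x; side.
set B:= \int[mu n]_x (zsum (fun j=> g j x`^Q)`^(P/Q)).
have B0: 0 <= B by side.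
have [Boo|Bn]:= eqVneq B +oo.
 by rewrite Boo gt0_muley ?leey// lte_fin ltr_wpDl// powR_ge0.
have Bf: B \is a fin_num by rewrite ge0_fin_numE// ltey.
have mT j: mfun (T j (g j)) by side.
have T0 j x: 0 <= T j (g j) x by side.
have Tf j x: T j (g j) x < +oo.
 apply: (@le_lt_trans _ _ (\int[mu n]_y ((M j)%:E*(eta (tz j) (x - y))%:E))).
  apply: le_integral_ge0.
  - by apply: emeasurable_funM=> //; apply: meas_kernelE; side.
  - by apply: measurable_funeM; apply: meas_kernelE; side.
  - by move=> y; rewrite mule_ge0 ?lee_fin ?eta_ge0 ?tz_gt0.
  - by move=> y; rewrite muleC; apply: lee_wpmul2r=> //; rewrite lee_fin eta_ge0 ?tz_gt0.
 rewrite ge0_integralZl//; last 3 first.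
 - by apply: meas_kernelE; side.
 - by move=> y _; rewrite lee_fin eta_ge0 ?tz_gt0.
 - exact: le_trans (gM j x).
 rewrite (sop_cst (k:= eta (tz j)) (meas_eta _)) integral_eta ?tz_gt0//.
 by apply: lte_mul_pinfty; rewrite ?etaI_lty//; exact: le_trans (gM j x).
apply: (@integral_zsum_le _ _ _ _ (fun j x=> T j (g j) x`^Q))=> //; try side.
move=> J.
pose G j x:= zcut J (fun j=> T j (g j) x) j.
pose g' j x:= zcut J (fun j=> g j x) j.
have mG j: mfun (G j) by rewrite /G /zcut; case: (_ <= _ < _)%R=> //; side.
have G0 j x: 0 <= G j x by apply: zcut_ge0=> ?.
have mg' j: mfun (g' j) by rewrite /g' /zcut; case: (_ <= _ < _)%R=> //; side.
have g'0 j x: 0 <= g' j x by apply: zcut_ge0=> ?.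
have zcutP (a: int -> \bar R) (e: R) j: e != 0%R -> zcut J (fun j=> a j`^e) j = (zcut J a j)`^e.
 by move=> e0; rewrite /zcut; case: ifP=> // _; rewrite poweR0r.
pose Z x:= zsum (fun j=> G j x`^Q).
have ZE x: zsum (zcut J (fun j=> T j (g j) x`^Q)) = Z x.
 by apply: eq_zsum=> j; rewrite zcutP ?qn.
under eq_integral do rewrite ZE.
have Z0 x: 0 <= Z x by side.
have mZ: mfun Z.
 by apply: (meas_zsum (a:= fun j x=> G j x`^Q))=> [j|j x]; [side|side].
have Zf x: Z x \is a fin_num.
 rewrite ge0_fin_numE// -ZE zsum_zcut; last side.
 by apply: lte_sum_pinfty=> i _; apply: poweR_lty.
set A:= \int[mu n]_x (Z x`^(P/Q)).
have A0: 0 <= A by apply: integral_ge0=> x _; side.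
(* Since P/Q <= 1 the power may be taken term by term, and each of the finitely many terms is
   controlled by the finite B. *)
have Af: A < +oo.
 apply: (@le_lt_trans _ _ (zsum (zcut J (fun=> (ce*fine B)%:E)))); last first.
  by rewrite zcut_cst_lty// mulr_ge0// fine_ge0.
 le_via (\int[mu n]_x zsum (fun j=> G j x`^P)).
  apply: le_integral_ge0; try side.
  - move=> x; apply: (le_trans (zsum_poweR_le1 PQ0 PQle1 _))=> [j|]; first side.
   by apply: le_zsum=> j; rewrite -poweRrM mulrCA divff ?qn// mulr1.
 rewrite (integral_zsum _ _ (a:= fun j x=> G j x`^P))//; last 2 first.
 - side.
 - side.
 apply: le_zsum=> j; rewrite /G /zcut; case: ifP=> _; last first.
  by under eq_integral do rewrite poweR0r ?pn//; rewrite integral0.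
 apply: (le_trans (integral_T_poweR j (ltW P1) (mg j) (g0 j))).
 rewrite ceE EFinM fineK//; apply: lee_wpmul2l; first side.
 apply: le_integral_ge0; try side.
 - move=> x; rewrite (_: g j x`^P = (g j x`^Q)`^(P/Q)); last first.
   by rewrite -poweRrM mulrCA divff ?qn// mulr1.
  apply: le_poweR; first side.
   side.
  by apply: (zsum_term (a:= fun j=> g j x`^Q))=> ?; side.
le_via ((K`^P)%:E*B); last by apply: lee_wpmul2r=> //; rewrite lee_fin lerDl.
apply: absorb_power=> //.
(* The dual sequence [h]: summed against G it gives Z^(P/Q), and its Q'-th powers sum to a power of
   Z. Where Z vanishes, [powR] sends the negative power to 0, which agrees with both identities. *)
pose zz x:= (fine (Z x)`^(P/Q - 1))%R.
pose h j x:= (zz x)%:E*G j x`^(Q - 1).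
have zz0 x: (0 <= zz x)%R by side.
have mzz: mfun (fun x=> (zz x)%:E).
 apply/mEFinP; apply: (mcomp (measurable_powR _)).
 exact: meas_fine_T.
have mh j: mfun (h j) by side.
have h0 j x: 0 <= h j x by side.
have mTh j: mfun (T j (h j)) by side.
have Th0 j x: 0 <= T j (h j) x by side.
have PQn1: (P/Q != 0)%R by side.
have E1 x: Z x`^(P/Q) = zsum (fun j=> G j x*h j x).
 transitivity ((zz x)%:E*Z x).
  rewrite -(fineK (Zf x)) poweR_EFin -EFinM; congr (_%:E).
  rewrite -[RHS]powRr1; last side.
  by apply/esym/powR_identity=> //; [side|rewrite subrK mulr1].
 rewrite /Z -zsumZ//; last side.
 by apply: eq_zsum=> j; rewrite /h muleCA -poweRSr// ltW.
have E2 x: zsum (fun j=> h j x`^Q') = ((zz x)`^Q'*fine (Z x))%:E.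
 rewrite EFinM fineK// /Z -zsumZ ?powR_ge0//; last side.
 apply: eq_zsum=> j; rewrite /h poweRM ?lee_fin ?poweR_ge0// -poweRrM /Q' mulrCA divff ?mulr1// gt_eqF//.
have EA: A = zsum (fun j=> \int[mu n]_x (g' j x*T j (h j) x)).
 rewrite /A; under eq_integral do rewrite E1.
 rewrite (integral_zsum _ _ (a:= fun j x=> G j x*h j x))//; last 2 first.
 - by move=> j; side.
 - side.
 apply: eq_zsum=> j; rewrite -(T_adjoint j (mg' j) (mh j) (g'0 j) (h0 j)).
 apply: eq_integral=> x _; rewrite /G /g' /zcut; case: ifP=> // _.
 by rewrite mul0e /sop; under eq_integral do rewrite mule0; rewrite integral0 mul0e.
rewrite {1}EA -(integral_zsum _ _ (a:= fun j x=> g' j x*T j (h j) x))//; last 2 first.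
- by move=> j; exact: emeasurable_funM.
- side.
pose b x:= zsum (fun j=> g' j x`^Q)`^Q^-1.
pose t x:= zsum (fun j=> T j (h j) x`^Q')`^Q'^-1.
have mb: mfun b.
 apply: meas_poweRr; apply: (meas_zsum (a:= fun j x=> g' j x`^Q))=> [j|j x]; last side.
 side.
have mt: mfun t.
 apply: meas_poweRr; apply: (meas_zsum (a:= fun j x=> T j (h j) x`^Q'))=> [j|j x]; last side.
 side.
have b0 x: 0 <= b x by side.
have t0 x: 0 <= t x by side.
le_via (\int[mu n]_x (b x*t x)).
 apply: le_integral_ge0.
 - apply: (meas_zsum (a:= fun j x=> g' j x*T j (h j) x))=> [j|j x]; last side.
  exact: emeasurable_funM.
 - side.
 - by move=> x; apply: zsum_ge0=> j; side.
 - by move=> x; exact: (hoelder_zsum (a:= fun j=> g' j x) (b:= fun j=> T j (h j) x)).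
apply: (le_trans (@hoelder_ereal _ _ _ (mu n) _ _ _ _ P0 P'0 PP mb mt b0 t0)).
rewrite -muleA [leRHS]muleCA; apply: lee_pmul; rewrite ?poweR_ge0//.
 apply: le_poweR; rewrite ?invr_ge0 ?(ltW P0)//; first side.
 apply: le_integral_ge0; try side.
 - move=> x; rewrite /b -poweRrM mulrC; apply: le_poweR; first side.
   by apply: zsum_ge0=> j; side.
  by apply: le_zsum=> j; apply: le_poweR=> //; [side|exact: zcut_le].
rewrite (_: 1 - P^-1 = P'^-1)%R; last by rewrite -PP addrAC subrr add0r.
rewrite /K -poweR_EFin -poweRM ?lee_fin ?(ltW C10)//.
apply: le_poweR; rewrite ?invr_ge0 ?(ltW P'0)//; first side.
apply: le_trans (le_trans (h1 h mh h0) _).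
 apply: le_of_eq; apply: eq_integral=> x _.
 by rewrite /t -poweRrM [(_*P')%R]mulrC.
apply: lee_wpmul2l; first side.
apply: le_of_eq; apply: eq_integral=> x _.
rewrite E2 poweR_EFin -[in RHS](fineK (Zf x)) poweR_EFin; congr (_%:E).
rewrite /zz -powRrM; apply: powR_identity=> //; try side.
by rewrite /P' /Q'; field; rewrite qn !gt_eqF.
Qed.

Fixpoint zmax (a: int -> \bar R) (m: nat): \bar R :=
 if m is m'.+1 then maxe (zmax a m') (a (zs m')) else 0.
Lemma zmax_ge0 a m: 0 <= zmax a m.
Proof. by elim: m=> //= m IH; rewrite le_max IH. Qed.
Hint Resolve zmax_ge0: side.
Lemma zmax_le a m (M: \bar R): 0 <= M -> (forall k, (k < m)%N -> a (zs k) <= M) -> zmax a m <= M.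
Proof.
move=> M0; elim: m=> //= m IH h; rewrite ge_max h// andbT; apply: IH=> k km.
by apply: h; rewrite ltnS ltnW.
Qed.
Lemma zmax_cvg a: (forall j, 0 <= a j) -> zmax a m @[m --> \oo] --> ereal_sup (range a).
Proof.
move=> a0; have nd: {homo zmax a: m k/(m <= k)%N >-> m <= k}.
 by apply/nondecreasing_seqP=> m /=; rewrite le_max lexx.
suff -> : ereal_sup (range a) = ereal_sup (range (zmax a)) by exact: ereal_nondecreasing_cvgn.
apply/eqP; rewrite eq_le; apply/andP; split; apply: ge_ereal_sup.
 move=> _ [j _ <-]; have [_ _ /(_ j I)[k _ <-]]:= zs_bij.
 le_via (zmax a k.+1); first by rewrite /= le_max lexx orbT.
 by apply: ereal_sup_ubound; exists k.+1.
move=> _ [m _ <-]; apply: zmax_le=> [|k _]; last by apply: ereal_sup_ubound; exists (zs k).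
by apply: le_trans (a0 0%R) _; apply: ereal_sup_ubound; exists 0%R.
Qed.
Lemma meas_zmax {d} {X: measurableType d} (a: int -> X -> \bar R) m :
 (forall j, mfun (a j)) -> mfun (fun x=> zmax (a ^~ x) m).
Proof. by move=> ma; elim: m=> [|m IH] /=; [side|exact: measurable_maxe]. Qed.
Hint Resolve meas_zmax: side.
Lemma meas_zsup {d} {X: measurableType d} (a: int -> X -> \bar R) :
 (forall j, mfun (a j)) -> (forall j x, 0 <= a j x) ->
 mfun (fun x=> ereal_sup (range (a ^~ x))).
Proof.
move=> ma a0; apply: (emeasurable_fun_cvg (fun m x=> zmax (a ^~ x) m)).
 side.
by move=> x _; exact: zmax_cvg.
Qed.
(** A measurable choice of a maximizing index, written as weights of total at most 1: going through
    the indices, the choice switches on the set where the new function exceeds the value selected so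
    far. It makes a supremum linear, as duality requires. *)
Lemma linearized_max {d} {X: measurableType d} (G: nat -> X -> \bar R) m :
 (forall i, mfun (G i)) -> (forall i x, 0 <= G i x) ->
 exists chi: nat -> X -> \bar R, [/\ forall i, mfun (chi i),
  forall i x, 0 <= chi i x, forall x, \sum_(i < m) chi i x <= 1 &
  forall x k, (k < m)%N -> G k x <= \sum_(i < m) chi i x*G i x].
Proof.
move=> mG G0; elim: m=> [|m [chi [mchi chi0 chi1 hchi]]].
 by exists (fun _ _=> 0); split=> // x; rewrite big_ord0.
pose H x:= \sum_(i < m) chi i x*G i x.
have mH: mfun H by apply: emeasurable_sum=> i; side.
have mA: measurable [set x | H x < G m x].
 by rewrite -[X in measurable X]setTI; exact: emeasurable_fun_lt.
pose U:= [set x | H x < G m x].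
pose c x: \bar R:= (\1_U x)%:E.
pose c' x: \bar R:= (\1_(~` U) x)%:E.
have mc': mfun c' by apply/mEFinP; apply: measurable_indic; exact: measurableC.
exists (fun i x=> if i == m then c x else c' x*chi i x); split.
- by move=> i; case: eqP=> // _; side.
- by move=> i x; case: eqP=> _; rewrite ?mule_ge0 ?lee_fin.
- move=> x; rewrite big_ord_recr/= eqxx.
 rewrite (eq_bigr (fun i: 'I_m=> c' x*chi i x)); last by move=> i _; rewrite ltn_eqF.
 rewrite /c /c' !indicE in_setC; case: (x \in _)=> /=.
  by rewrite big1 ?add0e// => i _; rewrite mul0e.
 by rewrite adde0; under eq_bigr do rewrite mul1e; exact: chi1.
- move=> x k; rewrite ltnS leq_eqVlt big_ord_recr/= eqxx=> km.
 rewrite (eq_bigr (fun i: 'I_m=> c' x*(chi i x*G i x))); last first.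
  by move=> i _; rewrite ltn_eqF// muleA.
 rewrite /c /c' !indicE in_setC; have [xA|xA]:= boolP (x \in _)=> /=.
  rewrite big1 ?add0e ?mul1e; last by move=> i _; rewrite mul0e.
  case/orP: km=> [/eqP ->//|km]; apply: (le_trans (hchi x k km)).
  by move: xA; rewrite inE/= => /ltW.
 rewrite mul0e adde0; under eq_bigr do rewrite mul1e.
 case/orP: km=> [/eqP ->|km]; last exact: hchi.
 by move: xA; rewrite notin_setE/= => /negP; rewrite -leNgt.
Qed.
Lemma zs_window k J: (k < J)%N ->
 (`|(zs k + J%:Z)%R| < J + J)%N /\ (zs k = `|(zs k + J%:Z)%R|%N%:Z - J%:Z)%R.
Proof.
move=> kJ; rewrite /zs; have:= odd_double_half k.
by case: (odd k)=> /= h; split; lia.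
Qed.
(** The endpoint where the sum is a supremum. After linearization the dual family is chi_i H^(P-1),
    whose sum is at most H^(P-1); hence [sop_eta_star] with the conjugate exponent P' is enough. *)
Lemma fs_sup (P: R): (1 < P)%R -> exists2 C: R, (0 < C)%R & forall g,
 (forall j, mfun (g j)) -> (forall j x, 0 <= g j x) ->
 \int[mu n]_x (ereal_sup (range (fun j=> T j (g j) x))`^P) <=
 C%:E*\int[mu n]_x (ereal_sup (range (fun j=> g j x))`^P).
Proof.
move=> P1; have P0: (0 < P)%R by exact: lt_trans P1.
have pn:= gt_eqF P0; have P10: (0 < P - 1)%R by side.
pose P':= (P/(P - 1))%R.
have P'0: (0 < P')%R by side.
have PP: (P^-1 + P'^-1 = 1)%R by rewrite /P'; field; rewrite pn gt_eqF.
have P'1: (1 <= P')%R by rewrite /P' ler_pdivlMr// mul1r gerBl.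
have [C1 C10 h1]:= @sop_eta_star R n _ P'1.
pose K:= (C1`^P'^-1)%R.
have K0: (0 <= K)%R by side.
have [ce ce0 ceE]:= etaI_EFin (ltW P0).
exists (K`^P + 1)%R=> [|g mg g0]; first by rewrite ltr_wpDl// powR_ge0.
pose D x:= ereal_sup (range (fun j=> g j x)).
have gD j x: g j x <= D x by apply: ereal_sup_ubound; exists j.
have D0 x: 0 <= D x:= le_trans (g0 0%R x) (gD _ _).
have mD: mfun D by exact: meas_zsup.
set B:= \int[mu n]_x (D x`^P).
have B0: 0 <= B by side.
have [Boo|Bn]:= eqVneq B +oo.
 by rewrite Boo gt0_muley ?leey// lte_fin ltr_wpDl// powR_ge0.
have Bf: B \is a fin_num by rewrite ge0_fin_numE// ltey.
have mT j: mfun (T j (g j)) by side.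
have T0 j x: 0 <= T j (g j) x by side.
apply: (@integral_poweR_cvg _ _ _ _ (fun m x=> zmax (fun j=> T j (g j) x) m))=> //; try side.
- by move=> x; apply/nondecreasing_seqP=> m /=; rewrite le_max lexx.
- by move=> x; exact: zmax_cvg.
move=> J; pose G (i: nat):= T (i%:Z - J%:Z)%R (g (i%:Z - J%:Z)%R).
have mG i: mfun (G i) by exact: mT.
have G0 i x: 0 <= G i x by exact: T0.
have [chi [mchi chi0 chi1 hchi]]:= @linearized_max _ _ G (J + J) mG G0.
pose H x:= \sum_(i < J + J) chi i x*G i x.
have mH: mfun H by apply: emeasurable_sum=> i; side.
have H0 x: 0 <= H x by side.
pose A:= \int[mu n]_x (H x`^P).
have A0: 0 <= A by side.
le_via A.
 apply: le_integral_ge0; try side.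
 - move=> x; apply: le_poweR; [side|side|].
  apply: zmax_le=> // k kJ.
  have kk: (`|(zs k + J%:Z)%R| < J + J)%N /\ (zs k = `|(zs k + J%:Z)%R|%N%:Z - J%:Z)%R.
   exact: zs_window.
  have [k1 k2]:= kk; have:= hchi x _ k1; rewrite /G -k2; exact.
have [C2 C20 h2]:= @poweR_sum_le R P (J + J) P0.
have GP i: \int[mu n]_x (G i x`^P) <= (ce*fine B)%:E.
 apply: (le_trans (integral_T_poweR _ (ltW P1) (mg _) (g0 _))).
 rewrite ceE EFinM fineK//; apply: lee_wpmul2l; first side.
 apply: le_integral_ge0; try side.
 - by move=> x; apply: le_poweR=> //; side.
have Af: A < +oo.
 apply: (@le_lt_trans _ _ (\int[mu n]_x (C2%:E*\sum_(i < J + J) G i x`^P))).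
  apply: le_integral_ge0; try side.
  - by apply: measurable_funeM; apply: emeasurable_sum=> i; side.
  - move=> x; apply: le_trans (h2 (fun i=> G i x) _)=> //; apply: le_poweR=> //; first side.
   apply: lee_sum=> i _; rewrite -[leRHS]mul1e; apply: lee_wpmul2r=> //.
   apply: le_trans (chi1 x); rewrite (bigD1 i)//= leeDl// sume_ge0//.
 rewrite ge0_integralZl ?lee_fin//; try side; last first.
 - by apply: emeasurable_sum=> i; side.
 rewrite ge0_integral_sum//; try side.
 apply: lte_mul_pinfty; rewrite ?lee_fin//.
 by apply: lte_sum_pinfty=> i _; apply: le_lt_trans (GP i) _; exact: ltry.
le_via ((K`^P)%:E*B); last by apply: lee_wpmul2r=> //; rewrite lee_fin lerDl.
apply: absorb_power=> //.
pose u (i: nat) x:= chi i x*H x`^(P - 1).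
have mu0 i: mfun (u i) by side.
have u0 i x: 0 <= u i x by side.
have mTu i: mfun (T (i%:Z - J%:Z)%R (u i)) by side.
have Tu0 i x: 0 <= T (i%:Z - J%:Z)%R (u i) x by side.
have EA: A = \sum_(i < J + J) \int[mu n]_x (g (i%:Z - J%:Z)%R x*T (i%:Z - J%:Z)%R (u i) x).
 transitivity (\int[mu n]_x \sum_(i < J + J) (G i x*u i x)).
  apply: eq_integral=> x _; rewrite poweRSr//; last side.
  rewrite {1}/H ge0_sume_distrl; last side.
  by apply: eq_bigr=> i _; rewrite /u muleCA muleA.
 rewrite ge0_integral_sum//; last 2 first.
 - side.
 - side.
 by apply: eq_bigr=> i _; apply: T_adjoint.
rewrite {1}EA; le_via (\int[mu n]_x (D x*\sum_(i < J + J) T (i%:Z - J%:Z)%R (u i) x)).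
 rewrite -ge0_integral_sum//; try side.
 apply: le_integral_ge0.
 - by apply: emeasurable_sum=> i; side.
 - by apply: emeasurable_funM=> //; apply: emeasurable_sum=> i; exact: mTu.
 - side.
 - move=> x; rewrite ge0_sume_distrr; last by move=> i _; exact: Tu0.
  by apply: lee_sum=> i _; apply: lee_wpmul2r.
have mS: mfun (fun x=> \sum_(i < J + J) T (i%:Z - J%:Z)%R (u i) x).
 by apply: emeasurable_sum=> i; exact: mTu.
have S0 x: 0 <= \sum_(i < J + J) T (i%:Z - J%:Z)%R (u i) x by side.
apply: (le_trans (@hoelder_ereal _ _ _ (mu n) _ _ _ _ P0 P'0 PP mD mS D0 S0)).
rewrite -muleA [leRHS]muleCA; apply: lee_wpmul2l; first side.
rewrite (_: 1 - P^-1 = P'^-1)%R; last by rewrite -PP addrAC subrr add0r.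
rewrite /K -poweR_EFin -poweRM ?lee_fin//.
apply: le_poweR; rewrite ?invr_ge0 ?(ltW P'0)//; first side.
have hh:= h1 (tz (- J%:Z)) (J + J)%N u (@tz_gt0 R _) mu0 u0.
apply: le_trans (le_trans hh _).
 apply: le_of_eq; apply: eq_integral=> x _.
 by under eq_bigr do rewrite sop_eta_tz_subn.
apply: lee_wpmul2l; first side.
apply: le_integral_ge0.
- by apply: meas_poweRr; apply: emeasurable_sum=> i; exact: mu0.
- side.
- side.
- move=> x; rewrite /u -ge0_sume_distrl; last by move=> i _; exact: chi0.
 le_via ((H x`^(P - 1))`^P').
  apply: le_poweR; first side.
   side.
  by rewrite -[leRHS]mul1e; apply: lee_wpmul2r; rewrite ?poweR_ge0.
 by rewrite -poweRrM /P' mulrCA divff ?mulr1// gt_eqF.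
Qed.

End fefferman_stein.
Lemma zsumZe {R: realType} (c: \bar R) (a: int -> \bar R): 0 <= c -> (forall j, 0 <= a j) ->
 zsum (fun j=> c*a j) = c*zsum a.
Proof.
move=> c0 a0; rewrite !zsum_int//; last side.
by rewrite ge0_integralZl.
Qed.
(** Young's inequality for sequences, extended to every e > 0: Jensen's inequality for e >= 1,
    subadditivity of the e-th power below. *)
Lemma zsum_conv_poweR {R: realType} (w: int -> R) (e: R): (0 < e)%R -> (forall j, 0 <= w j)%R ->
 zsum (fun j=> (w j)%:E) < +oo -> zsum (fun j=> (w j`^e)%:E) < +oo ->
 exists2 C: R, (0 < C)%R & forall d: int -> \bar R, (forall j, 0 <= d j) ->
 zsum (fun l=> zsum (fun j=> (w (l - j))%:E*d j)`^e) <= C%:E*zsum (fun j=> d j`^e).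
Proof.
move=> e0 w0 wf wef.
have S0: 0 <= zsum (fun j=> (w j)%:E) by side.
have Sf: zsum (fun j=> (w j)%:E) \is a fin_num by rewrite ge0_fin_numE.
have Se0: 0 <= zsum (fun j=> (w j`^e)%:E) by side.
have Sef: zsum (fun j=> (w j`^e)%:E) \is a fin_num by rewrite ge0_fin_numE.
set S:= fine (zsum (fun j=> (w j)%:E)) in Sf *; set Se:= fine (zsum (fun j=> (w j`^e)%:E)) in Sef *.
have S0': (0 <= S)%R by side.
have Se0': (0 <= Se)%R by side.
have dbl (v: int -> R) (b: int -> \bar R): (forall j, 0 <= v j)%R -> (forall j, 0 <= b j) ->
  zsum (fun l=> zsum (fun j=> (v (l - j)%R)%:E*b j)) = zsum (fun j=> b j*zsum (fun l=> (v l)%:E)).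
 move=> v0 b0; rewrite zsum_interchange; last side.
 apply: eq_zsum=> j; rewrite -(zsum_shift (fun l=> (v l)%:E) (- j)) -zsumZe//; last side.
 by apply: eq_zsum=> l; rewrite muleC.
exists (S`^(e - 1)*S + Se + 1)%R=> [|d d0]; first by rewrite ltr_wpDl// addr_ge0// mulr_ge0 ?powR_ge0.
have de0 j: 0 <= d j`^e by side.
have Z0: 0 <= zsum (fun j=> d j`^e) by side.
have wd0 l j: 0 <= (w (l - j))%:E*d j by side.
have [e1|e1]:= leP 1%R e.
 le_via ((S`^(e - 1)*S)%:E*zsum (fun j=> d j`^e)); last first.
  by apply: lee_wpmul2r=> //; rewrite lee_fin -addrA lerDl addr_ge0.
 le_via (zsum (fun l=> (S`^(e - 1))%:E*zsum (fun j=> (w (l - j))%:E*d j`^e))).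
  apply: le_zsum=> l; apply: (le_trans (jensen_zsum e1 (fun j=> w0 (l - j)%R) d0)).
  by rewrite (zsum_conv (fun j=> (w j)%:E)) -poweR_EFin fineK.
 rewrite zsumZ ?powR_ge0//; last by move=> l; apply: zsum_ge0=> j; rewrite mule_ge0 ?lee_fin.
 rewrite dbl// EFinM -muleA fineK//.
 rewrite (_: zsum (fun j=> d j`^e*_) = zsum (fun j=> (w j)%:E)*zsum (fun j=> d j`^e))//.
 by rewrite -zsumZe//; apply: eq_zsum=> j; rewrite muleC.
le_via (Se%:E*zsum (fun j=> d j`^e)); last first.
 by apply: lee_wpmul2r=> //; rewrite lee_fin addrAC lerDr addr_ge0// mulr_ge0 ?powR_ge0.
le_via (zsum (fun l=> zsum (fun j=> (w (l - j)`^e)%:E*d j`^e))).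
 apply: le_zsum=> l; apply: (le_trans (zsum_poweR_le1 e0 (ltW e1) (wd0 l))).
 by apply: le_zsum=> j; rewrite poweRM ?lee_fin.
rewrite (dbl (fun j=> w j`^e)%R (fun j=> d j`^e))=> [|j|//]; last side.
rewrite fineK// le_eqVlt; apply/orP; left; apply/eqP.
by rewrite -zsumZe//; apply: eq_zsum=> j; rewrite muleC.
Qed.

Definition zw {R: realType} (z: R) (j: int): R:= (z^+`|j|%N)%R.
Lemma zw_ge0 {R: realType} (z: R) j: (0 <= z)%R -> (0 <= zw z j)%R.
Proof. by move=> z0; exact: exprn_ge0. Qed.
Hint Resolve zw_ge0: side.
Lemma zw_powR {R: realType} (z e: R) j: (0 <= z)%R -> (zw z j`^e = zw (z`^e) j)%R.
Proof. move=> z0; rewrite /zw; set k:= `|j|%N.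
by rewrite -(powR_mulrn k z0) -(powR_mulrn k (powR_ge0 z e)) -powRrM -[RHS]powRrM mulrC. Qed.
Lemma zs_absz k: (k <= (`|zs k|%N).*2.+1)%N.
Proof. by rewrite /zs; have:= odd_double_half k; case: (odd k)=> /=; lia. Qed.
Lemma zsum_zw {R: realType} (z: R): (0 < z)%R -> (z < 1)%R -> zsum (fun j=> (zw z j)%:E) < +oo.
Proof.
move=> z0 z1; pose y:= Num.sqrt z.
have y0: (0 < y)%R by rewrite sqrtr_gt0.
have y1: (y < 1)%R by rewrite -sqrtr1 ltr_sqrt.
have zE: (z = y^+2)%R by rewrite sqr_sqrtr// ltW.
rewrite zsum_nat; last by move=> j; rewrite lee_fin zw_ge0// ltW.
apply: (@le_lt_trans _ _ (\sum_(k <oo) ((y^-1)%:E*(y^+k)%:E))).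
 apply: lee_nneseries=> k _=> [_|]; first by rewrite lee_fin zw_ge0// ltW.
 rewrite -EFinM lee_fin /zw zE -exprM mulrC ler_pdivlMr// -exprSr mul2n.
 by apply: ler_wiXn2l (zs_absz k); side.
rewrite nneseriesZl; last side.
apply: lte_mul_pinfty=> //; first side.
by apply: nneseries_geometric_lty=> //; side.
Qed.
Hint Resolve meas_zsup zw_ge0: side.

Local Close Scope ereal_scope.
Local Open Scope complex_scope.

(** * Multipliers with rough symbols *)
Section parametrized.
Context {R: realType} {d1 d2} {T1: measurableType d1} {T2: measurableType d2}
 (m2: {sigma_finite_measure set T2 -> \bar R}).
Lemma meas_fine_integral (f: T1*T2 -> \bar R): mfun f ->
 mfun (fun x=> fine (\int[m2]_y f (x, y))%E).
Proof.
move=> mf; apply: meas_fine_T.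
apply: (eq_measurable_fun (fun x=> (\int[m2]_y (f^\+)%E (x, y) - \int[m2]_y (f^\-)%E (x, y))%E)).
 by move=> x _; rewrite [in RHS]integralE; congr (_ - _)%E; apply: eq_integral=> y _; rewrite unlock.
apply: emeasurable_funB; apply: measurable_fun_fubini_tonelli_F=> //.
- exact: measurable_funepos.
- exact: measurable_funeneg.
Qed.
Hint Resolve meas_fine_integral: side.
Lemma cmeas_Cint (f: T1*T2 -> R[i]): cmeas f -> cmeas (fun x=> Cint m2 (fun y=> f (x, y))).
Proof.
move=> [a b]; split=> /=.
 by apply: (meas_fine_integral (f:= fun z=> (Re (f z))%:E)); apply/mEFinP.
by apply: (meas_fine_integral (f:= fun z=> (Im (f z))%:E)); apply/mEFinP.
Qed.

End parametrized.

Section sbound.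
Context {R: realType} {n: nat}.
Implicit Types (x y z: 'rV[R]_n) (h f g: 'rV[R]_n -> R[i]).
Lemma cmeas_FT a g: cmeas g -> cmeas (FT a g).
Proof.
move=> mg; apply: (@cmeas_Cint R _ _ _ _ (mu n) (fun z: 'rV[R]_n*'rV[R]_n=> g z.2*cexpi (a*dotp z.2 z.1))).
apply: cmeasM.
 side.
apply: cmeas_cexpi; apply: measurable_funM; first side.
side.
Qed.
Lemma coord_le_enorm x i: `|x ord0 i| <= enorm x.
Proof.
rewrite /enorm -sqrtr_sqr ler_sqrt ?dotp_ge0// /dotp (bigD1 i)//= expr2 lerDl.
by apply: sumr_ge0=> j _; rewrite -expr2 sqr_ge0.
Qed.
Lemma dotp_seg x i (d: R): dotp (x + d *: evec R i) (x + d *: evec R i) = dotp x x + 2*d*x ord0 i + d^+2.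
Proof.
have e1: (evec R i) ord0 i = 1 by rewrite mxE eqxx.
by rewrite !dotpDl !dotpDr !dotpZl !dotpZr (dotpC x (evec R i)) !dotp_evec e1; ring.
Qed.
Lemma enorm_seg_le x i (d: R): enorm (x + d *: evec R i) <= enorm x + `|d|.
Proof.
rewrite -(@ler_pXn2r _ 2) ?nnegrE ?addr_ge0 ?enorm_ge0// sqrrD !enorm_sqr dotp_seg lerD//; last by rewrite real_normK ?num_real.
rewrite lerD2l -mulr_natr -mulrA.
have h1: d*x ord0 i <= `|d| * `|x ord0 i| by rewrite -normrM ler_norm.
have:= ler_wpM2l (normr_ge0 d) (coord_le_enorm x i); lra.
Qed.
Lemma enorm_seg_ge x i (d: R): enorm x - `|d| <= enorm (x + d *: evec R i).
Proof.
rewrite lerBlDr -[in leLHS](addrK (d *: evec R i) x) -scaleNr -(normrN d).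
exact: enorm_seg_le.
Qed.

Definition ann x:= 2^-1 <= enorm x <= 2.
Definition supp_ann h:= forall x, ~~ ann x -> h x = 0.

(** Differences are controlled only along coordinate segments inside 1/4 <= |x| <= 4, a
    neighbourhood of [ann]; nothing is asked near the origin, where the symbols are singular. *)
Definition sbound (K: nat) (A: R) h:= forall x i (d: R),
 (forall u, 0 <= u <= K%:R -> 4^-1 <= enorm (x + (u*d) *: evec R i) <= 4) ->
 dbound K A `|d| (fun j: nat=> h (x + j%:R *: (d *: evec R i))).
Lemma sboundW K A B h: A <= B -> sbound K A h -> sbound K B h.
Proof. by move=> AB hA x i d s; apply: dboundW (hA x i d s). Qed.
Lemma eq_sbound K A h g: (forall x, 4^-1 <= enorm x <= 4 -> h x = g x) -> sbound K A h -> sbound K A g.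
Proof.
move=> hg hA x i d s; apply: eq_dbound (hA x i d s)=> j jK; apply: hg.
by have:= s j%:R; rewrite -scalerA; apply; rewrite ler0n ler_nat.
Qed.
Lemma sboundM K A B f g: 0 <= A -> 0 <= B -> sbound K A f -> sbound K B g ->
 sbound K (2^+K*(A*B)) (fun x=> f x * g x).
Proof. by move=> A0 B0 hf hg x i d s; apply: dboundM=> //; [exact: hf|exact: hg]. Qed.
Lemma sbound_cst K (c: R[i]): sbound K (cabs c) (fun=> c).
Proof.
move=> x i d _ [|k] j jk; first by rewrite /= mulr1.
have -> : iter k.+1 (@sdiff _) (fun=> c) j = 0.
 elim: k {jk} j=> [|k IH] j; first by rewrite /= /sdiff subrr.
 by rewrite iterS /sdiff !IH subrr.
by rewrite cabs0 mulr_ge0 ?cabs_ge0 ?exprn_ge0.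
Qed.
Lemma sboundZ K A (c: R[i]) f: sbound K A f -> sbound K (cabs c*A) (fun x=> c*f x).
Proof.
move=> hf x i d s k j jk; have -> : iter k (@sdiff _) (fun j: nat=> c*f (x + j%:R *: (d *: evec R i))) j =
  c*iter k (@sdiff _) (fun j: nat=> f (x + j%:R *: (d *: evec R i))) j.
 elim: k {jk} j=> [//|k IH] j; by rewrite !iterS /sdiff !IH mulrBr.
by rewrite cabsM -mulrA ler_wpM2l ?cabs_ge0//; apply: hf.
Qed.
Lemma sboundV K (A c: R): 0 <= A -> 0 < c -> exists2 B: R, 0 <= B & forall f,
 sbound K A f -> (forall x, 4^-1 <= enorm x <= 4 -> c <= cabs (f x)) -> sbound K B (fun x=> (f x)^-1).
Proof.
move=> A0 c0; have [B B0 hB]:= @dboundV R K A c A0 c0; exists B=> // f hf fc x i d s.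
apply: hB=> //; first exact: hf.
by move=> j jK; apply: fc; have:= s j%:R; rewrite -scalerA; apply; rewrite ler0n ler_nat.
Qed.
Lemma sbound_coord K i0: sbound K 4 (fun x=> (x ord0 i0)%:C).
Proof.
move=> x i d s [|[|k]] j jk.
- rewrite /= mulr1 cabs_real (le_trans (coord_le_enorm _ _))//.
 have:= s j%:R; rewrite -scalerA=> /(_ _)/andP[|//].
 by rewrite ler0n ler_nat; rewrite addn0 in jk.
- rewrite /= /sdiff -rmorphB cabs_real !mxE -natr1 expr1.
 rewrite (_: _ - _ = d*(i0 == i)%:R); last by ring.
 rewrite normrM; case: (i0 == i); rewrite ?normr1 ?normr0 ?mulr1 ?mulr0; last side.
 by rewrite ler_peMl// ler1n.
have -> : iter k.+2 (@sdiff _) (fun j: nat=> ((x + j%:R *: (d *: evec R i)) ord0 i0)%:C) j = 0.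
 elim: k {jk} j=> [|k IH] j; last by rewrite iterS /sdiff !IH subrr.
 by rewrite /= /sdiff -!rmorphB !mxE -!natr1 (_: _ - _ = 0) //; ring.
by rewrite cabs0 mulr_ge0 ?exprn_ge0.
Qed.
Lemma sbound_le K A h x: (0 < n)%N -> sbound K A h -> 4^-1 <= enorm x <= 4 -> cabs (h x) <= A.
Proof.
move=> n0 hA xa; have:= hA x (Ordinal n0) 0 _ 0%N 0%N (leq0n _).
by rewrite /= scale0r addr0 mulr1; apply=> u _; rewrite mulr0 scale0r addr0.
Qed.
(** Feeds [FT_decay]. A segment that meets [ann] stays inside 1/4 <= |x| <= 4 when its K steps are
    short, so [sbound] applies; on every other segment the symbol vanishes at all sample points. *)
Lemma kernel_bound (K: nat): (0 < n)%N -> exists2 C: R, 0 < C & forall a A h, a^+2 = (2 * pi)^+2 ->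
 0 <= A -> cmeas h -> sbound K A h -> supp_ann h ->
 [/\ cintg (mu n) h, forall x, cabs (h x) <= A & forall y, cabs (FT a h y) <= C*A*nu y ^- K].
Proof.
(* K steps of length at most [d0] move a point by less than 1/4. *)
move=> n0; pose d0: R:= (4*K.+1%:R)^-1.
have d00: 0 < d0 by side.
have [C [C0 hC]]:= @FT_decay R n K d0 d00.
(* An integrable majorant of the indicator of the ball of radius 4, on which [gau 1] is at least
   e^-16. *)
pose G: 'rV[R]_n -> R:= fun x=> expR 16 * gau 1 x.
have [[_ iG] _]:= @FT_gau R n 1 0 0 ltr01.
have {}iG: (mu n).-integrable setT (EFin \o G).
 have:= integrableZl measurableT (expR 16) iG; congr (_.-integrable _ _); apply/funext=> x /=.
 by rewrite cabs_real ger0_norm// expR_ge0.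
have G0 x: 0 <= G x by rewrite mulr_ge0 ?expR_ge0.
have G1 x: enorm x <= 4 -> 1 <= G x.
 move=> x4; rewrite /G /gau -expRD -[leLHS]expR0 ler_expR mul1r subr_ge0 -enorm_sqr.
 by have:= enorm_ge0 x; nra.
pose V:= (\int[mu n]_x (G x)%:E)%E.
have V0: (0 <= V)%E by side.
have Vf: V \is a fin_num by exact: integrable_fin_num iG.
pose v:= fine V + 1.
have v0: 0 < v by rewrite ltr_wpDl// fine_ge0.
have Vv: (V <= v%:E)%E by rewrite -(fineK Vf) lee_fin lerDl.
have mG: mfun (EFin \o G) by exact: measurable_int iG.
exists (C * v)=> [|a A h a2 A0 mh hA hs]; first side.
have h4 x: 4 < enorm x -> h x = 0.
 by move=> x4; apply: hs; apply/negP=> /andP[_ x2]; lra.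
have hle x: cabs (h x) <= A.
 have [xa|xa]:= boolP (ann x); last by rewrite hs// cabs0.
 by apply: sbound_le hA _=> //; case/andP: xa=> *; apply/andP; split; lra.
have hG x: cabs (h x) <= A*G x.
 have [x4|x4]:= leP (enorm x) 4; last by rewrite h4// cabs0 mulr_ge0.
 by rewrite (le_trans (hle x))// ler_peMr// G1.
have ih: cintg (mu n) h.
 by apply: (cintgP mh _ hG); exact: (integrableZl measurableT A iG).
split=> // y; rewrite -(mulrA C v A) (mulrC v A).
have intle (f: 'rV[R]_n -> R[i]) (B: R): cmeas f -> 0 <= B -> (forall x, cabs (f x) <= B*G x) ->
  (\int[mu n]_x (cabs (f x))%:E <= (B * v)%:E)%E.
 move=> mf B0 fB; le_via (\int[mu n]_x (B%:E*(G x)%:E))%E.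
  apply: le_integral_ge0; try side.
 rewrite ge0_integralZl//; first by rewrite EFinM; apply: lee_wpmul2l.
 side.
apply: hC=> //; first side.
 exact: intle.
move=> i d dd0; rewrite mulrAC; apply: intle; try side.
- by have []:= cintg_fdiff (d *: evec R i) K ih.
move=> x; have:= iter_fdiff_seq h (d *: evec R i) K x 0; rewrite scale0r addr0=> ->.
have K0: 0 <= A * `|d| ^+ K by side.
have Kd: K%:R * `|d| <= 4^-1.
 have h1: K.+1%:R * `|d| <= 4^-1.
  by have:= ler_wpM2l (ler0n R K.+1) dd0; rewrite /d0 invfM mulrCA divff ?mulr1// pnatr_eq0.
 by apply: le_trans h1; rewrite ler_wpM2r// ler_nat.
have [/existsP[j xj]|]:= boolP [exists j: 'I_K.+1, ann (x + (j: nat)%:R *: (d *: evec R i))].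
 have jK: (j <= K)%N by rewrite -ltnS.
 have seg u: 0 <= u <= K%:R -> 4^-1 <= enorm (x + (u*d) *: evec R i) <= 4.
  move=> /andP[u0 uK]; set p:= x + (j: nat)%:R *: (d *: evec R i) in xj.
  have -> : x + (u*d) *: evec R i = p + ((u - (j: nat)%:R)*d) *: evec R i.
   by rewrite /p -addrA scalerA -scalerDl; congr (_ + _ *: _); ring.
  have h1:= enorm_seg_le p i ((u - (j: nat)%:R)*d).
  have h2:= enorm_seg_ge p i ((u - (j: nat)%:R)*d).
  have h3: `|(u - (j: nat)%:R)*d| <= 4^-1.
   rewrite normrM; apply: le_trans Kd; rewrite ler_wpM2r// ler_norml.
   have j0: 0 <= (j: nat)%:R :> R by exact: ler0n.
   have j1: (j: nat)%:R <= K%:R :> R by rewrite ler_nat.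
   by apply/andP; split; lra.
  case/andP: xj=> p1 p2; apply/andP; split; lra.
 le_via (A * `|d| ^+ K).
  by have:= hA x i d seg K 0%N; rewrite add0n leqnn; exact.
 rewrite ler_peMr// G1//; have:= seg 0; rewrite mul0r scale0r addr0 lexx ler0n=> /(_ isT)/andP[//].
rewrite negb_exists=> /forallP hz.
rewrite (@eq_iter_sdiff _ K _ (fun=> 0)); last first.
 by move=> j /andP[_]; rewrite add0n -ltnS=> jK; apply: hs; exact: (hz (Ordinal jK)).
rewrite (_: iter _ _ _ _ = 0); first by rewrite cabs0 mulr_ge0.
elim: (K) 0%N=> [//|k IH] j; by rewrite iterS /sdiff !IH subrr.
Qed.

Definition rc h x:= forall z,
 (fun k: nat=> Re (h (x - k.+1%:R^-1 *: z))) @ \oo --> Re (h x) /\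
 (fun k: nat=> Im (h (x - k.+1%:R^-1 *: z))) @ \oo --> Im (h x).
Lemma rcM f g x: rc f x -> rc g x -> rc (fun x=> f x * g x) x.
Proof.
move=> hf hg z; have [f1 f2]:= hf z; have [g1 g2]:= hg z.
rewrite ReM ImM; under eq_fun do rewrite ReM; split.
 by apply: cvgB; exact: cvgM.
under eq_fun do rewrite ImM.
by apply: cvgD; exact: cvgM.
Qed.
Lemma rc_real (r: 'rV[R]_n -> R) x :
 (forall z, (fun k: nat=> r (x - k.+1%:R^-1 *: z)) @ \oo --> r x) -> rc (fun x=> (r x)%:C) x.
Proof. by move=> hr z; split; [exact: hr|exact: cvg_cst]. Qed.
Lemma ray_scale (t: R) x z (k: nat): t *: (x - k.+1%:R^-1 *: z) = t *: x - k.+1%:R^-1 *: (t *: z).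
Proof. by rewrite scalerBr !scalerA [t*_]mulrC. Qed.
Lemma rc_scale h (t: R) x: rc h (t *: x) -> rc (fun x=> h (t *: x)) x.
Proof.
move=> hc z; have [h1 h2]:= hc (t *: z); split.
 by rewrite (_: (fun k: nat=> _) = (fun k: nat=> Re (h (t *: x - k.+1%:R^-1 *: (t *: z)))))//; apply/funext=> k; rewrite ray_scale.
by rewrite (_: (fun k: nat=> _) = (fun k: nat=> Im (h (t *: x - k.+1%:R^-1 *: (t *: z)))))//; apply/funext=> k; rewrite ray_scale.
Qed.
Lemma cvg_ray_dotp x y z: (fun k: nat=> dotp y (x - k.+1%:R^-1 *: z)) @ \oo --> dotp y x.
Proof.
rewrite (_: (fun k: nat=> _) = (fun k: nat=> dotp y x - k.+1%:R^-1*dotp y z)); last first.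
 by apply/funext=> k; rewrite dotpDr dotpNr dotpZr.
rewrite -[X in _ --> X]subr0; apply: cvgB; first exact: cvg_cst.
by rewrite -(mul0r (dotp y z)); apply: cvgM; [exact: cvg_invS|exact: cvg_cst].
Qed.
Lemma cvg_ray_sqr x z: (fun k: nat=> dotp (x - k.+1%:R^-1 *: z) (x - k.+1%:R^-1 *: z)) @ \oo --> dotp x x.
Proof.
rewrite (_: (fun k: nat=> _) = (fun k: nat=> dotp x (x - k.+1%:R^-1 *: z) - k.+1%:R^-1*dotp z (x - k.+1%:R^-1 *: z))); last first.
 by apply/funext=> k; rewrite dotpDl dotpNl dotpZl.
rewrite -[X in _ --> X]subr0; apply: cvgB; first exact: cvg_ray_dotp.
by rewrite -(mul0r (dotp z x)); apply: cvgM; [exact: cvg_invS|exact: cvg_ray_dotp].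
Qed.
Lemma cvg_comp_cont (u: nat -> R) (l: R) (g: R -> R): continuous_at l g -> u @ \oo --> l ->
 (fun k=> g (u k)) @ \oo --> g l.
Proof. by move=> cg ul; exact: (continuous_cvg _ cg ul). Qed.
Lemma cvg_ray_enorm x z: (fun k: nat=> enorm (x - k.+1%:R^-1 *: z)) @ \oo --> enorm x.
Proof. apply: (@cvg_comp_cont (fun k: nat=> dotp (x - k.+1%:R^-1 *: z) (x - k.+1%:R^-1 *: z)) _ Num.sqrt).
 exact: sqrt_continuous.
exact: cvg_ray_sqr. Qed.
Lemma rc_FT a g x: cintg (mu n) g -> rc (FT a g) x.
Proof.
move=> gi z; apply: (Cint_dominated (h:= fun y=> cabs (g y))); try side.
- by case: gi.
- by move=> k y; rewrite cabsM cabs_cexpi mulr1.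
- move=> y; rewrite ReM; under eq_fun do rewrite ReM.
 apply: cvgB; (apply: cvgM; first exact: cvg_cst).
  apply: (@cvg_comp_cont (fun k=> a*dotp y (x - k.+1%:R^-1 *: z)) _ cos); first exact: continuous_cos.
  by apply: cvgM; [exact: cvg_cst|exact: cvg_ray_dotp].
 apply: (@cvg_comp_cont (fun k=> a*dotp y (x - k.+1%:R^-1 *: z)) _ sin); first exact: continuous_sin.
 by apply: cvgM; [exact: cvg_cst|exact: cvg_ray_dotp].
- move=> y; rewrite ImM; under eq_fun do rewrite ImM.
 apply: cvgD; (apply: cvgM; first exact: cvg_cst).
  apply: (@cvg_comp_cont (fun k=> a*dotp y (x - k.+1%:R^-1 *: z)) _ sin); first exact: continuous_sin.
  by apply: cvgM; [exact: cvg_cst|exact: cvg_ray_dotp].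
 apply: (@cvg_comp_cont (fun k=> a*dotp y (x - k.+1%:R^-1 *: z)) _ cos); first exact: continuous_cos.
 by apply: cvgM; [exact: cvg_cst|exact: cvg_ray_dotp].
Qed.
Lemma rc_supp f g: (forall x, 4^-1 < enorm x -> rc f x) -> (forall x, 4^-1 < enorm x -> rc g x) -> supp_ann g ->
 raycont (fun x=> f x * g x).
Proof.
move=> hf hg sg x; rewrite -/(rc _ x).
have [x4|x4]:= ltP 4^-1 (enorm x); first by apply: rcM; [exact: hf|exact: hg].
have g0 y: enorm y < 2^-1 -> f y * g y = 0.
 by move=> y2; rewrite sg ?mulr0//; apply/negP=> /andP[h _]; lra.
move=> z; have xh: enorm x < 2^-1 by lra.
have ev: \forall k \near \oo, enorm (x - k.+1%:R^-1 *: z) < 2^-1.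
 by have /cvgr_lt:= @cvg_ray_enorm x z; apply.
rewrite (g0 x xh); split; apply: cvg_near_cst; near=> k; rewrite g0//; near: k; exact: ev.
Unshelve. all: by end_near. Qed.
Lemma meas_point0: measurable [set (0: 'rV[R]_n)].
Proof.
have -> : [set (0: 'rV[R]_n)] = @l1 R n @^-1` [set 0%R].
 apply/seteqP; split=> [_ ->|x /= x0]; first by rewrite /= /l1 big1// => i _; rewrite mxE normr0.
 apply/rowP=> i; rewrite mxE; apply/normr0_eq0/eqP; move/eqP: x0.
 by rewrite psumr_eq0// => /allP/(_ i); rewrite mem_index_enum; apply.
by rewrite -[X in measurable X]setTI; apply: meas_l1.
Qed.
(** Dilation by 2 fixes the origin and multiplies integrals by 2^-n < 1; a finite mass equal to 2^-n
    times itself is 0. *)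
Lemma mu_set0: (0 < n)%N -> (\int[mu n]_x (\1_[set (0: 'rV[R]_n)] x: R)%:E = 0)%E.
Proof.
move=> n0; have m0:= meas_point0.
have mi: mfun (fun x: 'rV[R]_n=> (\1_[set (0: 'rV[R]_n)] x: R)%:E).
 side.
have i0 x: (0 <= (\1_[set (0: 'rV[R]_n)] x: R)%:E)%E by side.
set I:= (\int[mu n]_x _)%E.
have If: I \is a fin_num.
 rewrite ge0_fin_numE; last side.
 apply: le_lt_trans (@ekI_lty R n); apply: le_integral_ge0=> //.
  by have:= @meas_ekE R n 1; under eq_fun do rewrite /ek expr1n !mul1r.
 move=> x; rewrite lee_fin indicE; case: (boolP (x \in _))=> [|_]; last side.
 by rewrite inE=> ->; rewrite /l1 big1 ?oppr0 ?expR0// => i _; rewrite mxE normr0.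
have:= @ge0_integral_mu_scale R n 2 _ (ltr0n R 2) mi i0.
rewrite (eq_integral (fun x=> (\1_[set (0: 'rV[R]_n)] x: R)%:E)); last first.
 move=> x _; rewrite !indicE; congr (_%:R)%:E; congr nat_of_bool; apply/idP/idP; rewrite !inE/=.
  by move=> /eqP; rewrite scaler_eq0 pnatr_eq0/= => /eqP.
 by move=> ->; rewrite scaler0.
rewrite -/I -(fineK If) -EFinM=> -[] /eqP; rewrite -subr_eq0 -{1}[fine I]mul1r -mulrBl mulf_eq0.
case/orP=> [|/eqP -> //]; rewrite subr_eq0 eq_sym=> /eqP h; exfalso.
have: (2 ^- n: R) < 1 by rewrite invf_lt1 ?exprn_gt0// exprn_egt1// ?ltr1n// -lt0n.
by rewrite h ltxx.
Qed.
Lemma eq_Cint_off0 f g: (0 < n)%N -> cmeas f -> cmeas g -> (forall x, x != 0 -> f x = g x) -> Cint (mu n) f = Cint (mu n) g.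
Proof.
move=> n0 [f1 f2] [g1 g2] fg.
have ae (p: R[i] -> R): mfun (p \o f) -> mfun (p \o g) ->
 (\int[mu n]_x (p (f x))%:E = \int[mu n]_x (p (g x))%:E)%E.
 move=> mf mg; apply: ae_eq_integral=> //; [side|side|].
 exists [set 0]; split.
 - exact: meas_point0.
 - by rewrite -(mu_set0 n0) integral_indic ?setIT//; exact: meas_point0.
 - move=> x /=; apply: contra_notP=> /eqP x0 _; by rewrite fg.
by apply: complex_ext=> /=; rewrite ae.
Qed.
End sbound.
Hint Resolve cmeas_FT: side.

(** * Expressing one multiplier through the dyadic pieces of another *)

Section transfer.
Context {R: realType} {n: nat}.
Hypothesis n0: (0 < n)%N.
Implicit Types (x y z xi: 'rV[R]_n) (A B Q Phi F: 'rV[R]_n -> R[i]).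

Definition etk (K: nat) (r: R) x: R:= r^+n*nu (r *: x) ^- K.
Lemma etk_ge0 K r x: 0 < r -> 0 <= etk K r x.
Proof. by move=> r0; rewrite mulr_ge0 ?invr_ge0 ?exprn_ge0 ?(ltW r0)// ltW// nu_gt0. Qed.
Hint Resolve etk_ge0: side.
Lemma meas_etk K r: mfun (etk K r).
Proof. by apply: measurable_funM; [side|exact: meas_nuV]. Qed.
Hint Resolve meas_etk: side.
Lemma etk_le_eta K r x: 0 < r -> (n < K)%N -> etk K r x <= eta r x.
Proof.
move=> r0 nK; apply: ler_wpM2l; first side.
by rewrite lef_pV2 ?posrE ?exprn_gt0 ?nu_gt0// ler_weXn2l// nu_ge1.
Qed.
Lemma integrable_eta r: 0 < r -> (mu n).-integrable setT (EFin \o (@eta R n r)).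
Proof.
move=> r0; apply/integrableP; split; first by apply/mEFinP; exact: meas_eta.
under eq_integral=> x _ do rewrite /= ger0_norm ?eta_ge0//.
by rewrite integral_eta// etaI_lty.
Qed.
Lemma cintg_etk K r (C: R) (h: 'rV[R]_n -> R[i]): 0 < r -> (n < K)%N -> 0 <= C -> cmeas h ->
 (forall x, cabs (h x) <= C*etk K r x) -> cintg (mu n) h.
Proof.
move=> r0 nK C0 mh hC; apply: (@cintgP _ _ _ _ _ (fun x=> C*eta r x))=> //.
 exact: (integrableZl measurableT C (integrable_eta r0)).
by move=> x; rewrite (le_trans (hC x))// ler_wpM2l// etk_le_eta.
Qed.
Lemma cintg_scale (h: 'rV[R]_n -> R[i]) (c: R): 0 < c -> cintg (mu n) h ->
 cintg (mu n) (fun x=> h (c *: x)).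
Proof.
move=> c0 [mh /integrableP[mh2 hi]]; have mc: mfun (fun x: 'rV[R]_n=> c *: x).
 by apply: meas_scaleV; [side|side].
split; first side.
apply/integrableP; split; first side.
rewrite (@ge0_integral_mu_scale R n c (fun x=> `|(cabs (h x))%:E|)%E)//; last exact: mcomp.
by apply: lte_mul_pinfty=> //; rewrite lee_fin invr_ge0 exprn_ge0 // ltW.
Qed.
Lemma FT_scale (a c: R) (g: 'rV[R]_n -> R[i]) y: 0 < c -> cintg (mu n) g ->
 FT a (fun x=> g (c *: x)) y = (c ^- n)%:C*FT a g (c^-1 *: y).
Proof.
move=> c0 gi; rewrite /FT -(Cint_scale c0); last exact: cintg_char.
apply: eq_Cint=> x; congr (_*cexpi _).
by rewrite dotpZl dotpZr mulrA -[in RHS]mulrA; congr (a*_); rewrite mulrA divff ?mul1r// gt_eqF.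
Qed.

(** The modulus of A(tD) applied to the function whose Fourier transform is F. *)
Definition Umod A F (t: R) x: R:= cabs (FT (2 * pi) (fun xi=> A (t *: xi)*F xi) x).

(** [kap tau] measures the dilate A(tau xi) on the unit annulus. Its decay for small and for large
    tau is later what makes the sum over scale gaps converge. *)
Definition symbol (K: nat) A (kap: R -> R) (M: R) :=
 [/\ cmeas A, forall x, cabs (A x) <= M, forall x, 0 < enorm x -> rc A x &
   forall tau, 0 < tau -> 0 <= kap tau /\ sbound K (kap tau) (fun xi=> A (tau *: xi))].
Lemma tzN j: tz (- j) = (tz j)^-1 :> R.
Proof. by rewrite /tz invr_expz. Qed.
Lemma enormZ (t: R) x: 0 <= t -> enorm (t *: x) = t*enorm x.
Proof. by move=> t0; rewrite /enorm dotpZl dotpZr mulrA sqrtrM ?mulr_ge0// -expr2 sqrtr_sqr ger0_norm. Qed.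
Lemma sop_conv_swap (k: 'rV[R]_n -> R) (u: 'rV[R]_n -> \bar R) x: mfun k -> mfun u ->
 (\int[mu n]_y ((k y)%:E*u (x - y)%R) = sop k u x)%E.
Proof.
move=> mk mu0; have ms: mfun (fun y: 'rV[R]_n=> x - y).
 by apply: meas_subV; [side|side].
have mk': mfun (fun y=> (k y)%:E) by side.
rewrite /sop -[RHS]integral_muN; last first.
 side.
rewrite -[RHS](integral_mu_shift (- x)); last first.
 apply: emeasurable_funM; last by apply: (mcomp mu0); apply: meas_oppV.
 apply: (mcomp mk'); apply: meas_subV; first side.
 side.
apply: eq_integral=> y _; have -> : x - - (y - x) = y by rewrite opprK addrC subrK.
by rewrite opprB.
Qed.

(* One dyadic block: [A(t xi) Q(2^-j xi)] is a multiplier whose kernel is concentrated at scale [2^-j]. *)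
Lemma block_bound (K: nat): (n < K)%N -> exists2 C: R, 0 < C &
 forall A kap M B MB Q CQ F (t: R) x (c c' th: R), symbol K A kap M ->
 cmeas B -> (forall x, cabs (B x) <= MB) -> cmeas Q -> (forall x, 4^-1 < enorm x -> rc Q x) -> supp_ann Q ->
 0 <= CQ -> sbound K CQ Q -> cintg (mu n) F -> 0 < t -> 0 < c -> c' = c^-1 ->
 ((cabs (FT (2 * pi) (fun xi=> A (t *: xi)*Q (c' *: xi)*B ((th*c') *: xi)*F xi) x))%:E <=
 (C*CQ)%:E*((kap (t*c))%:E*sop (etk K c) (fun y=> (Umod B F (th*c') y)%:E) x))%E.
Proof.
move=> nK; have [C C0 hC]:= @kernel_bound R n K n0.
exists (2*(C*2^+K)); first side.
move=> A kap M B MB Q CQ F t x c c' th [mA AM rA sA] mB BM mQ rQ sQ CQ0 bQ Fi t0 c0 cE.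
have c'0: 0 < c' by rewrite cE invr_gt0.
have tc0: 0 < t*c by side.
have [k0 sk]:= sA _ tc0.
pose a: R:= 2 * pi.
have a2: a^+2 = (2 * pi)^+2 by [].
have mscale (s: R): mfun (fun x: 'rV[R]_n=> s *: x).
 by apply: meas_scaleV; [side|side].
pose g xi:= A ((t*c) *: xi)*Q xi.
have mg: cmeas g by apply: cmeasM=> //; side.
have sg: supp_ann g by move=> xi hxi; rewrite /g sQ// mulr0.
have bg: sbound K (2^+K*(kap (t*c)*CQ)) g by apply: sboundM.
have Cg0: 0 <= 2^+K*(kap (t*c)*CQ) by side.
have [gi gle gF]:= hC a _ g a2 Cg0 mg bg sg.
have rg: raycont g.
 apply: rc_supp=> // y hy; apply: rc_scale; apply: rA; rewrite enormZ ?mulr_gt0 ?(ltW tc0)//.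
 by apply: lt_trans hy; rewrite invr_gt0.
pose h xi:= g (c' *: xi).
have hi: cintg (mu n) h by exact: cintg_scale.
have rh: raycont h by move=> y; apply: rc_scale; exact: rg.
pose D:= C*(2^+K*(kap (t*c)*CQ)).
have D0: 0 <= D by side.
have mFh: cmeas (FT a h) by side.
have hF y: cabs (FT a h y) <= D*etk K c y.
 rewrite /h FT_scale// cabsM cabs_real ger0_norm ?invr_ge0 ?exprn_ge0 ?(ltW c'0)//.
 rewrite cE invrK exprVn invrK /etk mulrCA ler_wpM2l ?exprn_ge0 ?(ltW c0)//.
have Fhi: cintg (mu n) (FT a h) by exact: (cintg_etk c0 nK D0).
have hinv: forall xi, FT (- a) (FT a h) xi = h xi:= (FT_inversion a2 hi (fun y=> gle _) rh Fhi).
pose G xi:= B ((th*c') *: xi)*F xi.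
have Gi: cintg (mu n) G.
 by apply: (cintgMl_bounded Fi)=> [|y]; [side|exact: BM].
have cv:= conv_FT a x Fhi Gi.
have -> : FT (2 * pi) (fun xi=> A (t *: xi)*Q (c' *: xi)*B ((th*c') *: xi)*F xi) x =
  Cint (mu n) (fun y=> FT a h y*FT a G (x - y)).
 have tcc: t*c*c' = t by rewrite cE mulfK// gt_eqF.
 rewrite cv; apply: eq_Cint=> xi; rewrite hinv /h /g /G scalerA tcc dotpC.
 by rewrite -!mulrA.
have mFG: cmeas (FT a G) by apply: cmeas_FT; case: Gi.
have FGle: exists MG, forall y, cabs (FT a G y) <= MG.
 exists (fine (2%:E*\int[mu n]_x (cabs (G x))%:E)%E)=> y.
 have Gci: cintg (mu n) (fun x=> G x*cexpi (a*dotp x y)) by exact: cintg_char.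
 have:= cabs_Cint Gci; rewrite -/(FT a G y).
 under eq_integral=> z _ do rewrite cabsM cabs_cexpi mulr1.
 have If: (\int[mu n]_x (cabs (G x))%:E)%E \is a fin_num by case: Gi=> _ /integrable_fin_num; apply.
 by rewrite -(fineK If) -EFinM lee_fin.
have [MG hMG]:= FGle.
have ms: mfun (fun y: 'rV[R]_n=> x - y).
 by apply: meas_subV; [side|side].
have Ci: cintg (mu n) (fun y=> FT a h y*FT a G (x - y)).
 by apply: (cintgM_bounded Fhi)=> [|y]; [exact: (cmeas_comp mFG ms)|exact: hMG].
apply: (le_trans (cabs_Cint Ci)).
have mU: mfun (fun y=> (Umod B F (th*c') y)%:E).
 by apply/mEFinP; exact: cmeas_cabs.
rewrite -sop_conv_swap//; last side.
rewrite (_: (2*(C*2^+K)*CQ)%:E = (2*(C*2^+K*CQ))%:E)%E; last by congr EFin; ring.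
rewrite EFinM -muleA; apply: lee_wpmul2l; first side.
rewrite muleA -EFinM -ge0_integralZl//; try side; last 2 first.
- by apply: emeasurable_funM; [apply/mEFinP; exact: meas_etk|exact: (mcomp mU ms)].
- by move=> y _; rewrite -EFinM lee_fin mulr_ge0 ?cabs_ge0// etk_ge0.
apply: le_integral_ge0; try side.
- apply: measurable_funeM; apply: emeasurable_funM; first by apply/mEFinP; exact: meas_etk.
 exact: (mcomp mU ms).
- move=> y; rewrite -!EFinM lee_fin cabsM mulrA; apply: ler_wpM2r; first side.
 apply: (le_trans (hF y)); rewrite ler_wpM2r ?etk_ge0// /D le_eqVlt; apply/orP; left; apply/eqP; ring.
Qed.
Lemma zw_window_sum (N: nat) (a: int -> \bar R): (forall j, 0 <= a j)%E ->
 (\sum_(k < (N + N).+1) a (k%:Z - N%:Z)%R <= zsum a)%E.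
Proof.
(* [zcut N.+1] covers -N-1 <= j <= N, one term more than the symmetric window. *)
move=> a0; le_via (zsum (zcut N.+1 a)); last first.
 by apply: le_zsum=> j; exact: zcut_le.
rewrite zsum_zcut// addSn addnS [leRHS]big_ord_recl.
have E (k: nat): (k.+1%:Z - N.+1%:Z = k%:Z - N%:Z)%R by rewrite !intS; ring.
le_via (\sum_(k < (N + N).+1) a ((lift ord0 k: nat)%:Z - N.+1%:Z)%R)%E; last by rewrite leeDr.
by apply: le_of_eq; apply: eq_bigr=> k _; congr a; rewrite -E.
Qed.
Lemma tzD i j: tz (i + j) = tz i*tz j :> R.
Proof. by rewrite /tz expfzDr// pnatr_eq0. Qed.
Lemma tz_le4 d: tz d <= 4 :> R -> d <= 2.
Proof.
move=> h; rewrite -(@ler_eXz2l R 2) ?ltr1n//; apply: le_trans h _.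
by rewrite -exprnP expr2 -natrM.
Qed.
Lemma zw_half_ge d: d <= 2 -> - 2 <= d -> 1 <= 4*zw (2^-1: R) d.
Proof.
move=> d1 d2; rewrite /zw exprVn -ler_pdivrMr ?invr_gt0 ?exprn_gt0// mul1r invrK.
rewrite (_: 4 = 2^+2); last by rewrite expr2 -natrM.
by rewrite ler_eXn2l ?ltr1n//; lia.
Qed.

(* At a fixed frequency at most a bounded number of dyadic annuli are hit, whence a uniform bound on the partial sums. *)
Lemma partial_sum_bound Phi (MP: R): supp_ann Phi -> (forall x, cabs (Phi x) <= MP) -> exists MS: R,
 forall N xi, cabs (\sum_(k < (N + N).+1) Phi (tz (- (k%:Z - N%:Z)) *: xi)^+2) <= MS.
Proof.
move=> sP PM; have MP0: 0 <= MP by exact: le_trans (cabs_ge0 _) (PM 0).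
have h1: (2^-1: R) < 1 by rewrite invf_lt1// ltr1n.
have Sf: zsum (fun j=> (zw (2^-1: R) j)%:E) \is a fin_num.
 by rewrite ge0_fin_numE ?zsum_zw// zsum_ge0// => j; rewrite lee_fin zw_ge0// ltW.
exists (MP^+2*4*fine (zsum (fun j=> (zw (2^-1: R) j)%:E)))=> N xi.
rewrite -lee_fin (EFinM (MP^+2*4)) fineK//.
pose a (j: int): \bar R:= (cabs (Phi (tz (- j) *: xi))^+2)%:E.
have a0 j: (0 <= a j)%E by side.
le_via (zsum a).
 apply: le_trans (zw_window_sum N a0); rewrite /a sumEFin lee_fin.
 by apply: le_trans (cabs_sum _ _ _) _; apply: ler_sum=> k _; rewrite cabsX.
have [[j1 hj1]|nj]:= pselect (exists j, ann (tz (- j) *: xi)); last first.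
 rewrite (_: zsum a = 0%E).
  by rewrite mule_ge0 ?lee_fin ?mulr_ge0 ?exprn_ge0// zsum_ge0// => j; rewrite lee_fin zw_ge0// ltW.
 rewrite -[RHS](@zsum_eq0 R); apply: eq_zsum=> j; rewrite /a sP ?cabs0 ?expr0n//.
 by apply/negP=> hj; apply: nj; exists j.
rewrite -(zsum_shift (fun j=> (zw (2^-1: R) j)%:E) (- j1)) -zsumZ; try side; last first.
- by move=> j; rewrite lee_fin zw_ge0// ltW.
apply: le_zsum=> j; rewrite /a -EFinM lee_fin.
have [hj|hj]:= boolP (ann (tz (- j) *: xi)); last first.
 by rewrite sP// cabs0 expr0n/= !mulr_ge0 ?exprn_ge0 ?zw_ge0// ltW.
have hd: 1 <= 4*zw (2^-1: R) (j - j1).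
 have e0:= enorm_ge0 xi.
 move: hj hj1; rewrite /ann !enormZ ?(ltW (tz_gt0 _))// => /andP[a1 a2] /andP[b1 b2].
 have key i1 i2: 2^-1 <= tz (- i1)*enorm xi -> tz (- i2)*enorm xi <= 2 -> i1 - i2 <= 2.
  move=> c1 c2; apply: tz_le4.
  have e1: tz (i1 - i2)*(tz (- i1)*enorm xi) = tz (- i2)*enorm xi.
   by rewrite mulrA -tzD; congr (tz _*_); ring.
  have t0:= @tz_gt0 R (i1 - i2); have:= ler_wpM2l (ltW t0) c1; rewrite e1=> h; lra.
 apply: zw_half_ge; first exact: key a1 b2.
 by have:= key _ _ b1 a2; lia.
le_via (MP^+2); first by rewrite lerXn2r ?nnegrE ?cabs_ge0.
by rewrite -mulrA ler_peMr ?exprn_ge0.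
Qed.

Definition lp_partition Phi:= [/\ cmeas Phi, supp_ann Phi, exists M, forall x, cabs (Phi x) <= M &
 forall xi, xi != 0 ->
 ((fun N: nat=> Re (\sum_(k < (N + N).+1) Phi (tz (- (k%:Z - N%:Z)) *: xi)^+2)) @ \oo --> (1: R)) /\
 ((fun N: nat=> Im (\sum_(k < (N + N).+1) Phi (tz (- (k%:Z - N%:Z)) *: xi)^+2)) @ \oo --> (0: R))].
(** Inserts the partition of unity: in the k-th block Phi^2 is replaced by the product of Q and the
    dilated B, so that [block_bound] expresses it through B at scale 2^-k. The uniform bound on
    partial sums justifies the limit by dominated convergence. *)
Lemma transfer (K: nat): (n < K)%N -> exists2 C: R, 0 < C &
 forall A kap M B MB Q CQ Phi F (t th: R) x, symbol K A kap M ->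
 cmeas B -> (forall x, cabs (B x) <= MB) -> cmeas Q -> (forall x, 4^-1 < enorm x -> rc Q x) -> supp_ann Q ->
 0 <= CQ -> sbound K CQ Q -> lp_partition Phi -> (forall xi, Q xi*B (th *: xi) = Phi xi^+2) ->
 cintg (mu n) F -> 0 < t -> 0 < th ->
 ((Umod A F t x)%:E <= (C*CQ)%:E *
  zsum (fun j=> (kap (t*tz j))%:E*sop (etk K (tz j)) (fun y=> (Umod B F (th*tz (- j)) y)%:E) x))%E.
Proof.
move=> nK; have [C C0 hC]:= block_bound nK; exists C=> //.
move=> A kap M B MB Q CQ Phi F t th x sA mB BM mQ rQ sQ CQ0 bQ [mP sP [MP PM] limP] QB Fi t0 th0.
set Z:= zsum _.
have Z0: (0 <= Z)%E.
 apply: zsum_ge0=> j; rewrite mule_ge0//.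
  by case: sA=> _ _ _ /(_ (t*tz j)); rewrite mulr_gt0 ?tz_gt0// lee_fin=> /(_ isT)[].
 by apply: sop_ge0=> [y|y]; [side|side].
have [mA AM _ _]:= sA.
have mscale (s: R): mfun (fun x: 'rV[R]_n=> s *: x).
 by apply: meas_scaleV; [side|side].
pose S N xi:= \sum_(k < (N + N).+1) Phi (tz (- (k%:Z - N%:Z)) *: xi)^+2.
have [MS hS]:= partial_sum_bound sP PM.
have mS N: cmeas (S N).
 by apply: cmeas_sum=> k; apply: cmeasM; side.
pose G xi:= A (t *: xi)*F xi*cexpi (2 * pi*dotp xi x).
have AFi: cintg (mu n) (fun xi=> A (t *: xi)*F xi).
 by apply: (cintgMl_bounded Fi)=> [|y]; [side|exact: AM].
have Gi: cintg (mu n) G by exact: cintg_char.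
have [mG _]:= Gi.
have GSi N: cintg (mu n) (fun xi=> S N xi*G xi).
 by apply: (cintgMl_bounded Gi)=> [//|y]; exact: hS.
have bound N: ((cabs (Cint (mu n) (fun xi=> S N xi*G xi)))%:E <= (C*CQ)%:E*Z)%E.
 rewrite (_: (fun xi=> S N xi*G xi) = (fun xi=> \sum_(k < (N + N).+1)
   (A (t *: xi)*Q (tz (- (k%:Z - N%:Z)) *: xi)*B ((th*tz (- (k%:Z - N%:Z))) *: xi)*F xi*cexpi (2 * pi*dotp xi x)))); last first.
  apply/funext=> xi; rewrite /S mulr_suml; apply: eq_bigr=> k _.
  by rewrite -QB /G scalerA; ring.
 have Ti (k: nat): cintg (mu n) (fun xi =>
   A (t *: xi)*Q (tz (- (k%:Z - N%:Z)) *: xi)*B ((th*tz (- (k%:Z - N%:Z))) *: xi)*F xi*cexpi (2 * pi*dotp xi x)).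
  have -> : (fun xi=> A (t *: xi)*Q (tz (- (k%:Z - N%:Z)) *: xi)*B ((th*tz (- (k%:Z - N%:Z))) *: xi)*F xi*cexpi (2 * pi*dotp xi x)) =
   (fun xi=> Phi (tz (- (k%:Z - N%:Z)) *: xi)^+2*G xi).
   by apply/funext=> xi; rewrite -QB /G scalerA; ring.
  apply: (@cintgMl_bounded _ _ _ _ _ _ (MP^+2))=> //.
   by apply: cmeasM; side.
  by move=> y; rewrite cabsX lerXn2r ?nnegrE ?cabs_ge0// (le_trans (cabs_ge0 _) (PM 0)).
 have [_ ->]:= @Cint_sum _ _ _ (mu n) _ (index_enum _) (fun (k: 'I_(N + N).+1) xi =>
   A (t *: xi)*Q (tz (- (k%:Z - N%:Z)) *: xi)*B ((th*tz (- (k%:Z - N%:Z))) *: xi)*F xi*cexpi (2 * pi*dotp xi x)) (fun k=> Ti k).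
 le_via (\sum_(k < (N + N).+1) (C*CQ)%:E*((kap (t*tz (k%:Z - N%:Z)))%:E *
   sop (etk K (tz (k%:Z - N%:Z))) (fun y=> (Umod B F (th*tz (- (k%:Z - N%:Z))) y)%:E) x))%E.
  le_via (\sum_(k < (N + N).+1) (cabs (FT (2 * pi) (fun xi =>
   A (t *: xi)*Q (tz (- (k%:Z - N%:Z)) *: xi)*B ((th*tz (- (k%:Z - N%:Z))) *: xi)*F xi) x))%:E)%E.
   by rewrite sumEFin lee_fin; exact: cabs_sum.
  apply: lee_sum=> k _; apply: (hC A kap M B MB Q CQ F t x (tz (k%:Z - N%:Z)) (tz (- (k%:Z - N%:Z))) th)=> //.
   side.
  exact: tzN.
 pose b j: \bar R:= ((C*CQ)%:E*((kap (t*tz j))%:E*sop (etk K (tz j)) (fun y=> (Umod B F (th*tz (- j)) y)%:E) x))%E.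
 have b0' j: (0 <= (kap (t*tz j))%:E*sop (etk K (tz j)) (fun y=> (Umod B F (th*tz (- j)) y)%:E) x)%E.
  rewrite mule_ge0//.
   by case: sA=> _ _ _ /(_ (t*tz j)); rewrite mulr_gt0 ?tz_gt0// lee_fin=> /(_ isT)[].
  by apply: sop_ge0=> [y|y]; [side|side].
 have CC: 0 <= C*CQ by side.
 rewrite /Z -zsumZ//; apply: (@zw_window_sum N b)=> j; by side.
have [Zoo|Zn]:= eqVneq ((C*CQ)%:E*Z)%E +oo%E; first by rewrite Zoo leey.
have Zf: ((C*CQ)%:E*Z)%E \is a fin_num.
 by rewrite ge0_fin_numE ?ltey// mule_ge0// lee_fin mulr_ge0// ltW.
rewrite -(fineK Zf) lee_fin; set ZZ:= fine _.
(* The partial sums tend to 1 off the origin but are 0 at it; the limit is therefore corrected at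
   one point, which the integral does not see. *)
pose L xi:= if xi == 0 then 0 else G xi.
have LE: Cint (mu n) G = Cint (mu n) L.
 apply: eq_Cint_off0=> //; last by move=> xi /negbTE h; rewrite /L h.
 have -> : L = (fun xi=> ((\1_(~` [set (0: 'rV[R]_n)]) xi: R)%:C*G xi)).
  apply/funext=> xi; rewrite /L indicE in_setC; have [->|x0]:= eqVneq xi 0.
   by rewrite mem_set// mul0r.
  by rewrite memNset ?mul1r//; exact/eqP.
 apply: cmeasM=> //; apply: cmeas_real; apply: measurable_indic; apply: measurableC; exact: meas_point0.
have mL: cmeas L.
 have -> : L = (fun xi=> ((\1_(~` [set (0: 'rV[R]_n)]) xi: R)%:C*G xi)).
  apply/funext=> xi; rewrite /L indicE in_setC; have [->|x0]:= eqVneq xi 0.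
   by rewrite mem_set// mul0r.
  by rewrite memNset ?mul1r//; exact/eqP.
 apply: cmeasM=> //; apply: cmeas_real; apply: measurable_indic; apply: measurableC; exact: meas_point0.
have [h1 h2]: (fun N=> Re (Cint (mu n) (fun xi=> S N xi*G xi))) @ \oo --> Re (Cint (mu n) L) /\
 (fun N=> Im (Cint (mu n) (fun xi=> S N xi*G xi))) @ \oo --> Im (Cint (mu n) L).
 have P0: Phi 0 = 0.
  by apply: sP; rewrite /ann -(scale0r (0: 'rV[R]_n)) enormZ// mul0r; apply/negP=> /andP[h _]; lra.
 have S0 N: S N 0 = 0 by rewrite /S big1// => k _; rewrite scaler0 P0 expr0n.
 apply: (Cint_dominated (h:= fun xi=> MS*cabs (G xi)))=> //; try side.
 - by case: Gi=> _ gi; exact: (integrableZl measurableT MS gi).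
 - by move=> N xi; rewrite cabsM; apply: ler_wpM2r; [side|exact: hS].
 - move=> xi; rewrite /L; have [->|x0]:= eqVneq xi 0.
   by under eq_fun do rewrite S0 mul0r; exact: cvg_cst.
  have [p1 p2]:= limP xi x0.
  rewrite (_: Re (G xi) = 1*Re (G xi) - 0*Im (G xi)); last by rewrite mul1r mul0r subr0.
  under eq_fun do rewrite ReM.
  by apply: cvgB; apply: cvgM=> //; exact: cvg_cst.
 - move=> xi; rewrite /L; have [->|x0]:= eqVneq xi 0.
   by under eq_fun do rewrite S0 mul0r; exact: cvg_cst.
  have [p1 p2]:= limP xi x0.
  rewrite (_: Im (G xi) = 1*Im (G xi) + 0*Re (G xi)); last by rewrite mul1r mul0r addr0.
  under eq_fun do rewrite ImM.
  by apply: cvgD; apply: cvgM=> //; exact: cvg_cst.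
rewrite /Umod /FT -/(G _) -[Cint _ _]/(Cint (mu n) G) LE.
have lim: (fun N=> cabs (Cint (mu n) (fun xi=> S N xi*G xi))) @ \oo --> cabs (Cint (mu n) L).
 rewrite /cabs; apply: (@cvg_comp_cont R _ _ Num.sqrt); first exact: sqrt_continuous.
 by apply: cvgD; rewrite ?expr2; under eq_fun do rewrite expr2; exact: cvgM.
rewrite -(cvg_lim _ lim)//; apply: limr_le; first by apply/cvg_ex; eexists; exact: lim.
by apply: nearW=> N; rewrite -lee_fin fineK.
Qed.

End transfer.
Hint Resolve etk_ge0 meas_etk: side.

(** * From linear estimates to r-th powers *)

Section stromberg_torchinsky.
Context {R: realType}.

(* Asymmetric geometric weight: ratio [p] towards coarser and [q] towards finer scales. *)
Definition rho (p q: R) (d: int): R:= if 0 <= d then p^+`|d|%N else q^+`|d|%N.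

Section rho.
Variables (p q: R).
Hypotheses (p0: 0 < p) (p1: p < 1) (q0: 0 < q) (q1: q < 1).
Lemma rho_gt0 d: 0 < rho p q d.
Proof. by rewrite /rho; case: ifP=> _; side. Qed.
Hint Resolve rho_gt0: side.
Lemma rho_le1 d: rho p q d <= 1.
Proof. by rewrite /rho; case: ifP=> _; apply: exprn_ile1; side. Qed.
Lemma rho0: rho p q 0 = 1. Proof. by rewrite /rho lexx expr0. Qed.
(** A triangle inequality for the scale gap: steps of opposite signs only contribute additional
    factors p, q < 1. *)
Lemma rhoM i j: rho p q i*rho p q j <= rho p q (i + j).
Proof.
have mix (u v: R) (a b: nat): 0 < u -> u < 1 -> 0 < v -> v < 1 -> (b <= a)%N -> u^+a * v^+b <= u^+(a - b).
 move=> u0 u1 v0 v1 ba; rewrite -{1}(subnK ba) exprD -mulrA ler_piMr ?exprn_ge0 ?(ltW u0)//.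
 by rewrite mulr_ile1 ?exprn_ge0 ?exprn_ile1 ?(ltW u0) ?(ltW v0) ?(ltW u1) ?(ltW v1).
rewrite /rho; case: i=> [a|a]; case: j=> [b|b] /=.
- by rewrite -exprD.
- have [ba|ab]:= leqP b.+1 a.
  have -> : (a%:Z + Negz b)%R = (a - b.+1)%N%:Z by lia.
  exact: mix.
 rewrite mulrC; have -> : (a%:Z + Negz b)%R = Negz (b - a)%N by lia.
 have -> : `|Negz (b - a)|%N = (b.+1 - a)%N by lia.
 by rewrite (_: (0 <= Negz (b - a)) = false)//; apply: mix=> //; exact: ltnW.
- have [ba|ab]:= leqP a.+1 b.
  have -> : (Negz a + b%:Z)%R = (b - a.+1)%N%:Z by lia.
  by rewrite mulrC; exact: mix.
 have -> : (Negz a + b%:Z)%R = Negz (a - b)%N by lia.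
 have -> : `|Negz (a - b)|%N = (a.+1 - b)%N by lia.
 by rewrite (_: (0 <= Negz (a - b)) = false)//; apply: mix=> //; exact: ltnW.
- by rewrite -exprD (_: (a.+1 + b.+1)%N = (a + b).+2)// addSn addnS.
Qed.

End rho.
Lemma ler_frac (X A B Y D: R): 0 < A -> 0 < B -> 0 < D -> X*D <= Y*A*B -> X/A/B <= Y/D.
Proof.
move=> A0 B0 D0 h; rewrite ler_pdivlMr// (_: X/A/B*D = X*D/(A*B)); last by field; rewrite !gt_eqF.
by rewrite ler_pdivrMr ?mulr_gt0// mulrA.
Qed.

Section st.
Variable n: nat.
Implicit Types (x y z: 'rV[R]_n).
Lemma nuD x y: nu (x + y) <= nu x*nu y.
Proof.
rewrite !nuE; have:= l1D x y; have:= l1_ge0 x; have:= l1_ge0 y.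
by move=> h1 h2 h3; nra.
Qed.
Lemma nuZ_le (c: R) x: 1 <= c -> nu (c *: x) <= c*nu x.
Proof.
move=> c1; rewrite !nuE l1Z; last by lra.
by have:= l1_ge0 x; lra.
Qed.
Lemma nuZ_le1 (c: R) x: 0 <= c -> c <= 1 -> nu (c *: x) <= nu x.
Proof.
move=> c0 c1; rewrite !nuE l1Z//; have:= l1_ge0 x=> h.
have:= ler_wpM2r h c1; lra.
Qed.

(** With d = i - m, the number of dyadic steps from scale i up to a finer scale m; each of them can
    cost a factor 2 in [nu_rescale]. *)
Definition negpart (d: int): nat:= if 0 <= d then 0%N else `|d|%N.
Lemma tz_nat (k: nat): tz k%:Z = 2^+k :> R. Proof. by []. Qed.
Lemma nu_rescale i m x: nu (tz m *: x) <= 2^+negpart (i - m)*nu (tz i *: x).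
Proof.
have -> : tz m *: x = tz (m - i) *: (tz i *: x) by rewrite scalerA -tzD subrK.
rewrite /negpart; case: ifP=> h.
 rewrite expr0 mul1r; apply: nuZ_le1; first side.
 rewrite (_: m - i = - (`|i - m|%N%:Z))%R; last by lia.
 by rewrite tzN tz_nat invf_le1 ?exprn_gt0// exprn_ege1// ler1n.
rewrite (_: m - i = `|i - m|%N%:Z)%R; last by lia.
by rewrite tz_nat; apply: nuZ_le; rewrite exprn_ege1// ler1n.
Qed.

Variables (p q r lam C0: R) (N: nat) (kap: int -> R).
Hypotheses (p0: 0 < p) (p1: p < 1) (q0: 0 < q) (q1: q < 1).
Hypotheses (r0: 0 < r) (r1: r <= 1) (lamr: lam*r = n.+1%:R) (lamN: lam <= N%:R) (C00: 0 <= C0).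
Hypothesis kap0: forall d, 0 <= kap d.
Hypothesis kapC: forall d, kap d*(2`^lam)^+negpart d <= C0*rho p q d.
Let lam0: 0 < lam.
Proof. by rewrite -(pmulr_lgt0 _ r0) lamr ltr0n. Qed.

Variable a: int -> 'rV[R]_n -> R.
Hypotheses (a0: forall j x, 0 <= a j x) (ma: forall j, mfun (a j)).
Variable M0: R.
Hypothesis aM: forall j x, a j x <= M0.
Hypothesis self: forall i z,
 ((a i z)%:E <= zsum (fun m=> (kap (i - m))%:E*sop (etk N (tz m)) (fun y=> (a m y)%:E) z))%E.

Local Notation rh:= (rho p q).
(** Going from x at scale l through z at scale i to y at scale m weighs no more than going directly.
    The factor lost in [nu_rescale] is paid by the decay [kapC], and the distance from z to y by the
    kernel, as lam <= N. *)
Lemma st_kernel i m l x z y: rh (l - i)*kap (i - m)*nu (tz i *: (x - z))`^(- lam)*nu (tz m *: (z - y)) ^- N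
 <= C0*rh (l - m)*nu (tz m *: (x - y))`^(- lam).
Proof.
set A:= nu (tz i *: (x - z)); set B:= nu (tz m *: (z - y)); set D:= nu (tz m *: (x - y)).
have A1: 0 < A by side.
have B1: 0 < B by side.
have D1: 0 < D by side.
have hD: D <= 2^+negpart (i - m)*A*B.
 rewrite /D (_: tz m *: (x - y) = tz m *: (x - z) + tz m *: (z - y)); last first.
  by rewrite -scalerDr addrA subrK.
 apply: le_trans (nuD _ _) _; rewrite ler_wpM2r ?(ltW B1)//; exact: nu_rescale.
have h2: 0 < 2^+negpart (i - m) :> R by side.
have hDl: D`^lam <= (2`^lam)^+negpart (i - m)*A`^lam*B^+N.
 le_via ((2^+negpart (i - m)*A*B)`^lam).
  by apply: ge0_ler_powR; rewrite ?nnegrE ?(ltW lam0) ?(ltW D1)// !mulr_ge0 ?(ltW h2) ?(ltW A1) ?(ltW B1).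
 rewrite !powRM ?mulr_ge0 ?(ltW h2) ?(ltW A1) ?(ltW B1)//.
 rewrite -[2^+_]powR_mulrn// -[(2`^lam)^+_]powR_mulrn ?powR_ge0// -!powRrM [lam*_]mulrC.
 rewrite ler_wpM2l ?mulr_ge0 ?powR_ge0//.
 by rewrite -(powR_mulrn N (ltW B1)); apply: ler_powR=> //; exact: nu_ge1.
rewrite !powRN; have Al: 0 < A`^lam by side.
have Dl: 0 < D`^lam by exact: powR_gt0.
have BN: 0 < B^+N by side.
apply: ler_frac=> //.
have ri:= rho_gt0 p0 q0 (l - i).
le_via (rh (l - i)*kap (i - m)*((2`^lam)^+negpart (i - m)*A`^lam*B^+N)).
 by rewrite ler_wpM2l// mulr_ge0// ltW.
have h3: rh (l - i)*(kap (i - m)*(2`^lam)^+negpart (i - m)) <= C0*rh (l - m).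
 le_via (rh (l - i)*(C0*rh (i - m))); first by rewrite ler_wpM2l// ltW.
 rewrite mulrCA ler_wpM2l//; have:= rhoM p0 p1 q0 q1 (l - i) (i - m).
 by rewrite (_: l - i + (i - m) = l - m)%R// addrA subrK.
have:= ler_wpM2r (mulr_ge0 (ltW Al) (ltW BN)) h3.
move=> h4; rewrite (_: _*_*(_*_*_) = rh (l - i)*(kap (i - m)*(2`^lam)^+negpart (i - m))*(A`^lam*B^+N)); last by ring.
by rewrite -[leRHS]mulrA.
Qed.

(** Its supremum is a Peetre maximal function, taken over all points and all scales. The relation
    lam r = n + 1 is what turns the Peetre weight, raised to the power r, into the weight of
    [eta]. *)
Definition st_set l x: set R:= [set rh (l - iz.1)*a iz.1 iz.2*nu (tz iz.1 *: (x - iz.2))`^(- lam) | iz in [set: int*'rV[R]_n]].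
Lemma st_term_ge0 l i x z: 0 <= rh (l - i)*a i z*nu (tz i *: (x - z))`^(- lam).
Proof. by rewrite !mulr_ge0 ?powR_ge0 ?(ltW (rho_gt0 p0 q0 _)). Qed.
Hint Resolve st_term_ge0: side.
Lemma st_le_sup l x i z: rh (l - i)*a i z*nu (tz i *: (x - z))`^(- lam) <= sup (st_set l x).
Proof.
apply: ub_le_sup; last by exists (i, z).
exists M0=> _ [[i' z'] _ <-] /=.
rewrite -[leRHS]mulr1; apply: ler_pM; rewrite ?powR_ge0 ?mulr_ge0 ?(ltW (rho_gt0 p0 q0 _))//.
 by rewrite -[leRHS]mul1r; apply: ler_pM; rewrite ?(ltW (rho_gt0 p0 q0 _)) ?rho_le1.
by rewrite -[leRHS](powRr0 (nu (tz i' *: (x - z')))); apply: ler_powR; rewrite ?nu_ge1// oppr_le0 ltW.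
Qed.

Definition st_Y l x: \bar R:= zsum (fun m=> (rh (l - m)`^r)%:E*sop (eta (tz m)) (fun y=> (a m y`^r)%:E) x)%E.
Lemma st_Y_ge0 l x: (0 <= st_Y l x)%E.
Proof.
apply: zsum_ge0=> m; rewrite mule_ge0 ?lee_fin ?powR_ge0// sop_eta_ge0 ?tz_gt0// => y.
side.
Qed.
(** Split a = a^r a^(1-r) under the integral and bound the second factor by the supremum S: the
    linear estimate becomes one for a^r, with S^(1-r) in front. *)
Lemma st_main (c: R) l x i z:
 (c%:E <= zsum (fun m=> (kap (i - m))%:E*sop (etk N (tz m)) (fun y=> (a m y)%:E) z))%E ->
 ((rh (l - i)*c*nu (tz i *: (x - z))`^(- lam))%:E <= (C0*sup (st_set l x)`^(1 - r))%:E*st_Y l x)%E.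
Proof.
move=> hc; set S:= sup _.
have S0: 0 <= S by apply: le_trans (st_le_sup l x 0 0); exact: st_term_ge0.
have w0: 0 <= rh (l - i)*nu (tz i *: (x - z))`^(- lam) by rewrite mulr_ge0 ?powR_ge0// ltW// rho_gt0.
have ma' m: mfun (fun y=> (a m y)%:E) by side.
have mar m: mfun (fun y=> (a m y`^r)%:E).
 side.
have s0 m: (0 <= (kap (i - m))%:E*sop (etk N (tz m)) (fun y=> (a m y)%:E) z)%E.
 by rewrite mule_ge0 ?lee_fin// sop_ge0=> [//|y|y]; [side|side].
rewrite (_: (rh (l - i)*c*_) = rh (l - i)*nu (tz i *: (x - z))`^(- lam)*c); last by ring.
rewrite EFinM; apply: (le_trans (lee_wpmul2l _ hc)); first side.
rewrite -zsumZ// /st_Y -zsumZ ?mulr_ge0 ?powR_ge0//; last first.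
 move=> m; rewrite mule_ge0 ?lee_fin ?powR_ge0// sop_eta_ge0 ?tz_gt0// => y.
 side.
apply: le_zsum=> m; rewrite !muleA -!EFinM /sop.
have cc0: 0 <= rh (l - i)*nu (tz i *: (x - z))`^(- lam)*kap (i - m) by side.
have mk: mfun (fun y: 'rV[R]_n=> (etk N (tz m) (z - y))%:E).
 side.
have mk': mfun (fun y: 'rV[R]_n=> (eta (tz m) (x - y))%:E).
 side.
rewrite -ge0_integralZl; try side; last first.
- by move=> y _; rewrite mule_ge0 ?lee_fin ?etk_ge0 ?tz_gt0.
rewrite -ge0_integralZl; try side; last first.
- by move=> y _; rewrite mule_ge0 ?lee_fin ?eta_ge0 ?tz_gt0 ?powR_ge0.
apply: le_integral_ge0; try side.
- by move=> y; rewrite !mule_ge0 ?lee_fin ?etk_ge0 ?tz_gt0.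
move=> y; rewrite -!EFinM lee_fin.
have [ay|ay]:= eqVneq (a m y) 0.
 rewrite ay (mulr0 (etk _ _ _)) mulr0; apply: mulr_ge0; first side.
 by rewrite mulr_ge0 ?eta_ge0 ?tz_gt0 ?powR_ge0.
have K:= st_kernel i m l x z y.
set D:= nu (tz m *: (x - y)) in K *.
have D1: 0 < D by side.
have rl:= rho_gt0 p0 q0 (l - m).
have h1: a m y`^(1 - r) <= S`^(1 - r)*(rh (l - m)`^(r - 1)*D`^(lam*(1 - r))).
 have h:= st_le_sup l x m y; rewrite -/S -/D in h.
 have h': a m y <= S*(rh (l - m)`^(- 1)*D`^lam).
  rewrite powRN powRr1 ?(ltW rl)//; rewrite powRN in h.
  by move: h; rewrite ler_pdivrMr ?powR_gt0// mulrCA ler_pdivlMl.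
 have r1': 0 <= 1 - r by side.
 le_via ((S*(rh (l - m)`^(- 1)*D`^lam))`^(1 - r)).
  by apply: ge0_ler_powR=> //; rewrite nnegrE// !mulr_ge0 ?powR_ge0.
 rewrite !powRM ?mulr_ge0 ?powR_ge0// -!powRrM mulN1r opprB//.
have aE: a m y = a m y`^r*a m y`^(1 - r).
 by rewrite -powRD ?ay ?implybT// addrC subrK powRr1.
have t0: 0 <= tz m^+n :> R by rewrite exprn_ge0// ltW// tz_gt0.
rewrite /etk /eta -/D.
rewrite (_: _*_*_*_ = (rh (l - i)*kap (i - m)*nu (tz i *: (x - z))`^(- lam)*nu (tz m *: (z - y)) ^- N)*(tz m^+n*a m y)); last by ring.
le_via ((C0*rh (l - m)*D`^(- lam))*(tz m^+n*a m y)).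
 by rewrite ler_wpM2r// mulr_ge0.
rewrite {1}aE; set ar:= a m y`^r.
le_via ((C0*rh (l - m)*D`^(- lam))*(tz m^+n*(ar*(S`^(1 - r)*(rh (l - m)`^(r - 1)*D`^(lam*(1 - r))))))).
 rewrite ler_wpM2l ?mulr_ge0 ?powR_ge0 ?(ltW rl)// ler_wpM2l// ler_wpM2l ?powR_ge0//.
have e1: rh (l - m)*rh (l - m)`^(r - 1) = rh (l - m)`^r.
 rewrite -{1}(powRr1 (ltW rl)) -powRD; last by rewrite (gt_eqF rl) implybT.
 by congr (_`^_); ring.
have e2: D`^(- lam)*D`^(lam*(1 - r)) = D ^- n.+1.
 rewrite -powRD; last by rewrite (gt_eqF D1) implybT.
 rewrite (_: - lam + lam*(1 - r) = - n.+1%:R); last by rewrite -lamr; ring.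
 by rewrite powRN powR_mulrn// ltW.
rewrite -e1 -e2 le_eqVlt; apply/orP; left; apply/eqP; ring.
Qed.
(** Applied to the self-estimate, [st_main] gives S <= C0 S^(1-r) Y. As S is finite by [aM], this
    means S^r <= C0 Y, which is inserted into the estimate of [b]; the powers of C0 Y add up to
    one. *)
Lemma stromberg_torchinsky (b: R) l x: 0 <= b ->
 (b%:E <= zsum (fun m=> (kap (l - m))%:E*sop (etk N (tz m)) (fun y=> (a m y)%:E) x))%E ->
 ((b`^r)%:E <= C0%:E*st_Y l x)%E.
Proof.
move=> b0 hb; set S:= sup (st_set l x).
have S0: 0 <= S by apply: le_trans (st_le_sup l x 0 0); exact: st_term_ge0.
have hb2: (b%:E <= (C0*S`^(1 - r))%:E*st_Y l x)%E.
 have:= st_main l x hb; rewrite subrr rho0 mul1r subrr scaler0.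
 by rewrite nuE /l1 big1 ?addr0 ?powR1 ?mulr1// => i _; rewrite mxE normr0.
have Y0:= st_Y_ge0 l x.
have [Yoo|Yn]:= eqVneq (st_Y l x) +oo%E.
 have [C0z|C0n]:= eqVneq C0 0; last first.
  by rewrite Yoo gt0_muley ?leey// lte_fin lt_def C0n.
 move: hb2; rewrite C0z mul0r !mul0e !lee_fin=> hb2.
 by rewrite (_: b = 0) ?powR0 ?gt_eqF//; apply/eqP; rewrite eq_le hb2.
have Yf: st_Y l x \is a fin_num by rewrite ge0_fin_numE// ltey.
rewrite -(fineK Yf) in hb2 *; set y:= fine _ in hb2 *.
have y0: 0 <= y by side.
rewrite -EFinM lee_fin in hb2; rewrite -EFinM lee_fin.
have hS: S <= C0*S`^(1 - r)*y.
 apply: ge_sup; first by exists (rh (l - 0)*a 0 0*nu (tz 0 *: (x - 0))`^(- lam)); exists (0%R, 0%R).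
 move=> _ [[i z] _ <-] /=; rewrite -lee_fin.
 have -> : ((C0*S`^(1 - r)*y)%:E = (C0*S`^(1 - r))%:E*st_Y l x)%E by rewrite [LHS]EFinM /y fineK.
 exact: (st_main l x (self i z)).
have [Sz|Sn]:= eqVneq S 0.
 have [r1e|r1n]:= eqVneq r 1.
  by rewrite r1e powRr1//; move: hb2; rewrite r1e subrr powRr0 mulr1.
 have: b = 0.
  apply/eqP; rewrite eq_le b0 andbT; apply: le_trans hb2 _.
  by rewrite Sz powR0 ?mulr0 ?mul0r// subr_eq0 eq_sym.
 by move=> ->; rewrite powR0 ?gt_eqF// mulr_ge0.
have Sp: 0 < S by rewrite lt_def Sn.
have Sr: S`^r <= C0*y.
 have z0: 0 < S`^(1 - r) by side.
 rewrite -(ler_pM2r z0) -powRD; last by rewrite Sn implybT.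
 by rewrite addrC subrK powRr1// mulrAC.
have r1': 0 <= 1 - r by side.
le_via ((C0*S`^(1 - r)*y)`^r).
 by apply: ge0_ler_powR; rewrite ?nnegrE ?(ltW r0)// !mulr_ge0 ?powR_ge0.
rewrite mulrAC powRM ?mulr_ge0 ?powR_ge0// -powRrM mulrC [(1 - r)*r]mulrC powRrM.
have Cy0: 0 <= C0*y by side.
le_via ((C0*y)`^(1 - r)*(C0*y)`^r).
 by rewrite ler_wpM2r ?powR_ge0//; apply: ge0_ler_powR; rewrite ?nnegrE ?powR_ge0.
have [->|Cyn]:= eqVneq (C0*y) 0; first by rewrite (@powR0 _ r) ?gt_eqF// mulr0.
by rewrite -powRD ?Cyn ?implybT// subrK powRr1.
Qed.

End st.
End stromberg_torchinsky.
Hint Resolve rho_gt0: side.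

Local Close Scope complex_scope.
Local Open Scope ereal_scope.

(** * Dyadic shells on the half line *)

Section dyadic.
Context {R: realType}.
Local Notation leb:= (@lebesgue_measure R).
Lemma dyadic_exists (t: R): (0 < t)%R -> exists l: int, (tz l <= t < 2*tz l)%R.
Proof.
move=> t0; have [t1|t1]:= leP 1%R t.
 have ex: exists k, (t < 2^+k)%R.
  exists (Num.bound t); apply: lt_le_trans (archi_boundP (ltW t0)) _.
  by rewrite -natrX ler_nat ltnW// ltn_expl.
 pose k:= ex_minn ex; have [tk kmin]: (t < 2^+k)%R /\ forall m, (t < 2^+m)%R -> (k <= m)%N.
  by rewrite /k; case: ex_minnP.
 case: k tk kmin=> [|k] tk kmin; first by rewrite ltNge t1 in tk.
 exists k%:Z; rewrite tz_nat -exprS tk andbT leNgt; apply/negP=> /kmin; by rewrite ltnn.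
have ex: exists k, (2^-1^+k <= t)%R.
 exists (Num.bound t^-1); rewrite exprVn -[leRHS]invrK lef_pV2 ?posrE ?exprn_gt0 ?invr_gt0//.
 apply: ltW; apply: lt_le_trans (archi_boundP _) _; first side.
 by rewrite -natrX ler_nat ltnW// ltn_expl.
pose k:= ex_minn ex; have [tk kmin]: (2^-1^+k <= t)%R /\ forall m, (2^-1^+m <= t)%R -> (k <= m)%N.
 by rewrite /k; case: ex_minnP.
case: k tk kmin=> [|k] tk kmin; first by rewrite expr0 leNgt t1 in tk.
exists (- k.+1%:Z)%R; rewrite tzN tz_nat -exprVn tk/= exprS mulrA divff// mul1r.
by rewrite ltNge; apply/negP=> /kmin; rewrite ltnn.
Qed.
Lemma dyadic_unique (t: R) (l m: int): (tz l <= t < 2*tz l)%R -> (tz m <= t < 2*tz m)%R -> l = m.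
Proof.
have key i j: (tz i <= t < 2*tz i)%R -> (tz j <= t < 2*tz j)%R -> (i <= j)%R.
 move=> /andP[a1 a2] /andP[b1 b2]; have h: (tz i < tz (1 + j) :> R)%R.
  by rewrite tzD {2}/tz expr1z; apply: le_lt_trans b2.
 by move: h; rewrite /tz ltr_eXz2l ?ltr1n//; lia.
by move=> h1 h2; apply/eqP; rewrite eq_le !key.
Qed.
Lemma ge0_integral_dyadic (h: R -> \bar R): measurable_fun [set: R] h -> (forall t, 0 <= h t) ->
 \int[leb]_(t in [set u: R | (0 < u)%R]) h t =
 zsum (fun l=> (tz (- l))%:E*\int[leb]_(t in `[1%R, 2%R[) h (tz (- l)*t)%R).
Proof.
move=> mh h0; pose I (l: int): set R:= `[tz (- l), (2*tz (- l))%R[%classic.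
have mI l: measurable (I l) by exact: measurable_itv.
pose c l (t: R): \bar R:= (\1_(I l) t)%:E.
have c0 l t: 0 <= c l t by side.
have cE (t: R): zsum (c ^~ t) = (\1_[set u: R | (0 < u)%R] t)%:E.
 have [t0|t0]:= ltP 0%R t.
  have [l hl]:= dyadic_exists t0; rewrite (@zsum_single _ _ (- l)%R)//.
   rewrite /c !indicE !mem_set// /I/= in_itv/= opprK//.
  move=> j jl; rewrite /c indicE memNset// /I/= in_itv/= => hj.
  by move/eqP: jl; apply; rewrite -(dyadic_unique hj hl) opprK.
 rewrite indicE memNset/=; last by apply/negP; rewrite -leNgt.
 rewrite -[RHS](@zsum_eq0 R); apply: eq_zsum=> l; rewrite /c indicE memNset// /I/= in_itv/= => /andP[+ _].
 by apply/negP; rewrite -ltNge; apply: le_lt_trans t0 _; exact: tz_gt0.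
transitivity (\int[leb]_t zsum (fun l=> h t*c l t)).
 rewrite integral_mkcond; apply: eq_integral=> t _; rewrite zsumZe// cE patchE indicE.
 by case: (t \in _); rewrite ?mule1 ?mule0.
transitivity (zsum (fun l=> \int[leb]_t (h t*c l t))).
 have mhc l: measurable_fun [set: R] (fun t=> h t*c l t) by side.
 by apply: (integral_zsum leb (a:= fun l t=> h t*c l t))=> // l t _; side.
apply: eq_zsum=> l; have tl: (0 < tz (- l) :> R)%R by exact: tz_gt0.
rewrite -(ge0_integral_affine 0 tl); try side.
congr (_*_); rewrite [RHS]integral_mkcond; apply: eq_integral=> t _.
rewrite addr0 patchE /c indicE /I; case: ifPn=> ht.
 rewrite (_: (_ \in _) = true) ?mule1//; apply/mem_set; move: ht; rewrite inE/= !in_itv/= => /andP[h1 h2].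
 by rewrite ler_peMr ?(ltW tl)//= mulrC ltr_pM2r.
rewrite (_: (_ \in _) = false) ?mule0//; apply/negbTE; apply: contra ht; rewrite !inE/= !in_itv/= => /andP[h1 h2].
by move: h1 h2; rewrite ler_pMr// mulrC ltr_pM2r// => -> ->.
Qed.
Lemma ge0_integral_itv12 (c: R): (0 <= c)%R -> \int[leb]_(t in `[1%R, 2%R[) c%:E = c%:E.
Proof.
move=> c0; rewrite integral_cst//= lebesgue_measure_itv/= lte_fin ltr1n//= -EFinB.
by rewrite (_: 2 - 1 = 1)%R ?mule1//; ring.
Qed.
(** Each of the two bounds is used on the shells where it decays, so that the shell integrals are
    geometric in |l|. *)
Lemma integral_pos_finite (f: R -> R) (C c: R): (0 < c)%R -> (0 <= C)%R -> measurable_fun [set: R] f ->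
 (forall t, 0 <= f t)%R -> (forall t, 0 < t -> t*f t <= C*t`^c)%R ->
 (forall t, 0 < t -> t*f t <= C*t`^(- c))%R ->
 \int[leb]_(t in [set u: R | (0 < u)%R]) (f t)%:E < +oo.
Proof.
move=> c0 C0 mf f0 fs fl; have mfE: measurable_fun [set: R] (EFin \o f) by exact/mEFinP.
rewrite (ge0_integral_dyadic mfE); last side.
pose z:= (2`^(- c): R)%R.
have z0: (0 < z)%R by side.
have z1: (z < 1)%R.
 have: (1`^c < 2`^c :> R)%R by apply: gt0_ltr_powR; rewrite ?nnegrE// ltr1n.
 by rewrite powR1 /z powRN=> h; rewrite invf_lt1 ?powR_gt0.
have h2: (0 <= 2`^c*C :> R)%R by side.
apply: (@le_lt_trans _ _ (zsum (fun l=> (2`^c*C)%:E*(zw z l)%:E))); last first.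
 rewrite zsumZ//; last by move=> l; rewrite lee_fin zw_ge0// ltW.
 by apply: lte_mul_pinfty=> //; exact: zsum_zw.
have zpow (k: nat): ((2^+k)`^(- c) = z^+k :> R)%R.
 by rewrite -powR_mulrn// -powRrM mulrC powRrM powR_mulrn// powR_ge0.
have pVp (x: R): (0 < x)%R -> (x^-1`^c = x`^(- c))%R.
 by move=> x0; rewrite -powR_inv1 ?(ltW x0)// -powRrM mulN1r.
apply: le_zsum=> l; rewrite -EFinM.
have tl: (0 < tz (- l) :> R)%R by exact: tz_gt0.
have key (t: R): (1 <= t)%R -> (t < 2)%R -> (tz (- l)*f (tz (- l)*t) <= 2`^c*C*zw z l)%R.
 move=> t1 t2; have t0: (0 < t)%R by exact: lt_le_trans t1.
 have lt0: (0 < tz (- l)*t)%R by side.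
 le_via (tz (- l)*t*f (tz (- l)*t))%R.
  by rewrite -mulrA ler_wpM2l ?(ltW tl)// ler_peMl.
 have h2c: (1 <= 2`^c :> R)%R by rewrite -[leLHS](powRr0 2); apply: ler_powR; [rewrite ler1n|side].
 have zl0: (0 <= zw z l)%R by side.
 case: l tl lt0 zl0=> [l|l] tl lt0 zl0.
  apply: (le_trans (fs _ lt0)); rewrite [(2`^c*C)%R]mulrC -mulrA ler_wpM2l//.
  rewrite powRM ?(ltW tl) ?(ltW t0)// [(tz _`^c)%R](_: _ = zw z l%:Z); last first.
   by rewrite tzN tz_nat pVp ?exprn_gt0// zpow.
  rewrite mulrC ler_wpM2r//; apply: ge0_ler_powR; rewrite ?nnegrE ?(ltW c0) ?(ltW t0) ?(ltW t2)//.
 apply: (le_trans (fl _ lt0)); rewrite [(2`^c*C)%R]mulrC -mulrA ler_wpM2l//.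
 have -> : (- Negz l)%R = l.+1%:Z by [].
 rewrite tz_nat powRM ?exprn_ge0 ?(ltW t0)// zpow.
 rewrite [leRHS]mulrC; apply: ler_pM; rewrite ?powR_ge0 ?exprn_ge0 ?(ltW z0)//.
 apply: le_trans h2c; rewrite -[leRHS](powRr0 t); apply: ler_powR=> //; by rewrite oppr_le0 ltW.
rewrite -ge0_integralZl//; try side; last first.
- apply: measurable_funTS; apply: (mcomp mfE); side.
rewrite -[leRHS]ge0_integral_itv12; last by rewrite mulr_ge0// zw_ge0// ltW.
apply: ge0_le_integral=> //; try side.
- apply: measurable_funTS; apply: measurable_funeM; apply: (mcomp mfE); side.
- by move=> t; rewrite /= in_itv/= => /andP[t1 t2]; rewrite -EFinM lee_fin key.
Qed.

End dyadic.

Local Close Scope ereal_scope.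

(** * Bessel-type factors *)
Section gamma.
Context {R: realType}.
Local Notation leb:= (@lebesgue_measure R).
Lemma pow_exp_bounded (p: R): exists2 C: R, 0 <= C & forall s, 1 <= s -> s`^p*expR (- s) <= C.
Proof.
pose k:= Num.bound `|p|.
exists (k`!%:R)=> // s s1; have s0: 0 <= s by exact: le_trans s1.
apply: le_trans (_: s^+k*expR (- s) <= _).
 rewrite ler_wpM2r ?expR_ge0// -powR_mulrn//; apply: ler_powR=> //.
 by apply: le_trans (ler_norm p) _; apply/ltW/archi_boundP.
by have:= mul_expN_le k ltr01 s0; rewrite mul1r expr1n divr1.
Qed.
Lemma pow_exp_bounded0 (p: R): 0 <= p -> exists2 C: R, 0 <= C & forall s, 0 <= s -> s`^p*expR (- s) <= C.
Proof.
move=> p0; have [C C0 hC]:= pow_exp_bounded p; exists (C + 1)=> [|s s0]; first side.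
have [s1|s1]:= leP 1 s; first by rewrite (le_trans (hC s s1))// lerDl.
le_via (1*1); last by rewrite mulr1 lerDr.
apply: ler_pM; rewrite ?powR_ge0 ?expR_ge0//.
 have: s`^p <= 1`^p by apply: ge0_ler_powR; rewrite ?nnegrE// ltW.
 by rewrite powR1.
by rewrite -[leRHS]expR0 ler_expR oppr_le0.
Qed.
Lemma pow_exp2_bounded (p r: R): 0 < r -> exists2 C: R, 0 <= C &
 forall s, 0 < s -> s`^p*expR (- s)*expR (- (r/s)) <= C.
Proof.
move=> r0; have [p0|/ltW pn]:= leP 0 p.
 have [C C0 hC]:= pow_exp_bounded0 p0; exists C=> // s s0.
 rewrite -[leRHS]mulr1; apply: ler_pM; rewrite ?mulr_ge0 ?powR_ge0 ?expR_ge0 ?hC ?(ltW s0)//.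
 by rewrite -[leRHS]expR0 ler_expR oppr_le0 divr_ge0 ?ltW.
have np0: 0 <= - p by rewrite oppr_ge0.
have [C C0 hC]:= pow_exp_bounded0 np0; exists (r`^p*C)=> [|s s0]; first side.
rewrite mulrAC -[leRHS]mulr1; apply: ler_pM; rewrite ?mulr_ge0 ?powR_ge0 ?expR_ge0//; last first.
 by rewrite -[leRHS]expR0 ler_expR oppr_le0 ltW.
have rs0: 0 < r/s by side.
have -> : s`^p = r`^p*(r/s)`^(- p).
 have -> : s = r*(r/s)^-1 by rewrite invf_div mulrCA divff ?mulr1// gt_eqF.
 rewrite powRM ?invr_ge0 ?(ltW r0) ?(ltW rs0)//; congr (_*_).
 by rewrite -[X in X`^p = _]powR_inv1 ?(ltW rs0)// -powRrM mulN1r invf_div mulrCA divff ?mulr1// gt_eqF.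
by rewrite -mulrA ler_wpM2l ?powR_ge0// hC// ltW.
Qed.
Lemma meas_invr: measurable_fun [set: R] (fun x: R=> x^-1).
Proof.
rewrite (_: (fun x: R=> x^-1) = (fun x=> if x < 0 then - ((- x)`^(- 1)) else x`^(- 1))); last first.
 apply/funext=> x; case: ifPn=> x0; last by rewrite powR_inv1// leNgt.
 by rewrite powR_inv1 ?invrN ?opprK// oppr_ge0 ltW.
apply: measurable_fun_ifT; try side.
- exact: measurable_fun_ltr.
- apply: measurable_funN; apply: (mcomp (measurable_powR (- 1: R))); side.
Qed.
Hint Resolve meas_invr: side.

Definition Wg (b l: R): R:= if 0 < l then l`^(b - 1)*expR (- l) else 0.
Definition Eg (r l: R): R:= expR (- (r/l)).
Definition mbE (b r: R): \bar R:= (\int[leb]_l (Wg b l*Eg r l)%:E)%E.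
(** For r > 0 this is 2 r^(b/2) K_b(2 sqrt r), with K_b the modified Bessel function; at r = 0 and b
    > 0 it is Gamma(b). *)
Definition mb b r: R:= fine (mbE b r).
Lemma Wg_ge0 b l: 0 <= Wg b l.
Proof. by rewrite /Wg; case: ifP=> // _; rewrite mulr_ge0 ?powR_ge0 ?expR_ge0. Qed.
Hint Resolve Wg_ge0: side.
Lemma Eg_ge0 r l: 0 <= Eg r l. Proof. exact: expR_ge0. Qed.
Hint Resolve Eg_ge0: side.
Lemma meas_Wg b: measurable_fun [set: R] (Wg b).
Proof.
apply: measurable_fun_ifT=> //.
- by apply: measurable_fun_ltr.
- apply: measurable_funM; first side.
 by apply: (mcomp (@measurable_expR R)); side.
Qed.
Hint Resolve meas_Wg: side.
Lemma meas_Eg r: measurable_fun [set: R] (Eg r).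
Proof.
apply: (mcomp (@measurable_expR R)); apply: measurable_funN.
by apply: measurable_funM=> //; exact: meas_invr.
Qed.
Hint Resolve meas_Eg: side.
Lemma meas_WE b r: measurable_fun [set: R] (fun l=> (Wg b l*Eg r l)%:E).
Proof.
apply/mEFinP; apply: measurable_funM; [exact: meas_Wg|exact: meas_Eg].
Qed.
Hint Resolve meas_WE: side.
Lemma WE_ge0 b r l: (0 <= (Wg b l*Eg r l)%:E)%E.
Proof. by rewrite lee_fin mulr_ge0 ?Wg_ge0 ?Eg_ge0. Qed.
Hint Resolve WE_ge0: side.
Lemma mbE_ge0 b r: (0 <= mbE b r)%E.
Proof. by apply: integral_ge0=> l _; side. Qed.
Hint Resolve mbE_ge0: side.
Lemma mb_ge0 b r: 0 <= mb b r.
Proof. by rewrite fine_ge0 ?mbE_ge0. Qed.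
Hint Resolve mb_ge0: side.
Lemma mbE_pos b r: mbE b r = (\int[leb]_(l in [set u: R | (0 < u)%R]) (Wg b l*Eg r l)%:E)%E.
Proof.
rewrite [RHS]integral_mkcond; apply: eq_integral=> l _; rewrite patchE; case: ifPn=> //.
rewrite notin_setE/= => /negP; rewrite -leNgt=> l0.
by rewrite /Wg ltNge l0 mul0r.
Qed.
Hint Resolve mbE_pos: side.
Lemma mbE_lty_gt0 b r: 0 < r -> (mbE b r < +oo)%E.
Proof.
move=> r0; rewrite mbE_pos.
have [C1 C10 h1]:= pow_exp2_bounded (b - 1) r0.
have [C2 C20 h2]:= pow_exp2_bounded (b + 1) r0.
have E s: 0 < s -> s*(Wg b s*Eg r s) = s`^b*expR (- s)*expR (- (r/s)).
 move=> s0; rewrite /Wg s0 /Eg !mulrA; congr (_*_*_).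
 rewrite -{1}(powRr1 (ltW s0)) -powRD; last by rewrite (gt_eqF s0) implybT.
 by congr (_`^_); ring.
apply: (@integral_pos_finite R _ (C1 + C2) 1)=> //; try side.
- by apply: measurable_funM; [exact: meas_Wg|exact: meas_Eg].
- by move=> s; rewrite mulr_ge0 ?Wg_ge0 ?Eg_ge0.
- move=> s s0; rewrite E// powRr1 ?(ltW s0)//.
 have:= ler_wpM2r (ltW s0) (h1 s s0).
 rewrite (_: s`^b = s`^(b - 1)*s); last first.
  rewrite -{3}(powRr1 (ltW s0)) -powRD ?subrK//; by rewrite (gt_eqF s0) implybT.
 move=> h; le_via (C1*s); last by rewrite ler_wpM2r ?(ltW s0)// lerDl.
 by apply: le_trans h; apply: le_of_eq; ring.
- move=> s s0; rewrite E// powRN powRr1 ?(ltW s0)// ler_pdivlMr//.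
 le_via C2; last by rewrite lerDr.
 apply: le_trans (h2 s s0); rewrite powRD; last by rewrite (gt_eqF s0) implybT.
 by rewrite powRr1 ?(ltW s0)// le_eqVlt; apply/orP; left; apply/eqP; ring.
Qed.
Lemma mbE_mono b r r': r <= r' -> (mbE b r' <= mbE b r)%E.
Proof.
move=> rr; apply: le_integral_ge0; try side.
- exact: meas_WE.
- exact: meas_WE.
- move=> l; rewrite lee_fin /Wg; case: ifPn=> l0; last by rewrite !mul0r.
 rewrite ler_wpM2l ?mulr_ge0 ?powR_ge0 ?expR_ge0// ler_expR lerN2.
 by rewrite ler_wpM2r ?invr_ge0 ?(ltW l0).
Qed.
Lemma mbE0_lty b: 0 < b -> (mbE b 0 < +oo)%E.
Proof.
move=> b0; rewrite mbE_pos.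
have b20: 0 <= b + b by side.
have [C C0 hC]:= pow_exp_bounded0 b20.
have E s: 0 < s -> s*(Wg b s*Eg 0 s) = s`^b*expR (- s).
 move=> s0; rewrite /Wg s0 /Eg mul0r oppr0 expR0 mulr1 mulrA; congr (_*_).
 rewrite -{1}(powRr1 (ltW s0)) -powRD; last by rewrite (gt_eqF s0) implybT.
 by congr (_`^_); ring.
apply: (@integral_pos_finite R _ (C + 1) b)=> //; try side.
- by apply: measurable_funM; [exact: meas_Wg|exact: meas_Eg].
- by move=> s; rewrite mulr_ge0 ?Wg_ge0 ?Eg_ge0.
- move=> s s0; rewrite E// mulrC ler_wpM2r ?powR_ge0//.
 le_via 1; last by rewrite lerDr.
 by rewrite -[leRHS]expR0 ler_expR oppr_le0 ltW.
- move=> s s0; rewrite E// powRN ler_pdivlMr ?powR_gt0//.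
 le_via C; last by rewrite lerDl.
 apply: le_trans (hC s (ltW s0)); rewrite powRD; last by rewrite (gt_eqF s0) implybT.
 by apply: le_of_eq; ring.
Qed.

(** Where the integral converges: for r > 0 the factor e^(-r/l) removes any singularity at l = 0,
    and at r = 0 the Gamma integral needs b > 0. *)
Definition mbdom (b r: R):= (0 < r) || ((0 < b) && (0 <= r)).
Lemma mbE_fin b r: mbdom b r -> mbE b r \is a fin_num.
Proof.
move=> h; rewrite ge0_fin_numE ?mbE_ge0//; case/orP: h=> [r0|/andP[b0 r0]]; first exact: mbE_lty_gt0.
exact: le_lt_trans (mbE_mono b r0) (mbE0_lty b0).
Qed.
Lemma mbK b r: mbdom b r -> (mb b r)%:E = mbE b r.
Proof. by move=> h; rewrite fineK// mbE_fin. Qed.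
Lemma integrable_WE b r: mbdom b r -> leb.-integrable setT (fun l=> (Wg b l*Eg r l)%:E).
Proof.
move=> h; apply/integrableP; split; first exact: meas_WE.
under eq_integral=> l _ do rewrite gee0_abs ?WE_ge0//.
by have:= mbE_fin h; rewrite ge0_fin_numE ?mbE_ge0.
Qed.
Lemma mb_mono b r r': mbdom b r -> r <= r' -> mb b r' <= mb b r.
Proof.
move=> h rr; have h': mbdom b r'.
 move: h; rewrite /mbdom; case/orP=> [r0|/andP[b0 r0]]; first by rewrite (lt_le_trans r0).
 by rewrite b0 (le_trans r0 rr) orbT.
by rewrite -lee_fin !mbK// mbE_mono.
Qed.
Lemma mb_gt0 b r: mbdom b r -> 0 < mb b r.
Proof.
move=> h; rewrite -lte_fin mbK//.
have r0: 0 <= r by case/orP: h=> [/ltW//|/andP[]].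
have [d d0 hd]: exists2 d: R, 0 < d & forall l, 1 <= l -> l < 2 -> d <= Wg b l*Eg r l.
 exists (Num.min 1 (2`^(b - 1))*expR (- 2)*expR (- r)).
  by rewrite !mulr_gt0 ?expR_gt0// lt_min ltr01 powR_gt0.
 move=> l l1 l2; have l0: 0 < l by exact: lt_le_trans l1.
 rewrite /Wg l0; apply: ler_pM; rewrite ?mulr_ge0 ?expR_ge0 ?le_min ?ler01 ?powR_ge0//; last first.
  rewrite ler_expR lerN2 ler_pdivrMr//; exact: ler_peMr.
 apply: ler_pM; rewrite ?expR_ge0 ?le_min ?ler01 ?powR_ge0//; last by rewrite ler_expR lerN2 ltW.
 rewrite ge_min; have [b1|/ltW b1]:= leP 0 (b - 1).
  by apply/orP; left; rewrite -[leLHS](powRr0 l); apply: ler_powR.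
 apply/orP; right; rewrite -(opprK (b - 1)) powRN [leRHS]powRN lef_pV2 ?posrE ?powR_gt0//.
 by apply: ge0_ler_powR; rewrite ?oppr_ge0 ?nnegrE ?(ltW l0) ?(ltW l2).
apply: (@lt_le_trans _ _ (\int[leb]_(l in `[1%R, 2%R[) d%:E)%E).
 by rewrite ge0_integral_itv12 ?(ltW d0)// lte_fin.
le_via (\int[leb]_(l in `[1%R, 2%R[) (Wg b l*Eg r l)%:E)%E.
 apply: ge0_le_integral=> //; try side.
 - by apply: measurable_funTS; exact: meas_WE.
 - by move=> l; rewrite /= in_itv/= => /andP[l1 l2]; rewrite lee_fin hd.
apply: ge0_subset_integral=> //; first exact: meas_WE.
side.
Qed.
(** Bounding e^(-r/l) by a multiple of (l/r)^N trades decay in r for a power of l, that is, for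
    raising b to b + N. *)
Lemma mb_decay b (N: R): 0 <= N -> 0 < b + N -> exists2 C: R, 0 <= C & forall r, 0 < r -> mb b r <= C*r`^(- N).
Proof.
move=> N0 bN; have [C C0 hC]:= pow_exp_bounded0 N0.
have dom: mbdom (b + N) 0 by rewrite /mbdom bN lexx orbT.
exists (C * mb (b + N) 0)=> [|r r0]; first by rewrite mulr_ge0 ?mb_ge0.
have dr: mbdom b r by rewrite /mbdom r0.
rewrite -lee_fin mbK// mulrAC EFinM mbK// /mbE -ge0_integralZl//; try side; last first.
- exact: meas_WE.
apply: le_integral_ge0; try side.
- exact: meas_WE.
- by apply: measurable_funeM; exact: meas_WE.
- move=> l; rewrite -EFinM lee_fin /Wg; case: ifPn=> l0; last by rewrite !mul0r mulr0.
 have rl: 0 < r/l by side.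
 have:= hC (r/l) (ltW rl); rewrite -/(Eg r l) /(Eg 0 l) mul0r oppr0 expR0 mulr1=> h.
 have h': Eg r l <= C*r`^(- N) * l`^N.
  rewrite powRN mulrAC ler_pdivlMr ?powR_gt0//.
  have -> : r`^N = (r/l)`^N * l`^N.
   by rewrite -powRM ?divfK ?(ltW rl) ?(ltW l0)// gt_eqF.
  by rewrite mulrA ler_wpM2r ?powR_ge0// mulrC.
 have w0: 0 <= l`^(b - 1)*expR (- l) by side.
 apply: (le_trans (ler_wpM2l w0 h')).
 rewrite (_: b + N - 1 = b - 1 + N); last by ring.
 rewrite (@powRD _ l (b - 1) N); last by rewrite (gt_eqF l0) implybT.
 by apply: le_of_eq; ring.
Qed.
(** Drop e^(-l) and substitute l = r u: r^b factors out, and the remaining integral of u^(b-1)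
    e^(-1/u) converges at infinity because b < 0. *)
Lemma mb_small b: b < 0 -> exists2 C: R, 0 <= C & forall r, 0 < r -> mb b r <= C*r`^b.
Proof.
move=> b0; pose g (l: R):= if 0 < l then l`^(b - 1)*expR (- l^-1) else 0.
have g0 l: 0 <= g l by rewrite /g; case: ifP=> // _; rewrite mulr_ge0 ?powR_ge0 ?expR_ge0.
have mg: measurable_fun [set: R] g.
 apply: measurable_fun_ifT=> //.
 - by apply: measurable_fun_ltr.
 - apply: measurable_funM; first side.
  apply: (mcomp (@measurable_expR R)); apply: measurable_funN; exact: meas_invr.
have mgE: measurable_fun [set: R] (fun l=> (g l)%:E) by side.
have nb: 0 < - b by rewrite oppr_gt0.
have nb2: 0 <= - b + - b by rewrite addr_ge0 ?ltW.
have [C C0 hC]:= pow_exp_bounded0 nb2.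
have E s: 0 < s -> s * g s = s`^b*expR (- s^-1).
 move=> s0; rewrite /g s0 mulrA; congr (_*_).
 rewrite -{1}(powRr1 (ltW s0)) -powRD; last by rewrite (gt_eqF s0) implybT.
 by congr (_`^_); ring.
have sV s (p: R): 0 < s -> (s^-1)`^p = s`^(- p).
 by move=> s0; rewrite -powR_inv1 ?(ltW s0)// -powRrM mulN1r.
have gE: (\int[leb]_l (g l)%:E = \int[leb]_(l in [set u: R | (0 < u)%R]) (g l)%:E)%E.
 rewrite [RHS]integral_mkcond; apply: eq_integral=> l _; rewrite patchE; case: ifPn=> //.
 by rewrite notin_setE/= /g=> /negP/negbTE ->.
have If: (\int[leb]_l (g l)%:E)%E \is a fin_num.
 rewrite ge0_fin_numE; last side.
 rewrite gE; apply: (@integral_pos_finite R _ (C + 1) (- b))=> //; try side.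
 - move=> s s0; rewrite E//.
  have s'0: 0 < s^-1 by side.
  have:= hC _ (ltW s'0); rewrite sV// => h.
  le_via (C*s`^(- b)); last by rewrite ler_wpM2r ?powR_ge0// lerDl.
  have:= ler_wpM2r (powR_ge0 s (- b)) h; apply: le_trans.
  rewrite mulrAC -powRD; last by rewrite (gt_eqF s0) implybT.
  by apply: le_of_eq; congr (_`^_*_); ring.
 - move=> s s0; rewrite E// opprK mulrC ler_wpM2r ?powR_ge0//.
  le_via 1; last by rewrite lerDr.
  by rewrite -[leRHS]expR0 ler_expR oppr_le0 invr_ge0 ltW.
set I:= (\int[leb]_l (g l)%:E)%E in If.
exists (fine I)=> [|r r0]; first side.
have dr: mbdom b r by rewrite /mbdom r0.
rewrite -lee_fin mbK// EFinM fineK// muleC.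
have r'0: 0 < r^-1 by side.
rewrite /I -(ge0_integral_affine 0 r'0); try side.
have mgs: measurable_fun [set: R] (fun l=> (g (r^-1 * l + 0))%:E).
 apply: (mcomp mgE); under eq_fun do rewrite addr0; exact: mulrl_measurable.
rewrite muleA -EFinM -ge0_integralZl//; try side.
apply: le_integral_ge0; try side.
- exact: meas_WE.
- move=> l; rewrite -EFinM lee_fin addr0 /g /Wg pmulr_rgt0//; case: ifPn=> l0; last by rewrite mul0r mulr0.
 rewrite powRM ?(ltW l0) ?(ltW r'0)// invfM invrK sV// /Eg.
 have -> : r`^b/r*(r`^(- (b - 1)) * l`^(b - 1)*expR (- (r/l))) = l`^(b - 1)*expR (- (r/l)).
  have -> : r`^(- (b - 1)) = r/r`^b.
   rewrite opprB powRD; last by rewrite (gt_eqF r0) implybT.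
   by rewrite powRr1 ?(ltW r0)// powRN.
  by field; rewrite !gt_eqF// powR_gt0.
 rewrite ler_wpM2r ?expR_ge0// ler_piMr ?powR_ge0//.
 by rewrite -[leRHS]expR0 ler_expR oppr_le0 ltW.
Qed.
(** The slope is [mb (b - 1) c] because differentiating e^(-r/l) in r divides by l, which lowers b
    by one. *)
Lemma mb_lipschitz b c r r': 0 < c -> c <= r -> c <= r' -> `|mb b r - mb b r'| <= `|r - r'| * mb (b - 1) c.
Proof.
move=> c0; wlog rr: r r'/r <= r'.
 move=> h cr cr'; have [/h|/ltW /h]:= leP r r'; first by apply.
 by rewrite distrC [`|r - _|]distrC; apply.
move=> cr cr'; have r0: 0 < r by exact: lt_le_trans cr.
have r'0: 0 < r' by exact: lt_le_trans cr'.
have d1: mbdom b r by rewrite /mbdom r0.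
have d2: mbdom b r' by rewrite /mbdom r'0.
have d3: mbdom (b - 1) c by rewrite /mbdom c0.
rewrite ger0_norm ?subr_ge0 ?mb_mono// [`|r - _|]distrC ger0_norm ?subr_ge0//.
rewrite lerBlDl -lee_fin EFinD EFinM !mbK// /mbE.
rewrite -ge0_integralZl ?lee_fin//; try side; last first.
- exact: meas_WE.
rewrite -ge0_integralD//; try side; last 2 first.
- exact: meas_WE.
- by apply: measurable_funeM; exact: meas_WE.
apply: le_integral_ge0; try side.
- exact: meas_WE.
- apply: emeasurable_funD; first exact: meas_WE.
 by apply: measurable_funeM; exact: meas_WE.
- move=> l; rewrite -EFinM -EFinD lee_fin /Wg; case: ifPn=> l0; last by rewrite !mul0r mulr0 addr0.
 have hE: Eg r l <= Eg r' l + (r' - r)/l*Eg c l.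
  have h1: Eg r l*(1 - (r' - r)/l) <= Eg r' l.
   rewrite /Eg (_: - (r'/l) = - (r/l) + - ((r' - r)/l)); last by ring.
   by rewrite expRD ler_wpM2l ?expR_ge0// expR_ge1Dx.
  have h2: Eg r l <= Eg c l by rewrite ler_expR lerN2 ler_wpM2r ?invr_ge0 ?(ltW l0).
  have h3: 0 <= (r' - r)/l by side.
  have:= ler_wpM2l h3 h2; lra.
 have w0: 0 <= l`^(b - 1)*expR (- l) by side.
 apply: (le_trans (ler_wpM2l w0 hE)).
 have -> : l`^(b - 1) = l`^(b - 1 - 1) * l.
  by rewrite -{3}(powRr1 (ltW l0)) -powRD ?subrK// (gt_eqF l0) implybT.
 apply: le_of_eq; field; by side.
Qed.
Lemma continuous_mb b r: 0 < r -> {for r, continuous (mb b)}.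
Proof.
move=> r0; pose c:= r/2; have c0: 0 < c by side.
pose L:= mb (b - 1) c + 1.
have L0: 0 < L by rewrite ltr_wpDl ?mb_ge0.
apply/cvgrPdist_le=> e e0; near=> u.
have cu: c <= u.
 near: u; apply: (@filterS _ (nbhs r) _ (fun u=> `|r - u| < c)); last first.
  by exists c=> //= u.
 by move=> u; rewrite ltr_norml=> /andP[_ h]; rewrite /c in h *; lra.
have cr: c <= r by rewrite /c; lra.
apply: (le_trans (mb_lipschitz b c0 cr cu)).
have hu: `|r - u| <= e/L.
 near: u; apply: (@filterS _ (nbhs r) _ (fun u=> `|r - u| < e/L)); first side.
 by exists (e/L); rewrite /= ?divr_gt0.
le_via (e/L*L); last by rewrite divfK// gt_eqF.
by apply: ler_pM; rewrite ?mb_ge0// /L lerDl.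
Unshelve. all: by end_near. Qed.
(** The Gamma integral. It represents X^(-a) as a superposition of exponentials, hence, for X
    quadratic in x, as a superposition of Gaussians. *)
Lemma gamma_scale a (X: R): 0 < a -> 0 < X ->
 (\int[leb]_l ((if 0 < l then l`^(a - 1) else 0)*expR (- (l*X)))%:E = (X`^(- a) * mb a 0)%:E)%E.
Proof.
move=> a0 X0; have dom: mbdom a 0 by rewrite /mbdom a0 lexx orbT.
rewrite EFinM mbK// /mbE -(ge0_integral_affine 0 X0 (meas_WE a 0) (WE_ge0 a 0)).
have mS: measurable_fun [set: R] (fun l=> (Wg a (X * l + 0)*Eg 0 (X * l + 0))%:E).
 apply: (mcomp (meas_WE a 0)); under eq_fun do rewrite addr0; exact: mulrl_measurable.
rewrite muleA -EFinM -ge0_integralZl//; try side.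
apply: eq_integral=> l _; rewrite -EFinM; congr EFin; rewrite addr0 /Wg pmulr_rgt0// /Eg mul0r oppr0 expR0 mulr1.
case: ifPn=> l0; last by rewrite mul0r mulr0.
rewrite powRM ?(ltW X0) ?(ltW l0)// [l*X]mulrC !mulrA; congr (_*_).
rewrite -[LHS]mul1r; congr (_*_).
have -> : X`^(a - 1) = X`^a/X.
 by rewrite powRD ?(gt_eqF X0) ?implybT// powRN powRr1 ?(ltW X0).
rewrite powRN; field; by rewrite !gt_eqF// powR_gt0.
Qed.

End gamma.
Hint Resolve meas_invr Wg_ge0 Eg_ge0 meas_Wg meas_Eg meas_WE WE_ge0 mbE_ge0 mb_ge0 mb_gt0: side.

Local Open Scope complex_scope.

(** * Difference bounds for superpositions of Gaussians *)

Section superposition.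
Context {R: realType}.
Local Notation leb:= (@lebesgue_measure R).
Lemma iter_sdiff_Rintegral (G: nat -> R -> R) (k j: nat) :
 (forall i, (j <= i <= j + k)%N -> leb.-integrable setT (EFin \o G i)) ->
 iter k (@sdiff _) (fun i=> fine (\int[leb]_l (G i l)%:E)%E) j =
  fine (\int[leb]_l (iter k (@sdiff _) (fun i=> G i l) j)%:E)%E /\
 leb.-integrable setT (fun l=> (iter k (@sdiff _) (fun i=> G i l) j)%:E).
Proof.
elim: k j=> [|k IH] j Gi; first by split=> //; apply: Gi; rewrite addn0 leqnn.
have [|e1 i1]:= IH j.+1.
 by move=> i /andP[h1 h2]; apply: Gi; rewrite (ltnW h1) addnS -addSn.
have [|e0 i0]:= IH j.
 by move=> i /andP[h1 h2]; apply: Gi; rewrite h1 addnS (leqW h2).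
rewrite iterS {1}/sdiff e0 e1; split.
 rewrite -fineB; last 2 first.
 - exact: (integrable_fin_num measurableT i1).
 - exact: (integrable_fin_num measurableT i0).
 by congr fine; rewrite -integralB_EFin.
have:= integrableB measurableT i1 i0; apply: eq_integrable=> // l _.
Qed.

Variable n: nat.
(** Differences commute with the integral over the widths, so [gau_dbound] can be integrated.
    Keeping its factor e^(-c/64) inside the integral is what preserves the decay under dilation. *)
Lemma sbound_superposition (K: nat): exists2 C: R, 0 <= C & forall (w c: R -> R) (h: 'rV[R]_n -> R),
 measurable_fun [set: R] w -> measurable_fun [set: R] c -> (forall l, 0 <= w l) ->
 (forall l, w l = 0 \/ 0 <= c l) ->
 leb.-integrable setT (fun l=> (w l*expR (- (c l/64)))%:E) ->
 (forall x, 4^-1 <= enorm x <= 4 -> h x = fine (\int[leb]_l (w l * gau (c l) x)%:E)%E) ->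
 sbound K (C*fine (\int[leb]_l (w l*expR (- (c l/64)))%:E)%E) (fun x=> (h x)%:C).
Proof.
have [C C0 hC]:= @gau_dbound R n K; exists C=> // w c h mw mc w0 wc wi hh x i d s k j jk.
have s' u: 0 <= u <= K%:R -> 4^-1 <= enorm (x + (u*d) *: evec R i) by move=> /s/andP[].
pose y (j: nat):= x + j%:R *: (d *: evec R i).
have yK m: (m <= K)%N -> 4^-1 <= enorm (y m) <= 4.
 by move=> mK; have:= s m%:R; rewrite -scalerA; apply; rewrite ler0n ler_nat.
pose G m l:= w l * gau (c l) (y m).
have mgau m: measurable_fun [set: R] (fun l=> gau (c l) (y m)).
 apply: (mcomp (@measurable_expR R)); apply: measurable_funN.
 side.
have Gi m: (m <= K)%N -> leb.-integrable setT (EFin \o G m).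
 move=> mK; apply: (le_integrable _ _ _ wi)=> //.
  by apply/mEFinP; apply: measurable_funM; [exact: mw|exact: mgau].
 move=> l _; rewrite /= lee_fin !ger0_norm ?mulr_ge0 ?expR_ge0//.
 rewrite /G; have [->|cl]:= wc l; first by rewrite !mul0r.
 rewrite ler_wpM2l// /gau ler_expR lerN2 ler_wpM2l//.
 have /andP[h1 _]:= yK m mK; rewrite -enorm_sqr (@le_trans _ _ (4^-1^+2))//; last first.
  by rewrite ler_pXn2r ?nnegrE ?enorm_ge0.
 by lra.
rewrite -[X in cabs X](_: (iter k (@sdiff _) (fun m=> fine (\int[leb]_l (G m l)%:E)%E) j)%:C = _); last first.
 rewrite -iter_sdiff_real; apply: eq_iter_sdiff=> m /andP[_ hm].
 by congr (_%:C); rewrite -hh// yK// (leq_trans hm).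
have [|-> Di]:= @iter_sdiff_Rintegral G k j.
 by move=> m /andP[_ hm]; apply: Gi; exact: leq_trans hm jk.
rewrite cabs_real.
have key l: `|iter k (@sdiff _) (fun m=> G m l) j| <= C * `|d| ^+ k*(w l*expR (- (c l/64))).
 have -> : iter k (@sdiff _) (fun m=> G m l) j = w l*iter k (@sdiff _) (fun m=> gau (c l) (y m)) j.
  by elim: (k) (j)=> [//|k' IH] j'; rewrite !iterS /sdiff !IH mulrBr.
 rewrite normrM (ger0_norm (w0 l)); have [->|cl]:= wc l; first by rewrite !mul0r mulr0.
 have:= hC (c l) x i d cl s' k j jk; rewrite iter_sdiff_real cabs_real=> hb.
 apply: (le_trans (ler_wpM2l (w0 l) hb)).
 by apply: le_of_eq; ring.
have wfin:= integrable_fin_num measurableT wi.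
rewrite -lee_fin -[leLHS]abse_EFin fineK; last exact: (integrable_fin_num measurableT Di).
apply: (le_trans (le_abse_integral _ measurableT _)).
 by have /integrableP[]:= Di.
rewrite mulrAC EFinM fineK// -ge0_integralZl//; last 3 first.
- by have /integrableP[]:= wi.
- side.
- side.
apply: ge0_le_integral=> //.
- by apply: mcomp=> //; have /integrableP[]:= Di.
- by apply: measurable_funeM; have /integrableP[]:= wi.
- by move=> l _; rewrite -EFinM lee_fin.
Qed.
(** The dilated factor is a mixture of Gaussians with parameter pi^2 tau^2 / l; integrating the
    bound reproduces the function [mb b] itself at a smaller multiple of tau^2, so its decay in tau
    is inherited. *)
Lemma sbound_mb (K: nat): exists2 C: R, 0 <= C & forall b tau: R, 0 < tau ->
 sbound K (C * mb b (pi^+2/64*tau^+2)) (fun x: 'rV[R]_n=> (mb b (pi^+2*dotp (tau *: x) (tau *: x)))%:C).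
Proof.
have [C C0 hC]:= sbound_superposition K; exists C=> // b tau tau0.
pose c (l: R):= pi^+2*tau^+2/l.
have p0: 0 < pi^+2*tau^+2 :> R by side.
have E l: Wg b l*expR (- (c l/64)) = Wg b l*Eg (pi^+2/64*tau^+2) l.
 by rewrite /Eg /c; congr (_*expR (- _)); ring.
have dom: mbdom b (pi^+2/64*tau^+2).
 by rewrite /mbdom mulr_gt0 ?divr_gt0 ?exprn_gt0 ?pi_gt0.
have:= hC (Wg b) c (fun x=> mb b (pi^+2*dotp (tau *: x) (tau *: x))).
under eq_integral do rewrite E; apply=> //.
- side.
- by apply: measurable_funM; [side|exact: meas_invr].
- side.
- move=> l; have [l0|l0]:= leP l 0; first by left; rewrite /Wg ltNge l0.
 by right; rewrite divr_ge0// ltW.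
- by under eq_fun do rewrite E; exact: integrable_WE.
- move=> x _; congr fine; apply: eq_integral=> l _; congr EFin; congr (_*expR (- _)).
 by rewrite dotpZl dotpZr /c; ring.
Qed.
Lemma sbound_enorm_powV (K: nat) (be: R): 0 < be -> exists2 A: R, 0 <= A &
 sbound K A (fun x: 'rV[R]_n=> ((enorm x`^be)^-1)%:C).
Proof.
move=> be0; have a0: 0 < be/2 by side.
have [C C0 hC]:= sbound_superposition K.
pose w (l: R):= if 0 < l then l`^(be/2 - 1) else 0.
have w0 l: 0 <= w l by rewrite /w; case: ifP=> // _; side.
have mw: measurable_fun [set: R] w.
 apply: measurable_fun_ifT; [exact: measurable_fun_ltr|side|side].
have G0: 0 < mb (be/2) 0 by apply: mb_gt0; rewrite /mbdom a0 lexx orbT.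
have i64: (\int[leb]_l (w l*expR (- (l/64)))%:E = ((64^-1)`^(- (be/2)) * mb (be/2) 0)%:E)%E.
 by apply: gamma_scale=> //; rewrite invr_gt0.
have wi: leb.-integrable setT (fun l=> (w l*expR (- (l/64)))%:E).
 apply/integrableP; split.
  apply/mEFinP; apply: measurable_funM=> //.
  side.
 under eq_integral do rewrite gee0_abs ?lee_fin ?mulr_ge0 ?expR_ge0//.
 by rewrite i64 ltry.
exists (cabs (mb (be/2) 0)^-1%:C*(C*fine (\int[leb]_l (w l*expR (- (l/64)))%:E)%E)).
 by rewrite i64 !mulr_ge0 ?cabs_ge0 ?powR_ge0 ?(ltW G0).
have:= hC w idfun (fun x=> mb (be/2) 0*(enorm x`^be)^-1) mw (@measurable_id _ _ _) w0 _ wi.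
move=> /(_ _ _)/(sboundZ (mb (be/2) 0)^-1%:C) h.
apply: eq_sbound (h _ _)=> [x xa|l|x xa].
- by rewrite -rmorphM mulKf// gt_eqF.
- by rewrite /w; case: ifPn=> l0; [right; side|left].
- have x0: 0 < enorm x by case/andP: xa=> + _; apply: lt_le_trans; rewrite invr_gt0.
 rewrite (gamma_scale a0 (X:= dotp x x)); last by rewrite -enorm_sqr exprn_gt0.
 rewrite /= mulrC; congr (_*_); rewrite powRN -enorm_sqr -powR_mulrn ?enorm_ge0// -powRrM.
 by congr ((_`^_)^-1); field.
Qed.
(** A positive power of the norm grows and is no positive superposition of Gaussians, but its
    inverse is one by [gamma_scale]; the quotient rule [sboundV] goes back. *)
Lemma sbound_enorm_pow (K: nat) (be: R): 0 < be -> exists2 A: R, 0 <= A &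
 sbound K A (fun x: 'rV[R]_n=> (enorm x`^be)%:C).
Proof.
move=> be0; have [A A0 hA]:= sbound_enorm_powV K be0.
have c0: 0 < (4`^be)^-1 :> R by side.
have [B B0 hB]:= @sboundV R n K A _ A0 c0; exists B=> //.
apply: eq_sbound (hB _ hA _)=> x /andP[x1 x2].
 by rewrite -fmorphV invrK.
have x0: 0 < enorm x by apply: lt_le_trans x1; rewrite invr_gt0.
rewrite cabs_real ger0_norm ?invr_ge0 ?powR_ge0// lef_pV2 ?posrE ?powR_gt0//.
by apply: ge0_ler_powR; rewrite ?nnegrE ?enorm_ge0 ?(ltW be0).
Qed.

End superposition.

Section sgm.
Context {R: realType} {n: nat}.
Local Notation leb:= (@lebesgue_measure R).
Implicit Types g: 'rV[R]_n -> R[i].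

Definition kapdec (b': R) (kap: R -> R) :=
 (exists2 C: R, 0 <= C & forall tau, 0 < tau -> kap tau <= C*tau`^b') /\
 forall L: R, 0 <= L -> exists2 C: R, 0 <= C & forall tau, 1 <= tau -> kap tau <= C*tau`^(- L).
Lemma kapdecZ b' kap (c: R): 0 <= c -> kapdec b' kap -> kapdec b' (fun tau=> c*kap tau).
Proof.
move=> c0 [[C C0 h1] h2]; split.
 by exists (c*C)=> [|t t0]; [side|rewrite -mulrA ler_wpM2l// h1].
move=> L L0; have [D D0 hD]:= h2 L L0.
by exists (c*D)=> [|t t0]; [side|rewrite -mulrA ler_wpM2l// hD].
Qed.

(** The exponent at the origin of an e-homogeneous function times [mb b] at a multiple of |xi|^2:
    for b > 0 the factor is bounded and the exponent is e; for b < 0 it has size at most |xi|^(2b).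
    The second case, with b = s/2 - 1 and e = 2, is the origin of the condition alpha < s. *)
Definition mbexp (b e b': R):= (0 < b /\ b' = e) \/ (b < 0 /\ b' = e + 2*b).
Lemma kapdec_mb (b e b' kp: R): 0 < kp -> mbexp b e b' -> kapdec b' (fun tau=> tau`^e * mb b (kp*tau^+2)).
Proof.
move=> kp0 hb; split.
 case: hb=> -[b0 ->].
  exists (mb b 0)=> [|t t0]; first side.
  rewrite mulrC ler_wpM2r ?powR_ge0// mb_mono ?/mbdom ?b0 ?lexx ?orbT//.
  side.
 have [C C0 hC]:= mb_small b0.
 exists (C*kp`^b)=> [|t t0]; first side.
 have kt: 0 < kp*t^+2 by side.
 have:= ler_wpM2l (powR_ge0 t e) (hC _ kt); move=> /le_trans; apply.
 rewrite powRM ?(ltW kp0) ?sqr_ge0// -powR_mulrn ?(ltW t0)// -powRrM.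
 rewrite (@powRD _ t e (2*b)); last by rewrite (gt_eqF t0) implybT.
 by apply: le_of_eq; ring.
move=> L L0; pose N:= `|L| + `|e| + `|b| + 1.
have N0: 0 <= N by side.
have bN: 0 < b + N.
 by have:= ler_norm (- b); rewrite normrN /N; have:= normr_ge0 L; have:= normr_ge0 e; lra.
have [C C0 hC]:= mb_decay N0 bN.
exists (C*kp`^(- N))=> [|t t1]; first side.
have t0: 0 < t by exact: lt_le_trans t1.
have kt: 0 < kp*t^+2 by side.
apply: (le_trans (ler_wpM2l (powR_ge0 t e) (hC _ kt))).
rewrite powRM ?(ltW kp0) ?sqr_ge0// -powR_mulrn ?(ltW t0)// -powRrM.
rewrite [leLHS](_: _ = C*kp`^(- N)*(t`^e*t`^(2 * - N))); last by ring.
rewrite ler_wpM2l ?mulr_ge0 ?powR_ge0// -powRD; last by rewrite (gt_eqF t0) implybT.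
apply: ler_powR=> //; have:= ler_norm e; have:= ler_norm L; rewrite /N.
by have:= normr_ge0 b; have:= normr_ge0 e; have:= normr_ge0 L; lra.
Qed.

Definition sgm g (b: R) (x: 'rV[R]_n): R[i]:= g x*(mb b (pi^+2*dotp x x))%:C.

Definition homog (K: nat) (e: R) g:= [/\ cmeas g, forall x, 0 < enorm x -> rc g x,
 forall (t: R) x, 0 < t -> g (t *: x) = (t`^e)%:C * g x,
 exists2 A: R, 0 <= A & sbound K A g & exists2 C: R, 0 <= C & forall x, cabs (g x) <= C*enorm x`^e].
Lemma rc_mb b x: 0 < enorm x -> rc (fun x: 'rV[R]_n=> (mb b (pi^+2*dotp x x))%:C) x.
Proof.
move=> x0; apply: rc_real=> z.
apply: (@cvg_comp_cont R (fun k: nat=> pi^+2*dotp (x - k.+1%:R^-1 *: z) (x - k.+1%:R^-1 *: z)) _ (mb b)).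
 by apply: continuous_mb; rewrite mulr_gt0 ?exprn_gt0 ?pi_gt0// -enorm_sqr exprn_gt0.
by apply: cvgM; [exact: cvg_cst|exact: cvg_ray_sqr].
Qed.
Lemma meas_mb b: measurable_fun [set: R] (fun r=> mb b (pi^+2*r)).
Proof.
apply: (@meas_fine_integral _ _ _ (measurableTypeR R) (measurableTypeR R) leb
 (fun z: R*R=> (Wg b z.2*Eg (pi^+2*z.1) z.2)%:E)).
apply/mEFinP; apply: measurable_funM.
 by apply: (mcomp (meas_Wg b)); side.
apply: (mcomp (@measurable_expR R)); apply: measurable_funN; apply: measurable_funM.
 side.
by apply: (mcomp meas_invr); side.
Qed.
Lemma symbol_sgm (K: nat) g (b e b': R): mbexp b e b' -> 0 < b' -> 0 < e -> homog K e g ->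
 exists kap, kapdec b' kap /\ exists M, symbol K (sgm g b) kap M.
Proof.
move=> hb b'0 e0 [mg rg hg [A A0 sA] [Cg Cg0 gC]].
have [Cm Cm0 hCm]:= @sbound_mb R n K.
have pi0: 0 < pi^+2 :> R by side.
exists (fun tau=> 2^+K*(A*Cm)*(tau`^e * mb b (pi^+2/64*tau^+2))).
split.
 by apply: kapdecZ; [side|apply: kapdec_mb=> //; rewrite divr_gt0].
have [[C1 C10 h1] h2]:= kapdec_mb pi0 hb.
have [C2 C20 h2']:= h2 0 (lexx _).
exists (Cg*(C1 + C2)); split.
- apply: cmeasM=> //; split=> /=; last side.
 apply: (mcomp (meas_mb b)); apply: meas_dotp; side.
- move=> x; rewrite cabsM cabs_real (ger0_norm (mb_ge0 _ _)).
 have [x0|]:= ltP 0 (enorm x); last first.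
  move=> x0; have x00: enorm x = 0 by apply/eqP; rewrite eq_le x0 enorm_ge0.
  have:= gC x; rewrite x00 powR0 ?gt_eqF// mulr0=> g0.
  by le_via (0 * mb b (pi^+2*dotp x x)); rewrite ?ler_wpM2r ?mb_ge0// mul0r mulr_ge0// addr_ge0.
 apply: (le_trans (ler_wpM2r (mb_ge0 _ _) (gC x))); rewrite -mulrA ler_wpM2l// -enorm_sqr.
 have [t1|/ltW t1]:= leP 1 (enorm x).
  by apply: (le_trans (h2' _ t1)); rewrite oppr0 powRr0 mulr1 lerDr.
 apply: (le_trans (h1 _ x0)); le_via C1; last by rewrite lerDl.
 have: enorm x`^b' <= 1`^b' by apply: ge0_ler_powR; rewrite ?nnegrE ?enorm_ge0// ltW.
 by rewrite powR1=> h; rewrite ler_piMr.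
- by move=> x x0; apply: rcM; [exact: rg|exact: rc_mb].
- move=> tau tau0; split.
  by rewrite !mulr_ge0 ?exprn_ge0 ?powR_ge0 ?mb_ge0.
 have:= sboundM A0 (mulr_ge0 Cm0 (mb_ge0 b (pi^+2/64*tau^+2))) sA (hCm b tau tau0).
 move=> /(sboundZ (tau`^e)%:C); rewrite cabs_real ger0_norm ?powR_ge0// => h.
 apply: sboundW (eq_sbound _ h).
  by apply: le_of_eq; ring.
 by move=> x _; rewrite /sgm hg// mulrA.
Qed.

(** The upper limit 8 leaves room for the points th x with |x| <= 4 and th <= 2. *)
Definition elliptic (A: 'rV[R]_n -> R[i]):= exists2 c: R, 0 < c & forall x, 4^-1 <= enorm x <= 8 -> c <= cabs (A x).
Lemma elliptic_sgm g b: elliptic g -> elliptic (sgm g b).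
Proof.
move=> [c c0 hc]; have pi0: 0 < pi^+2 :> R by side.
exists (c * mb b (pi^+2*8^+2))=> [|x xa].
 by rewrite mulr_gt0// mb_gt0// /mbdom mulr_gt0// exprn_gt0.
rewrite cabsM cabs_real (ger0_norm (mb_ge0 _ _)); apply: ler_pM; rewrite ?mb_ge0 ?(ltW c0) ?hc//.
case/andP: xa=> x1 x2; have x0: 0 < enorm x by apply: lt_le_trans x1; rewrite invr_gt0.
rewrite -enorm_sqr mb_mono//; first by rewrite /mbdom mulr_gt0// exprn_gt0.
by rewrite ler_wpM2l ?(ltW pi0)// ler_pXn2r ?nnegrE ?enorm_ge0.
Qed.

End sgm.
Hint Resolve meas_mb: side.

(** * Comparison of multipliers *)
Section core.
Context {R: realType} {n: nat}.
Hypothesis n0: (0 < n)%N.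
Implicit Types (A B Phi F: 'rV[R]_n -> R[i]).

Definition goodsym (b': R) A:= forall K, exists kap, kapdec b' kap /\ exists M, symbol K A kap M.

(** Phi^2 can be divided by the dilates of B with parameter in [Th], uniformly. [Th] is the point 1
    when B is the bump Phi itself, and the interval from 1 to 2 when B is compared at a continuous
    scale. *)
Definition goodquot Phi B (Th: set R):= forall K, exists2 CQ: R, 0 <= CQ & forall th, Th th -> exists Q,
 [/\ cmeas Q, forall x, 4^-1 < enorm x -> rc Q x, supp_ann Q, sbound K CQ Q &
   forall xi, Q xi*B (th *: xi) = Phi xi^+2].
Lemma powR_expn_base (e: R) (k: nat): (2^+k)`^e = (2`^e)^+k.
Proof. by rewrite -powR_mulrn// -powRrM mulrC powRrM powR_mulrn// powR_ge0. Qed.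
Lemma powRV (x e: R): 0 <= x -> x^-1`^e = x`^(- e).
Proof. by move=> x0; rewrite -powR_inv1// -powRrM mulN1r. Qed.
Lemma tz_powR (e: R) d: (tz d: R)`^e = if 0 <= d then (2`^e)^+`|d|%N else (2`^(- e))^+`|d|%N.
Proof.
case: d=> k; first by rewrite tz_nat powR_expn_base.
have -> : Negz k = (- k.+1%:Z)%R by [].
by rewrite tzN tz_nat powRV ?exprn_ge0// powR_expn_base.
Qed.
Lemma tz_powRD (e: R) i j: (tz (i + j): R)`^e = tz i`^e*tz j`^e.
Proof. by rewrite tzD powRM// ltW// tz_gt0. Qed.
Lemma two_powN_lt1 (e: R): 0 < e -> 2`^(- e) < 1 :> R.
Proof.
move=> e0; have: (1`^e < 2`^e :> R) by apply: gt0_ltr_powR; rewrite ?nnegrE// ltr1n.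
by rewrite powR1 powRN=> h; rewrite invf_lt1 ?powR_gt0.
Qed.
(** For d >= 0 the argument of [kap] is small and the bound tau^b' is used; for d < 0 it is large,
    and decay of order lam + Bq leaves 2^(-Bq) per step after paying for the factor 2^lam. *)
Lemma kap_rho (b' lam Bq: R) (kap: R -> R): 0 < b' -> 0 <= lam -> 0 < Bq -> kapdec b' kap ->
 exists2 C: R, 0 <= C & forall th d, 1 <= th -> th <= 2 ->
 kap (th*tz (- d))*(2`^lam)^+negpart d <= C*rho (2`^(- b')) (2`^(- Bq)) d.
Proof.
move=> b0 l0 B0 [[C1 C10 h1] h2]; have L0: 0 <= lam + Bq by side.
have [C2 C20 h2']:= h2 _ L0.
exists (C1*2`^b' + C2)=> [|th d th1 th2]; first side.
have th0: 0 < th by exact: lt_le_trans th1.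
have CC: 0 <= C1*2`^b' by side.
case: d=> k.
 rewrite /negpart /rho /= expr0 mulr1 tzN tz_nat.
 have t0: 0 < th/2^+k by side.
 apply: (le_trans (h1 _ t0)); rewrite powRM ?invr_ge0 ?exprn_ge0 ?(ltW th0)//.
 rewrite powRV ?exprn_ge0// powR_expn_base mulrA ler_wpM2r ?exprn_ge0 ?powR_ge0//.
 le_via (C1*2`^b'); last by rewrite lerDl.
 by rewrite ler_wpM2l//; apply: ge0_ler_powR; rewrite ?nnegrE ?(ltW b0) ?(ltW th0).
have -> : (- Negz k)%R = k.+1%:Z by [].
rewrite /negpart /rho tz_nat /=.
have t1: 1 <= th*2^+k.+1 by rewrite mulr_ege1// exprn_ege1// ler1n.
le_via (C2*(2`^(- (lam + Bq)))^+k.+1*(2`^lam)^+k.+1).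
 rewrite ler_wpM2r ?exprn_ge0 ?powR_ge0//; apply: (le_trans (h2' _ t1)); rewrite ler_wpM2l//.
 rewrite powRM ?exprn_ge0 ?(ltW th0)// powR_expn_base ler_piMl ?exprn_ge0 ?powR_ge0//.
 by rewrite -[leRHS](powRr0 th); apply: ler_powR=> //; rewrite oppr_le0.
rewrite -mulrA -exprMn -powRD ?pnatr_eq0 ?implybT// (_: - (lam + Bq) + lam = - Bq); last by ring.
by rewrite ler_wpM2r ?exprn_ge0 ?powR_ge0// lerDr.
Qed.
(** Per dyadic step the smoothness weight and [rho] combine to 2^(alpha - b') < 1 when l >= m, and
    to 2^(-alpha - |alpha| - 1) <= 1/2 otherwise. The assumption alpha < b' enters here. *)
Lemma rho_weight (b' alpha r: R): 0 < b' -> alpha < b' -> 0 < r -> exists z: R, [/\ 0 < z, z < 1 &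
 forall l m, (tz l`^alpha)`^r*rho (2`^(- b')) (2`^(- (`|alpha| + 1))) (l - m)`^r <=
  zw z (l - m)*(tz m`^alpha)`^r].
Proof.
move=> b0 ab r0; pose c:= Num.min (b' - alpha) 1.
have c0: 0 < c by rewrite lt_min subr_gt0 ab ltr01.
pose y: R:= 2`^(- c); have y0: 0 <= y by side.
exists (y`^r); split; first side.
 have: y`^r < 1`^r by apply: gt0_ltr_powR; rewrite ?nnegrE// two_powN_lt1.
 by rewrite powR1.
move=> l m; rewrite -zw_powR//.
have p0: 0 <= rho (2`^(- b')) (2`^(- (`|alpha| + 1))) (l - m) :> R by rewrite ltW// rho_gt0 ?powR_gt0.
rewrite -!powRM ?powR_ge0 ?zw_ge0//; apply: ge0_ler_powR; rewrite ?nnegrE ?mulr_ge0 ?powR_ge0 ?zw_ge0 ?(ltW r0)//.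
rewrite -{1}(subrK m l) tz_powRD mulrAC ler_wpM2r ?powR_ge0//.
have:= ler_norm (- alpha); rewrite normrN=> hn.
have cb: c <= b' - alpha by rewrite ge_min lexx.
have c1: c <= 1 by rewrite ge_min lexx orbT.
rewrite tz_powR /rho /zw; case: ifP=> _; rewrite -exprMn -powRD ?pnatr_eq0 ?implybT//;
 rewrite lerXn2r ?nnegrE ?powR_ge0//; apply: ler_powR; rewrite ?ler1n//; lra.
Qed.
Lemma Umod_ge0 A F t x: 0 <= Umod A F t x. Proof. side. Qed.
Hint Resolve Umod_ge0: side.
Lemma meas_Umod A F t: cmeas A -> cmeas F -> mfun (Umod A F t).
Proof.
move=> mA mF; apply: cmeas_cabs; apply: cmeas_FT; apply: cmeasM=> //.
side.
Qed.
Lemma Umod_bounded A F M: cmeas A -> (forall x, cabs (A x) <= M) -> cintg (mu n) F ->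
 exists M0, forall t x, Umod A F t x <= M0.
Proof.
move=> mA AM Fi; have [mF /integrableP[mF' Flty]]:= Fi.
have M0: 0 <= M:= le_trans (cabs_ge0 _) (AM 0).
have Ff: (\int[mu n]_x (cabs (F x))%:E)%E \is a fin_num.
 rewrite ge0_fin_numE; last side.
 by under eq_integral do rewrite -[(cabs _)%:E]gee0_abs ?lee_fin ?cabs_ge0//.
exists (2*(M*fine (\int[mu n]_x (cabs (F x))%:E)%E))=> t x.
have ai: cintg (mu n) (fun xi=> A (t *: xi)*F xi).
 apply: (cintgMl_bounded Fi)=> [|y]; last exact: AM.
 side.
rewrite -lee_fin /Umod /FT; apply: (le_trans (cabs_Cint (cintg_char _ _ ai))).
rewrite !EFinM; apply: lee_wpmul2l=> //; rewrite fineK// -ge0_integralZl//; last first.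
 side.
apply: le_integral_ge0; try side.
move=> y; rewrite -EFinM lee_fin !cabsM cabs_cexpi mulr1; apply: ler_wpM2r; [side|exact: AM].
Qed.
(** [transfer] is used twice with the same B on the right: for A, and for B itself, the latter being
    the self-estimate of the Stromberg-Torchinsky argument. Taking for [kap] the sum of the two
    decays lets a single argument serve both. The ratio z depends only on b', alpha and r. *)
Lemma core (b' alpha r: R): 0 < r -> r <= 1 -> 0 < b' -> alpha < b' -> exists z: R, [/\ 0 < z, z < 1 &
 forall A B Phi (Th: set R), goodsym b' A -> goodsym b' B -> lp_partition Phi -> goodquot Phi B Th ->
 (forall th, Th th -> 1 <= th /\ th <= 2) ->
 exists2 C: R, 0 < C & forall F th th' l x, cintg (mu n) F -> Th th -> 1 <= th' -> th' <= 2 ->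
 (((tz l`^alpha*Umod A F (th'*tz (- l)) x)`^r)%:E <= C%:E *
  zsum (fun m=> (zw z (l - m))%:E*sop (eta (tz m))
   (fun y=> ((tz m`^alpha*Umod B F (th*tz (- m)) y)`^r)%:E) x))%E].
Proof.
move=> r0 r1 b0 ab; have [z [z0 z1 hz]]:= rho_weight b0 ab r0.
exists z; split=> // A B Phi Th gA gB lpP qB Th12.
pose lam: R:= n.+1%:R/r; have lam0: 0 <= lam by side.
have lamr: lam*r = n.+1%:R by rewrite divfK// gt_eqF.
(* Kernel decay at least lam, for the Peetre weight, and more than n, for integrability. *)
pose N:= (Num.bound lam + n.+1)%N.
have lamN: lam <= N%:R.
 rewrite natrD (le_trans (ltW (archi_boundP lam0)))// lerDl ler0n//.
have nN: (n < N)%N by rewrite /N addnS ltnS leq_addl.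
have [kA [dA [MA sA]]]:= gA N; have [kB [dB [MB sB]]]:= gB N.
have [CQ CQ0 hQ]:= qB N.
have [C C0 hC]:= @transfer R n n0 N nN.
pose Bq: R:= `|alpha| + 1; have Bq0: 0 < Bq by rewrite ltr_wpDl.
have CC: 0 <= C*CQ by side.
have [DA DA0 hDA]:= kap_rho b0 lam0 Bq0 (kapdecZ CC dA).
have [DB DB0 hDB]:= kap_rho b0 lam0 Bq0 (kapdecZ CC dB).
exists (DA + DB + 1); first by rewrite ltr_wpDl// addr_ge0.
move=> F th th' l x Fi thT th1 th2.
have [h1 h2]:= Th12 th thT; have th0: 0 < th by exact: lt_le_trans h1.
have th'0: 0 < th' by exact: lt_le_trans th1.
have [Q [mQ rQ sQ bQ QB]]:= hQ th thT.
have [mA AM _ kA0]:= sA; have [mB BM _ kB0]:= sB.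
pose kap d:= C*CQ*kA (th'*tz (- d)) + C*CQ*kB (th*tz (- d)).
pose a m y:= Umod B F (th*tz (- m)) y.
have [mF _]:= Fi.
have a0 m y: 0 <= a m y by side.
have ma m: mfun (a m) by exact: meas_Umod.
have [M0 hM0]:= Umod_bounded mB BM Fi.
have kA0' d: 0 <= kA (th'*tz (- d)) by case: (kA0 (th'*tz (- d)))=> //; rewrite mulr_gt0// tz_gt0.
have kB0' d: 0 <= kB (th*tz (- d)) by case: (kB0 (th*tz (- d)))=> //; rewrite mulr_gt0// tz_gt0.
have kap0 d: 0 <= kap d by side.
have s0 (k: int -> R) y: (forall d, 0 <= k d) -> forall m, (0 <= (k m)%:E*sop (etk N (tz m)) (fun y=> (a m y)%:E) y)%E.
 move=> k0 m; rewrite mule_ge0 ?lee_fin// sop_ge0=> [//|u|u]; [side|side].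
have step (A': 'rV[R]_n -> R[i]) k M (t: R) i y: symbol N A' k M -> 0 < t -> (forall d, 0 <= k (t*tz (- d))) ->
  (forall d, C*CQ*k (t*tz (- d)) <= kap d) ->
  ((Umod A' F (t*tz (- i)) y)%:E <= zsum (fun m=> (kap (i - m))%:E*sop (etk N (tz m)) (fun y=> (a m y)%:E) y))%E.
 move=> sA' t0 k0 kk.
 have tt: 0 < t*tz (- i) by rewrite mulr_gt0// tz_gt0.
 apply: (le_trans (hC A' k M B MB Q CQ Phi F (t*tz (- i)) th y sA' mB BM mQ rQ sQ CQ0 bQ lpP QB Fi tt th0)).
 have kE m: t*tz (- i)*tz m = t*tz (- (i - m)) by rewrite opprB addrC tzD mulrA.
 rewrite -zsumZ//; last by move=> m; rewrite kE; exact: (s0 (fun m=> k (t*tz (- (i - m))))).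
 apply: le_zsum=> m; rewrite muleA -EFinM; apply: lee_wpmul2r.
  by apply: sop_ge0=> [u|u]; [side|side].
 by rewrite lee_fin kE.
have p0: 0 < 2`^(- b') :> R by side.
have q0: 0 < 2`^(- Bq) :> R by side.
have kapC d: kap d*(2`^lam)^+negpart d <= (DA + DB)*rho (2`^(- b')) (2`^(- Bq)) d.
 by rewrite !mulrDl; apply: lerD; [exact: hDA|exact: hDB].
have ST:= @stromberg_torchinsky R n _ _ r lam (DA + DB) N kap p0 (two_powN_lt1 b0) q0 (two_powN_lt1 Bq0)
 r0 r1 lamr lamN (addr_ge0 DA0 DB0) kap0 kapC a a0 ma M0 (fun m y=> hM0 _ y).
have self i y: ((a i y)%:E <= zsum (fun m=> (kap (i - m))%:E*sop (etk N (tz m)) (fun y=> (a m y)%:E) y))%E.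
 apply: (step B kB MB th i y sB th0 kB0')=> d; rewrite /kap lerDr mulr_ge0//.
have hA: ((Umod A F (th'*tz (- l)) x)%:E <= zsum (fun m=> (kap (l - m))%:E*sop (etk N (tz m)) (fun y=> (a m y)%:E) x))%E.
 by apply: (step A kA MA th' l x sA th'0 kA0')=> d; rewrite /kap lerDl mulr_ge0.
have:= ST self _ l x (cabs_ge0 _) hA; rewrite -/(Umod A F (th'*tz (- l)) x)=> hST.
have V0:= Umod_ge0 A F (th'*tz (- l)) x.
clear hA; move: (Umod A F (th'*tz (- l)) x) V0 hST=> V V0 hST.
have -> : ((tz l`^alpha*V)`^r)%:E = (((tz l`^alpha)`^r)%:E*(V`^r)%:E)%E.
 by rewrite -EFinM; congr EFin; apply: powRM=> //; side.
apply: (le_trans (lee_wpmul2l _ hST)); first side.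
have e0 (m: int) y: (0 <= ((tz m`^alpha*Umod B F (th*tz (- m)) y)`^r)%:E)%E by side.
have Z0: (0 <= zsum (fun m=> (zw z (l - m))%:E*sop (eta (tz m))
   (fun y=> ((tz m`^alpha*Umod B F (th*tz (- m)) y)`^r)%:E) x))%E.
 by apply: zsum_ge0=> m; rewrite mule_ge0 ?lee_fin ?zw_ge0 ?(ltW z0)// sop_eta_ge0// tz_gt0.
le_via ((DA + DB)%:E*zsum (fun m=> (zw z (l - m))%:E*sop (eta (tz m))
   (fun y=> ((tz m`^alpha*Umod B F (th*tz (- m)) y)`^r)%:E) x))%E; last first.
 by apply: lee_wpmul2r=> //; rewrite lee_fin lerDl.
rewrite muleCA; apply: lee_wpmul2l; first side.
have ar0 m y: (0 <= (a m y`^r)%:E)%E by side.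
rewrite /st_Y -zsumZ ?powR_ge0//; last by move=> m; rewrite mule_ge0 ?lee_fin ?powR_ge0// sop_eta_ge0// tz_gt0.
apply: le_zsum=> m; rewrite muleA -EFinM.
have -> : (fun y=> ((tz m`^alpha*Umod B F (th*tz (- m)) y)`^r)%:E) =
 (fun y=> ((tz m`^alpha)`^r)%:E*(a m y`^r)%:E)%E.
 by apply/funext=> y; rewrite -EFinM; congr EFin; apply: powRM; [side|side].
have -> : sop (eta (tz m)) (fun y=> ((tz m`^alpha)`^r)%:E*(a m y`^r)%:E)%E x =
 (((tz m`^alpha)`^r)%:E*sop (eta (tz m)) (fun y=> (a m y`^r)%:E) x)%E.
 rewrite /sop; under eq_integral do rewrite muleCA.
 rewrite ge0_integralZl//; try side; last first.
 - by move=> y _; rewrite mule_ge0 ?lee_fin ?eta_ge0 ?tz_gt0 ?powR_ge0.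
 apply: emeasurable_funM; first by apply: meas_kernelE; side.
 side.
rewrite muleA -EFinM; apply: lee_wpmul2r; first by rewrite sop_eta_ge0 ?tz_gt0.
side.
Qed.

End core.
Hint Resolve Umod_ge0 meas_Umod: side.

Section complex_inverse.
Context {R: realType}.
Implicit Types z: R[i].
Lemma ReV z: Re z^-1 = Re z/(Re z^+2 + Im z^+2). Proof. by case: z. Qed.
Lemma ImV z: Im z^-1 = - (Im z/(Re z^+2 + Im z^+2)). Proof. by case: z. Qed.
Lemma cmeasV {d} {T: measurableType d} (f: T -> R[i]): cmeas f -> cmeas (fun x=> (f x)^-1).
Proof.
move=> [a b].
have mV: mfun (fun x=> (Re (f x)^+2 + Im (f x)^+2)^-1).
 by apply: (mcomp meas_invr); apply: measurable_funD; side.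
split.
 by under eq_fun do rewrite ReV; exact: measurable_funM.
by under eq_fun do rewrite ImV; apply: measurable_funN; side.
Qed.
Lemma rcV n (h: 'rV[R]_n -> R[i]) x: h x != 0 -> rc h x -> rc (fun x=> (h x)^-1) x.
Proof.
move=> h0 hc z; have [c1 c2]:= hc z.
have d0: Re (h x)^+2 + Im (h x)^+2 != 0.
 by rewrite -(@sqr_sqrtr _ (Re (h x)^+2 + Im (h x)^+2)) ?addr_ge0 ?sqr_ge0// sqrf_eq0 -/(cabs (h x)) cabs_eq0.
have cd: (fun k: nat=> (Re (h (x - k.+1%:R^-1 *: z))^+2 + Im (h (x - k.+1%:R^-1 *: z))^+2)^-1) @ \oo -->
 (Re (h x)^+2 + Im (h x)^+2)^-1.
 apply: (@cvg_comp_cont R (fun k: nat=> Re (h (x - k.+1%:R^-1 *: z))^+2 + Im (h (x - k.+1%:R^-1 *: z))^+2) _ GRing.inv).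
  exact: inv_continuous.
 by apply: cvgD; rewrite expr2; under eq_fun do rewrite expr2; exact: cvgM.
rewrite ReV ImV; split.
 by under eq_fun do rewrite ReV; exact: cvgM.
by under eq_fun do rewrite ImV; apply: cvgN; exact: cvgM.
Qed.
Lemma cabs_cexpi1_le (th: R): cabs (cexpi th - 1) <= 2 * `|th|.
Proof.
have lip (f df: R -> R): (forall u, is_derive u (1: R) f (df u)) -> (forall u, `|df u| <= 1) ->
  forall a, 0 <= a -> `|f a - f 0| <= a.
 move=> fd d1 a a0; have cf: {within `[0, a], continuous f}.
   apply: continuous_subspaceT=> u; apply/differentiable_continuous/derivable1_diffP.
   exact: (@ex_derive _ _ _ _ _ _ _ (fd u)).
  have [u _ ->]:= @MVT_segment R f df 0 a a0 (fun u _=> fd u) cf.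
 by rewrite subr0 normrM (ger0_norm a0) ler_piMl.
have hc:= lip _ _ (@is_derive_cos R) _.
have hs:= lip _ _ (@is_derive_sin R) (@cos_max R).
apply: (le_trans (cabs_le _)); rewrite ReB ImB /= subr0 mulr_natl mulr2n.
wlog t0: th/0 <= th.
 move=> h; have [/h//|/ltW t0]:= leP 0 th.
 by have:= h (- th); rewrite oppr_ge0 normrN cosN sinN normrN; apply.
rewrite (ger0_norm t0); apply: lerD.
 by have:= hc (fun u=> _) th t0; rewrite cos0; apply=> u; rewrite normrN sin_max.
by have:= hs th t0; rewrite sin0 subr0.
Qed.

End complex_inverse.

Section schwartz_symbol.
Context {R: realType} {n: nat}.
Hypothesis n0: (0 < n)%N.
Implicit Types (g h phi: 'rV[R]_n -> R[i]).
Lemma cmeas_continuous g: continuous (fun x=> Re (g x)) -> continuous (fun x=> Im (g x)) -> cmeas g.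
Proof. by move=> c1 c2; split; exact: continuous_measurable_rV. Qed.
Lemma nu_le_enorm (x: 'rV[R]_n): nu x <= n.+1%:R*(1 + enorm x).
Proof.
rewrite /nu; have: \sum_(i < n) `|x ord0 i| <= n%:R*enorm x.
 le_via (\sum_(i < n) enorm x); first by apply: ler_sum=> i _; exact: coord_le_enorm.
 by rewrite sumr_const card_ord mulr_natl.
have:= enorm_ge0 x; have:= ler0n R n; rewrite -natr1; nra.
Qed.
Lemma decay_nu g (N: nat): (exists C: R, forall x, (1 + enorm x)^+N*cabs (g x) <= C) ->
 exists2 C: R, 0 <= C & forall x, cabs (g x) <= C*nu x ^- N.
Proof.
move=> [C hC]; have C0: 0 <= C by apply: le_trans (hC 0); rewrite mulr_ge0 ?cabs_ge0 ?exprn_ge0 ?addr_ge0 ?enorm_ge0.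
exists (n.+1%:R^+N*C)=> [|x]; first side.
rewrite ler_pdivlMr ?exprn_gt0 ?nu_gt0// mulrC.
le_via ((n.+1%:R*(1 + enorm x))^+N*cabs (g x)).
 by rewrite ler_wpM2r ?cabs_ge0// lerXn2r ?nnegrE ?(ltW (nu_gt0 _)) ?mulr_ge0 ?addr_ge0 ?enorm_ge0 ?nu_le_enorm.
by rewrite exprMn -mulrA ler_wpM2l ?exprn_ge0.
Qed.
Lemma schwartz_cmeas phi: schwartz phi -> cmeas phi.
Proof. by move=> [/(_ [::])[h1 [h2 _]] _]; exact: cmeas_continuous. Qed.
Hint Resolve schwartz_cmeas: side.
Lemma meas_nupow (K: nat): mfun (fun x: 'rV[R]_n=> nu x^+K).
Proof. by apply: measurable_funX; exact: meas_nu. Qed.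
Lemma decay_integrable g (N: nat) (C: R): (n < N)%N -> 0 <= C -> cmeas g -> (forall x, cabs (g x) <= C*nu x ^- N) ->
 cintg (mu n) g.
Proof.
move=> nN C0 mg gC; apply: (@cintg_etk R n N 1 C)=> //.
by move=> x; rewrite /etk expr1n mul1r scale1r.
Qed.
Lemma schwartz_nu_integrable phi (K: nat): schwartz phi -> cintg (mu n) (fun x=> (nu x^+K)%:C * phi x).
Proof.
move=> sp; have [C C0 hC]:= decay_nu (sp.2 [::] (K + n.+1)%N).
apply: (@decay_integrable _ n.+1 C)=> //.
 by apply: cmeasM; [apply: cmeas_real; exact: meas_nupow|side].
move=> x; rewrite cabsM cabs_real ger0_norm ?exprn_ge0 ?(ltW (nu_gt0 _))//.
apply: (le_trans (ler_wpM2l _ (hC x))); first by rewrite exprn_ge0 ?(ltW (nu_gt0 _)).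
rewrite exprD invfM mulrCA ler_wpM2l// mulrA mulfV ?mul1r//; by rewrite expf_neq0// gt_eqF// nu_gt0.
Qed.
Lemma schwartz_integrable phi: schwartz phi -> cintg (mu n) phi.
Proof. by move=> sp; have:= schwartz_nu_integrable 0 sp; under eq_fun do rewrite expr0 mul1r. Qed.
Lemma iter_sdiff_FT (a: R) h (y v: 'rV[R]_n) (k j: nat): cintg (mu n) h ->
 iter k (@sdiff _) (fun j: nat=> FT a h (y + j%:R *: v)) j =
 FT a (fun x=> h x*(cexpi (a*dotp x v) - 1)^+k) (y + j%:R *: v).
Proof.
move=> hi; have ki k': cintg (mu n) (fun x=> h x*(cexpi (a*dotp x v) - 1)^+k').
 elim: k'=> [|k' IH]; first by under eq_fun do rewrite expr0 mulr1.
 under eq_fun do rewrite exprSr mulrA.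
 apply: (@cintgM_bounded _ _ _ _ _ _ 2)=> //.
  side.
 by move=> x; rewrite (le_trans (cabsB _ _))// cabs_cexpi cabs1.
elim: k j=> [|k IH] j; first by rewrite /=; apply: eq_Cint=> x; rewrite expr0 mulr1.
rewrite iterS /sdiff !IH /FT -CintB; try exact: cintg_char.
apply: eq_Cint=> x; rewrite [in RHS]exprSr.
have -> : a*dotp x (y + j.+1%:R *: v) = a*dotp x (y + j%:R *: v) + a*dotp x v.
 by rewrite !dotpDr !dotpZr -natr1; ring.
by rewrite cexpiD; ring.
Qed.
(** A difference of order k of the transform multiplies phi by (e^(i a x.v) - 1)^k, of size at most
    a multiple of (|d| nu x)^k, which the decay of phi absorbs. *)
Lemma sbound_FT_schwartz (a T: R) (K: nat) phi: 0 <= T -> schwartz phi -> exists2 C: R, 0 <= C &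
 forall tau, 0 <= tau -> tau <= T -> sbound K C (fun xi=> FT a phi (tau *: xi)).
Proof.
move=> T0 sp; have pin:= schwartz_nu_integrable K sp; have pi0:= schwartz_integrable sp.
have [_ /integrableP[_ ilty]]:= pin.
set I:= (\int[mu n]_x (cabs ((nu x^+K)%:C * phi x))%:E)%E.
have I0: (0 <= I)%E by side.
have If: I \is a fin_num.
 rewrite ge0_fin_numE//; apply: le_lt_trans ilty; apply: le_of_eq.
 by apply: eq_integral=> x _; rewrite /= ger0_norm ?cabs_ge0.
pose D:= 2 * `|a| * T + 1.
have D1: 1 <= D by rewrite lerDr !mulr_ge0.
exists (2*(D^+K*fine I))=> [|tau tau0 tauT x i d _ k j jk].
 side.
rewrite (_: (fun j: nat=> _) = (fun j: nat=> FT a phi (tau *: x + j%:R *: (tau *: (d *: evec R i))))); last first.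
 apply/funext=> m; rewrite scalerDr; congr (FT a phi (_ + _)).
 by apply/rowP=> u; rewrite !mxE mulrCA.
rewrite iter_sdiff_FT//.
set v:= tau *: (d *: evec R i).
set h:= fun y=> phi y*(cexpi (a*dotp y v) - 1)^+k.
have kK: (k <= K)%N by apply: leq_trans jk; exact: leq_addl.
have hb y: cabs (h y) <= D^+K * `|d| ^+ k*cabs ((nu y^+K)%:C * phi y).
 rewrite /h !cabsM cabs_real cabsX [`|nu y^+K|]ger0_norm ?exprn_ge0 ?(ltW (nu_gt0 _))//.
 have -> : D^+K * `|d| ^+ k*(nu y^+K*cabs (phi y)) = cabs (phi y)*(D^+K * `|d| ^+ k*nu y^+K) by ring.
 rewrite ler_wpM2l ?cabs_ge0//.
 have hy: `|y ord0 i| <= nu y.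
  rewrite /nu (bigD1 i)//= addrCA lerDl addr_ge0//; side.
 le_via ((D * `|d| * nu y)^+k).
  rewrite lerXn2r ?nnegrE ?cabs_ge0 ?mulr_ge0 ?(le_trans ler01 D1) ?(ltW (nu_gt0 _))//.
  apply: (le_trans (cabs_cexpi1_le _)).
  rewrite /v dotpZr dotpZr dotpC dotp_evec !normrM (ger0_norm tau0).
  have h1: tau * `|d| * `|y ord0 i| <= T * `|d| * nu y.
   by apply: ler_pM=> //; rewrite ?mulr_ge0// ler_wpM2r.
  have h2: 0 <= 2 * `|a| by rewrite mulr_ge0.
  have:= ler_wpM2l h2 h1; have: 0 <= `|d| * nu y by rewrite mulr_ge0// ltW// nu_gt0.
  by rewrite /D; nra.
 rewrite !exprMn; apply: ler_pM; rewrite ?mulr_ge0 ?exprn_ge0 ?(le_trans ler01 D1) ?(ltW (nu_gt0 _))//.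
  by rewrite ler_wpM2r ?exprn_ge0// ler_weXn2l.
 by rewrite ler_weXn2l ?nu_ge1.
have mh: cmeas h.
 apply: cmeasM; first by case: pi0.
 have: cmeas (fun y=> cexpi (a*dotp y v) - 1) by side.
 move=> mc; elim: (k)=> [|k' IH]; first side.
 by under eq_fun do rewrite exprS; side.
have hi: cintg (mu n) h.
 apply: (cintgP mh (h:= fun y=> D^+K * `|d| ^+ k*cabs ((nu y^+K)%:C * phi y)))=> //.
 by case: pin=> _ pint; exact: (integrableZl measurableT _ pint).
rewrite -lee_fin /FT; apply: (le_trans (cabs_Cint (cintg_char _ _ hi))).
rewrite (_: 2*(D^+K*fine I) * `|d| ^+ k = 2*((D^+K * `|d| ^+ k)*fine I)); last by ring.
rewrite EFinM; apply: lee_wpmul2l=> //.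
rewrite EFinM fineK// /I -ge0_integralZl//; try side; last first.
- by apply/mEFinP; apply: cmeas_cabs; case: pin.
apply: le_integral_ge0; try side.
by move=> y; rewrite -EFinM lee_fin cabsM cabs_cexpi mulr1.
Qed.
(** A dilate of the bump by tau vanishes on 1/4 <= |x| <= 4 unless 1/8 <= tau <= 8, so every rate of
    decay in tau is available. *)
Lemma goodsym_FT_schwartz (b' a: R) phi: 0 < b' -> schwartz phi -> supp_ann (FT a phi) -> goodsym b' (FT a phi).
Proof.
move=> b0 sp sa K; have h8: (0: R) <= 8 by [].
have [C C0 hC]:= sbound_FT_schwartz a K h8 sp.
have ip:= schwartz_integrable sp.
pose kap (tau: R):= if 8^-1 <= tau <= 8 then C else 0.
have kap0 tau: 0 <= kap tau by rewrite /kap; case: ifP.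
exists kap; split.
 split.
  exists (C*8`^b')=> [|tau t0]; first side.
  rewrite /kap; case: ifPn=> [/andP[t1 t2]|_]; last side.
  rewrite -mulrA ler_peMr// -powRM ?(ltW t0)// -[leLHS](powRr0 (8*tau)); apply: ler_powR; last side.
  by rewrite mulrC -ler_pdivrMr// mul1r.
 move=> L L0; exists (C*8`^L)=> [|tau t1]; first side.
 have t0: 0 < tau by exact: lt_le_trans t1.
 rewrite /kap; case: ifPn=> [/andP[_ t2]|_]; last side.
 rewrite -mulrA ler_peMr// powRN ler_pdivlMr ?powR_gt0// mul1r.
 by apply: ge0_ler_powR; rewrite ?nnegrE// ltW.
have [M hM]: exists M, forall x, cabs (FT a phi x) <= M.
 have [_ /integrableP[_ ilty]]:= ip.
 exists (2*fine (\int[mu n]_x (cabs (phi x))%:E)%E)=> x.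
 have If: (\int[mu n]_x (cabs (phi x))%:E)%E \is a fin_num.
  rewrite ge0_fin_numE; last side.
  apply: le_lt_trans ilty; apply: le_of_eq.
  by apply: eq_integral=> y _; rewrite /= ger0_norm ?cabs_ge0.
 rewrite -lee_fin EFinM fineK//; apply: (le_trans (cabs_Cint (cintg_char _ _ ip))).
 by under eq_integral do rewrite cabsM cabs_cexpi mulr1.
exists M; split=> //; try side.
- by move=> x _; exact: rc_FT.
- move=> tau t0; split=> //; rewrite /kap; case: ifPn=> [/andP[t1 t2]|ht].
  side.
 have h0 x: 4^-1 <= enorm x <= 4 -> FT a phi (tau *: x) = 0.
  move=> /andP[x1 x2]; apply: sa; apply: contra ht; rewrite /ann enormZ ?(ltW t0)// => /andP[y1 y2].
  by apply/andP; split; nra.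
 apply: (@eq_sbound _ _ K 0 (fun=> 0))=> [x xa|]; first by rewrite h0.
 by have:= @sbound_cst R n K 0; rewrite cabs0.
Qed.
(** With B = Phi the quotient Phi^2 / B is Phi itself, so the zeros of the bump cause no
    division. *)
Lemma goodquot_FT_schwartz (a: R) phi: schwartz phi -> supp_ann (FT a phi) ->
 goodquot (FT a phi) (FT a phi) [set 1].
Proof.
move=> sp sa K; have [C C0 hC]:= sbound_FT_schwartz a K ler01 sp.
exists C=> // th /= ->; exists (FT a phi); split=> //.
- side.
- by move=> x _; apply: rc_FT; exact: schwartz_integrable.
- by have:= hC 1 ler01 (lexx _); under [X in sbound _ _ X -> _]eq_fun do rewrite scale1r.
- by move=> xi; rewrite scale1r expr2.
Qed.
Lemma goodquot_elliptic (a b': R) phi B: 0 < b' -> schwartz phi -> supp_ann (FT a phi) -> goodsym b' B -> elliptic B ->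
 (forall x, 0 < enorm x -> B x != 0) -> goodquot (FT a phi) B [set th | 1 <= th <= 2].
Proof.
move=> b0 sp sa gB [c c0 Bc] Bn0 K; have [C C0 hC]:= sbound_FT_schwartz a K ler01 sp.
have [kap [[[D D0 hD] _] [M [mB BM rB sB]]]]:= gB K.
have DD: 0 <= D*2`^b' by side.
have [E E0 hE]:= @sboundV R n K _ _ DD c0.
have hC1: sbound K C (FT a phi).
 by have:= hC 1 ler01 (lexx _); under [X in sbound _ _ X -> _]eq_fun do rewrite scale1r.
exists (2^+K*(2^+K*(C*C)*E))=> [|th /= /andP[th1 th2]]; first side.
have th0: 0 < th by exact: lt_le_trans th1.
exists (fun x=> FT a phi x*FT a phi x*(B (th *: x))^-1).
have enth (x: 'rV[R]_n): 4^-1 < enorm x -> 0 < enorm (th *: x).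
 by move=> x0; rewrite enormZ ?(ltW th0)// mulr_gt0// (lt_trans _ x0)// invr_gt0.
split.
- apply: cmeasM; first side.
 by apply: cmeasV; apply: (cmeas_comp mB); apply: meas_scaleV; [side|side].
- move=> x x4; have rP: rc (FT a phi) x by apply: rc_FT; exact: schwartz_integrable.
 apply: rcM; first exact: rcM.
 apply: rcV; first by rewrite Bn0// enth.
 by apply: rc_scale; apply: rB; rewrite enth.
- by move=> x xa; rewrite sa// !mul0r.
- apply: sboundM=> //; first side.
  exact: sboundM.
 apply: hE=> [|x /andP[x1 x2]]; last first.
  by apply: Bc; rewrite enormZ ?(ltW th0)//; apply/andP; split; nra.
 have [_ hs]:= sB th th0; apply: sboundW hs.
 apply: (le_trans (hD th th0)); rewrite ler_wpM2l//.
 by apply: ge0_ler_powR; rewrite ?nnegrE ?(ltW b0) ?(ltW th0).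
- move=> xi; rewrite -expr2; have [xa|xa]:= boolP (ann xi).
  rewrite -mulrA mulVf ?mulr1// Bn0// enth//; case/andP: xa=> + _; apply: lt_le_trans.
  by rewrite ltf_pV2 ?posrE// ltr_nat.
 by rewrite sa// expr0n/= !mul0r.
Qed.
Lemma lp_admissible_symbol phi: lp_admissible phi ->
 [/\ schwartz phi, supp_ann (FT (- (2 * pi)) phi) & lp_partition (FT (- (2 * pi)) phi)].
Proof.
move=> [sp [cl su]]; have ip:= schwartz_integrable sp.
have fE xi: fourier phi xi = FT (- (2 * pi)) phi xi by exact: fourierE.
have sa: supp_ann (FT (- (2 * pi)) phi).
 move=> x xa; apply: contraNeq xa=> h.
 have: closure [set xi | fourier phi xi != 0] x by apply: subset_closure=> /=; rewrite fE.
 by rewrite cl.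
split=> //; split=> //; try side.
- by have [_ [_ [M [_ hM _ _]]]]:= goodsym_FT_schwartz ltr01 sp sa 0; exists M.
- have fE': fourier phi = FT (- (2 * pi)) phi by apply/funext.
 by move=> xi x0; have:= su xi x0; rewrite fE'.
Qed.

End schwartz_symbol.

Section homogeneous.
Context {R: realType} {n: nat}.
Implicit Types (g: 'rV[R]_n -> R[i]).
Lemma homogZ K (e: R) (c: R[i]) g: homog K e g -> homog K e (fun x=> c * g x).
Proof.
move=> [mg rg hg [A A0 sA] [C C0 hC]]; split; try side.
- move=> x x0; apply: rcM; last exact: rg.
 by move=> z; split; exact: cvg_cst.
- by move=> t x t0; rewrite hg// mulrCA.
- by exists (cabs c*A); [side|exact: sboundZ].
- exists (cabs c*C)=> [|x]; first side.
 by rewrite cabsM -mulrA ler_wpM2l ?cabs_ge0.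
Qed.
Lemma continuous_powR_at (e r: R): 0 < r -> {for r, continuous (fun x: R=> x`^e)}.
Proof.
move=> r0; apply/differentiable_continuous/derivable1_diffP.
by apply: derivable_powR; rewrite in_itv/= r0.
Qed.
Lemma meas_enorm: mfun (@enorm R n).
Proof.
apply: mcomp; first by apply: continuous_measurable_fun; exact: sqrt_continuous.
by apply: meas_dotp; side.
Qed.
Lemma homog_enorm K (e: R): 0 < e -> homog K e (fun x: 'rV[R]_n=> (enorm x`^e)%:C).
Proof.
move=> e0; split.
- by apply: cmeas_real; apply: (mcomp (measurable_powR e)); exact: meas_enorm.
- move=> x x0; apply: rc_real=> z.
 apply: (@cvg_comp_cont R (fun k: nat=> enorm (x - k.+1%:R^-1 *: z)) _ (fun u=> u`^e)).
  exact: continuous_powR_at.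
 exact: cvg_ray_enorm.
- by move=> t x t0; rewrite enormZ ?(ltW t0)// powRM ?(ltW t0) ?enorm_ge0// rmorphM.
- exact: sbound_enorm_pow.
- by exists 1=> // x; rewrite cabs_real ger0_norm ?powR_ge0// mul1r.
Qed.
Lemma homog_coord K i: homog K 1 (fun x: 'rV[R]_n=> (x ord0 i)%:C).
Proof.
split.
- by apply: cmeas_real; exact: meas_coord.
- move=> x x0; apply: rc_real=> z; have: (fun k: nat=> dotp (evec R i) (x - k.+1%:R^-1 *: z)) @ \oo --> dotp (evec R i) x by exact: cvg_ray_dotp.
 by under eq_fun do rewrite dotp_evec; rewrite dotp_evec.
- by move=> t x t0; rewrite mxE powRr1 ?(ltW t0)// rmorphM.
- by exists 4=> //; exact: sbound_coord.
- by exists 1=> // x; rewrite cabs_real powRr1 ?enorm_ge0// mul1r coord_le_enorm.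
Qed.
Lemma goodsym_sgm (b e b': R) g: mbexp b e b' -> 0 < b' -> 0 < e -> (forall K, homog K e g) -> goodsym b' (sgm g b).
Proof. by move=> hb b0 e0 hg K; exact: (symbol_sgm hb b0 e0 (hg K)). Qed.
Lemma elliptic_enorm (e: R): 0 < e -> elliptic (fun x: 'rV[R]_n=> (enorm x`^e)%:C).
Proof.
move=> e0; exists (4^-1`^e)=> [|x /andP[x1 _]]; first side.
by rewrite cabs_real ger0_norm ?powR_ge0//; apply: ge0_ler_powR; rewrite ?nnegrE ?invr_ge0 ?enorm_ge0 ?(ltW e0).
Qed.
Lemma ellipticZ (c: R[i]) g: c != 0 -> elliptic g -> elliptic (fun x=> c * g x).
Proof.
move=> c0 [d d0 hd]; exists (cabs c*d)=> [|x xa]; first by rewrite mulr_gt0 ?cabs_gt0.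
by rewrite cabsM ler_wpM2l ?cabs_ge0 ?hd.
Qed.

End homogeneous.
Hint Resolve meas_nupow meas_enorm: side.

(** * Test functions and the Poisson extension *)
Section test_functions.
Context {R: realType} {n: nat}.
Hypothesis n0: (0 < n)%N.
Implicit Types (f g: 'rV[R]_n -> R[i]).
Lemma cvg_ray (x z: 'rV[R]_n): (fun k: nat=> x - k.+1%:R^-1 *: z) @ \oo --> x.
Proof.
rewrite -[X in _ --> X]subr0 -(scale0r z); apply: cvgB; first exact: cvg_cst.
by apply: cvgZ; [exact: cvg_invS|exact: cvg_cst].
Qed.
Lemma raycont_continuous g: continuous (fun x=> Re (g x)) -> continuous (fun x=> Im (g x)) -> raycont g.
Proof.
move=> c1 c2 x z; split.
 exact: (cvg_comp _ _ (@cvg_ray x z) (c1 x)).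
exact: (cvg_comp _ _ (@cvg_ray x z) (c2 x)).
Qed.
Lemma compact_support_bounded (h: 'rV[R]_n -> R) (M: R): continuous h -> (forall x, M < enorm x -> h x = 0) ->
 exists B, forall x, `|h x| <= B.
Proof.
move=> ch hM; pose A:= [set v: 'rV[R]_n | forall i, `[- `|M|, `|M|]%classic (v ord0 i)].
have cA: compact A:= @rV_compact R n (fun=> `[- `|M|, `|M|]%classic) (fun=> @segment_compact R _ _).
have cI: compact (h @` A) by apply: continuous_compact=> //; exact: continuous_subspaceT.
have [B [Br hB]]:= compact_bounded cI.
exists (`|B| + 1)=> x; have [xM|Mx]:= leP (enorm x) M; last first.
 by rewrite hM// normr0 addr_ge0.
apply: (hB (`|B| + 1)); first by rewrite (le_lt_trans (ler_norm B))// ltrDl.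
exists x=> // i /=; rewrite in_itv/=; apply/andP.
have:= le_trans (coord_le_enorm x i) (le_trans xM (ler_norm M)).
by rewrite ler_norml=> /andP[].
Qed.
Lemma cderiv_shift (G: R -> R[i]) (u: R): cderivable (fun h=> G (u + h)) 0 ->
 is_derive u (1: R) (fun v=> Re (G v)) (Re (cderiv (fun h=> G (u + h)) 0)) /\
 is_derive u (1: R) (fun v=> Im (G v)) (Im (cderiv (fun h=> G (u + h)) 0)).
Proof.
have key (H: R -> R): derivable (fun h=> H (u + h)) 0 1 -> is_derive u (1: R) H (derive1 (fun h=> H (u + h)) 0).
 move=> dH; have h1: is_derive u (1: R) (fun v: R=> v - u) 1.
  by apply: is_derive_eq; rewrite subr0.
 have h2: is_derive (u - u) (1: R) (fun h=> H (u + h)) (derive1 (fun h=> H (u + h)) 0).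
  by rewrite subrr; apply: DeriveDef=> //; rewrite derive1E.
 have:= @is_derive1_comp _ (fun h=> H (u + h)) (fun v: R=> v - u) u _ _ h2 h1.
 rewrite mulr1 (_: (fun h: R=> H (u + h)) \o _ = H)//.
 by apply/funext=> v /=; rewrite addrC subrK.
by move=> [d1 d2]; split; [exact: (key (fun v=> Re (G v)))|exact: (key (fun v=> Im (G v)))].
Qed.
Lemma iter_pderiv_line f (i: 'I_n) (k: nat) (x: 'rV[R]_n) (u: R): smooth f ->
 is_derive u (1: R) (fun v=> Re (iter_pderiv (nseq k i) f (x + v *: evec R i)))
  (Re (iter_pderiv (nseq k.+1 i) f (x + u *: evec R i))) /\
 is_derive u (1: R) (fun v=> Im (iter_pderiv (nseq k i) f (x + v *: evec R i)))
  (Im (iter_pderiv (nseq k.+1 i) f (x + u *: evec R i))).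
Proof.
move=> sf; have [_ [_ dv]]:= sf (nseq k i).
have E: (fun h=> iter_pderiv (nseq k i) f (x + (u + h) *: evec R i)) =
 (fun h=> iter_pderiv (nseq k i) f (x + u *: evec R i + h *: evec R i)).
 by apply/funext=> h; rewrite scalerDl addrA.
have:= @cderiv_shift (fun v=> iter_pderiv (nseq k i) f (x + v *: evec R i)) u.
by rewrite E; apply; exact: dv.
Qed.
Lemma iter_pderiv_support f (M: R) (ds: seq 'I_n): 0 <= M -> (forall x, M < enorm x -> f x = 0) ->
 forall x, M < enorm x -> iter_pderiv ds f x = 0.
Proof.
move=> M0 fM; elim: ds=> [//|i ds IH] x Mx /=.
have loc: \forall h \near (0: R), iter_pderiv ds f (x + h *: evec R i) = 0.
 exists (enorm x - M)=> /=; first side.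
 move=> h /=; rewrite sub0r normrN=> hM; apply: IH.
 by have:= enorm_seg_ge x i h; lra.
have key (H: R -> R): (\forall h \near (0: R), H h = 0) -> derive1 H 0 = 0.
 move=> H0; rewrite derive1E; have:= @near_eq_derive _ _ _ H (cst 0) 0 1; rewrite derive_cst; apply=> //.
by apply: complex_ext=> /=; apply: key; near=> h; (have -> : iter_pderiv ds f (x + h *: evec R i) = 0 by near: h).
Unshelve. all: by end_near. Qed.
Lemma Cc_infty_bounded f ds: Cc_infty f -> exists2 B: R, 0 <= B & forall x, cabs (iter_pderiv ds f x) <= B.
Proof.
move=> [sf [M hM]]; have [c1 [c2 _]]:= sf ds.
have s0 x: `|M| < enorm x -> iter_pderiv ds f x = 0.
 apply: iter_pderiv_support=> // y My; apply: hM; exact: le_lt_trans (ler_norm M) My.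
have [B1 h1]:= compact_support_bounded c1 (M:= `|M|) (fun x h=> congr1 Re (s0 x h)).
have [B2 h2]:= compact_support_bounded c2 (M:= `|M|) (fun x h=> congr1 Im (s0 x h)).
have b1: 0 <= B1:= le_trans (normr_ge0 _) (h1 0).
have b2: 0 <= B2:= le_trans (normr_ge0 _) (h2 0).
exists (B1 + B2)=> [|x]; first side.
by rewrite (le_trans (cabs_le _))// lerD.
Qed.
Lemma Cc_infty_cmeas f: Cc_infty f -> cmeas f.
Proof. by move=> [/(_ [::])[c1 [c2 _]] _]; exact: cmeas_continuous. Qed.
Hint Resolve Cc_infty_cmeas: side.
Lemma ball_indic_nu (r: R) (x: 'rV[R]_n): 0 <= r -> enorm x <= r -> 1 <= (n.+1%:R*(1 + r))^+n.+1*nu x ^- n.+1.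
Proof.
move=> r0 xr; rewrite ler_pdivlMr ?exprn_gt0 ?nu_gt0// mul1r.
rewrite lerXn2r ?nnegrE ?(ltW (nu_gt0 _)) ?mulr_ge0 ?addr_ge0//.
by apply: (le_trans (nu_le_enorm x)); rewrite ler_wpM2l// lerD2l.
Qed.
Lemma Cc_infty_integrable f: Cc_infty f -> cintg (mu n) f.
Proof.
move=> cf; have [B B0 hB]:= Cc_infty_bounded [::] cf.
have [_ [M hM]]:= cf.
apply: (@decay_integrable R n f n.+1 (B*(n.+1%:R*(1 + `|M|))^+n.+1))=> //; try side.
move=> x; have [xM|Mx]:= leP (enorm x) `|M|; last first.
 rewrite hM ?(le_lt_trans (ler_norm M))// cabs0 !mulr_ge0 ?exprn_ge0 ?mulr_ge0 ?addr_ge0//.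
 by rewrite invr_ge0 exprn_ge0 ?(ltW (nu_gt0 _)).
by rewrite -mulrA -[leLHS]mulr1; apply: ler_pM; rewrite ?cabs_ge0 ?hB// ball_indic_nu.
Qed.
(** [FT_decay] with steps of length at most 1: the K-th difference of f is bounded by its K-th
    directional derivative through [sdiff_derive_bound]. *)
Lemma Cc_infty_FT_decay (a: R) f (K: nat): a^+2 = (2 * pi)^+2 -> Cc_infty f ->
 exists2 C: R, 0 <= C & forall xi, cabs (FT a f xi) <= C*nu xi ^- K.
Proof.
move=> a2 cf; have fi:= Cc_infty_integrable cf; have [sf [M hM]]:= cf.
(* K steps of length at most 1 enlarge the support by at most K. *)
pose T:= `|M| + K%:R; have T0: 0 <= T by side.
pose D:= (n.+1%:R*(1 + T))^+n.+1; have D0: 0 <= D by side.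
have bd (i: 'I_n) (k: nat): exists2 B: R, 0 <= B & forall x, cabs (iter_pderiv (nseq k i) f x) <= B by exact: Cc_infty_bounded.
pose B i k:= projT1 (cid2 (bd i k)).
have B0 i k: 0 <= B i k by rewrite /B; case: cid2.
have hB i k x: cabs (iter_pderiv (nseq k i) f x) <= B i k by rewrite /B; case: cid2=> /= b _; exact.
pose J: R:= fine (etaI n); have J0: 0 <= J by side.
have JE: (etaI n = J%:E :> \bar R)%E by rewrite fineK// ge0_fin_numE ?etaI_ge0 ?etaI_lty.
have eta1 (x: 'rV[R]_n): @eta R n 1 x = nu x ^- n.+1 by rewrite /eta expr1n mul1r scale1r.
have domi (h: 'rV[R]_n -> R[i]) (b: R): 0 <= b -> cmeas h -> (forall x, cabs (h x) <= b) ->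
  (forall x, T < enorm x -> h x = 0) -> (\int[mu n]_x (cabs (h x))%:E <= (b*(D*J))%:E)%E.
 move=> b0 mh hb hT; rewrite EFinM EFinM -JE -(integral_eta n ltr01) muleA -EFinM -ge0_integralZl//; try side; last 2 first.
 - by apply/mEFinP; exact: meas_eta.
 - by move=> x _; rewrite lee_fin eta_ge0.
 apply: le_integral_ge0; try side.
 - by apply: measurable_funeM; apply/mEFinP; exact: meas_eta.
 - move=> x; rewrite -EFinM lee_fin eta1; have [xT|Tx]:= leP (enorm x) T; last first.
   by rewrite hT// cabs0 !mulr_ge0// invr_ge0 exprn_ge0// ltW// nu_gt0.
  by rewrite -mulrA -[leLHS]mulr1; apply: ler_pM; rewrite ?cabs_ge0 ?hb// ball_indic_nu.
have MT x: T < enorm x -> f x = 0.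
 move=> Tx; apply: hM; apply: le_lt_trans Tx; apply: (le_trans (ler_norm M)); by rewrite lerDl.
have [C [C0 hC]]:= @FT_decay R n K 1 ltr01.
pose i0:= Ordinal n0.
pose S:= \sum_(i < n) (B i 0%N + 2*B i K).
have Si i: B i 0%N + 2*B i K <= S.
 by rewrite /S (bigD1 i)//= lerDl; apply: sumr_ge0=> j _; rewrite addr_ge0// mulr_ge0.
have SDJ: 0 <= S*(D*J) by side.
exists (C*(S*(D*J)))=> [|xi]; first side.
apply: hC=> // [|i d d1].
 apply: (@le_trans _ _ (B i0 0%N*(D*J))%:E).
  by apply: domi=> //; [side|move=> x; exact: (hB i0 0%N)].
 rewrite lee_fin ler_wpM2r ?mulr_ge0//; apply: le_trans (Si i0); by rewrite lerDl mulr_ge0.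
have fdE x: iter K (fdiff (d *: evec R i)) f x = iter K (@sdiff _) (fun j: nat=> f (x + j%:R *: (d *: evec R i))) 0%N.
 by have:= iter_fdiff_seq f (d *: evec R i) K x 0; rewrite scale0r addr0.
apply: (@le_trans _ _ (2*B i K * `|d| ^+ K*(D*J))%:E); last first.
 rewrite lee_fin mulrAC ler_wpM2r ?exprn_ge0// ler_wpM2r ?mulr_ge0//.
 by apply: le_trans (Si i); rewrite lerDr.
apply: domi; try side.
- by case: (cintg_fdiff (d *: evec R i) K fi).
- move=> x; rewrite fdE.
 have part (Q: R[i] -> R): (forall z w, Q (z - w) = Q z - Q w) -> (forall z, `|Q z| <= cabs z) ->
  (forall k u, is_derive u (1: R) (fun v=> Q (iter_pderiv (nseq k i) f (x + v *: evec R i)))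
   (Q (iter_pderiv (nseq k.+1 i) f (x + u *: evec R i)))) ->
  `|Q (iter K (@sdiff _) (fun j: nat=> f (x + j%:R *: (d *: evec R i))) 0%N)| <= B i K * `|d| ^+ K.
  move=> QB Qle Qd.
  have -> : Q (iter K (@sdiff _) (fun j: nat=> f (x + j%:R *: (d *: evec R i))) 0%N) =
    iter K (@sdiff _) (fun j: nat=> Q (f (x + (0 + j%:R*d) *: evec R i))) 0%N.
   have gen k m: Q (iter k (@sdiff _) (fun j: nat=> f (x + j%:R *: (d *: evec R i))) m) =
    iter k (@sdiff _) (fun j: nat=> Q (f (x + (0 + j%:R*d) *: evec R i))) m.
    by elim: k m=> [|k IH] m; [rewrite /= add0r scalerA|rewrite !iterS /sdiff QB !IH].
   exact: gen.
  pose L:= K%:R * `|d|; have L0: 0 <= L by side.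
  have gb k u: - L <= u <= L -> `|Q (iter_pderiv (nseq k i) f (x + u *: evec R i))| <= B i k.
   by move=> _; rewrite (le_trans (Qle _)).
  have h1: - L <= 0 <= L by rewrite oppr_le0 L0.
  have h2: - L <= 0 + K%:R*d <= L by rewrite add0r -ler_norml normrM (ger0_norm (ler0n _ _)).
  exact: (@sdiff_derive_bound R (fun k v=> Q (iter_pderiv (nseq k i) f (x + v *: evec R i))) (B i) (- L) L d Qd gb K 0%N 0 h1 h2).
 rewrite (le_trans (cabs_le _))// -mulrA mulr_natl mulr2n; apply: lerD.
  apply: part=> [z w|z|k u]; [exact: ReB|exact: Re_le_cabs|by have []:= iter_pderiv_line i k x u sf].
 apply: part=> [z w|z|k u]; [exact: ImB|exact: Im_le_cabs|by have []:= iter_pderiv_line i k x u sf].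
- move=> x Tx; rewrite fdE -(iter_sdiff0 R[i] K 0%N); apply: eq_iter_sdiff=> j /andP[_ jK].
 apply: hM; rewrite scalerA; have:= enorm_seg_ge x i (j%:R*d); rewrite normrM (ger0_norm (ler0n R j)).
 have h1: j%:R * `|d| <= K%:R by rewrite -[leRHS]mulr1; apply: ler_pM=> //; rewrite ler_nat.
 have:= ler_norm M; move: Tx; rewrite /T; lra.
Qed.
Lemma Cc_infty_FT_integrable (a: R) f (K: nat): a^+2 = (2 * pi)^+2 -> Cc_infty f ->
 cintg (mu n) (fun xi=> (nu xi^+K)%:C*FT a f xi).
Proof.
move=> a2 cf; have [C C0 hC]:= Cc_infty_FT_decay (K + n.+1) a2 cf.
apply: (@decay_integrable R n _ n.+1 C)=> //.
 apply: cmeasM; first by apply: cmeas_real; exact: meas_nupow.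
 side.
move=> x; rewrite cabsM cabs_real ger0_norm ?exprn_ge0 ?(ltW (nu_gt0 _))//.
apply: (le_trans (ler_wpM2l _ (hC x))); first by rewrite exprn_ge0 ?(ltW (nu_gt0 _)).
by rewrite exprD invfM mulrCA ler_wpM2l// mulrA mulfV ?mul1r// expf_neq0// gt_eqF// nu_gt0.
Qed.
Lemma Cc_infty_inversion f x: Cc_infty f -> FT (2 * pi) (FT (- (2 * pi)) f) x = f x.
Proof.
move=> cf; have a2: (- (2 * pi))^+2 = (2 * pi)^+2 :> R by rewrite sqrrN.
have [B _ hB]:= Cc_infty_bounded [::] cf.
have [/(_ [::])[c1 [c2 _]] _]:= cf.
have Fi: cintg (mu n) (FT (- (2 * pi)) f).
 by have:= Cc_infty_FT_integrable 0 a2 cf; under eq_fun do rewrite expr0 mul1r.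
rewrite -{1}(opprK (2 * pi)); apply: (FT_inversion a2 _ hB)=> //.
- exact: Cc_infty_integrable.
- exact: raycont_continuous.
Qed.

End test_functions.

(** * The Poisson kernel as a mixture of Gaussians *)

Section poisson_kernel.
Context {R: realType} {n: nat}.
Local Notation leb:= (@lebesgue_measure R).
Variable s: R.
Hypothesis s0: 0 < s.
Let a: R:= (n%:R + s)/2.
Let a0: 0 < a. Proof. by rewrite divr_gt0// ltr_wpDl. Qed.
Let s20: 0 < s/2. Proof. side. Qed.

Definition pk (z: 'rV[R]_n): R:= (dotp z z + 1)`^(- a).
Let X0 (z: 'rV[R]_n): 0 < dotp z z + 1 :> R. Proof. by rewrite ltr_wpDl ?dotp_ge0. Qed.
Lemma meas_pk: mfun pk.
Proof.
apply: (mcomp (measurable_powR (- a))); apply: measurable_funD=> //.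
by apply: meas_dotp; side.
Qed.
Hint Resolve meas_pk: side.
Lemma pk_gt0 z: 0 < pk z. Proof. by rewrite powR_gt0// X0. Qed.
Hint Resolve pk_gt0: side.
Let Wp (l: measurableTypeR R): R:= Wg a l.
Let mWp: measurable_fun [set: measurableTypeR R] Wp.
Proof. exact: meas_Wg. Qed.
Lemma pk_superposition z: (\int[leb]_l (Wg a l * gau l z)%:E = (mb a 0 * pk z)%:E)%E.
Proof.
rewrite mulrC -(gamma_scale a0 (X0 z)); apply: eq_integral=> l _; congr EFin.
rewrite /Wg /gau; case: ifP=> _; last by rewrite !mul0r.
by rewrite -mulrA -expRD; congr (_*expR _); ring.
Qed.
Let pi_n: R:= Num.sqrt pi^+n.
Let pi_n0: 0 < pi_n. Proof. by rewrite exprn_gt0// sqrtr_gt0 pi_gt0. Qed.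
Let Wg_gauss (l: R): 0 < l -> Wg a l*Num.sqrt (pi/l)^+n = pi_n*Wg (s/2) l.
Proof.
move=> l0; rewrite /Wg l0 sqrtrM ?(ltW (pi_gt0 _))// exprMn.
have -> : Num.sqrt l^-1^+n = l`^(- (n%:R/2)).
 rewrite -powR12_sqrt ?invr_ge0 ?(ltW l0)// powRV ?(ltW l0)// -powR_mulrn ?powR_ge0// -powRrM.
 by congr (_`^_); field.
rewrite (_: s/2 - 1 = (a - 1) + - (n%:R/2)); last by rewrite /a; field.
rewrite (@powRD _ l (a - 1)) ?(gt_eqF l0) ?implybT//; by rewrite /pi_n; ring.
Qed.
Let integral_gau (l: R): 0 < l -> (\int[@mu R n]_z (gau l z)%:E = (Num.sqrt (pi/l)^+n)%:E)%E.
Proof.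
move=> l0; have [gi h]:= @FT_gau R n l 0 0 l0.
have If: (\int[mu n]_z (gau l z)%:E)%E \is a fin_num.
 exact: (integrable_fin_num measurableT (cintg_Re gi)).
move: h; rewrite /FT; under eq_Cint do rewrite mul0r cexpi0 mulr1.
rewrite Cint_real /gau expr0n/= mul0r mul0r oppr0 expR0 mulr1=> /(congr1 Re)/= h.
by rewrite -h fineK.
Qed.
Let mgau2: mfun (fun w: measurableTypeR R*'rV[R]_n=> gau (w.1: R) w.2).
Proof.
apply: (mcomp (@measurable_expR R)); apply: measurable_funN; apply: measurable_funM.
 side.
by apply: meas_dotp; side.
Qed.
Let mWgau: mfun (fun w: measurableTypeR R*'rV[R]_n=> Wp w.1 * gau (w.1: R) w.2).
Proof. side. Qed.
Let inner_z (l: R): (\int[mu n]_z (Wg a l * gau l z)%:E = (pi_n*Wg (s/2) l)%:E)%E.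
Proof.
have [l0|l0]:= leP l 0.
 by rewrite /Wg !ltNge !l0 /= mulr0; under eq_integral do rewrite mul0r; rewrite integral0.
under eq_integral do rewrite EFinM.
rewrite ge0_integralZl ?lee_fin ?Wg_ge0//; last 2 first.
- apply/mEFinP; apply: (mcomp (@measurable_expR R)); apply: measurable_funN.
 apply: measurable_funM=> //; apply: meas_dotp; side.
- by move=> z _; rewrite lee_fin expR_ge0.
by rewrite integral_gau// -EFinM Wg_gauss.
Qed.
Let total: (\int[leb]_(l in [set: measurableTypeR R]) (pi_n*Wg (s/2) l)%:E = (pi_n * mb (s/2) 0)%:E)%E.
Proof.
have dom: mbdom (s/2) 0 by rewrite /mbdom s20 lexx orbT.
rewrite EFinM mbK// /mbE -ge0_integralZl ?lee_fin ?(ltW pi_n0)//; try side; last first.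
- exact: meas_WE.
by apply: eq_integral=> l _; rewrite -EFinM /Eg mul0r oppr0 expR0 mulr1.
Qed.
Lemma integral_pk: (\int[mu n]_z (pk z)%:E = (pi_n * mb (s/2) 0/mb a 0)%:E)%E.
Proof.
have dom: mbdom a 0 by rewrite /mbdom a0 lexx orbT.
have m0:= mb_gt0 dom.
have h: ((mb a 0)%:E*\int[mu n]_z (pk z)%:E = (pi_n * mb (s/2) 0)%:E)%E.
 rewrite -ge0_integralZl ?lee_fin ?(ltW m0)//; last 2 first.
 - by apply/mEFinP; exact: meas_pk.
 - by move=> z _; rewrite lee_fin ltW// pk_gt0.
 under eq_integral do rewrite -EFinM -pk_superposition.
 rewrite -total -(@fubini_tonelli _ _ _ _ R leb (mu n) (fun w=> (Wp w.1 * gau (w.1: R) w.2)%:E))//=; try side.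
 - by apply: eq_integral=> l _; exact: inner_z.
 - by move=> w; rewrite lee_fin mulr_ge0 ?Wg_ge0 ?expR_ge0.
have -> : (\int[mu n]_z (pk z)%:E = (mb a 0)^-1%:E*((mb a 0)%:E*\int[mu n]_z (pk z)%:E))%E.
 by rewrite muleA -EFinM mulVf ?mul1e// gt_eqF.
by rewrite h -EFinM mulrC.
Qed.
Lemma cintg_pk: cintg (mu n) (fun z=> (pk z)%:C).
Proof.
split; first by apply: cmeas_real; exact: meas_pk.
apply/integrableP; split; first by apply/mEFinP; apply: cmeas_cabs; apply: cmeas_real; exact: meas_pk.
under eq_integral do rewrite cabs_real abse_EFin normr_id ger0_norm ?(ltW (pk_gt0 _))//.
by rewrite integral_pk ltry.
Qed.
(** The Gamma formula writes the kernel as a mixture of Gaussians with weight [Wg a]. Transforming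
    each one brings a factor (pi/l)^(n/2), which lowers the index from a = (n + s)/2 to s/2,
    together with e^(-pi^2 |xi|^2 / l), the factor [Eg]. *)
Lemma FT_pk (b: R) xi: b^+2 = (2 * pi)^+2 ->
 FT b (fun z=> (pk z)%:C) xi = (pi_n/mb a 0 * mb (s/2) (pi^+2*dotp xi xi))%:C.
Proof.
move=> b2; have dom: mbdom a 0 by rewrite /mbdom a0 lexx orbT.
have m0:= mb_gt0 dom.
pose f (w: measurableTypeR R*'rV[R]_n): R[i]:= (Wp w.1 * gau (w.1: R) w.2)%:C*cexpi (b*dotp w.2 xi).
have fi: cintg (leb \x mu n)%E f.
 have mf: cmeas f.
  apply: cmeasM; first side.
  apply: cmeas_cexpi; apply: measurable_funM=> //.
  side.
 split=> //; apply/integrable12ltyP; first by apply/mEFinP; exact: cmeas_cabs.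
 under eq_integral=> l _.
  under eq_integral=> z _ do rewrite abse_EFin ger0_norm ?cabs_ge0// cabsM cabs_cexpi mulr1 cabs_real/= ger0_norm ?mulr_ge0 ?Wg_ge0 ?expR_ge0//.
  rewrite inner_z; over.
 by rewrite total ltry.
have fub:= Cint_fubini fi.
have lhs: Cint leb (fun l=> Cint (mu n) (fun z=> f (l, z))) = (pi_n * mb (s/2) (pi^+2*dotp xi xi))%:C.
 have dx: mbdom (s/2) (pi^+2*dotp xi xi) by rewrite /mbdom s20 mulr_ge0 ?sqr_ge0 ?dotp_ge0 ?orbT.
 transitivity (Cint leb (fun l: measurableTypeR R=> (pi_n*(Wg (s/2) l*Eg (pi^+2*dotp xi xi) l))%:C)).
  apply: eq_Cint.
  move=> l; rewrite /f /=; have [l0|l0]:= leP (l: R) 0.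
   rewrite /Wp /Wg !ltNge !l0 /= !mul0r !mulr0.
   under eq_Cint do rewrite mul0r mul0r.
   by rewrite (Cint_real (mu n) (fun=> 0)) integral0.
  have [gi gE]:= @FT_gau R n l b xi l0.
  transitivity ((Wg a l)%:C*FT b (fun x: 'rV[R]_n=> (gau l x)%:C) xi).
   rewrite /FT -CintZ; last exact: cintg_char.
   by apply: eq_Cint=> z; rewrite mulrA -rmorphM.
  rewrite gE -rmorphM; congr (_%:C); rewrite [LHS]mulrA (Wg_gauss l0) -[LHS]mulrA; congr (_*(_*expR (- _))).
  by rewrite b2; field; rewrite gt_eqF.
 rewrite Cint_real; congr (_%:C); under eq_integral do rewrite EFinM.
 rewrite ge0_integralZl ?lee_fin ?(ltW pi_n0)//; last 2 first.
 - exact: meas_WE.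
 - by move=> l _; exact: WE_ge0.
 by rewrite -/(mbE _ _) -mbK.
have rhs: Cint (mu n) (fun z=> Cint leb (fun l=> f (l, z))) = (mb a 0)%:C*FT b (fun z=> (pk z)%:C) xi.
 rewrite /FT -CintZ; last by apply: cintg_char; exact: cintg_pk.
 apply: eq_Cint=> z; rewrite /f /=.
 have gi: cintg leb (fun l: measurableTypeR R=> (Wp l * gau (l: R) z)%:C).
  have mm: measurable_fun [set: measurableTypeR R] (fun l: measurableTypeR R=> Wp l * gau (l: R) z).
   apply: measurable_funM; first exact: mWp.
   apply: (mcomp (@measurable_expR R)); apply: measurable_funN; side.
  split; first side.
  apply/integrableP; split; first side.
  under eq_integral do rewrite cabs_real abse_EFin normr_id ger0_norm ?mulr_ge0 ?Wg_ge0 ?expR_ge0//.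
  by rewrite pk_superposition ltry.
 under eq_Cint do rewrite mulrC.
 by rewrite CintZ// Cint_real pk_superposition mulrC mulrA -rmorphM.
have:= fub; rewrite lhs rhs=> h.
have mC: (mb a 0)%:C != 0 :> R[i] by rewrite -cabs_eq0 cabs_real gt_eqF// normr_gt0 gt_eqF.
by apply: (mulfI mC); rewrite -h -rmorphM; congr (_%:C); field; rewrite gt_eqF.
Qed.
Lemma Cns_gt0: 0 < @Cns R n s.
Proof.
have -> : @Cns R n s = (fine (\int[mu n]_z (pk z)%:E)%E)^-1.
 rewrite /Cns ge0_iintE.
 - by congr (fine _)^-1; apply: eq_integral=> z _; rewrite /pk enorm_sqr.
 - apply/mEFinP; under eq_fun do rewrite enorm_sqr; exact: meas_pk.
 - side.
rewrite integral_pk/= invr_gt0 divr_gt0 ?mulr_gt0 ?mb_gt0// /mbdom ?a0 ?s20 lexx orbT//.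
Qed.

(** By [integral_pk] this is 1 / mb (s/2) 0, that is 1 / Gamma(s/2): the symbol takes the value 1 at
    the origin, as the kernel has integral 1. *)
Definition pst_const: R:= @Cns R n s*(pi_n/mb a 0).
Lemma pst_const_gt0: 0 < pst_const.
Proof. by rewrite !mulr_gt0 ?Cns_gt0// ?invr_gt0 ?mb_gt0// /mbdom a0 lexx orbT. Qed.

Definition pkt (t: R) (z: 'rV[R]_n): R:= @Cns R n s*(t`^s)*((enorm z^+2 + t^+2)`^(- a)).
Lemma pktE t z: 0 < t -> pkt t z = @Cns R n s*t^-1^+n * pk (t^-1 *: z).
Proof.
move=> t0; rewrite /pkt /pk -!mulrA; congr (_*_).
have -> : dotp (t^-1 *: z) (t^-1 *: z) + 1 = (enorm z^+2 + t^+2)*t ^- 2.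
 by rewrite dotpZl dotpZr -enorm_sqr; field; rewrite gt_eqF.
have t2: 0 < t^+2 by side.
rewrite powRM ?addr_ge0 ?sqr_ge0 ?invr_ge0 ?(ltW t2)// mulrC [RHS]mulrCA; congr (_*_).
have -> : (t ^- 2)`^(- a) = t`^(n%:R + s).
 rewrite powRV ?(ltW t2)// opprK -powR_mulrn ?(ltW t0)// -powRrM; congr (_`^_); by rewrite /a; field.
have -> : t^-1^+n = t`^(- n%:R) by rewrite powRN powR_mulrn ?(ltW t0)// exprVn.
rewrite -powRD; first by congr (_`^_); ring.
by rewrite (gt_eqF t0) implybT.
Qed.
Lemma cintg_pkt t: 0 < t -> cintg (mu n) (fun z=> (pkt t z)%:C).
Proof.
move=> t0; have ti: 0 < t^-1 by side.
have:= cintgZ (@Cns R n s*t^-1^+n)%:C (cintg_scale ti cintg_pk).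
by under eq_fun do rewrite -rmorphM -pktE//.
Qed.
Lemma FT_pkt (b t: R) xi: 0 < t -> b^+2 = (2 * pi)^+2 ->
 FT b (fun z=> (pkt t z)%:C) xi = (pst_const * mb (s/2) (pi^+2*dotp (t *: xi) (t *: xi)))%:C.
Proof.
move=> t0 b2; have ti: 0 < t^-1 by side.
transitivity ((@Cns R n s*t^-1^+n)%:C*FT b (fun z=> (pk (t^-1 *: z))%:C) xi).
 rewrite /FT -CintZ; last by apply: cintg_char; exact: (cintg_scale ti cintg_pk).
 by apply: eq_Cint=> z; rewrite mulrA -rmorphM -pktE.
rewrite (FT_scale b (g:= fun z=> (pk z)%:C) xi ti cintg_pk) invrK FT_pk// -!rmorphM.
congr (_%:C); rewrite /pst_const; field; rewrite !gt_eqF ?mb_gt0//= ?exprn_gt0// /mbdom a0 lexx orbT//.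
Qed.
Lemma Pst_FT t (g G: 'rV[R]_n -> R[i]) x: 0 < t -> cintg (mu n) G -> (forall y, g y = FT (2 * pi) G y) ->
 Pst s t g x = FT (2 * pi) (fun xi=> (pst_const * mb (s/2) (pi^+2*dotp (t *: xi) (t *: xi)))%:C*G xi) x.
Proof.
move=> t0 Gi gE; have {gE} -> : g = FT (2 * pi) G by apply/funext.
have ki:= cintg_pkt t0.
have [mG /integrableP[_ Glty]]:= Gi.
have [M hM]: exists M, forall y, cabs (FT (2 * pi) G y) <= M.
 exists (2*fine (\int[mu n]_x (cabs (G x))%:E)%E)=> y.
 have If: (\int[mu n]_x (cabs (G x))%:E)%E \is a fin_num.
  rewrite ge0_fin_numE; last side.
  by under eq_integral do rewrite -[(cabs _)%:E]gee0_abs ?lee_fin ?cabs_ge0//.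
 rewrite -lee_fin EFinM fineK//; apply: (le_trans (cabs_Cint (cintg_char _ _ Gi))).
 by under eq_integral do rewrite cabsM cabs_cexpi mulr1.
pose h y:= (pkt t y)%:C*FT (2 * pi) G (x - y).
have hi: cintg (mu n) h.
 apply: (cintgM_bounded ki)=> [|y]; last exact: hM.
 by apply: (cmeas_comp (cmeas_FT _ mG)); apply: meas_subV; [side|side].
have E: (fun y=> (@Cns R n s*t`^s*(enorm (x - y)^+2 + t^+2)`^(- ((n%:R + s)/2)))%:C*FT (2 * pi) G y) =
 (fun y=> h (- (y + - x))).
 apply/funext=> y; rewrite /h (_: - (y + - x) = x - y); last by rewrite opprD opprK addrC.
 by rewrite subKr.
have hn:= cintg_neg hi.
rewrite /Pst E cintE; last exact: (cintg_shift (f:= fun y=> h (- y)) (- x) hn).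
rewrite (@Cint_shift _ _ (fun y=> h (- y)) (- x)); last by case: hn.
rewrite Cint_neg; last by case: hi.
rewrite conv_FT//; apply: eq_Cint=> xi.
by rewrite FT_pkt ?sqrrN// [dotp x xi]dotpC.
Qed.

End poisson_kernel.
Hint Resolve Cns_gt0 pst_const_gt0: side.

Local Notation Ic:= (Complex 0 1).

Section cderiv_integral.
Context {R: realType} {d} {Y: measurableType d}.
Variable m: {measure set Y -> \bar R}.

Definition is_cderive (x: R) (f: R -> R[i]) (z: R[i]) :=
 is_derive x (1: R) (fun u=> Re (f u)) (Re z) /\ is_derive x (1: R) (fun u=> Im (f u)) (Im z).
Lemma is_cderive_cderiv x f z: is_cderive x f z -> cderiv f x = z.
Proof.
move=> [h1 h2]; apply: complex_ext=> /=; rewrite derive1E.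
 exact: (@derive_val _ _ _ _ _ _ _ h1).
exact: (@derive_val _ _ _ _ _ _ _ h2).
Qed.
Lemma is_cderive_Cint (f f': R -> Y -> R[i]) (G: Y -> R) (a e: R): 0 < e ->
 (forall x, cintg m (f x)) ->
 (forall x y, `|x - a| < e -> is_cderive x (f ^~ y) (f' x y)) ->
 m.-integrable setT (EFin \o G) ->
 (forall x y, `|x - a| < e -> cabs (f' x y) <= G y) ->
 is_cderive a (fun x=> Cint m (f x)) (Cint m (f' a)).
Proof.
move=> e0 fi fd Gi fG; split.
 apply: (@is_derive_under_integral _ _ _ m (fun x y=> Re (f x y)) (fun x y=> Re (f' x y)) G a e)=> //.
 - by move=> x; exact: cintg_Re.
 - by move=> x y xa; have []:= fd x y xa.
 - by move=> x y xa; rewrite (le_trans (Re_le_cabs _))// fG.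
apply: (@is_derive_under_integral _ _ _ m (fun x y=> Im (f x y)) (fun x y=> Im (f' x y)) G a e)=> //.
- by move=> x; exact: cintg_Im.
- by move=> x y xa; have []:= fd x y xa.
- by move=> x y xa; rewrite (le_trans (Im_le_cabs _))// fG.
Qed.
Lemma is_cderive_cexpi (c: R[i]) (p k x: R) :
 is_cderive x (fun h=> c*cexpi (p + h*k)) (k%:C*Ic*c*cexpi (p + x*k)).
Proof.
have h0: is_derive x (1: R) (fun h: R=> p + h*k) k.
 by apply: is_derive_eq; rewrite /GRing.scale/=; ring.
have hc: is_derive x (1: R) (fun h: R=> cos (p + h*k)) (- sin (p + x*k)*k).
 exact: (@is_derive1_comp _ cos (fun h: R=> p + h*k) x _ _ (is_derive_cos _) h0).
have hs: is_derive x (1: R) (fun h: R=> sin (p + h*k)) (cos (p + x*k)*k).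
 exact: (@is_derive1_comp _ sin (fun h: R=> p + h*k) x _ _ (is_derive_sin _) h0).
split.
 rewrite (_: (fun u=> Re _) = (fun u=> Re c *: cos (p + u*k) - Im c *: sin (p + u*k))); last first.
  by apply/funext=> u; rewrite ReM.
 apply: is_derive_eq; case: c=> c1 c2; rewrite /GRing.scale/=; ring.
rewrite (_: (fun u=> Im _) = (fun u=> Re c *: sin (p + u*k) + Im c *: cos (p + u*k))); last first.
 by apply/funext=> u; rewrite ImM.
apply: is_derive_eq; case: c=> c1 c2; rewrite /GRing.scale/=; ring.
Qed.
Lemma is_cderive_real (c: R[i]) (h: R -> R) (x dh: R): is_derive x (1: R) h dh ->
 is_cderive x (fun u=> (h u)%:C*c) (dh%:C*c).
Proof.
move=> hd; split.
 rewrite (_: (fun u=> Re _) = (fun u=> Re c *: h u)); last by apply/funext=> u; rewrite ReRM mulrC.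
 by rewrite ReRM mulrC; exact: is_deriveZ.
rewrite (_: (fun u=> Im _) = (fun u=> Im c *: h u)); last by apply/funext=> u; rewrite ImRM mulrC.
by rewrite ImRM mulrC; exact: is_deriveZ.
Qed.

End cderiv_integral.

Section mb_derivative.
Context {R: realType}.
Local Notation leb:= (@lebesgue_measure R).
Lemma Wg_divl (b l: R): Wg b l/l = Wg (b - 1) l.
Proof.
rewrite /Wg; case: ifPn=> l0; last by rewrite mul0r.
rewrite (@powRD _ l (b - 1) (-1)) ?(gt_eqF l0) ?implybT// powR_inv1 ?(ltW l0)//; ring.
Qed.
(** In the exponential variable the argument stays positive, so the integral can be differentiated
    at every point, with a dominating function given by [mb (b - 1)] at a slightly smaller
    argument. *)
Lemma is_derive_mb_exp (b x: R): is_derive x (1: R) (fun u=> mb b (expR u)) (- expR x * mb (b - 1) (expR x)).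
Proof.
have dom (c u: R): mbdom c (expR u) by rewrite /mbdom expR_gt0.
pose f (u: R) (l: measurableTypeR R): R:= Wg b l*Eg (expR u) l.
pose f' (u: R) (l: measurableTypeR R): R:= - expR u*(Wg (b - 1) l*Eg (expR u) l).
pose G (l: measurableTypeR R): R:= expR (x + 1)*(Wg (b - 1) l*Eg (expR (x - 1)) l).
have H:= @is_derive_under_integral R _ _ leb f f' G x 1 ltr01.
have -> : - expR x * mb (b - 1) (expR x) = (\int[leb]_y (f' x y))%R.
 by rewrite /f' RintegralZl//; exact: integrable_WE.
apply: H.
- by move=> u; exact: integrable_WE.
- move=> u l _; rewrite /f /f' /Eg.
 have h1: is_derive u (1: R) (fun v: R=> - (expR v/l)) (- (expR u/l)).
  have:= is_deriveN (is_deriveZ (l: R)^-1 (is_derive_expR u)).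
  by rewrite /GRing.scale/= [l^-1*_]mulrC; under eq_fun do rewrite mulrC.
 have h2:= @is_derive1_comp _ expR (fun v: R=> - (expR v/l)) u _ _ (is_derive_expR _) h1.
 have:= is_deriveZ (Wg b l) h2; rewrite /GRing.scale/= => h3.
 by apply: is_derive_eq; rewrite /GRing.scale/= -Wg_divl; ring.
- exact: (integrableZl measurableT (expR (x + 1)) (integrable_WE (dom (b - 1) (x - 1)))).
- move=> u l; rewrite ltr_norml=> /andP[u1 u2]; rewrite /f' /G normrM normrN !ger0_norm ?mulr_ge0 ?expR_ge0 ?Wg_ge0//.
 apply: ler_pM; rewrite ?mulr_ge0 ?expR_ge0 ?Wg_ge0//; first by rewrite ler_expR; lra.
 rewrite /Wg; case: ifPn=> l0; last by rewrite !mul0r.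
 rewrite ler_wpM2l ?mulr_ge0 ?powR_ge0 ?expR_ge0// ler_expR lerN2 ler_wpM2r ?invr_ge0 ?(ltW l0)// ler_expR; lra.
Qed.
Lemma is_derive_mb_scale n (b x: R) (xi: 'rV[R]_n) :
 is_derive x (1: R) (fun u=> mb b (pi^+2*dotp (expR u *: xi) (expR u *: xi)))
 (- 2 * pi^+2*dotp (expR x *: xi) (expR x *: xi) * mb (b - 1) (pi^+2*dotp (expR x *: xi) (expR x *: xi))).
Proof.
have E u: dotp (expR u *: xi) (expR u *: xi) = expR u^+2*dotp xi xi by rewrite dotpZl dotpZr expr2 mulrA.
have [x0|xn]:= eqVneq (dotp xi xi) 0.
 under eq_fun do rewrite E x0 !mulr0; rewrite E x0 !mulr0 mul0r; exact: is_derive_cst.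
have p0: 0 < pi^+2*dotp xi xi by rewrite mulr_gt0 ?exprn_gt0 ?pi_gt0// lt_def xn dotp_ge0.
pose k:= ln (pi^+2*dotp xi xi).
have Ek u: pi^+2*dotp (expR u *: xi) (expR u *: xi) = expR (u*2 + k).
 rewrite E expRD lnK ?posrE// [u*2]mulrC (_: 2*u = u + u); last by ring.
 by rewrite expRD expr2; ring.
have -> : - 2 * pi^+2*dotp (expR x *: xi) (expR x *: xi) * mb (b - 1) (pi^+2*dotp (expR x *: xi) (expR x *: xi)) =
  - expR (x*2 + k) * mb (b - 1) (expR (x*2 + k))*2 by rewrite -Ek; ring.
under eq_fun do rewrite Ek.
have h1: is_derive x (1: R) (fun u: R=> u*2 + k) 2.
 by apply: is_derive_eq; rewrite /GRing.scale/= ?mulr1 ?mulr0 ?addr0 ?add0r.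
exact: (@is_derive1_comp _ (fun v=> mb b (expR v)) (fun u: R=> u*2 + k) x _ _ (is_derive_mb_exp b _) h1).
Qed.

End mb_derivative.

(** * Fourier representation of the three extensions *)

Section links.
Context {R: realType} {n: nat}.
Hypothesis n0: (0 < n)%N.
Implicit Types (f phi: 'rV[R]_n -> R[i]).
Local Notation Fo f:= (FT (- (2 * pi)) f).
Let a2: (- (2 * pi))^+2 = (2 * pi)^+2 :> R. Proof. by rewrite sqrrN. Qed.
Lemma Fo_nu_integrable f: Cc_infty f -> cintg (mu n) (fun xi=> (nu xi)%:C*Fo f xi).
Proof. by move=> cf; have:= Cc_infty_FT_integrable n0 1 a2 cf; under eq_fun do rewrite expr1. Qed.
Lemma Fo_integrable f: Cc_infty f -> cintg (mu n) (Fo f).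
Proof. by move=> cf; have:= Cc_infty_FT_integrable n0 0 a2 cf; under eq_fun do rewrite expr0 mul1r. Qed.
Lemma conv_Umod phi f j x: schwartz phi -> Cc_infty f ->
 cabs (Defs.conv (lpdil phi j) f x) = Umod (Fo phi) (Fo f) (tz (- j)) x.
Proof.
move=> sp cf; have ip:= schwartz_integrable sp.
have tj: 0 < (tz j: R) by side.
have il: cintg (mu n) (lpdil phi j).
 by apply: cintgZ; exact: (cintg_scale tj ip).
have [B _ hB]:= Cc_infty_bounded [::] cf.
have E: Defs.conv (lpdil phi j) f x = Cint (mu n) (fun y=> lpdil phi j y*FT (2 * pi) (Fo f) (x - y)).
 rewrite /Defs.conv cintE.
  by apply: eq_Cint=> y; rewrite Cc_infty_inversion.
 apply: (cintgM_bounded il)=> [|y]; last exact: hB.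
 by apply: (cmeas_comp (Cc_infty_cmeas cf)); apply: meas_subV; [side|side].
rewrite E conv_FT//; last exact: Fo_integrable.
congr cabs; rewrite /FT; apply: eq_Cint=> xi; rewrite [dotp x xi]dotpC; congr (_*_*_).
transitivity ((2 ^ (j*n%:Z))%:C*FT (- (2 * pi)) (fun y=> phi (tz j *: y)) xi).
 rewrite /FT -CintZ; last by apply: cintg_char; exact: (cintg_scale tj ip).
 by apply: eq_Cint=> y; rewrite mulrA.
rewrite FT_scale// mulrA -rmorphM -tzN.
rewrite -exprz_exp -exprnP -/(tz j) mulfV ?mul1r//.
side.
Qed.

(** [sg1], [sg2] and [sg3] are the symbols, at t = 1, of t^beta P_t (-Delta)^(beta/2), of t times a
    partial derivative in x, and of t d/dt. The last comes from [is_derive_mb_scale], which lowers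
    the index s/2 by one and produces -2 pi^2 |xi|^2. *)
Definition sg1 (s beta: R): 'rV[R]_n -> R[i] :=
 sgm (fun xi=> (@pst_const R n s*(2 * pi)`^beta)%:C*(enorm xi`^beta)%:C) (s/2).
Definition sg2 (s: R) (i: 'I_n): 'rV[R]_n -> R[i] :=
 sgm (fun xi=> ((@pst_const R n s*(2 * pi))%:C*Ic)*(xi ord0 i)%:C) (s/2).
Definition sg3 (s: R): 'rV[R]_n -> R[i] :=
 sgm (fun xi=> (@pst_const R n s*(- 2 * pi^+2))%:C*(enorm xi`^2)%:C) (s/2 - 1).
Lemma mb_half_le s (r: R): 0 < s -> 0 <= r -> mb (s/2) r <= mb (s/2) 0.
Proof. by move=> s0 r0; apply: mb_mono=> //; rewrite /mbdom divr_gt0// lexx orbT. Qed.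
Lemma cmeas_mult s t: cmeas (fun xi: 'rV[R]_n=> (@pst_const R n s * mb (s/2) (pi^+2*dotp (t *: xi) (t *: xi)))%:C).
Proof.
apply: cmeas_real; apply: measurable_funM=> //; apply: (mcomp (meas_mb (s/2))).
by apply: meas_dotp; (apply: meas_scaleV; [side|side]).
Qed.
Lemma mult_bounded s t (xi: 'rV[R]_n): 0 < s ->
 cabs ((@pst_const R n s * mb (s/2) (pi^+2*dotp (t *: xi) (t *: xi)))%:C) <= @pst_const R n s * mb (s/2) 0.
Proof.
move=> s0; have P0:= ltW (@pst_const_gt0 R n s s0).
have d0: 0 <= pi^+2*dotp (t *: xi) (t *: xi) by rewrite mulr_ge0 ?sqr_ge0 ?dotp_ge0.
rewrite cabs_real ger0_norm; last by apply: mulr_ge0=> //; exact: mb_ge0.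
by apply: ler_wpM2l=> //; exact: mb_half_le.
Qed.
Lemma fraclap_Umod s beta f t x: 0 < s -> 0 < beta -> beta <= 1 -> Cc_infty f -> 0 < t ->
 t`^beta*cabs (Pst s t (fraclap beta f) x) = Umod (sg1 s beta) (Fo f) t x.
Proof.
move=> s0 b0 b1 cf t0; have p20: 0 < 2 * pi :> R by side.
have nuF:= Fo_nu_integrable cf.
pose G xi:= ((2 * pi*enorm xi)`^beta)%:C*Fo f xi.
have mG: cmeas G.
 apply: cmeasM; last by apply: cmeas_FT; exact: Cc_infty_cmeas.
 apply: cmeas_real; apply: (mcomp (measurable_powR beta)).
 by apply: measurable_funM=> //; exact: meas_enorm.
have Gi: cintg (mu n) G.
 have [_ nFi]:= nuF.
 apply: (cintgP mG (integrableZl measurableT (1 + 2 * pi*n.+1%:R) nFi))=> xi.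
 rewrite /G !cabsM !cabs_real !ger0_norm ?powR_ge0 ?(ltW (nu_gt0 _))// mulrA ler_wpM2r ?cabs_ge0//.
 have e0:= enorm_ge0 xi.
 have en: enorm xi <= nu xi*n.+1%:R.
  le_via (nu xi); last by rewrite ler_peMr ?(ltW (nu_gt0 _))// ler1n.
  rewrite -(@ler_pXn2r _ 2) ?nnegrE ?(ltW (nu_gt0 _))// enorm_sqr /dotp.
  le_via ((\sum_(i < n) `|xi ord0 i|)^+2); last first.
   by rewrite lerXn2r ?nnegrE ?sumr_ge0 ?(ltW (nu_gt0 _))// lerDr.
  rewrite expr2 mulr_suml; apply: ler_sum=> i _; rewrite -expr2 -real_normK ?num_real// expr2 ler_wpM2l//.
  by rewrite (bigD1 i)//= lerDl sumr_ge0.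
 (* As beta <= 1, one factor [nu] dominates the fractional power, and [nu] times the transform is
    integrable. *)
 have h: (2 * pi*enorm xi)`^beta <= 1 + 2 * pi*enorm xi.
  have X0: 0 <= 2 * pi*enorm xi by side.
  le_via ((1 + 2 * pi*enorm xi)`^beta).
   by apply: ge0_ler_powR; rewrite ?nnegrE ?(ltW b0) ?addr_ge0// lerDr.
  by rewrite -[leRHS]powRr1 ?addr_ge0//; apply: ler_powR=> //; rewrite lerDl.
 apply: (le_trans h).
 have -> : (1 + 2 * pi*n.+1%:R)*nu xi = nu xi + 2 * pi*(nu xi*n.+1%:R) by ring.
 by apply: lerD; [exact: nu_ge1|rewrite ler_wpM2l// ltW].
have fE y: fraclap beta f y = FT (2 * pi) G y.
 rewrite /fraclap -[RHS]cintE; last exact: cintg_char.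
 congr cint; apply/funext=> xi; rewrite /G fourierE; last exact: Cc_infty_integrable.
 by rewrite [dotp y xi]dotpC.
rewrite (Pst_FT s0 x t0 Gi fE) -[t`^beta]ger0_norm ?powR_ge0// -cabs_real -cabsM /Umod; congr cabs.
rewrite /FT -CintZ; last first.
 apply: cintg_char; apply: (cintgMl_bounded Gi (cmeas_mult s t))=> xi; exact: mult_bounded.
apply: eq_Cint=> xi; rewrite /sg1 /sgm /G enormZ ?(ltW t0)//.
rewrite !powRM ?mulr_ge0 ?enorm_ge0 ?pi_ge0 ?(ltW p20) ?(ltW t0)// -/(Fo f xi) !RCM; ring.
Qed.
Lemma Pst_Cc s f t y: 0 < s -> Cc_infty f -> 0 < t ->
 Pst s t f y = FT (2 * pi) (fun xi=> (@pst_const R n s * mb (s/2) (pi^+2*dotp (t *: xi) (t *: xi)))%:C*Fo f xi) y.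
Proof.
move=> s0 cf t0; apply: Pst_FT=> //; first exact: Fo_integrable.
by move=> z; rewrite Cc_infty_inversion.
Qed.
Lemma pderiv_Umod s f i t x: 0 < s -> Cc_infty f -> 0 < t ->
 t*cabs (pderiv i (fun y=> Pst s t f y) x) = Umod (sg2 s i) (Fo f) t x.
Proof.
move=> s0 cf t0.
pose S (xi: 'rV[R]_n):= (@pst_const R n s * mb (s/2) (pi^+2*dotp (t *: xi) (t *: xi)))%:C*Fo f xi.
have Fi:= Fo_integrable cf; have nuF:= Fo_nu_integrable cf.
have Si: cintg (mu n) S.
 by apply: (cintgMl_bounded Fi (cmeas_mult s t))=> xi; exact: mult_bounded.
pose g (h: R) (xi: 'rV[R]_n):= S xi*cexpi (2 * pi*dotp xi x + h*(2 * pi*xi ord0 i)).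
pose g' (h: R) (xi: 'rV[R]_n):= (2 * pi*xi ord0 i)%:C*(Ic: R[i])*S xi*cexpi (2 * pi*dotp xi x + h*(2 * pi*xi ord0 i)).
have gE h: Pst s t f (x + h *: evec R i) = Cint (mu n) (g h).
 rewrite Pst_Cc//; apply: eq_Cint=> xi; congr (_*cexpi _).
 by rewrite dotpDr dotpZr [dotp xi (evec R i)]dotpC dotp_evec; ring.
have Sb (xi: 'rV[R]_n): `|xi ord0 i| * cabs (S xi) <= @pst_const R n s * mb (s/2) 0*cabs ((nu xi)%:C*Fo f xi).
 rewrite /S !cabsM mulrCA; apply: ler_pM; rewrite ?mulr_ge0 ?cabs_ge0//; first exact: mult_bounded.
 rewrite ler_wpM2r ?cabs_ge0// !cabs_real (ger0_norm (ltW (nu_gt0 _))).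
 by rewrite /nu (bigD1 i)//= addrCA lerDl addr_ge0//; side.
have p20: 0 < 2 * pi :> R by side.
have [_ nFi]:= nuF.
have D:= @is_cderive_Cint R _ _ (mu n) g g' (fun xi=> 2 * pi*(@pst_const R n s * mb (s/2) 0)*cabs ((nu xi)%:C*Fo f xi)) 0 1 ltr01.
rewrite /pderiv; under [X in cderiv X]eq_fun do rewrite gE.
rewrite (is_cderive_cderiv (D _ _ _ _)).
- rewrite -[X in X*_](gtr0_norm t0) -cabs_real -cabsM /Umod; congr cabs.
 have i1: cabs (Ic: R[i]) = 1 by rewrite /cabs/= expr0n expr1n add0r sqrtr1.
 have gIc: cintg (mu n) (g' 0).
  have E0: g' 0 = (fun xi=> ((2 * pi)%:C*Ic)*((xi ord0 i)%:C*S xi)*cexpi (2 * pi*dotp xi x)).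
   by apply/funext=> xi; rewrite /g' mul0r addr0 !rmorphM/=; ring.
  rewrite E0; apply: cintg_char; apply: cintgZ.
  apply: (cintgP _ (integrableZl measurableT (@pst_const R n s * mb (s/2) 0) nFi)).
   by apply: cmeasM; [apply: cmeas_real; exact: meas_coord|case: Si].
  by move=> xi; rewrite cabsM cabs_real.
 rewrite /FT -CintZ//; apply: eq_Cint=> xi; rewrite /g' /S /sg2 /sgm mul0r addr0 mxE -/(Fo f xi) !RCM; ring.
- move=> h; rewrite (_: g h = (fun xi: 'rV[R]_n=> S xi*cexpi (2 * pi*dotp xi x)*cexpi (h*(2 * pi*xi ord0 i)))).
  apply: (@cintgM_bounded _ _ _ _ _ _ 1).
  + exact: cintg_char.
  + apply: cmeas_cexpi; apply: measurable_funM=> //; apply: measurable_funM=> //; exact: meas_coord.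
  + by move=> xi; rewrite cabs_cexpi.
 by apply/funext=> xi; rewrite /g cexpiD mulrA.
- by move=> h xi _; exact: is_cderive_cexpi.
- exact: (integrableZl measurableT _ nFi).
- move=> h xi _; rewrite /g' !cabsM cabs_cexpi mulr1.
 have i1: cabs (Ic: R[i]) = 1 by rewrite /cabs/= expr0n expr1n add0r sqrtr1.
 have -> : cabs (2 * pi*xi ord0 i)%:C = 2 * pi * `|xi ord0 i| by rewrite cabs_real normrM (gtr0_norm p20).
 rewrite [cabs Ic]i1 mulr1; have:= ler_wpM2l (ltW p20) (Sb xi); rewrite /S !cabsM; lra.
Qed.
(** Differentiation is carried out in u = ln t, where t d/dt becomes d/du. The differentiated
    integrand carries the bounded symbol [sg3], so a multiple of the transform of f dominates it. *)
Lemma dt_Umod s f t x: 0 < s -> s < 2 -> Cc_infty f -> 0 < t ->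
 t*cabs (cderiv (fun u=> Pst s u f x) t) = Umod (sg3 s) (Fo f) t x.
Proof.
move=> s0 s2 cf t0; have Fi:= Fo_integrable cf.
have [kap [_ [M sM]]]: exists kap, kapdec s kap /\ exists M, symbol 0 (sg3 s) kap M.
 apply: (@symbol_sgm R n 0 _ (s/2 - 1) 2 s)=> //; last by apply: homogZ; exact: homog_enorm.
 by right; split; lra.
have [m3 b3 _ _]:= sM.
pose g (u: R) (xi: 'rV[R]_n):= (@pst_const R n s * mb (s/2) (pi^+2*dotp (expR u *: xi) (expR u *: xi)))%:C *
 (Fo f xi*cexpi (2 * pi*dotp xi x)).
pose g' (u: R) (xi: 'rV[R]_n):= sg3 s (expR u *: xi)*(Fo f xi*cexpi (2 * pi*dotp xi x)).
have Fx:= cintg_char (2 * pi) x Fi.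
have D: is_cderive (ln t) (fun u=> Cint (mu n) (g u)) (Cint (mu n) (g' (ln t))).
 apply: (@is_cderive_Cint R _ _ (mu n) g g' (fun xi=> M*cabs (Fo f xi)) (ln t) 1 ltr01).
 - by move=> u; apply: (cintgMl_bounded Fx (cmeas_mult s (expR u)))=> xi; exact: mult_bounded.
 - move=> u xi _; rewrite /g /g' /sg3 /sgm.
  have h:= is_deriveZ (@pst_const R n s) (is_derive_mb_scale (s/2) u xi).
  have hh:= is_cderive_real (Fo f xi*cexpi (2 * pi*dotp xi x)) h.
  rewrite [X in is_cderive _ _ X](_: _ = (@pst_const R n s*(- 2 * pi^+2*dotp (expR u *: xi) (expR u *: xi) *
   mb (s/2 - 1) (pi^+2*dotp (expR u *: xi) (expR u *: xi))))%:C*(Fo f xi*cexpi (2 * pi*dotp xi x))).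
   exact: hh.
  congr (_*_); rewrite -!RCM; congr (_%:C).
  by rewrite (@powR_mulrn _ _ 2) ?enorm_ge0// enorm_sqr; ring.
 - exact: (integrableZl measurableT _ Fi.2).
 - by move=> u xi _; rewrite /g' cabsM [cabs (Fo f xi*_)]cabsM cabs_cexpi mulr1 ler_wpM2r ?cabs_ge0 ?b3.
have PE u: 0 < u -> Pst s u f x = Cint (mu n) (g (ln u)).
 move=> u0; rewrite Pst_Cc// /FT; apply: eq_Cint=> xi; by rewrite /g lnK ?posrE// mulrA.
have key (Q: R[i] -> R) (dq: R): is_derive (ln t) (1: R) (fun u=> Q (Cint (mu n) (g u))) dq ->
  derive1 (fun u=> Q (Pst s u f x)) t = dq*t^-1.
 move=> h; have h2:= @is_derive1_comp _ (fun u=> Q (Cint (mu n) (g u))) (@ln R) t _ _ h (is_derive1_ln t0).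
 rewrite derive1E; have <- := @derive_val _ _ _ _ _ _ _ h2; apply: near_eq_derive=> //.
 near=> u; rewrite /= PE//; near: u; exact: lt_nbhsr.
have -> : cderiv (fun u=> Pst s u f x) t = (t^-1)%:C*Cint (mu n) (g' (ln t)).
 apply: complex_ext; rewrite ?ReRM ?ImRM [RHS]mulrC.
  exact: (key (fun z=> Re z) _ D.1).
 exact: (key (fun z=> Im z) _ D.2).
rewrite cabsM cabs_real gtr0_norm ?invr_gt0// mulrA divff ?gt_eqF// mul1r /Umod /FT; congr cabs.
by apply: eq_Cint=> xi; rewrite /g' lnK ?posrE// mulrA.
Unshelve. all: by end_near. Qed.

End links.

Local Close Scope complex_scope.
Local Open Scope ereal_scope.

(** * Mixed norms *)
Section essential_sup.
Context {R: realType}.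
(** The essential supremum exceeds r exactly when the section of the superlevel set has positive
    measure, and that measure depends measurably on x. *)
Lemma meas_ess_sup {d1 d2} {X: measurableType d1} {Y: measurableType d2} (m: {sigma_finite_measure set Y -> \bar R})
 (f: X*Y -> \bar R): mfun f -> mfun (fun x=> ess_sup m (fun y=> f (x, y))).
Proof.
move=> mf; have mfx x: mfun (fun y=> f (x, y)) by apply: mcomp=> //; side.
apply: (measurability _ (ErealGenOInfty.measurableE R))=> _ [_ [r ->] <-]; rewrite setTI.
pose g (z: X*Y): \bar R:= (\1_(f @^-1` `]r%:E, +oo[) z)%:E.
have mE: measurable (f @^-1` `]r%:E, +oo[) by rewrite -[X in measurable X]setTI; apply: mf=> //; exact: emeasurable_itv.
have mg: mfun g by side.
have g0 z: 0 <= g z by side.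
have mG: mfun (fubini_F m g) by apply: measurable_fun_fubini_tonelli_F.
have -> : (fun x=> ess_sup m (fun y=> f (x, y))) @^-1` `]r%:E, +oo[ =
 (fun x=> \int[m]_y g (x, y)) @^-1` `]0, +oo[.
 apply/seteqP; have E x: \int[m]_y g (x, y) = m ((fun y=> f (x, y)) @^-1` `]r%:E, +oo[).
  transitivity (\int[m]_y (\1_((fun y: Y=> f (x, y)) @^-1` `]r%:E, +oo[) y)%:E).
   by apply: eq_integral=> y _; rewrite /g !indicE.
  rewrite integral_indic ?setIT// -[X in measurable X]setTI; apply: mfx=> //; exact: emeasurable_itv.
 split=> x /=; rewrite !in_itv/= !andbT E=> h.
  rewrite lt0e measure_ge0 andbT; apply/eqP=> h0; move: h; apply/negP; rewrite -leNgt.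
  by apply/ess_supP; apply/(ae_le_measureP _ _ (mfx x)).
 rewrite ltNge; apply/negP=> /ess_supP/(ae_le_measureP _ _ (mfx x)) h0.
 by move: h; rewrite h0 ltxx.
rewrite -[X in measurable X]setTI; apply: (mG measurableT (`]0, +oo[%classic: set (\bar R))); exact: emeasurable_itv.
Qed.

Context {n: nat}.
Lemma esssupRnE (h: 'rV[R]_n -> \bar R): mfun h -> esssupRn h = ess_sup (mu n) h.
Proof.
move=> mh; rewrite ess_supEmu0// /esssupRn; congr ereal_inf; apply/seteqP.
have mE M: measurable (h @^-1` `]M, +oo[) by rewrite -[X in measurable X]setTI; apply: mh=> //; exact: emeasurable_itv.
have E (M: \bar R): iint (fun x: 'rV[R]_n=> (\1_[set y: 'rV[R]_n | (M < h y)%E] x)%:E) = mu n (h @^-1` `]M, +oo[).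
 rewrite -[h @^-1` _ in RHS]setIT -(integral_indic (mu n) measurableT)// -ge0_iintE; try side.
 - congr iint; apply/funext=> x; rewrite !indicE; congr (_%:R%:E); congr nat_of_bool.
  by apply/idP/idP; rewrite !inE/= in_itv/= andbT.
by split=> M /=; rewrite E.
Qed.
Lemma LpRn_fin (r: R) (h: 'rV[R]_n -> \bar R): mfun h -> (forall x, 0 <= h x) ->
 LpRn r%:E h = (\int[mu n]_x (h x`^r))`^r^-1.
Proof.
move=> mh h0; rewrite /LpRn ge0_iintE//; first side.
side.
Qed.
Lemma LpRn_pinfty (h: 'rV[R]_n -> \bar R): mfun h -> LpRn +oo h = ess_sup (mu n) h.
Proof. exact: esssupRnE. Qed.
(** On a space of measure 0 the essential supremum would be -oo; the measure of R^n is positive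
    since it dominates the integral of a Gaussian. *)
Lemma ess_sup_ge0 (h: 'rV[R]_n -> \bar R): (forall x, 0 <= h x) -> 0 <= ess_sup (mu n) h.
Proof.
move=> h0; apply: ess_sup_gee; last exact: nearW.
rewrite -[X in _ < X]mul1e -(integral_cst (mu n) measurableT).
apply: (@lt_le_trans _ _ (\int[mu n]_x (gau 1 x)%:E)); last first.
 apply: le_integral_ge0=> [|//|x|x].
 - apply/mEFinP; apply: (mcomp (@measurable_expR R)); apply: measurable_funN.
  side.
 - by rewrite lee_fin expR_ge0.
 - by rewrite lee_fin gau_le1.
have [gi hg]:= @FT_gau R n 1 0 0 ltr01; rewrite -(fineK (integrable_fin_num measurableT (cintg_Re gi))) lte_fin.
move: hg; rewrite /FT; under eq_Cint do rewrite mul0r cexpi0 mulr1.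
rewrite Cint_real /gau expr0n/= mul0r mul0r oppr0 expR0 mulr1=> /(congr1 (fun z=> Re z))/= ->.
by rewrite exprn_gt0// sqrtr_gt0 divr_gt0 ?pi_gt0.
Qed.
Hint Resolve ess_sup_ge0: side.
Lemma LpRn_ge0 (p: \bar R) (h: 'rV[R]_n -> \bar R): 0 < p -> mfun h -> (forall x, 0 <= h x) ->
 0 <= LpRn p h.
Proof.
case: p=> [r _ _ _|_ mh h0|//]; first exact: poweR_ge0.
by rewrite LpRn_pinfty// ess_sup_ge0.
Qed.
Hint Resolve LpRn_ge0: side.
Lemma le_LpRn (p: \bar R) (g h: 'rV[R]_n -> \bar R): 0 < p -> mfun g -> mfun h ->
 (forall x, 0 <= g x) -> (forall x, g x <= h x) -> LpRn p g <= LpRn p h.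
Proof.
case: p=> [r r0 mg mh g0 gh|_ mg mh g0 gh|//].
 have r0': (0 < r)%R by rewrite -lte_fin.
 rewrite !LpRn_fin//; last by move=> x; exact: le_trans (gh x).
 apply: le_poweR; first side.
  side.
 apply: le_integral_ge0=> [||x|x]; [side|side|side|].
 by apply: le_poweR=> //; side.
by rewrite !LpRn_pinfty//; apply: le_ess_sup; exact: nearW.
Qed.
Lemma LpRnZ (p: \bar R) (c: R) (h: 'rV[R]_n -> \bar R): 0 < p -> (0 < c)%R -> mfun h ->
 (forall x, 0 <= h x) -> LpRn p (fun x=> c%:E*h x) = c%:E*LpRn p h.
Proof.
case: p=> [r r0 c0 mh h0|_ c0 mh h0|//].
 have r0': (0 < r)%R by rewrite -lte_fin.
 have rn: r != 0%R by side.
 rewrite !LpRn_fin//; try side.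
 under eq_integral do rewrite poweRM ?lee_fin ?(ltW c0)//.
 rewrite ge0_integralZl ?poweR_ge0//; try side.
 rewrite poweRM ?poweR_ge0//; last side.
 by rewrite poweRK// lee_fin ltW.
rewrite !LpRn_pinfty//; first exact: ess_sup_pZl.
side.
Qed.

End essential_sup.

(** * From pointwise estimates to Besov norms *)

Section lp_convolution.
Context {R: realType} {n: nat}.
Local Notation T j g:= (sop (eta (tz j)) g).
Lemma lp_conv_unif (P S: R): (1 <= P)%R -> exists2 C: R, (0 < C)%R & forall (w: int -> R) (g: int -> 'rV[R]_n -> \bar R) u,
 (forall j, 0 <= w j)%R -> zsum (fun j=> (w j)%:E) <= S%:E ->
 (forall j, mfun (g j)) -> (forall j x, 0 <= g j x) -> mfun u ->
 (forall x, 0 <= u x) -> (forall x, u x <= zsum (fun j=> (w j)%:E*T j (g j) x)) ->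
 \int[mu n]_x (u x`^P) <= C%:E*zsum (fun j=> (w j)%:E*\int[mu n]_x (g j x`^P)).
Proof.
move=> P1; have P0: (0 < P)%R by exact: lt_le_trans P1.
have [ce ce0 ceE]:= etaI_EFin n (ltW P0).
exists (S`^(P - 1)*ce + 1)%R=> [|w g u w0 wS mg g0 mu0 u0 ug].
 by rewrite ltr_wpDl// mulr_ge0 ?powR_ge0.
have mT j: mfun (T j (g j)) by side.
have T0 j x: 0 <= T j (g j) x by side.
have mwT j: mfun (fun x=> (w j)%:E*T j (g j) x`^P).
 side.
have wT0 j x: 0 <= (w j)%:E*T j (g j) x`^P by side.
have S0: 0 <= zsum (fun j=> (w j)%:E) by side.
le_via (\int[mu n]_x ((S`^(P - 1))%:E*zsum (fun j=> (w j)%:E*T j (g j) x`^P))).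
 apply: le_integral_ge0; try side.
 - move=> x; le_via (zsum (fun j=> (w j)%:E*T j (g j) x)`^P).
   by apply: le_poweR=> //; side.
  apply: (le_trans (jensen_zsum P1 w0 (fun j=> T0 j x))); apply: lee_wpmul2r; first exact: zsum_ge0.
  by rewrite -poweR_EFin; apply: le_poweR=> //; rewrite subr_ge0.
rewrite ge0_integralZl ?lee_fin ?powR_ge0//; last 2 first.
- exact: (meas_zsum (a:= fun j x=> (w j)%:E*T j (g j) x`^P)).
- by move=> x _; exact: zsum_ge0.
have B0 j: 0 <= (w j)%:E*\int[mu n]_x (g j x`^P).
 side.
le_via ((S`^(P - 1)*ce)%:E*zsum (fun j=> (w j)%:E*\int[mu n]_x (g j x`^P))).
 rewrite EFinM -muleA; apply: lee_wpmul2l; first side.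
 rewrite (integral_zsum _ _ (a:= fun j x=> (w j)%:E*T j (g j) x`^P))// -zsumZ//.
 apply: le_zsum=> j; rewrite ge0_integralZl ?lee_fin//; try side.
 rewrite muleCA; apply: lee_wpmul2l; first side.
 by rewrite -ceE; exact: integral_T_poweR.
by apply: lee_wpmul2r; [exact: zsum_ge0|rewrite lee_fin lerDl].
Qed.

Definition conv_le (C z r: R) (v g: int -> 'rV[R]_n -> \bar R):= forall l x,
 v l x`^r <= C%:E*zsum (fun m=> (zw z (l - m))%:E*T m (fun y=> g m y`^r) x).
Lemma zsum_zw_shift (z: R) l: (0 < z)%R -> zsum (fun m=> (zw z (l - m))%:E) = zsum (fun j=> (zw z j)%:E).
Proof. by move=> z0; apply: (zsum_conv (fun j=> (zw z j)%:E))=> j; rewrite lee_fin zw_ge0// ltW. Qed.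

Variables (C0 z r: R) (p q: \bar R).
Hypotheses (C00: (0 < C0)%R) (z0: (0 < z)%R) (z1: (z < 1)%R) (r0: (0 < r)%R) (rp: r%:E < p) (rq: r%:E < q).
Implicit Types (v g: int -> 'rV[R]_n -> \bar R).
Let rn: r != 0%R. Proof. side. Qed.
Let p0: 0 < p. Proof. by apply: lt_trans rp; rewrite lte_fin. Qed.
Let q0: 0 < q. Proof. by apply: lt_trans rq; rewrite lte_fin. Qed.
(** The power [eps] is p when p is finite: there Jensen's inequality with exponent p/r handles both
    the sum over m and the averages. It is r when p is infinite, where the averages are bounded
    directly. *)
Lemma LpRn_conv: exists eps C: R, [/\ (0 < eps)%R, (0 < C)%R & forall v g,
 (forall j, mfun (g j)) -> (forall j x, 0 <= g j x) ->
 (forall j, mfun (v j)) -> (forall j x, 0 <= v j x) -> conv_le C0 z r v g ->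
 forall l, LpRn p (v l)`^eps <= C%:E*zsum (fun m=> (zw z (l - m))%:E*LpRn p (g m)`^eps)].
Proof.
have zS:= zsum_zw z0 z1; have zw0 j: (0 <= zw z j)%R by side.
have S0: 0 <= zsum (fun j=> (zw z j)%:E) by side.
have Sf: zsum (fun j=> (zw z j)%:E) \is a fin_num by rewrite ge0_fin_numE.
case Ep: p=> [P||]; last by move: p0; rewrite Ep.
 have Pr: (r < P)%R by rewrite -lte_fin -Ep.
 have P0: (0 < P)%R by exact: lt_trans Pr.
 have Pn: P != 0%R by side.
 have P1: (1 <= P/r)%R by rewrite ler_pdivlMr// mul1r ltW.
 have [C1 C10 h1]:= lp_conv_unif (C0*fine (zsum (fun j=> (zw z j)%:E))) P1.
 exists P, (C1*C0)%R; split=> //; first side.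
 move=> v g mg g0 mv v0 hv l.
 rewrite LpRn_fin// poweRVK//; last side.
 have pe (h: 'rV[R]_n -> \bar R) x: h x`^P = (h x`^r)`^(P/r).
  by rewrite -poweRrM; congr poweR; rewrite mulrCA divff ?mulr1.
 under eq_integral do rewrite pe.
 apply: (le_trans (h1 (fun m=> C0*zw z (l - m))%R (fun m x=> g m x`^r) _ _ _ _ _ _ _ _)); try side.
 - under eq_zsum do rewrite EFinM.
  rewrite zsumZ ?(ltW C00)//; last side.
  by rewrite zsum_zw_shift// EFinM fineK.
 - move=> x; apply: (le_trans (hv l x)); rewrite -zsumZ ?(ltW C00)//; last first.
   by move=> m; rewrite mule_ge0 ?lee_fin// T_ge0// => y; side.
  by apply: le_zsum=> m; rewrite EFinM muleA.
 rewrite EFinM -muleA; apply: lee_wpmul2l; first side.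
 rewrite -zsumZ ?(ltW C00)//; last side.
 apply: le_zsum=> m; rewrite EFinM -muleA LpRn_fin// poweRVK//; last first.
  side.
 by under eq_integral do rewrite -pe.
have ce0: 0 <= (etaI n: \bar R) by side.
have cef: (etaI n: \bar R) \is a fin_num by rewrite ge0_fin_numE ?etaI_lty.
pose ce: R:= fine (etaI n); have cep: (0 <= ce)%R by side.
exists r, (C0*(ce + 1))%R; split=> //; first by rewrite mulr_gt0// ltr_wpDl.
move=> v g mg g0 mv v0 hv l; rewrite LpRn_pinfty//.
set Z:= (X in _ <= X).
have Z0: 0 <= Z.
 by rewrite /Z mule_ge0 ?lee_fin ?mulr_ge0 ?(ltW C00) ?addr_ge0// zsum_ge0// => m; rewrite mule_ge0 ?lee_fin ?poweR_ge0.
suff: ess_sup (mu n) (v l) <= Z`^r^-1.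
 by move=> h; rewrite -(poweRVK rn Z0); apply: le_poweR=> //; [side|exact: ess_sup_ge0].
apply/ess_supP; apply: nearW=> x; rewrite -(poweRK rn (v0 l x)).
apply: le_poweR; [side|side|apply: (le_trans (hv l x))].
rewrite /Z EFinM -muleA; apply: lee_wpmul2l; first side.
rewrite -zsumZ ?addr_ge0//; last side.
apply: le_zsum=> m; rewrite muleCA; apply: lee_wpmul2l; first side.
le_via (ce%:E*LpRn +oo (g m)`^r); last first.
 by apply: lee_wpmul2r; [side|rewrite lee_fin lerDl].
have tm: (0 < tz m :> R)%R by exact: tz_gt0.
have mE: mfun (fun y: 'rV[R]_n=> (eta (tz m) (x - y))%:E).
 side.
rewrite fineK// -(integral_eta n tm) -(sop_cst (k:= eta (tz m)) _ x); last side.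
rewrite muleC -ge0_integralZl//; try side; last first.
- by move=> y _; rewrite lee_fin eta_ge0.
apply: ae_ge0_le_integral=> //; try side.
- by move=> y _; rewrite mule_ge0 ?lee_fin ?eta_ge0 ?poweR_ge0.
- by move=> y _; rewrite mule_ge0 ?lee_fin ?eta_ge0 ?poweR_ge0.
rewrite LpRn_pinfty//; apply: filterS (ess_sup_ge (mu n) (g m))=> y hy _.
rewrite muleC; apply: lee_wpmul2r; first by rewrite lee_fin eta_ge0.
by apply: le_poweR=> //; side.
Qed.
Lemma lqZ_conv (eps C1: R): (0 < eps)%R -> (0 < C1)%R -> exists2 C: R, (0 < C)%R & forall a b: int -> \bar R,
 (forall j, 0 <= a j) -> (forall j, 0 <= b j) ->
 (forall l, a l`^eps <= C1%:E*zsum (fun m=> (zw z (l - m))%:E*b m`^eps)) ->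
 lqZ q a <= C%:E * lqZ q b.
Proof.
move=> e0 C10; have en: eps != 0%R by side.
have zS:= zsum_zw z0 z1; have zw0 j: (0 <= zw z j)%R by side.
have S0: 0 <= zsum (fun j=> (zw z j)%:E) by side.
have Sf: zsum (fun j=> (zw z j)%:E) \is a fin_num by rewrite ge0_fin_numE.
case Eq: q=> [Q||]; last by move: q0; rewrite Eq.
 have Q0: (0 < Q)%R by rewrite -lte_fin -Eq.
 have Qe: (0 < Q/eps)%R by side.
 have zwe: zsum (fun j=> (zw z j`^(Q/eps))%:E) < +oo.
  under eq_zsum do rewrite zw_powR ?(ltW z0)//.
  apply: zsum_zw; first side.
  have: (z`^(Q/eps) < 1`^(Q/eps))%R by apply: gt0_ltr_powR; rewrite ?nnegrE ?(ltW z0).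
  by rewrite powR1.
 have [C2 C20 h2]:= zsum_conv_poweR Qe zw0 zS zwe.
 exists ((C1`^(Q/eps)*C2)`^Q^-1)%R=> [|a b a0 b0 hab]; first side.
 have pe (x: \bar R): x`^Q = (x`^eps)`^(Q/eps).
  by rewrite -poweRrM; congr poweR; rewrite mulrCA divff ?mulr1.
 rewrite /lqZ -poweR_EFin -poweRM ?lee_fin ?mulr_ge0 ?powR_ge0 ?(ltW C20)//; last by apply: zsum_ge0=> j; side.
 apply: le_poweR; [side|by apply: zsum_ge0=> j; side|].
 rewrite -/(zsum _) -/(zsum _).
 le_via (zsum (fun l=> (C1`^(Q/eps))%:E*zsum (fun m=> (zw z (l - m))%:E*b m`^eps)`^(Q/eps))).
  apply: le_zsum=> l; rewrite pe -poweR_EFin -poweRM ?lee_fin ?(ltW C10)//; last first.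
   by apply: zsum_ge0=> m; rewrite mule_ge0 ?lee_fin ?poweR_ge0.
  by apply: le_poweR=> //; [side|side].
 rewrite zsumZ ?powR_ge0//; last side.
 rewrite EFinM -muleA; apply: lee_wpmul2l; first side.
 apply: (le_trans (h2 _ (fun m=> poweR_ge0 _ _))).
 by under eq_zsum do rewrite -pe.
exists ((C1*fine (zsum (fun j=> (zw z j)%:E)) + 1)`^eps^-1)%R=> [|a b a0 b0 hab].
 by rewrite powR_gt0// ltr_wpDl// mulr_ge0 ?(ltW C10)// fine_ge0.
have B0: 0 <= ereal_sup (range b) by apply: (le_trans (b0 0%R)); apply: ereal_sup_ubound; exists 0%R.
rewrite /lqZ; apply: ub_ereal_sup=> _ [l _ <-]; rewrite -(poweRK en (a0 l)) -(poweRK en B0).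
rewrite -poweR_EFin -poweRM ?poweR_ge0 ?lee_fin ?addr_ge0 ?mulr_ge0 ?(ltW C10) ?fine_ge0//.
apply: le_poweR; [side|side|apply: (le_trans (hab l))].
have bB m: b m`^eps <= ereal_sup (range b)`^eps.
 by apply: le_poweR=> //; [side|apply: ereal_sup_ubound; exists m].
le_via ((C1*fine (zsum (fun j=> (zw z j)%:E)))%:E*ereal_sup (range b)`^eps); last first.
 by apply: lee_wpmul2r; [side|rewrite lee_fin lerDl].
rewrite EFinM fineK// -muleA; apply: lee_wpmul2l; first side.
rewrite -(zsum_zw_shift l z0) muleC -zsumZe ?poweR_ge0//; last side.
by apply: le_zsum=> m; rewrite muleC; apply: lee_wpmul2r; [side|exact: bB].
Qed.
Lemma besov_conv: exists2 C: R, (0 < C)%R & forall v g,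
 (forall j, mfun (g j)) -> (forall j x, 0 <= g j x) ->
 (forall j, mfun (v j)) -> (forall j x, 0 <= v j x) -> conv_le C0 z r v g ->
 lqZ q (fun l=> LpRn p (v l)) <= C%:E * lqZ q (fun m=> LpRn p (g m)).
Proof.
have [eps [C1 [e0 C10 h1]]]:= LpRn_conv; have [C CC h2]:= lqZ_conv e0 C10.
exists C=> // v g mg g0 mv v0 hv; apply: h2=> [j|j|l]; [exact: LpRn_ge0|exact: LpRn_ge0|exact: h1].
Qed.

End lp_convolution.
Hint Resolve ess_sup_ge0 LpRn_ge0: side.

(** * From pointwise estimates to Triebel-Lizorkin norms *)

Section triebel_convolution.
Context {R: realType} {n: nat}.
Local Notation T j g:= (sop (eta (tz j)) g).
Lemma sup_poweR (e: R) (a: int -> \bar R): (0 < e)%R -> (forall j, 0 <= a j) ->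
 ereal_sup (range (fun j=> a j`^e)) = ereal_sup (range a)`^e.
Proof.
move=> e0 a0; have en: e != 0%R by side.
have s0 (b: int -> \bar R): (forall j, 0 <= b j) -> 0 <= ereal_sup (range b).
 by move=> b0; apply: (le_trans (b0 0%R)); apply: ereal_sup_ubound; exists 0%R.
have S0:= s0 _ (fun j=> poweR_ge0 (a j) e).
apply/eqP; rewrite eq_le; apply/andP; split.
 apply: ub_ereal_sup=> _ [j _ <-]; apply: le_poweR=> //; first side.
 by apply: ereal_sup_ubound; exists j.
rewrite -[leRHS](poweRVK en S0); apply: le_poweR; [side|exact: s0|].
apply: ub_ereal_sup=> _ [j _ <-]; rewrite -(poweRK en (a0 j)); apply: le_poweR; try side.
by apply: ereal_sup_ubound; exists j.
Qed.
Lemma lqZ_ge0 (q: \bar R) (a: int -> \bar R): 0 < q -> (forall j, 0 <= a j) -> 0 <= lqZ q a.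
Proof.
case: q=> [Q _ _|_ a0|//]; first exact: poweR_ge0.
by apply: (le_trans (a0 0%R)); apply: ereal_sup_ubound; exists 0%R.
Qed.
Hint Resolve lqZ_ge0: side.
Lemma meas_lqZ {d} {X: measurableType d} (q: \bar R) (a: int -> X -> \bar R): 0 < q ->
 (forall j, mfun (a j)) -> (forall j x, 0 <= a j x) ->
 mfun (fun x=> lqZ q (a ^~ x)).
Proof.
case: q=> [Q _ ma a0|_ ma a0|//]; last exact: meas_zsup.
apply: meas_poweRr; apply: (meas_zsum (a:= fun j x=> a j x`^Q))=> [j|j x]; first side.
side.
Qed.
Hint Resolve meas_lqZ: side.

Variables (P0 r: R) (q: \bar R).
Hypotheses (r0: (0 < r)%R) (rp: (r < P0)%R) (rq: r%:E < q).
Let P00: (0 < P0)%R. Proof. exact: lt_trans rp. Qed.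
Let q0: 0 < q. Proof. by apply: lt_trans rq; rewrite lte_fin. Qed.
Let P1: (1 < P0/r)%R. Proof. by rewrite ltr_pdivlMr// mul1r. Qed.
Lemma lqZ_root (Q: R) (a: int -> \bar R): (0 < Q)%R -> (forall j, 0 <= a j) ->
 lqZ Q%:E (fun m=> a m`^r^-1)`^P0 = zsum (fun m=> a m`^(Q/r))`^((P0/r)/(Q/r)).
Proof.
move=> Q0 a0; rewrite /lqZ -/(zsum _) -poweRrM; congr poweR.
 by apply: eq_zsum=> m; rewrite -poweRrM mulrC.
by field; rewrite !gt_eqF.
Qed.
Lemma lqZ_root_sup (a: int -> \bar R): (forall j, 0 <= a j) ->
 lqZ +oo (fun m=> a m`^r^-1)`^P0 = ereal_sup (range a)`^(P0/r).
Proof.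
by move=> a0; rewrite /lqZ sup_poweR ?invr_gt0// -poweRrM mulrC.
Qed.
(** Since r < P0 and r < q, the exponents P0/r and q/r exceed 1; the cases q <= P0, P0 < q < oo and
    q = oo are [fs_ge], [fs_lt] and [fs_sup]. *)
Lemma fefferman_stein_lqZ: exists2 C: R, (0 < C)%R & forall (g: int -> 'rV[R]_n -> \bar R) (M: int -> R),
 (forall j, mfun (g j)) -> (forall j x, 0 <= g j x) -> (forall j x, g j x <= (M j)%:E) ->
 LpRn P0%:E (fun x=> lqZ q (fun m=> T m (g m) x`^r^-1)) <=
 C%:E*LpRn P0%:E (fun x=> lqZ q (fun m=> g m x`^r^-1)).
Proof.
have [C C0 hC]: exists2 C: R, (0 < C)%R & forall (g: int -> 'rV[R]_n -> \bar R) (M: int -> R),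
 (forall j, mfun (g j)) -> (forall j x, 0 <= g j x) -> (forall j x, g j x <= (M j)%:E) ->
 \int[mu n]_x (lqZ q (fun m=> T m (g m) x`^r^-1)`^P0) <=
 C%:E*\int[mu n]_x (lqZ q (fun m=> g m x`^r^-1)`^P0).
 case Eq: q=> [Q||]; last by move: q0; rewrite Eq.
  have Q0: (0 < Q)%R by rewrite -lte_fin -Eq.
  have Q1: (1 < Q/r)%R by rewrite ltr_pdivlMr// mul1r -lte_fin -Eq.
  have [QP|PQ]:= leP (Q/r)%R (P0/r)%R.
   have [C C0 hC]:= @fs_ge R n _ _ (ltW Q1) QP; exists C=> // g M mg g0 gM.
   have Tg0 j x: 0 <= T j (g j) x by side.
   by under eq_integral do rewrite lqZ_root//; under [in leRHS]eq_integral do rewrite lqZ_root//; exact: hC.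
  have [C C0 hC]:= @fs_lt R n _ _ P1 PQ; exists C=> // g M mg g0 gM.
  have Tg0 j x: 0 <= T j (g j) x by side.
  by under eq_integral do rewrite lqZ_root//; under [in leRHS]eq_integral do rewrite lqZ_root//; exact: (hC g M).
 have [C C0 hC]:= @fs_sup R n _ P1; exists C=> // g M mg g0 gM.
 have Tg0 j x: 0 <= T j (g j) x by side.
 by under eq_integral do rewrite lqZ_root_sup//; under [in leRHS]eq_integral do rewrite lqZ_root_sup//; exact: hC.
exists (C`^P0^-1)%R=> [|g M mg g0 gM]; first side.
have mG: mfun (fun x=> lqZ q (fun m=> g m x`^r^-1)).
 by apply: meas_lqZ=> // [j|j x]; [side|side].
have mTg j: mfun (T j (g j)) by side.
have mTG: mfun (fun x=> lqZ q (fun m=> T m (g m) x`^r^-1)).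
 by apply: meas_lqZ=> // [j|j x]; [side|side].
have l0 (a: int -> \bar R): 0 <= lqZ q (fun m=> a m`^r^-1) by side.
have i0 (h: 'rV[R]_n -> \bar R): 0 <= \int[mu n]_x (h x`^P0) by side.
rewrite !LpRn_fin// -poweR_EFin -poweRM ?lee_fin ?(ltW C0)//.
by apply: le_poweR; [side|exact: i0|exact: hC].
Qed.

End triebel_convolution.

(** * Continuous scales against dyadic ones *)

Section continuous_parameter.
Context {R: realType}.
Local Notation leb:= (@lebesgue_measure R).
Local Notation "\int12 F" := (\int[leb]_(th in `[1%R, 2%R[) F th) (at level 10, F at level 9).
Variables (q: \bar R) (H: R -> \bar R).
Hypotheses (q0: 0 < q) (mH: measurable_fun [set: R] H) (H0: forall t, 0 <= H t).

(** The L^q norm for the dilation-invariant measure dt/t. *)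
Definition Lqt_dil: \bar R:= Lqt q (fun t=> (t`^(- einv q))%:E*H t).
Let mHl l: measurable_fun [set: R] (fun th: R=> H (tz (- l)*th)%R).
Proof. by apply: (mcomp mH); side. Qed.
Let mHQ (Q: R) l: measurable_fun [set: R] (fun th: R=> H (tz (- l)*th)%R`^Q).
Proof. side. Qed.
Lemma integral12_cst (c: \bar R): 0 <= c -> \int[leb]_(th in `[1%R, 2%R[) c = c.
Proof.
move=> c0; rewrite integral_cst//= lebesgue_measure_itv/= lte_fin ltr1n//= -EFinB.
by rewrite (_: 2 - 1 = 1)%R ?mule1//; ring.
Qed.
Lemma Lqt_dil_fin (Q: R): q = Q%:E ->
 Lqt_dil`^Q = zsum (fun l=> \int[leb]_(th in `[1%R, 2%R[) ((th^-1)%:E*H (tz (- l)*th)%R`^Q)).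
Proof.
move=> qQ; have Q0: (0 < Q)%R by rewrite -lte_fin -qQ.
have Qn: Q != 0%R by side.
pose h (t: R):= (t^-1*(0 < t)%R%:R)%:E*H t`^Q.
have h0 t: 0 <= h t.
 rewrite mule_ge0 ?poweR_ge0// lee_fin; have [t0|_]:= ltP 0%R t; last by rewrite mulr0.
 side.
have mh: measurable_fun [set: R] h.
 apply: emeasurable_funM; last side.
 apply/mEFinP; apply: measurable_funM; first exact: meas_invr.
 rewrite (_: (fun t: R=> _) = (fun t: R=> if (0 < t)%R then 1%R else 0%R)).
  by apply: measurable_fun_ifT=> //; exact: measurable_fun_ltr.
 by apply/funext=> t; case: ifP.
rewrite /Lqt_dil qQ /Lqt poweRVK//; last side.
transitivity (\int[leb]_(t in [set u: R | (0 < u)%R]) h t).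
 apply: eq_integral=> t; rewrite inE/= => t0; rewrite /h t0 mulr1 poweRM ?lee_fin ?powR_ge0//.
 by rewrite poweR_EFin -powRrM mulNr mulVf// powR_inv1// ltW.
rewrite ge0_integral_dyadic//; apply: eq_zsum=> l.
have tl: (0 < tz (- l) :> R)%R by exact: tz_gt0.
rewrite -ge0_integralZl ?lee_fin ?(ltW tl)//; last first.
 by apply: measurable_funTS; apply: (mcomp mh); side.
apply: eq_integral=> th; rewrite inE/= in_itv/= => /andP[th1 _].
have th0: (0 < th)%R by exact: lt_le_trans th1.
rewrite /h pmulr_rgt0// th0 mulr1 muleA -EFinM; congr (_%:E*_).
by rewrite invfM mulrA divff ?mul1r// gt_eqF.
Qed.
Let Jl (Q: R) l:= \int[leb]_(th in `[1%R, 2%R[) (H (tz (- l)*th)%R`^Q).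
(** On the shell 1 <= th < 2 the density 1/th lies between 1/2 and 1; this is the origin of the
    factor 2^(1/q) below. *)
Lemma Lqt_dil_le (Q: R): q = Q%:E -> Lqt_dil`^Q <= zsum (Jl Q) /\ zsum (Jl Q) <= 2%:E*Lqt_dil`^Q.
Proof.
move=> qQ; rewrite (Lqt_dil_fin qQ).
have mt (l: int): measurable_fun (`[1%R, 2%R[%classic: set R) (fun th: R=> (th^-1)%:E*H (tz (- l)*th)%R`^Q).
 apply: measurable_funTS; apply: emeasurable_funM; last exact: mHQ.
 by apply/mEFinP; exact: meas_invr.
have t0 (l: int) (th: R): (`[1%R, 2%R[%classic: set R) th -> 0 <= (th^-1)%:E*H (tz (- l)*th)%R`^Q.
 rewrite /= in_itv/= => /andP[th1 _]; rewrite mule_ge0 ?poweR_ge0// lee_fin invr_ge0; exact: le_trans th1.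
split.
 apply: le_zsum=> l; apply: ge0_le_integral=> //; try side.
 - exact: mt.
 - by apply: measurable_funTS; exact: mHQ.
 - move=> th; rewrite /= in_itv/= => /andP[th1 _]; apply: gee_pMl; rewrite ?poweR_ge0 ?lee_fin//.
  by rewrite invf_le1 ?(lt_le_trans _ th1).
rewrite -zsumZ//; last side.
apply: le_zsum=> l; rewrite -ge0_integralZl//; last by move=> th; exact: t0.
apply: ge0_le_integral=> //; try side.
- by apply: measurable_funTS; exact: mHQ.
- by apply: measurable_funeM; exact: mt.
- move=> th; rewrite /= in_itv/= => /andP[th1 /ltW th2]; rewrite muleA -EFinM.
 have th0: (0 < th)%R by exact: lt_le_trans th1.
 have h2: (1 <= 2*th^-1)%R by rewrite ler_pdivlMr// mul1r.
 rewrite -[leLHS]mul1e; apply: lee_wpmul2r; first side.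
 side.
exact: mt.
Qed.
Lemma Lqt_dil_ge0: 0 <= Lqt_dil.
Proof.
rewrite /Lqt_dil; case: q q0=> [Q _|_|//]; first exact: poweR_ge0.
rewrite /Lqt; apply: ess_sup_gee.
 rewrite -[X in _ < X]mul1e -(integral_cst leb measurableT).
 apply: (@lt_le_trans _ _ (\int[leb]_(th in `[1%R, 2%R[) 1)); first by rewrite integral12_cst.
 by apply: ge0_subset_integral.
by apply: nearW=> t; case: ifP=> // _; rewrite mule_ge0// lee_fin powR_ge0.
Qed.
Hint Resolve Lqt_dil_ge0: side.
Let N: set R:= H @^-1` `]Lqt_dil, +oo[.
(** Equal to +oo on the set where H exceeds [Lqt_dil]. For q = oo that set is negligible among
    positive t, so H <= [Lqt_dil] + [bad] holds at every point while [bad] integrates to 0; an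
    almost-everywhere bound can then be used simultaneously at all dyadic scales. *)
Let bad (t: R): \bar R:= +oo*(\1_N t)%:E.
Let mN: measurable (N: set (measurableTypeR R)).
Proof. by rewrite /N -[X in measurable X]setTI; apply: mH=> //; exact: emeasurable_itv. Qed.
Let mI: measurable_fun [set: R] (fun t: R=> (\1_N t)%:E: \bar R).
Proof. side. Qed.
Let I0 t: 0 <= (\1_N t)%:E :> \bar R. Proof. side. Qed.
Let H_le t: H t <= Lqt_dil + bad t.
Proof.
rewrite /bad indicE; have [tN|]:= boolP (t \in N).
 by rewrite mule1 addey ?leey//; have:= Lqt_dil_ge0; case: Lqt_dil.
by rewrite notin_setE /N/= in_itv/= andbT mule0 adde0=> /negP; rewrite -leNgt.
Qed.
Let mbad l: measurable_fun [set: R] (fun th: R=> bad (tz (- l)*th)%R).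
Proof.
apply: measurable_funeM; apply: (mcomp mI); side.
Qed.
Let bad0 t: 0 <= bad t. Proof. by rewrite mule_ge0. Qed.
Let bad_null: q = +oo -> forall l, \int[leb]_(th in `[1%R, 2%R[) bad (tz (- l)*th)%R = 0.
Proof.
move=> qoo l.
have mD: measurable ([set u: R | (0 < u)%R]: set (measurableTypeR R)).
 by rewrite (_: [set u: R | (0 < u)%R] = `]0%R, +oo[%classic)//; apply/seteqP; split=> u /=; rewrite in_itv/= andbT.
have tot: \int[leb]_(t in [set u: R | (0 < u)%R]) (\1_N t)%:E = 0.
 rewrite (ae_eq_integral (cst 0)) ?integral0//; first side.
 have:= ess_sup_ge leb (fun t=> if (0 < t)%R then (t`^(- einv q))%:E*H t else 0).
 apply: filterS=> t; case: ifPn=> [t0|t0]; last by move=> _ /= tD; rewrite tD in t0.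
 rewrite qoo /= oppr0 powRr0 mul1e=> h _; rewrite indicE memNset//.
 rewrite /N/= in_itv/= andbT; apply/negP; rewrite -leNgt.
 by move: h; rewrite /Lqt_dil qoo /Lqt /= oppr0.
move: tot; rewrite ge0_integral_dyadic// => tot.
have tl: (0 < tz (- l) :> R)%R by exact: tz_gt0.
have J0 j: 0 <= (tz (- j))%:E*\int[leb]_(th in `[1%R, 2%R[) (\1_N (tz (- j)*th)%R)%:E.
 by rewrite mule_ge0 ?lee_fin ?(ltW (tz_gt0 _))// integral_ge0.
have:= zsum_term l J0; rewrite tot=> h.
have z: \int[leb]_(th in `[1%R, 2%R[) (\1_N (tz (- l)*th)%R)%:E = 0.
 have: (tz (- l))%:E*\int[leb]_(th in `[1%R, 2%R[) (\1_N (tz (- l)*th)%R)%:E = 0.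
  by apply/eqP; rewrite eq_le h J0.
 by move/eqP; rewrite mule_eq0 eqe gt_eqF//= => /eqP.
rewrite ge0_integralZl ?leey//; first by rewrite z mule0.
by apply: measurable_funTS; apply: (mcomp mI); side.
Qed.
Lemma Lqt_dil_ub (X: \bar R) :
 (forall th, (1 <= th)%R -> (th <= 2)%R -> lqZ q (fun l=> H (th*tz (- l))%R) <= X) -> Lqt_dil <= X.
Proof.
move=> hX; have X0: 0 <= X.
 by apply: (le_trans _ (hX 1%R (lexx _) _)); rewrite ?ler1n//; exact: lqZ_ge0.
case Eq: q=> [Q||]; last by move: q0; rewrite Eq.
 have Q0: (0 < Q)%R by rewrite -lte_fin -Eq.
 have Qn: Q != 0%R by side.
 rewrite -(poweRK Qn Lqt_dil_ge0) -(poweRK Qn X0); apply: le_poweR; [side|side|].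
 have [h _]:= Lqt_dil_le Eq; apply: (le_trans h).
 rewrite /Jl -(integral_zsum leb (a:= fun l th=> H (tz (- l)*th)%R`^Q)) //; try side; last first.
 - by move=> l; apply: measurable_funTS; exact: mHQ.
 rewrite -[leRHS]integral12_cst ?poweR_ge0//; apply: ge0_le_integral=> //.
 - by move=> th _; apply: zsum_ge0=> l; side.
 - by apply: measurable_funTS; apply: (meas_zsum (a:= fun l th=> H (tz (- l)*th)%R`^Q))=> [l|l th]; [exact: mHQ|side].
 - move=> th; rewrite /= in_itv/= => /andP[th1 /ltW th2].
  have:= hX th th1 th2; rewrite Eq /lqZ -/(zsum _)=> h1.
  under eq_zsum do rewrite mulrC.
  have Z0: 0 <= zsum (fun l=> H (th*tz (- l))%R`^Q) by side.
  by rewrite -(poweRVK Qn Z0); apply: le_poweR=> //; [side|side].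
rewrite /Lqt_dil Eq /Lqt; apply/ess_supP; apply: nearW=> t; case: ifPn=> // t0.
rewrite /= oppr0 powRr0 mul1e; have [l /andP[l1 l2]]:= dyadic_exists t0.
have tl: (0 < tz l :> R)%R by exact: tz_gt0.
have th1: (1 <= t/tz l)%R by rewrite ler_pdivlMr// mul1r.
have th2: (t/tz l <= 2)%R by rewrite ler_pdivrMr// ltW.
apply: (le_trans _ (hX _ th1 th2)); rewrite Eq /lqZ; apply: ereal_sup_ubound; exists (- l)%R=> //.
by rewrite opprK divfK// gt_eqF.
Qed.
Lemma Lqt_dil_lb (Y: \bar R): 0 <= Y ->
 (forall th, (1 <= th)%R -> (th <= 2)%R -> Y <= lqZ q (fun l=> H (th*tz (- l))%R)) ->
 Y <= (2`^einv q)%:E*Lqt_dil.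
Proof.
move=> Y0 hY; have L0:= Lqt_dil_ge0.
case Eq: q=> [Q||]; last by move: q0; rewrite Eq.
 have Q0: (0 < Q)%R by rewrite -lte_fin -Eq.
 have Qn: Q != 0%R by side.
 rewrite -(poweRK Qn Y0) -(poweRK Qn L0) /= -poweR_EFin -poweRM ?lee_fin ?poweR_ge0//.
 apply: le_poweR; [side|side|].
 have [_ h]:= Lqt_dil_le Eq; apply: (le_trans _ h).
 rewrite /Jl -(integral_zsum leb (a:= fun l th=> H (tz (- l)*th)%R`^Q)) //; try side; last first.
 - by move=> l; apply: measurable_funTS; exact: mHQ.
 rewrite -[leLHS]integral12_cst ?poweR_ge0//; apply: ge0_le_integral=> //.
 - side.
 - by apply: measurable_funTS; apply: (meas_zsum (a:= fun l th=> H (tz (- l)*th)%R`^Q))=> [l|l th]; [exact: mHQ|side].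
 - move=> th; rewrite /= in_itv/= => /andP[th1 /ltW th2].
  have:= hY th th1 th2; rewrite Eq /lqZ -/(zsum _)=> h1.
  under eq_zsum do rewrite mulrC.
  have Z0: 0 <= zsum (fun l=> H (th*tz (- l))%R`^Q) by side.
  by rewrite -(poweRVK Qn Z0); apply: le_poweR=> //; side.
rewrite /= powRr0 mul1e -[leLHS]integral12_cst//.
have Z0 (th: R): 0 <= zsum (fun l=> bad (tz (- l)*th)%R) by side.
le_via (\int[leb]_(th in `[1%R, 2%R[) (Lqt_dil + zsum (fun l=> bad (tz (- l)*th)%R))).
 have mZ: measurable_fun [set: R] (fun th: R=> zsum (fun l=> bad (tz (- l)*th)%R)).
  by apply: (meas_zsum (a:= fun l (th: R)=> bad (tz (- l)*th)%R))=> [l|l th]; [exact: mbad|exact: bad0].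
 apply: ge0_le_integral=> //.
 - by apply: measurable_funTS; apply: emeasurable_funD=> //; side.
 - move=> th; rewrite /= in_itv/= => /andP[th1 /ltW th2].
  apply: (le_trans (hY th th1 th2)); rewrite Eq /lqZ; apply: ub_ereal_sup=> _ [l _ <-].
  apply: (le_trans (H_le _)); apply: leeD=> //; rewrite mulrC.
  exact: (zsum_term (a:= fun l=> bad (tz (- l)*th)%R)).
rewrite ge0_integralD//; last first.
 by apply: measurable_funTS; apply: (meas_zsum (a:= fun l (th: R)=> bad (tz (- l)*th)%R))=> [l|l th]; [exact: mbad|exact: bad0].
rewrite integral12_cst// (integral_zsum leb (a:= fun l (th: R)=> bad (tz (- l)*th)%R))//; last first.
 side.
by under eq_zsum do rewrite bad_null//; rewrite zsum_eq0 adde0.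
Qed.
(** Averaging r-th powers over a shell before summing loses nothing, by Jensen's inequality with
    exponent q/r. *)
Lemma Lqt_dil_average (r: R): (0 < r)%R -> r%:E < q ->
 lqZ q (fun l=> (\int[leb]_(th in `[1%R, 2%R[) (H (tz (- l)*th)%R`^r))`^r^-1) <= (2`^einv q)%:E*Lqt_dil.
Proof.
move=> r0 rq; have rn: r != 0%R by side.
have L0:= Lqt_dil_ge0.
case Eq: q=> [Q||]; last by move: q0; rewrite Eq.
 have Q0: (0 < Q)%R by rewrite -lte_fin -Eq.
 have Qn: Q != 0%R by side.
 have Q1: (1 <= Q/r)%R by rewrite ler_pdivlMr// mul1r ltW// -lte_fin -Eq.
 rewrite /lqZ -/(zsum _) -(poweRK Qn L0) /= -poweR_EFin -poweRM ?lee_fin ?poweR_ge0//.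
 apply: le_poweR; [side|by apply: zsum_ge0=> l; side|].
 have [_ h]:= Lqt_dil_le Eq; apply: (le_trans _ h); apply: le_zsum=> l.
 rewrite -poweRrM mulrC; pose w (th: R): R:= \1_(`[1%R, 2%R[%classic: set R) th.
 have mw: measurable_fun [set: R] w by apply: measurable_indic; side.
 have w0 th: (0 <= w th)%R by rewrite /w indicE.
 have wE (h': R -> \bar R): \int[leb]_(th in `[1%R, 2%R[) h' th = \int[leb]_th ((w th)%:E*h' th).
  rewrite integral_mkcond; apply: eq_integral=> th _; rewrite patchE /w indicE.
  by case: ifP=> _; rewrite ?mul1e ?mul0e.
 have mr: measurable_fun [set: R] (fun th: R=> H (tz (- l)*th)%R`^r) by exact: mHQ.
 have:= jensen_ereal leb Q1 mw mr w0 (fun th=> poweR_ge0 _ _).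
 rewrite /Jl !wE=> hj; apply: (le_trans hj).
 have -> : \int[leb]_th (w th)%:E = 1.
  have:= wE (cst 1); rewrite integral12_cst// => ->.
  by apply: eq_integral=> th _; rewrite mule1.
 rewrite poweR_EFin powR1 mul1e le_eqVlt; apply/orP; left; apply/eqP; apply: eq_integral=> th _.
 by rewrite -poweRrM; congr (_ * poweR _ _); rewrite mulrCA divff ?mulr1.
rewrite /= powRr0 mul1e /lqZ; apply: ub_ereal_sup=> _ [l _ <-].
rewrite -(poweRK rn L0); apply: le_poweR; [side|side|].
le_via (\int[leb]_(th in `[1%R, 2%R[) (Lqt_dil`^r + bad (tz (- l)*th)%R)).
 apply: ge0_le_integral=> //.
 - side.
 - by apply: measurable_funTS; exact: mHQ.
 - by apply: measurable_funTS; apply: emeasurable_funD; [side|exact: mbad].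
 - move=> th _; have [tN|tN]:= boolP (tz (- l)*th \in N)%R.
   by rewrite /bad indicE tN mule1 addey ?leey//; have:= poweR_ge0 Lqt_dil r; case: poweR.
  rewrite /bad indicE (negbTE tN) mule0 adde0; apply: le_poweR=> //; first side.
  by have:= H_le (tz (- l)*th)%R; rewrite /bad indicE (negbTE tN) mule0 adde0.
rewrite ge0_integralD//; try side.
by rewrite integral12_cst ?poweR_ge0// bad_null// adde0.
Qed.

End continuous_parameter.
Hint Resolve lqZ_ge0 meas_lqZ: side.

(** * Comparison of continuous and dyadic mixed norms *)

Section norm_comparison.
Context {R: realType} {n: nat}.
Local Notation leb:= (@lebesgue_measure R).
Local Notation T j g:= (sop (eta (tz j)) g).

Record scale_family (u: R -> 'rV[R]_n -> R): Prop:= ScaleFamily {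
 sf_meas: mfun (fun z: measurableTypeR R*'rV[R]_n=> u z.1 z.2);
 sf_ge0: forall t x, (0 <= u t x)%R;
 sf_bound: forall m, exists M: R, forall th x, (1 <= th)%R -> (th <= 2)%R -> (u (th*tz (- m)) x <= M)%R }.

Record dyadic_family (w: int -> 'rV[R]_n -> R): Prop:= DyadicFamily {
 df_meas: forall m, mfun (w m);
 df_ge0: forall m x, (0 <= w m x)%R;
 df_bound: forall m, exists M: R, forall x, (w m x <= M)%R }.

Definition dil (u: R -> 'rV[R]_n -> R) (th: R) (l: int) (x: 'rV[R]_n): \bar R:= (u (th*tz (- l))%R x)%:E.
Lemma sf_meas1 u t: scale_family u -> mfun (fun x=> (u t x)%:E).
Proof. by move=> [mu _ _]; apply/mEFinP; exact: (mcomp mu (measurable_pair1 (t: measurableTypeR R))). Qed.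
Hint Resolve sf_meas1: side.
Lemma sf_meas2 u x: scale_family u -> measurable_fun [set: R] (fun t=> (u t x)%:E).
Proof. by move=> [mu _ _]; apply/mEFinP; exact: (mcomp mu (measurable_pair2 x)). Qed.
Hint Resolve sf_meas2: side.

Variables (C0 z r: R) (q: \bar R).
Hypotheses (C00: (0 < C0)%R) (z0: (0 < z)%R) (z1: (z < 1)%R) (r0: (0 < r)%R) (rq: r%:E < q).
Let rn: r != 0%R. Proof. side. Qed.
Let q0: 0 < q. Proof. by apply: lt_trans rq; rewrite lte_fin. Qed.
Lemma meas_LpRn_scale p u: 0 < p -> scale_family u ->
 measurable_fun [set: R] (fun t=> LpRn p (fun x=> (u t x)%:E)).
Proof.
move=> p0 su; have [mU u0 _]:= su.
have mE: mfun (fun w: measurableTypeR R*'rV[R]_n=> (u w.1 w.2)%:E) by side.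
case: p p0=> [P P0|_|//].
 apply: (eq_measurable_fun (fun t: measurableTypeR R=> (\int[mu n]_x ((u t x)%:E`^P))`^P^-1)).
  by move=> t _; rewrite (LpRn_fin P (sf_meas1 t su))// => x; rewrite lee_fin.
 apply: (mcomp (measurable_poweR P^-1)).
 apply: (measurable_fun_fubini_tonelli_F (fun w: measurableTypeR R*'rV[R]_n=> (u w.1 w.2)%:E`^P))=> [|w].
  side.
 side.
apply: (eq_measurable_fun (fun t: measurableTypeR R=> ess_sup (mu n) (fun x=> (u t x)%:E))).
 by move=> t _; rewrite LpRn_pinfty//; exact: (@sf_meas1 u t su).
exact: (meas_ess_sup (mu n) mE).
Qed.
Hint Resolve meas_LpRn_scale: side.
Lemma meas_Lqt_scale u: scale_family u ->
 mfun (fun x=> Lqt_dil q (fun t=> (u t x)%:E)).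
Proof.
move=> [mu u0 _].
pose f (w: 'rV[R]_n * measurableTypeR R): \bar R:= if (0 < (w.2: R))%R then ((w.2: R)`^(- einv q))%:E*(u w.2 w.1)%:E else 0.
have mf: mfun f.
 apply: measurable_fun_ifT; last side.
  by apply: measurable_fun_ltr; [side|side].
 apply: emeasurable_funM; apply/mEFinP.
  side.
 have ms: mfun (fun w: 'rV[R]_n * measurableTypeR R=> (w.2, w.1)).
  by apply/measurable_fun_pairP; split; [exact: measurable_snd|exact: measurable_fst].
 exact: (mcomp mu ms).
rewrite /Lqt_dil; case Eq: q=> [Q||]; last by move: q0; rewrite Eq.
 have Q0: (0 < Q)%R by rewrite -lte_fin -Eq.
 apply: (mcomp (measurable_poweR Q^-1)).
 apply: (eq_measurable_fun (fun x=> \int[leb]_t (f (x, t)`^Q))).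
  move=> x _; rewrite [RHS]integral_mkcond; apply: eq_integral=> t _; rewrite patchE /f /= Eq.
  have [t0|t0]:= boolP (0 < t)%R; first by rewrite mem_set.
  by rewrite memNset; [rewrite poweR0r// gt_eqF|exact/negP].
 apply: (measurable_fun_fubini_tonelli_F (fun w=> f w`^Q))=> [|w].
  side.
 side.
by have:= meas_ess_sup leb mf; rewrite /f /= Eq.
Qed.
Hint Resolve meas_Lqt_scale: side.
Lemma mixB_upper p: r%:E < p -> exists2 C: R, (0 < C)%R & forall u w, scale_family u -> dyadic_family w ->
 (forall th, (1 <= th)%R -> (th <= 2)%R -> conv_le C0 z r (dil u th) (fun m x=> (w m x)%:E)) ->
 Lqt_dil q (fun t=> LpRn p (fun x=> (u t x)%:E)) <= C%:E * lqZ q (fun m=> LpRn p (fun x=> (w m x)%:E)).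
Proof.
move=> rp; have p0: 0 < p by apply: lt_trans rp; rewrite lte_fin.
have [C CC hC]:= @besov_conv R n C0 z r p q C00 z0 z1 r0 rp rq; exists C=> // u w su [mw w0 _] huw.
have mE m: mfun (fun x=> (w m x)%:E) by side.
apply: Lqt_dil_ub=> //; first side.
 by move=> t; apply: LpRn_ge0=> //; [exact: sf_meas1|move=> x; rewrite lee_fin; case: su].
move=> th th1 th2; apply: (hC (dil u th) (fun m x=> (w m x)%:E))=> // [j|j x|]; last exact: huw.
 exact: sf_meas1.
by rewrite lee_fin; case: su.
Qed.
Lemma mixB_lower p: r%:E < p -> exists2 C: R, (0 < C)%R & forall u w, scale_family u -> dyadic_family w ->
 (forall th, (1 <= th)%R -> (th <= 2)%R -> conv_le C0 z r (fun m x=> (w m x)%:E) (dil u th)) ->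
 lqZ q (fun m=> LpRn p (fun x=> (w m x)%:E)) <= C%:E*Lqt_dil q (fun t=> LpRn p (fun x=> (u t x)%:E)).
Proof.
move=> rp; have p0: 0 < p by apply: lt_trans rp; rewrite lte_fin.
have [C CC hC]:= @besov_conv R n C0 z r p q C00 z0 z1 r0 rp rq.
exists (C*2`^einv q)%R=> [|u w su [mw w0 _] huw]; first side.
have mE m: mfun (fun x=> (w m x)%:E) by side.
set L:= lqZ _ _; have L0: 0 <= L by side.
have Ci: (0 < C^-1)%R by side.
have: C^-1%:E*L <= (2`^einv q)%:E*Lqt_dil q (fun t=> LpRn p (fun x=> (u t x)%:E)).
 apply: Lqt_dil_lb=> //; first exact: meas_LpRn_scale.
 - by move=> t; apply: LpRn_ge0=> //; [exact: sf_meas1|move=> x; rewrite lee_fin; case: su].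
 - side.
 move=> th th1 th2; rewrite -lee_pdivlMl// invrK.
 apply: (hC (fun m x=> (w m x)%:E) (dil u th))=> // [j|j x|]; last exact: huw.
  exact: sf_meas1.
 by rewrite lee_fin; case: su.
by rewrite -lee_pdivlMl ?invr_gt0// invrK muleA -EFinM.
Qed.

Variable P0: R.
Hypothesis rP: (r < P0)%R.
Let P00: 0 < P0%:E. Proof. by rewrite lte_fin; exact: lt_trans rP. Qed.
Let root (a b: int -> \bar R):= forall l, a l`^r <= C0%:E*zsum (fun m=> (zw z (l - m))%:E*b m).
Let lqZ_root_conv: exists2 C: R, (0 < C)%R & forall a b: int -> \bar R, (forall j, 0 <= a j) -> (forall j, 0 <= b j) ->
 root a b -> lqZ q a <= C%:E * lqZ q (fun m=> b m`^r^-1).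
Proof.
have [C CC hC]:= lqZ_conv z0 z1 r0 rq r0 C00; exists C=> // a b a0 b0 hab; apply: hC=> // [j|l]; first side.
by under eq_zsum do rewrite poweRVK//; exact: hab.
Qed.
Lemma mixF_upper: exists2 C: R, (0 < C)%R & forall u w, scale_family u -> dyadic_family w ->
 (forall th, (1 <= th)%R -> (th <= 2)%R -> conv_le C0 z r (dil u th) (fun m x=> (w m x)%:E)) ->
 LpRn P0%:E (fun x=> Lqt_dil q (fun t=> (u t x)%:E)) <= C%:E*LpRn P0%:E (fun x=> lqZ q (fun m=> (w m x)%:E)).
Proof.
have [C1 C10 h1]:= lqZ_root_conv.
have [C2 C20 h2]:= @fefferman_stein_lqZ R n P0 r q r0 rP rq.
exists (C1*C2)%R=> [|u w su [mw w0 wb] huw]; first side.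
pose g m x:= (w m x)%:E`^r.
have mg m: mfun (g m) by side.
have g0 m x: 0 <= g m x by side.
have mT m: mfun (T m (g m)) by side.
have T0 m x: 0 <= T m (g m) x by side.
have mTr m: mfun (fun x=> T m (g m) x`^r^-1) by side.
have mL: mfun (fun x=> lqZ q (fun m=> T m (g m) x`^r^-1)).
 by apply: meas_lqZ=> // j x; side.
have L0 x: 0 <= lqZ q (fun m=> T m (g m) x`^r^-1) by side.
have [M hM]:= choice wb.
have:= h2 g (fun m=> M m`^r)%R mg g0 _; rewrite /g.
have -> : (fun x=> lqZ q (fun m=> ((w m x)%:E`^r)`^r^-1)) = (fun x=> lqZ q (fun m=> (w m x)%:E)).
 by apply/funext=> x; congr lqZ; apply/funext=> m; rewrite poweRK ?lee_fin.
move=> h2'; rewrite EFinM -muleA.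
le_via (C1%:E*LpRn P0%:E (fun x=> lqZ q (fun m=> T m (g m) x`^r^-1))); last first.
 apply: lee_wpmul2l; first side.
 apply: h2'=> m x; rewrite lee_fin; apply: ge0_ler_powR; rewrite ?nnegrE ?w0 ?(ltW r0)//.
 exact: le_trans (w0 m x) (hM m x).
rewrite -LpRnZ//; apply: le_LpRn=> //; try side.
- by move=> x; apply: Lqt_dil_ge0=> // t; rewrite lee_fin; case: su.
move=> x; apply: Lqt_dil_ub=> //; first exact: sf_meas2.
 by move=> t; rewrite lee_fin; case: su.
move=> th th1 th2; apply: h1=> // [j|l]; first by rewrite lee_fin; case: su.
exact: (huw th th1 th2 l x).
Qed.
Lemma integral12E (h: R -> \bar R) :
 \int[leb]_(th in `[1%R, 2%R[) h th = \int[leb]_th ((\1_(`[1%R, 2%R[%classic: set R) th)%:E*h th).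
Proof.
rewrite integral_mkcond; apply: eq_integral=> th _; rewrite patchE indicE.
by case: ifP=> _; rewrite ?mul1e ?mul0e.
Qed.
(** The pointwise estimate holds for each th in the shell, but the L^p norm stands outside the
    integral in t. The estimate is therefore averaged over th first, by Fubini under the kernel; the
    Fefferman-Stein inequality is then applied once, to the averages [G m], and [Lqt_dil_average]
    returns to the integral in t. *)
Lemma mixF_lower: exists2 C: R, (0 < C)%R & forall u w, scale_family u -> dyadic_family w ->
 (forall th, (1 <= th)%R -> (th <= 2)%R -> conv_le C0 z r (fun m x=> (w m x)%:E) (dil u th)) ->
 LpRn P0%:E (fun x=> lqZ q (fun m=> (w m x)%:E)) <= C%:E*LpRn P0%:E (fun x=> Lqt_dil q (fun t=> (u t x)%:E)).
Proof.
have [C1 C10 h1]:= lqZ_root_conv.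
have [C2 C20 h2]:= @fefferman_stein_lqZ R n P0 r q r0 rP rq.
exists (C1*C2*2`^einv q)%R=> [|u w su [mw w0 wb] huw]; first side.
have mE m: mfun (fun x=> (w m x)%:E) by side.
have [muu u0 ub]:= su; have [M hM]:= choice ub.
pose I: set R:= `[1%R, 2%R[%classic.
pose iI (th: measurableTypeR R): R:= \1_I th.
have miI: measurable_fun [set: measurableTypeR R] iI by apply: measurable_indic; exact: measurable_itv.
pose f m (s: measurableTypeR R*'rV[R]_n): \bar R:= (iI s.1)%:E*(u (tz (- m)*s.1)%R s.2)%:E`^r.
have mus m: mfun (fun s: measurableTypeR R*'rV[R]_n=> (u (tz (- m)*s.1)%R s.2)%:E`^r).
 apply: (mcomp (measurable_poweR r)); apply/mEFinP.
 have ms: mfun (fun s: measurableTypeR R*'rV[R]_n=> ((tz (- m)*s.1)%R: measurableTypeR R, s.2)).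
  apply/measurable_fun_pairP; split; last exact: measurable_snd.
  by apply: measurable_funM; [side|side].
 exact: (mcomp muu ms).
have mf m: mfun (f m).
 side.
have f0 m s: 0 <= f m s by side.
pose G m x: \bar R:= \int[leb]_(th in `[1%R, 2%R[) ((u (tz (- m)*th)%R x)%:E`^r).
have GE m x: G m x = \int[leb]_th f m (th, x) by rewrite /G integral12E.
have mG m: mfun (G m).
 apply: (eq_measurable_fun (fun x=> \int[leb]_th f m (th, x)))=> [x _|]; first by rewrite GE.
 exact: (measurable_fun_fubini_tonelli_G (m1:= leb) (f m) (mf m) (f0 m)).
have G0 m x: 0 <= G m x by side.
have mut m x: measurable_fun [set: R] (fun th: R=> (u (tz (- m)*th)%R x)%:E`^r).
 exact: (mcomp (mus m) (measurable_pair2 x)).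
have mT m: mfun (T m (G m)) by side.
have T0 m x: 0 <= T m (G m) x by side.
have mTr m: mfun (fun x=> T m (G m) x`^r^-1) by side.
have mGr m: mfun (fun x=> G m x`^r^-1) by side.
have mLT: mfun (fun x=> lqZ q (fun m=> T m (G m) x`^r^-1)).
 by apply: meas_lqZ=> // j x; side.
have mLG: mfun (fun x=> lqZ q (fun m=> G m x`^r^-1)).
 by apply: meas_lqZ=> // j x; side.
have L0 x: 0 <= lqZ q (fun m=> T m (G m) x`^r^-1) by side.
have GM m x: G m x <= (M m`^r)%:E.
 rewrite /G -[leRHS](@integral12_cst R) ?lee_fin ?powR_ge0//; apply: ge0_le_integral=> //.
 - side.
 - by apply: measurable_funTS; exact: mut.
 - move=> th; rewrite /= in_itv/= => /andP[th1 /ltW th2]; rewrite lee_fin.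
  have h:= hM m th x th1 th2; rewrite mulrC in h.
  by apply: ge0_ler_powR; rewrite ?nnegrE ?(ltW r0) ?(le_trans (u0 _ x) h).
have avg x: root (fun m=> (w m x)%:E) (fun m=> T m (G m) x).
 move=> l; rewrite -[leLHS](@integral12_cst R) ?poweR_ge0//.
 pose k (m: int) (th: R):= C0%:E*((zw z (l - m))%:E*T m (fun y=> dil u th m y`^r) x).
 have tm m: (0 < tz m :> R)%R by exact: tz_gt0.
 have k0 m th: 0 <= k m th.
  by rewrite /k !mule_ge0 ?lee_fin ?zw_ge0 ?(ltW C00) ?(ltW z0)// T_ge0// => y; side.
 have me m: mfun (fun y: 'rV[R]_n=> (eta (tz m) (x - y))%:E).
  side.
 pose F m (s: measurableTypeR R*'rV[R]_n):= (eta (tz m) (x - s.2))%:E*(u (tz (- m)*s.1)%R s.2)%:E`^r.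
 have mF m: mfun (F m).
  side.
 have F0 m s: 0 <= F m s by apply: mule_ge0; [rewrite lee_fin eta_ge0|side].
 have mk m: measurable_fun [set: R] (k m).
  apply: measurable_funeM; apply: measurable_funeM.
  apply: (eq_measurable_fun (fun th: measurableTypeR R=> \int[mu n]_y F m (th, y))).
   by move=> th _; rewrite /sop; apply: eq_integral=> y _; rewrite /F/= /dil mulrC.
  exact: (measurable_fun_fubini_tonelli_F (F m) (mF m) (F0 m)).
 le_via (\int[leb]_(th in `[1%R, 2%R[) zsum (fun m=> k m th)).
  apply: ge0_le_integral=> //.
  - side.
  - by apply: measurable_funTS; exact: (meas_zsum (a:= k)).
  - move=> th; rewrite /= in_itv/= => /andP[th1 /ltW th2].
   apply: (le_trans (huw th th1 th2 l x)); rewrite zsumZ// ?(ltW C00)// => m.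
   by rewrite mule_ge0 ?lee_fin ?zw_ge0 ?(ltW z0)// T_ge0// => y; side.
 rewrite (integral_zsum leb (a:= k))//; last side.
 rewrite -zsumZ ?(ltW C00)//; last by move=> m; rewrite mule_ge0 ?lee_fin ?zw_ge0 ?(ltW z0).
 apply: le_zsum=> m; apply: le_of_eq.
 have kE th: k m th = (C0*zw z (l - m))%:E*\int[mu n]_y F m (th, y).
  have sE: T m (fun y=> dil u th m y`^r) x = \int[mu n]_y F m (th, y).
   by rewrite /sop; apply: eq_integral=> y _; rewrite /F /dil /= [(th*_)%R]mulrC.
  by rewrite /k sE; move: (\int[mu n]_y F m (th, y)) (zw z _)=> J Z; rewrite muleA.
 under eq_integral do rewrite kE.
 have mI12: measurable_fun (`[1%R, 2%R[%classic: set R) (fun th: R=> \int[mu n]_y F m (th, y)).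
  apply: measurable_funTS; exact: (measurable_fun_fubini_tonelli_F (F m) (mF m) (F0 m)).
 have i0 (th: R): 0 <= \int[mu n]_y F m (th, y) by side.
 rewrite ge0_integralZl ?lee_fin ?mulr_ge0 ?zw_ge0 ?(ltW C00) ?(ltW z0)//.
 rewrite EFinM -muleA; congr (_*(_*_)); rewrite integral12E.
 pose FF (s: measurableTypeR R*'rV[R]_n):= (iI s.1)%:E*F m s.
 transitivity (\int[leb]_th \int[mu n]_y FF (th, y)).
  apply: eq_integral=> th _; rewrite /FF/= ge0_integralZl ?lee_fin//.
  exact: (mcomp (mF m) (measurable_pair1 _)).
 have mFF: mfun FF.
  side.
 have FF0 s: 0 <= FF s by side.
 rewrite (fubini_tonelli (m1:= leb) (m2:= mu n) FF mFF FF0) /sop; apply: eq_integral=> y _.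
 rewrite GE -ge0_integralZl//; last 2 first.
 - exact: (mcomp (mf m) (measurable_pair2 y)).
 - by rewrite lee_fin eta_ge0.
 by apply: eq_integral=> th _; rewrite /FF /F /f/= muleCA.
le_via (C1%:E*LpRn P0%:E (fun x=> lqZ q (fun m=> T m (G m) x`^r^-1))).
 rewrite -LpRnZ//; apply: le_LpRn=> //.
 - by apply: meas_lqZ=> // j x; rewrite lee_fin.
 - side.
 - side.
 - side.
rewrite !EFinM -!muleA; apply: lee_wpmul2l; first side.
apply: (le_trans (h2 G (fun m=> M m`^r)%R mG G0 GM)); apply: lee_wpmul2l; first side.
have D0 x: 0 <= Lqt_dil q (fun t=> (u t x)%:E).
 by apply: Lqt_dil_ge0=> // t; rewrite lee_fin.
rewrite -LpRnZ ?powR_gt0//; last side.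
apply: le_LpRn=> //.
- by apply: measurable_funeM; exact: meas_Lqt_scale.
- side.
- move=> x; apply: Lqt_dil_average=> //; first exact: sf_meas2.
 side.
Qed.

End norm_comparison.
Hint Resolve meas_LpRn_scale meas_Lqt_scale: side.

Local Close Scope ereal_scope.

(** * Pointwise estimates for families of symbols *)

Section characterization.
Context {R: realType} {n: nat}.
Hypothesis n0: (0 < n)%N.
Local Notation Fo f:= (FT (- (2 * pi)) f).
Lemma powR_addr_le (a b r: R): 0 <= a -> 0 <= b -> 0 < r -> r <= 1 -> (a + b)`^r <= a`^r + b`^r.
Proof.
move=> a0 b0 r0 r1; have [ab|]:= ltP 0 (a + b); last first.
 by move=> ab; rewrite (_: a + b = 0) ?powR0 ?gt_eqF// ?addr_ge0 ?powR_ge0//; lra.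
have H x: 0 <= x -> x <= a + b -> (a + b)`^r*(x/(a + b)) <= x`^r.
 move=> x0 xab; have [->|xn]:= eqVneq x 0; first by rewrite mul0r mulr0 powR_ge0.
 have xp: 0 < x by rewrite lt_neqAle eq_sym xn.
 have y0: 0 < x/(a + b) by side.
 rewrite -[in leRHS](divfK (lt0r_neq0 ab) x) mulrC powRM ?(ltW y0) ?(ltW ab)//; apply: ler_wpM2r; first side.
 rewrite -[leLHS]powRr1 ?(ltW y0)//; apply: ger_powR=> //.
 by rewrite y0/= ler_pdivrMr// mul1r.
have -> : (a + b)`^r = (a + b)`^r*(a/(a + b)) + (a + b)`^r*(b/(a + b)).
 by rewrite -mulrDr -mulrDl divff ?mulr1// gt_eqF.
by apply: lerD; apply: H=> //; lra.
Qed.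
Lemma powR_sum_le k (a: 'I_k -> R) (r: R): (forall i, 0 <= a i) -> 0 < r -> r <= 1 ->
 (\sum_i a i)`^r <= \sum_i a i`^r.
Proof.
move=> a0 r0 r1; suff []: 0 <= \sum_i a i /\ (\sum_i a i)`^r <= \sum_i a i`^r by [].
apply: (big_ind2 (fun x y=> 0 <= x /\ x`^r <= y))=> [|x1 y1 x2 y2 [h1 h2] [h3 h4]|i _]; last by [].
 by rewrite powR0// gt_eqF.
by split; [side|exact: le_trans (powR_addr_le h1 h3 r0 r1) (lerD h2 h4)].
Qed.

(** The square sum matches the length of the gradient, with one symbol per coordinate; a single
    multiplier is the case k = 1. *)
Definition Usq k (A: 'I_k -> 'rV[R]_n -> R[i]) F t x:= Num.sqrt (\sum_i Umod (A i) F t x^+2).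
Lemma Usq1 (A: 'I_1 -> 'rV[R]_n -> R[i]) F t x: Usq A F t x = Umod (A ord0) F t x.
Proof. by rewrite /Usq big_ord1 sqrtr_sqr ger0_norm// Umod_ge0. Qed.
Lemma Usq_le_sum k (A: 'I_k -> 'rV[R]_n -> R[i]) F t x: Usq A F t x <= \sum_i Umod (A i) F t x.
Proof.
suff [h0 h]: 0 <= \sum_i Umod (A i) F t x /\ \sum_i Umod (A i) F t x^+2 <= (\sum_i Umod (A i) F t x)^+2.
 by rewrite /Usq -[leRHS]ger0_norm// -sqrtr_sqr ler_wsqrtr.
apply: (big_ind2 (fun x y=> 0 <= x /\ y <= x^+2))=> [|x1 y1 x2 y2 [h1 h2] [h3 h4]|i _]; try side.
- by split; [side|nra].
- by split; [side|].
Qed.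
Lemma meas_Umod2 A F: cmeas A -> cmeas F ->
 mfun (fun z: measurableTypeR R*'rV[R]_n=> Umod A F z.1 z.2).
Proof.
move=> mA mF; apply: cmeas_cabs.
apply: (@cmeas_Cint R _ _ _ _ (mu n) (fun w: (measurableTypeR R*'rV[R]_n)*'rV[R]_n =>
 A (w.1.1 *: w.2)*F w.2*cexpi ((2 * pi)*dotp w.2 w.1.2))).
have m1: mfun (fun w: (measurableTypeR R*'rV[R]_n)*'rV[R]_n=> (w.1.1: R)).
 exact: (mcomp measurable_fst measurable_fst).
have m2: mfun (fun w: (measurableTypeR R*'rV[R]_n)*'rV[R]_n=> w.1.2).
 exact: (mcomp measurable_snd measurable_fst).
apply: cmeasM; first apply: cmeasM.
- by apply: (cmeas_comp mA); apply: meas_scaleV; [exact: m1|exact: measurable_snd].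
- by apply: (cmeas_comp mF); exact: measurable_snd.
- apply: cmeas_cexpi; apply: measurable_funM; first exact: measurable_cst.
 by apply: meas_dotp; [exact: measurable_snd|exact: m2].
Qed.

Definition usc (alpha: R) k (A: 'I_k -> 'rV[R]_n -> R[i]) F t x:= t`^(- alpha)*Usq A F t x.
Definition wdy (alpha: R) Phi F (m: int) (x: 'rV[R]_n):= tz m`^alpha*Umod Phi F (tz (- m)) x.
Lemma powR_12 (th a: R): 1 <= th -> th <= 2 -> th`^a <= 2`^`|a|.
Proof.
move=> h1 h2; le_via (th`^`|a|); first by apply: ler_powR=> //; exact: ler_norm.
by apply: ge0_ler_powR=> //; rewrite nnegrE; lra.
Qed.
Lemma dilation_powR (alpha th: R) m: 1 <= th -> (th*tz (- m))`^(- alpha) = th`^(- alpha)*tz m`^alpha.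
Proof.
move=> h1; rewrite powRM ?(ltW (tz_gt0 _))//; last by lra.
by rewrite tzN powRV ?(ltW (tz_gt0 _))// opprK.
Qed.
Lemma goodsym_cmeas b' (A: 'rV[R]_n -> R[i]): goodsym b' A -> cmeas A /\ exists M, forall x, cabs (A x) <= M.
Proof. by move=> /(_ 0%N) [kap [_ [M [mA hM _ _]]]]; split=> //; exists M. Qed.
Lemma scale_family_usc alpha b' k (A: 'I_k -> 'rV[R]_n -> R[i]) F: (forall i, goodsym b' (A i)) -> cintg (mu n) F ->
 scale_family (usc alpha A F).
Proof.
move=> gA Fi; have mF: cmeas F by case: Fi.
split=> [|t x|m]; last 2 first.
- by rewrite mulr_ge0 ?powR_ge0 ?sqrtr_ge0.
- have hb i: exists M0, forall t x, Umod (A i) F t x <= M0.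
  by have [mA [M hM]]:= goodsym_cmeas (gA i); exact: (Umod_bounded mA hM Fi).
 have [M hM]:= choice hb.
 exists (2`^`|alpha| * tz m`^alpha*\sum_i M i)=> th x h1 h2; rewrite /usc.
 apply: ler_pM; rewrite ?powR_ge0 ?sqrtr_ge0//.
  rewrite dilation_powR//; apply: ler_wpM2r; first side.
  by rewrite -normrN; exact: powR_12.
 by apply: (le_trans (Usq_le_sum _ _ _ _)); apply: ler_sum=> i _; exact: hM.
apply: measurable_funM.
 side.
apply: mcomp; first by apply: continuous_measurable_fun; exact: sqrt_continuous.
apply: measurable_sum=> i; apply: measurable_funX; apply: meas_Umod2=> //.
by case: (goodsym_cmeas (gA i)).
Qed.
Lemma dyadic_family_wdy alpha b' Phi F: goodsym b' Phi -> cintg (mu n) F -> dyadic_family (wdy alpha Phi F).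
Proof.
move=> gP Fi; have mF: cmeas F by case: Fi.
have [mP [M hM]]:= goodsym_cmeas gP.
split=> [m|m x|m].
- by apply: measurable_funM; [side|exact: meas_Umod].
- by rewrite mulr_ge0 ?powR_ge0 ?Umod_ge0.
- have [M0 hM0]:= Umod_bounded mP hM Fi; exists (tz m`^alpha*M0)=> x.
 by apply: ler_wpM2l; [side|exact: hM0].
Qed.
Lemma sopZ (K: 'rV[R]_n -> R) (f: 'rV[R]_n -> \bar R) (c: R) x: mfun K -> (forall y, 0 <= K y) ->
 mfun f -> (forall y, (0 <= f y)%E) -> 0 <= c ->
 (sop K (fun y=> c%:E*f y) x = c%:E*sop K f x)%E.
Proof.
move=> mK K0 mf f0 c0; have mKE:= meas_kernelE mK x.
rewrite /sop -ge0_integralZl//; last 2 first.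
- side.
- side.
by apply: eq_integral=> y _; rewrite muleCA.
Qed.
(** Both halves come from [core], with the same z. Above, B is the Littlewood-Paley bump at dyadic
    scales and A is taken at the scale th 2^-l; below, the bump is estimated through an elliptic B
    at the scale th 2^-m. Powers of th are bounded on the shell, and a sum over k symbols splits
    because r <= 1. *)
Lemma conv_le_upper (b' alpha r: R): 0 < r -> r <= 1 -> 0 < b' -> alpha < b' -> exists z: R, [/\ 0 < z, z < 1 &
 forall phi a, schwartz phi -> supp_ann (FT a phi) -> lp_partition (FT a phi) ->
 (forall k (A: 'I_k -> 'rV[R]_n -> R[i]), (forall i, goodsym b' (A i)) ->
  exists2 C: R, 0 < C & forall F th, cintg (mu n) F -> 1 <= th -> th <= 2 ->
  conv_le C z r (dil (usc alpha A F) th) (fun m x=> (wdy alpha (FT a phi) F m x)%:E)) /\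
 (forall B, goodsym b' B -> elliptic B -> (forall x, 0 < enorm x -> B x != 0) ->
  exists2 C: R, 0 < C & forall F th, cintg (mu n) F -> 1 <= th -> th <= 2 ->
  conv_le C z r (fun m x=> (wdy alpha (FT a phi) F m x)%:E) (dil (usc alpha (fun _: 'I_1=> B) F) th))].
Proof.
move=> r0 r1 b0 ab; have [z [z0 z1 hz]]:= core n0 r0 r1 b0 ab.
exists z; split=> // phi a sp sa pa; have gP:= goodsym_FT_schwartz b0 sp sa.
have zg d: (0 <= (zw z d)%:E)%E by rewrite lee_fin zw_ge0 ?(ltW z0).
split=> [k A gA|B gB eB nB].
 have h1 (th: R): [set 1] th -> 1 <= th /\ th <= 2 by move=> ->; rewrite lexx ler1n.
 have hC i: exists C: R, 0 < C /\ forall F th' l x, cintg (mu n) F -> 1 <= th' -> th' <= 2 ->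
  (((tz l`^alpha*Umod (A i) F (th'*tz (- l)) x)`^r)%:E <= C%:E *
  zsum (fun m=> (zw z (l - m))%:E*sop (eta (tz m)) (fun y=> ((wdy alpha (FT a phi) F m y)%:E`^r)) x))%E.
  have [C C0 h]:= hz (A i) _ _ _ (gA i) gP pa (goodquot_FT_schwartz sp sa) h1.
  exists C; split=> // F th' l x Fi t1 t2; pose G (f: int -> 'rV[R]_n -> \bar R):= zsum (fun m=> (zw z (l - m))%:E*sop (eta (tz m)) (f m) x)%E.
  have gE: (fun m y=> (wdy alpha (FT a phi) F m y)%:E`^r)%E =
       (fun m y=> ((tz m`^alpha*Umod (FT a phi) F (1*tz (- m)) y)`^r)%:E).
   apply/funext=> m; apply/funext=> y.
   exact: (congr1 (fun c=> ((tz m`^alpha*Umod (FT a phi) F c y)`^r)%:E) (esym (mul1r (tz (- m))))).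
  change (((tz l`^alpha*Umod (A i) F (th'*tz (- l)) x)`^r)%:E <=
   C%:E*G (fun m y=> (wdy alpha (FT a phi) F m y)%:E`^r))%E.
  rewrite gE; exact: (h F 1 th' l x Fi erefl t1 t2).
 have [C hC']:= choice hC.
 have Csum: 0 <= \sum_i C i by apply: sumr_ge0=> i _; case: (hC' i)=> /ltW.
 exists ((2`^`|alpha|)`^r*(1 + \sum_i C i))=> [|F th Fi t1 t2 l x].
  by rewrite mulr_gt0 ?powR_gt0// ltr_wpDr.
 set S:= zsum _.
 have S0: (0 <= S)%E.
  apply: zsum_ge0=> m; rewrite mule_ge0//; apply: T_ge0=> u.
  side.
 have hS i: (((tz l`^alpha*Umod (A i) F (th*tz (- l)) x)`^r)%:E <= (C i)%:E*S)%E by case: (hC' i)=> _; apply.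
 move: S S0 hS=> S S0 hS.
 have V0: 0 <= Usq A F (th*tz (- l)) x by side.
 have hV:= Usq_le_sum A F (th*tz (- l)) x.
 rewrite /dil /usc poweR_EFin dilation_powR// -mulrA; move: (Usq _ _ _ _) V0 hV=> V V0 hV.
 rewrite powRM ?powR_ge0 ?mulr_ge0 ?powR_ge0//.
 rewrite !EFinM.
 rewrite -muleA.
 apply: lee_pmul.
 - side.
 - side.
 - rewrite lee_fin.
  apply: ge0_ler_powR; rewrite ?nnegrE ?powR_ge0 ?(ltW r0)//; rewrite -normrN; exact: powR_12.
 le_via ((\sum_i C i)%:E*S)%E; last first.
  by apply: lee_wpmul2r=> //; rewrite lee_fin lerDr.
 le_via (\sum_i ((tz l`^alpha*Umod (A i) F (th*tz (- l)) x)`^r)%:E)%E.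
  rewrite sumEFin lee_fin; apply: le_trans (powR_sum_le _ r0 r1)=> [|i]; last side.
  rewrite -mulr_sumr; apply: ge0_ler_powR; rewrite ?nnegrE ?(ltW r0)//; try side.
  - by apply: ler_wpM2l; [side|].
 rewrite -sumEFin ge0_sume_distrl; last by move=> i _; rewrite lee_fin; case: (hC' i)=> /ltW.
 by apply: lee_sum=> i _; exact: hS.
have h1 (th: R): [set th | 1 <= th <= 2] th -> 1 <= th /\ th <= 2 by move=> /= /andP.
have [C C0 h]:= hz (FT a phi) _ _ _ gP gB pa (goodquot_elliptic b0 sp sa gB eB nB) h1.
exists (C*(2`^`|alpha|)`^r)=> [|F th Fi t1 t2 l x]; first side.
have t12: 1 <= th <= 2 by rewrite t1.
have:= h F th 1 l x Fi t12 (lexx _) (ler1n _ 2); rewrite mul1r=> h'; apply: (le_trans h').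
rewrite EFinM -muleA; apply: lee_wpmul2l; first side.
rewrite -zsumZ ?powR_ge0//; last first.
 move=> m; rewrite mule_ge0//; apply: T_ge0=> u.
 side.
apply: le_zsum=> m; rewrite muleCA; apply: lee_wpmul2l=> //.
have md: mfun (fun y=> (dil (usc alpha (fun _: 'I_1=> B) F) th m y`^r)%E).
 have sf: scale_family (usc alpha (fun _: 'I_1=> B) F):= (scale_family_usc _ (fun=> gB) Fi).
 by apply: meas_poweRr; exact: sf_meas1.
rewrite -sopZ ?powR_ge0//; try side.

apply: le_sop.
- side.
- side.
- apply/mEFinP; apply: (mcomp (measurable_powR r)).
 apply: measurable_funM; first side.
 by apply: meas_Umod; [case: (goodsym_cmeas gB)|case: Fi].
- side.
- side.
move=> u.
rewrite /dil /usc Usq1 poweR_EFin -EFinM lee_fin dilation_powR// -[th`^_*_*_]mulrA [leRHS]mulrC.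
rewrite -powRM ?mulr_ge0 ?powR_ge0 ?Umod_ge0//.
have V0:= Umod_ge0 B F (th*tz (- m)) u; move: (Umod _ _ _ _) V0=> V V0.
apply: ge0_ler_powR; rewrite ?nnegrE ?(ltW r0) ?mulr_ge0 ?powR_ge0//.
rewrite mulrAC; apply: ler_peMl; first side.
have th0: 0 < th by lra.
by rewrite powRN mulrC ler_pdivlMr ?powR_gt0// mul1r; exact: powR_12.
Qed.

End characterization.

(** * The norm inequalities for test functions *)

Section norms.
Context {R: realType} {n: nat}.
Hypothesis n0: (0 < n)%N.
Local Notation Fo f:= (FT (- (2 * pi)) f).
Local Notation leb:= (@lebesgue_measure R).
Implicit Types (f phi: 'rV[R]_n -> R[i]) (p q: \bar R).
Lemma realc_neq0 (c: R): c != 0 -> c%:C%C != 0.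
Proof. by move=> cn; rewrite -cabs_eq0 cabs_real normr_eq0. Qed.
Lemma Lqt_ext q (h1 h2: R -> \bar R): (forall t, 0 < t -> h1 t = h2 t) -> Lqt q h1 = Lqt q h2.
Proof.
move=> h12; have E: ess_sup leb (fun t=> if (0 < t)%R then h1 t else 0%E) = ess_sup leb (fun t=> if (0 < t)%R then h2 t else 0%E).
 by congr ess_sup; apply/funext=> t; case: ifP=> // /h12.
case: q=> [Q| |] //=; congr poweR; apply: eq_integral=> t; rewrite inE/= => t0; by rewrite h12.
Qed.
Lemma lp_powR (j: int) (alpha: R): 2`^(j%:~R*alpha) = tz j`^alpha.
Proof. by rewrite powRrM powR_intmul. Qed.
Lemma besovE phi f alpha p q: schwartz phi -> Cc_infty f -> (0 < p)%E ->
 besov phi alpha p q f = lqZ q (fun m=> LpRn p (fun x=> (wdy alpha (Fo phi) (Fo f) m x)%:E)).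
Proof.
move=> sp cf p0; rewrite /besov; congr lqZ; apply/funext=> j.
have [mF _]:= Fo_integrable n0 cf.
have mP: cmeas (Fo phi) by apply: cmeas_FT; exact: schwartz_cmeas.
have -> : (fun x=> (cabs (Defs.conv (lpdil phi j) f x))%:E) = (fun x=> (Umod (Fo phi) (Fo f) (tz (- j)) x)%:E).
 by apply/funext=> x; rewrite conv_Umod.
rewrite lp_powR -LpRnZ//; try side.
by apply/mEFinP; exact: meas_Umod.
Qed.
Lemma triebelE phi f alpha p q: schwartz phi -> Cc_infty f ->
 triebel phi alpha p q f = LpRn p (fun x=> lqZ q (fun m=> (wdy alpha (Fo phi) (Fo f) m x)%:E)).
Proof.
move=> sp cf; rewrite /triebel; congr LpRn; apply/funext=> x; congr lqZ; apply/funext=> j.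
by rewrite lp_powR conv_Umod.
Qed.

Definition represents (b: R) k (A: 'I_k -> 'rV[R]_n -> R[i]) (G: ('rV[R]_n -> R[i]) -> 'rV[R]_n -> R -> R) :=
 forall f t x, Cc_infty f -> 0 < t -> t`^b * `|G f x t| = Usq A (Fo f) t x.

Section mixed.
Variables (b b' alpha: R) (k: nat) (A: 'I_k -> 'rV[R]_n -> R[i]) (G: ('rV[R]_n -> R[i]) -> 'rV[R]_n -> R -> R).
Hypotheses (gA: forall i, goodsym b' (A i)) (hG: represents b A G).
Let u f:= usc alpha A (Fo f).
Let su f: Cc_infty f -> scale_family (u f).
Proof. by move=> cf; exact: (scale_family_usc _ gA (Fo_integrable n0 cf)). Qed.
Let mixE f t x q: Cc_infty f -> 0 < t ->
 (`|t`^(- einv q - alpha + b)*G f x t|)%:E = ((t`^(- einv q))%:E*(u f t x)%:E)%E.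
Proof.
move=> cf t0; rewrite normrM ger0_norm ?powR_ge0// -EFinM /u /usc -(hG x cf t0) !powRD ?(gt_eqF t0) ?implybT//.
by congr EFin; ring.
Qed.
Lemma mixBE f p q: Cc_infty f -> (0 < p)%E ->
 mixB p q (- einv q - alpha + b) (G f) = Lqt_dil q (fun t=> LpRn p (fun x=> (u f t x)%:E)).
Proof.
move=> cf p0; rewrite /mixB /Lqt_dil; apply: Lqt_ext=> t t0.
rewrite -LpRnZ ?powR_gt0//.
- by congr LpRn; apply/funext=> x; exact: mixE.
- by apply: sf_meas1; exact: su.
- by move=> x; rewrite lee_fin; case: (su cf).
Qed.
Lemma mixFE f p q: Cc_infty f ->
 mixF p q (- einv q - alpha + b) (G f) = LpRn p (fun x=> Lqt_dil q (fun t=> (u f t x)%:E)).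
Proof.
move=> cf; rewrite /mixF /Lqt_dil; congr LpRn; apply/funext=> x; apply: Lqt_ext=> t t0; exact: mixE.
Qed.
Lemma mixB_ge0 f p q: Cc_infty f -> (0 < p)%E -> (0 < q)%E -> (0 <= mixB p q (- einv q - alpha + b) (G f))%E.
Proof.
move=> cf p0 q0; rewrite mixBE//; apply: Lqt_dil_ge0=> // t.
by apply: LpRn_ge0=> //; [apply: sf_meas1; exact: su|move=> x; rewrite lee_fin; case: (su cf)].
Qed.

End mixed.
Lemma besov_ge0 phi f alpha p q: schwartz phi -> Cc_infty f -> (0 < p)%E -> (0 < q)%E -> (0 <= besov phi alpha p q f)%E.
Proof.
move=> sp cf p0 q0; rewrite besovE//; apply: lqZ_ge0=> // j; apply: LpRn_ge0=> // [|x].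
- have [mF _]:= Fo_integrable n0 cf.
 have mP: cmeas (Fo phi) by apply: cmeas_FT; exact: schwartz_cmeas.
 by apply/mEFinP; apply: measurable_funM; [side|exact: meas_Umod].
- by rewrite lee_fin mulr_ge0 ?powR_ge0 ?Umod_ge0.
Qed.
Lemma exists_small_exponent p q: (0 < p)%E -> (0 < q)%E ->
 exists r: R, [/\ 0 < r, r <= 1, (r%:E < p)%E & (r%:E < q)%E].
Proof.
have H p': (0 < p')%E -> exists2 e: R, 0 < e & forall r, r <= e -> (r%:E < p')%E.
 case: p'=> [P P0|_|//]; last by exists 1=> // r _; rewrite ltry.
 rewrite lte_fin in P0; exists (P/2)=> [|r re]; first side.
 by rewrite lte_fin; lra.
move=> /H [e1 e10 h1] /H [e2 e20 h2]; exists (Num.min 1 (Num.min e1 e2)).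
split; [by rewrite !lt_min ltr01 e10 e20|by rewrite ge_min lexx| |].
- by apply: h1; rewrite !ge_min lexx orbT.
- by apply: h2; rewrite !ge_min lexx !orbT.
Qed.

Section comparison.
Variables (phi: 'rV[R]_n -> R[i]) (alpha b': R) (p q: \bar R).
Hypotheses (aphi: lp_admissible phi) (b0: 0 < b') (ab: alpha < b') (p0: (0 < p)%E) (q0: (0 < q)%E).
Lemma dominated_upper b k (A: 'I_k -> 'rV[R]_n -> R[i]) G: (forall i, goodsym b' (A i)) -> represents b A G ->
 dominated (@Cc_infty R n) (fun f=> mixB p q (- einv q - alpha + b) (G f)) (besov phi alpha p q) /\
 ((p < +oo)%E -> dominated (@Cc_infty R n) (fun f=> mixF p q (- einv q - alpha + b) (G f)) (triebel phi alpha p q)).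
Proof.
move=> gA hG; have [sp sa pa]:= lp_admissible_symbol aphi.
have [r [r0 r1 rp rq]]:= exists_small_exponent p0 q0.
have [z [z0 z1 hz]]:= conv_le_upper n0 r0 r1 b0 ab.
have [hu _]:= hz phi _ sp sa pa; have [C0 C00 hC]:= hu k A gA.
have gP:= goodsym_FT_schwartz b0 sp sa.
split=> [|pfin].
 have [C CC h]:= @mixB_upper R n C0 z r q C00 z0 z1 r0 rq p rp.
 exists C; split=> // f cf; have Fi:= Fo_integrable n0 cf; rewrite (mixBE _ gA hG)// besovE//.
 apply: h=> [||th t1 t2]; [exact: (scale_family_usc _ gA Fi)|exact: (dyadic_family_wdy _ gP Fi)|exact: hC].
case: p p0 rp pfin=> [P| |]// _ rp _; rewrite lte_fin in rp.
have [C CC h]:= @mixF_upper R n C0 z r q C00 z0 z1 r0 rq P rp.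
exists C; split=> // f cf; have Fi:= Fo_integrable n0 cf; rewrite (mixFE _ hG)// triebelE//.
by apply: h=> [||th t1 t2]; [exact: (scale_family_usc _ gA Fi)|exact: (dyadic_family_wdy _ gP Fi)|exact: hC].
Qed.
Lemma dominated_lower b (B: 'rV[R]_n -> R[i]) G: goodsym b' B -> elliptic B -> (forall x, 0 < enorm x -> B x != 0) ->
 represents b (fun _: 'I_1=> B) G ->
 dominated (@Cc_infty R n) (besov phi alpha p q) (fun f=> mixB p q (- einv q - alpha + b) (G f)) /\
 ((p < +oo)%E -> dominated (@Cc_infty R n) (triebel phi alpha p q) (fun f=> mixF p q (- einv q - alpha + b) (G f))).
Proof.
move=> gB eB nB hG; have [sp sa pa]:= lp_admissible_symbol aphi.
have gA (i: 'I_1): goodsym b' ((fun _: 'I_1=> B) i):= gB.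
have [r [r0 r1 rp rq]]:= exists_small_exponent p0 q0.
have [z [z0 z1 hz]]:= conv_le_upper n0 r0 r1 b0 ab.
have [_ hl]:= hz phi _ sp sa pa; have [C0 C00 hC]:= hl B gB eB nB.
have gP:= goodsym_FT_schwartz b0 sp sa.
split=> [|pfin].
 have [C CC h]:= @mixB_lower R n C0 z r q C00 z0 z1 r0 rq p rp.
 exists C; split=> // f cf; have Fi:= Fo_integrable n0 cf; rewrite (mixBE _ gA hG)// besovE//.
 apply: h=> [||th t1 t2]; [exact: (scale_family_usc _ gA Fi)|exact: (dyadic_family_wdy _ gP Fi)|exact: hC].
case: p p0 rp pfin=> [P| |]// _ rp _; rewrite lte_fin in rp.
have [C CC h]:= @mixF_lower R n C0 z r q C00 z0 z1 r0 rq P rp.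
exists C; split=> // f cf; have Fi:= Fo_integrable n0 cf; rewrite (mixFE _ hG)// triebelE//.
by apply: h=> [||th t1 t2]; [exact: (scale_family_usc _ gA Fi)|exact: (dyadic_family_wdy _ gP Fi)|exact: hC].
Qed.
Lemma dominated_equiv (Cl: ('rV[R]_n -> R[i]) -> Prop) N1 N2: (forall f, Cl f -> (0 <= N1 f)%E) -> (forall f, Cl f -> (0 <= N2 f)%E) ->
 dominated Cl N1 N2 -> dominated Cl N2 N1 -> equiv_norms Cl N1 N2.
Proof.
move=> p1 p2 [C1 [C10 h1]] [C2 [C20 h2]]; exists (C1 + C2); split; first side.
move=> f cf; split.
 by apply: (le_trans (h1 f cf)); apply: lee_wpmul2r; [exact: p2|rewrite lee_fin; lra].
by apply: (le_trans (h2 f cf)); apply: lee_wpmul2r; [exact: p1|rewrite lee_fin; lra].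
Qed.
Lemma elliptic_equiv b (B: 'rV[R]_n -> R[i]) G: goodsym b' B -> elliptic B -> (forall x, 0 < enorm x -> B x != 0) ->
 (forall f t x, Cc_infty f -> 0 < t -> t`^b*G f x t = Umod B (Fo f) t x) ->
 equiv_norms (@Cc_infty R n) (besov phi alpha p q) (fun f=> mixB p q (- einv q - alpha + b) (G f)) /\
 ((p < +oo)%E -> equiv_norms (@Cc_infty R n) (triebel phi alpha p q) (fun f=> mixF p q (- einv q - alpha + b) (G f))).
Proof.
move=> gB eB nB hG.
have gA (i: 'I_1): goodsym b' ((fun _: 'I_1=> B) i):= gB.
have hG1: represents b (fun _: 'I_1=> B) G.
 move=> f t x cf t0; rewrite Usq1 -[t`^b]ger0_norm ?powR_ge0// -normrM hG// ger0_norm//; side.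
have [sp _ _]:= lp_admissible_symbol aphi.
have [u1 u2]:= dominated_upper gA hG1; have [l1 l2]:= dominated_lower gB eB nB hG1.
split=> [|pfin]; apply: dominated_equiv=> //; try side.
- by move=> f cf; exact: besov_ge0.
- by move=> f cf; exact: (mixB_ge0 _ gA hG1).
- by move=> f cf; rewrite /triebel; case: p p0 pfin=> [P| |]//= _ _; side.
- by move=> f cf; rewrite /mixF; case: p p0 pfin=> [P| |]//= _ _; side.
Qed.

End comparison.

End norms.

Theorem theorem5p8 (R : realType) (n : nat) (alpha : R) (p q : \bar R) (s : R)
  (phi : 'rV[R]_n -> R[i]) :
  (0 < n)%N -> (0 < p)%E -> (0 < q)%E -> 0 < s -> s < 2 ->
  lp_admissible phi ->
  let F := fun (f : 'rV[R]_n -> R[i]) (x : 'rV[R]_n) (t : R) => Pst s t f x in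
  (* (i) *)
  (forall beta : R, 0 < beta -> beta <= 1 -> alpha < beta ->
     equiv_norms (@Cc_infty R n) (besov phi alpha p q)
       (fun f => mixB p q (- einv q - alpha + beta)
                   (fun x t => cabs (Pst s t (fraclap beta f) x))) /\
     ((p < +oo)%E ->
      equiv_norms (@Cc_infty R n) (triebel phi alpha p q)
       (fun f => mixF p q (- einv q - alpha + beta)
                   (fun x t => cabs (Pst s t (fraclap beta f) x))))) /\
  (* (ii) *)
  (alpha < 1 ->
     dominated (@Cc_infty R n)
       (fun f => mixB p q (- einv q - alpha + 1) (grad_x_abs (F f)))
       (besov phi alpha p q) /\
     ((p < +oo)%E ->
      dominated (@Cc_infty R n)
       (fun f => mixF p q (- einv q - alpha + 1) (grad_x_abs (F f)))
       (triebel phi alpha p q))) /\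
  (* (iii) *)
  (alpha < s ->
     equiv_norms (@Cc_infty R n) (besov phi alpha p q)
       (fun f => mixB p q (- einv q - alpha + 1) (dt_abs (F f))) /\
     ((p < +oo)%E ->
      equiv_norms (@Cc_infty R n) (triebel phi alpha p q)
       (fun f => mixF p q (- einv q - alpha + 1) (dt_abs (F f))))).
Proof.
move=> n0 p0 q0 s0 s2 aphi F.
have c0:= @pst_const_gt0 R n s s0.
have pi0: 0 < pi :> R by side.
have sgm_neq0 (b: R) (g: 'rV[R]_n -> R[i]) x: 0 < enorm x -> g x != 0 -> sgm g b x != 0.
 move=> x0 gx; rewrite /sgm mulf_neq0// realc_neq0// gt_eqF// mb_gt0// /mbdom mulr_gt0 ?exprn_gt0//.
 by rewrite -enorm_sqr exprn_gt0.
have en0 (e: R) (x: 'rV[R]_n): 0 < enorm x -> (enorm x`^e)%:C%C != 0.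
 by move=> x0; rewrite realc_neq0// gt_eqF// powR_gt0.
split=> [beta be0 be1 ab|]; last split=> ab.
- have k0: (@pst_const R n s*(2 * pi)`^beta)%:C%C != 0 by rewrite realc_neq0// gt_eqF// mulr_gt0// powR_gt0// mulr_gt0.
 apply: (@elliptic_equiv R n n0 phi alpha beta p q aphi be0 ab p0 q0 beta (sg1 s beta) (fun f x t=> cabs (Pst s t (fraclap beta f) x))).
 (* With b = s/2 > 0 the Bessel factor is bounded at the origin, so the decay exponent is the
    homogeneity beta. *)
 + apply: (@goodsym_sgm R n (s/2) beta beta)=> //; first by left; rewrite divr_gt0.
  by move=> K; apply: homogZ; exact: homog_enorm.
 + by apply: elliptic_sgm; apply: ellipticZ=> //; exact: elliptic_enorm.
 + by move=> x x0; apply: sgm_neq0=> //; rewrite mulf_neq0// en0.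
 + by move=> f t x cf t0; exact: fraclap_Umod.
(* The coordinate symbols vanish on hyperplanes and are not elliptic; only the upper bound is
   available, for all n of them together. *)
- apply: (@dominated_upper R n n0 phi alpha 1 p q aphi ltr01 ab p0 q0 1 n (sg2 s) (fun f=> grad_x_abs (F f)))=> [i|f t x cf t0].
  apply: (@goodsym_sgm R n (s/2) 1 1)=> //; first by left; rewrite divr_gt0.
  by move=> K; apply: homogZ; exact: homog_coord.
 rewrite powRr1 ?(ltW t0)// ger0_norm ?sqrtr_ge0// /grad_x_abs /Usq.
 have -> : \sum_i Umod (sg2 s i) (FT (- (2 * pi)) f) t x^+2 = \sum_i t^+2*cabs (pderiv i (fun y=> F f y t) x)^+2.
  by apply: eq_bigr=> i _; rewrite -exprMn; congr (_^+2); apply/esym; exact: pderiv_Umod.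
 by rewrite -mulr_sumr sqrtrM ?sqr_ge0// sqrtr_sqr ger0_norm ?(ltW t0).
- have k0: (@pst_const R n s*(- 2 * pi^+2))%:C%C != 0.
  by rewrite realc_neq0// mulf_neq0 ?(gt_eqF c0)// mulf_neq0 ?oppr_eq0 ?pnatr_eq0// expf_neq0// gt_eqF.
 apply: (@elliptic_equiv R n n0 phi alpha s p q aphi s0 ab p0 q0 1 (sg3 s) (fun f=> dt_abs (F f))).
 (* Here b = s/2 - 1 < 0: the factor is at most of size |xi|^(s-2) near the origin, against
    homogeneity 2, which leaves the exponent s. *)
 + apply: (@goodsym_sgm R n (s/2 - 1) 2 s)=> //; first by right; split; [lra|field].
  by move=> K; apply: homogZ; exact: homog_enorm.
 + by apply: elliptic_sgm; apply: ellipticZ=> //; exact: elliptic_enorm.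
 + by move=> x x0; apply: sgm_neq0=> //; rewrite mulf_neq0// en0.
 + by move=> f t x cf t0; rewrite powRr1 ?(ltW t0)//; exact: dt_Umod.
Qed.
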